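(* Let $e_n=[z^n]F_0(z)$ with $F_0(z)=D(z)E(z)$ be the total weight of excursions with catastrophes of length $n$. Then: (i) if $\rho_0<\rho$, $e_n=\frac{E(\rho_0)}{\rho_0Q'(\rho_0)}\rho_0^{-n}+o(K^n)$ for some $K<1/\rho_0$; (ii) if $\rho_0=\rho$, $e_n=\frac{E(\rho)}{\eta}\frac{\rho^{-n}}{\sqrt{\pi n}}\big(1+O(1/n)\big)$; (iii) if $\rho_0$ does not exist, $e_n=\frac{F_0(\rho)}{2}\Big(\sqrt{2\frac{P(\tau)}{P''(\tau)}}\,\frac1\tau+\eta D(\rho)\Big)\frac{\rho^{-n}}{\sqrt{\pi n^3}}\big(1+O(1/n)\big)$.
   Context: Fix integers $c,d\ge1$ and non-negative real weights $p_{-c},\dots,p_d$ with $p_{-c}\neq0\neq p_d$; jump set $\mathcal J=\{i: p_i\neq0\}$, jump polynomial $P(u)=\sum_{i=-c}^dp_iu^i$. Standing assumption: $P$ is aperiodic (there are no integer $b$, integer $p\ge2$ and Laurent polynomial $H$ with $P(u)=u^bH(u^p)$). A catastrophe is a step from an altitude $h>0$ with $-h\notin\mathcal J$ directly to altitude $0$, of weight $q>0$. Paths start at altitude $0$; each step is a jump $i\in\mathcal J$ (weight $p_i$) or a catastrophe; the weight of a path is the product of its step weights, and ''number'' means total weight. Meanders never go below $0$; excursions are meanders ending at $0$. Let $M(z,u)=\sum m_{n,k}z^nu^k$, with $m_{n,k}$ the total weight of catastrophe-free meanders of length $n$ ending at altitude $k$; $M_k(z)=[u^k]M(z,u)$,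 $M(z)=M(z,1)$, $E(z)=M_0(z)$. Let $Q(z)=zq\big(M(z)-E(z)-\sum_{j>0,-j\in\mathcal J}M_j(z)\big)$ and $D(z)=1/(1-Q(z))$. Let $\tau>0$ be the minimal positive real solution of $P'(\tau)=0$, $\rho=1/P(\tau)$. Let $\rho_0$ be the smallest positive real zero of $1-Q(z)$ satisfying $\rho_0\le\rho$, if it exists (''$\rho_0$ does not exist'' otherwise). In the cases $\rho_0=\rho$ or $\rho_0$ nonexistent, $\eta$ is defined by the Puiseux expansion $Q(z)=Q(\rho)-\eta\sqrt{1-z/\rho}+O(1-z/\rho)$ as $z\to\rho$. *)

(* Defs.v *)
From Stdlib Require Import Reals Lra Lia ZArith List.
From Coquelicot Require Import Coquelicot.
Open Scope R_scope.

Definition sumZ (lo hi : Z) (f : Z -> R) : R :=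
  fold_right Rplus 0
    (map (fun j => f (lo + Z.of_nat j)%Z) (seq 0 (Z.to_nat (hi - lo + 1)))).

Definition Pol (c d : nat) (p : Z -> R) (u : R) : R :=
  sumZ (- Z.of_nat c) (Z.of_nat d) (fun i => p i * powerRZ u i).

(* P aperiodic: there are no integers b, per >= 2 and Laurent polynomial H
   with P(u) = u^b H(u^per); the identity of Laurent polynomials is written
   coefficientwise: p_i = [i = b mod per] * H_((i-b)/per). *)
Definition aperiodic (p : Z -> R) : Prop :=
  ~ exists (b per : Z) (H : Z -> R),
      (2 <= per)%Z /\
      forall i : Z,
        p i = if Z.eqb ((i - b) mod per)%Z 0%Z then H ((i - b) / per)%Z else 0.

(* m n k = total weight of catastrophe-free meanders of length n ending at
   altitude k (0 for k < 0). *)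
Fixpoint mea (c d : nat) (p : Z -> R) (n : nat) (k : Z) : R :=
  match n with
  | O => if Z.eqb k 0%Z then 1 else 0
  | S n' => if Z.ltb k 0%Z then 0
            else sumZ (- Z.of_nat c) (Z.of_nat d)
                   (fun i => p i * mea c d p n' (k - i)%Z)
  end.

(* [z^n] M(z) : meanders of length n end at altitude <= n*d *)
Definition Mcoef (c d : nat) (p : Z -> R) (n : nat) : R :=
  sumZ 0%Z (Z.of_nat n * Z.of_nat d)%Z (fun k => mea c d p n k).

Definition Ecoef (c d : nat) (p : Z -> R) (n : nat) : R := mea c d p n 0%Z.

(* [z^n] Q(z), Q(z) = z q (M(z) - E(z) - sum_{j>0, -j in J} M_j(z)) *)
Definition Qcoef (c d : nat) (p : Z -> R) (q : R) (n : nat) : R :=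
  match n with
  | O => 0
  | S n' => q * (Mcoef c d p n' - Ecoef c d p n'
                 - sumZ 1%Z (Z.of_nat c)
                     (fun j => if Req_EM_T (p (- j)%Z) 0 then 0
                               else mea c d p n' j))
  end.

(* first n+1 coefficients of D(z) = 1/(1 - Q(z)) as a formal power series:
   d_0 = 1, d_n = sum_{k=1}^n [z^k]Q * d_{n-k} *)
Fixpoint Dlist (c d : nat) (p : Z -> R) (q : R) (n : nat) : list R :=
  match n with
  | O => 1 :: nil
  | S n' => let l := Dlist c d p q n' in
            l ++ (fold_right Rplus 0
                    (map (fun k => Qcoef c d p q k * nth (S n' - k) l 0)
                         (seq 1 (S n')))) :: nil
  end.

Definition Dcoef (c d : nat) (p : Z -> R) (q : R) (n : nat) : R :=
  nth n (Dlist c d p q n) 0.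

Definition ecoef (c d : nat) (p : Z -> R) (q : R) (n : nat) : R :=
  fold_right Rplus 0
    (map (fun k => Dcoef c d p q k * Ecoef c d p (n - k)) (seq 0 (S n))).

Definition Qf (c d : nat) (p : Z -> R) (q : R) (z : R) : R :=
  PSeries (Qcoef c d p q) z.
Definition Ef (c d : nat) (p : Z -> R) (z : R) : R := PSeries (Ecoef c d p) z.
Definition Df (c d : nat) (p : Z -> R) (q : R) (z : R) : R :=
  / (1 - Qf c d p q z).

Definition is_tau (c d : nat) (p : Z -> R) (tau : R) : Prop :=
  0 < tau /\ Derive (Pol c d p) tau = 0 /\
  forall u, 0 < u < tau -> Derive (Pol c d p) u <> 0.

Definition rho_of (c d : nat) (p : Z -> R) (tau : R) : R := / Pol c d p tau.

Definition zero_1mQ (c d : nat) (p : Z -> R) (q : R) (r : R) : Prop :=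
  0 < r /\ is_pseries (Qcoef c d p q) r 1.

Definition is_rho0 (c d : nat) (p : Z -> R) (q rho r : R) : Prop :=
  zero_1mQ c d p q r /\ r <= rho /\
  forall z, 0 < z < r -> ~ zero_1mQ c d p q z.

(* Q(z) = Q(rho) - eta sqrt(1 - z/rho) + O(1 - z/rho) as z -> rho (from the
   left along the reals, which determines eta uniquely) *)
Definition puiseux_eta (c d : nat) (p : Z -> R) (q rho eta : R) : Prop :=
  ex_pseries (Qcoef c d p q) rho /\
  exists C delta, 0 < delta /\
    forall z, rho - delta < z < rho ->
      Rabs (Qf c d p q z - (Qf c d p q rho - eta * sqrt (1 - z / rho)))
        <= C * (1 - z / rho).

Definition rel_O_inv_n (u T : nat -> R) : Prop :=
  exists C (N : nat), (1 <= N)%nat /\ forall n, (N <= n)%nat ->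
    Rabs (u n - T n) <= C / INR n * Rabs (T n).

(* Main.v *)
(* The singular expansions at rho = 1/P(tau) are obtained on coefficients, without analytic continuation.  Tilting
   the step weights by tau makes the walk centred, and a local limit theorem with error O(n^(-3/2)), proved by
   integration by parts on the characteristic function, gives [u^j] P(u)^n.  Spitzer's identities express the
   meander series as exponentials of the series log 1/(1 - zP(u)), so that after rescaling to rho the series E, M_k,
   and, when tau > 1, also M and Q, have the form X + sqrt(1-z) Y, where the coefficients of X and Y are O(n^(-5/2)).
   If tau <= 1, the drift is nonnegative and Q already diverges at 1/P(1) <= rho, so that only the case rho0 < rho
   can occur.
   Each case divides by a series that is bounded away from zero on the closed disc, by Wiener's lemma in the algebra
   of absolutely summable series and in the algebras of series with coefficients O(n^(-m/2)).  For rho0 < rho it is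
   (1 - Q)/(1 - z/rho0) on a slightly larger disc; for rho0 = rho it is (1 - Q)/sqrt(1 - z/rho); when there is no
   zero, it is (1 - Q) exp(kappa (1 - sqrt(1 - z/rho))), with kappa chosen to cancel the square-root term of 1 - Q. *)
Require Import Defs.
From Stdlib Require Import Reals ZArith.
From Coquelicot Require Import Coquelicot.
From Stdlib Require Import Lra Lia List FunctionalExtensionality Classical Ranalysis5.
Open Scope R_scope.

(** * Formal power series *)

(** The relative error 1/n fixes the orders: a remainder n^(-5/2) against n^(-3/2) for sqrt(1-z),
    and n^(-3/2) against n^(-1/2) for 1/sqrt(1-z). The obstacle is inversion. A series with a
    genuine square-root term decays only like n^(-3/2), so inverting it directly would lose the
    second-order information; the singular factor has to be removed before Wiener's lemma is applied
    and restored afterwards. The lower bounds that inversion asks for come from the nonnegative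
    coefficients of Q: if Q equals 1 at the point considered, two consecutive positive coefficients
    keep 1 - Q away from zero elsewhere on the closed disc, and their existence is where
    aperiodicity enters. In the local limit theorem, integration by parts yields for the return
    weights the recursion of binomial(2n,n)/4^n up to n^(-5/2), so the ratio of the two sequences
    converges at rate 1/n. The limit is then identified by comparison with a walk whose ratio is
    exactly 1, and no Gaussian integral is ever evaluated. *)

Section FormalSeries.
Context {A : Type} (a0 a1 : A) (add mul sub : A -> A -> A) (opp : A -> A).
Context (Ath : ring_theory a0 a1 add mul sub opp eq).
Add Ring Abase : Ath.

(** Sums are half-open, with n terms, and the ring is abstract: the development is instantiated once
    over the reals for series in z, and once over these series for series in z and u. *)
Fixpoint gsum (f : nat -> A) (n : nat) : A :=
  match n with O => a0 | S n' => add (gsum f n') (f n') end.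

Definition gstar (f g : nat -> A) (n : nat) : A :=
  gsum (fun k => mul (f k) (g (n - k)%nat)) (S n).
Definition gone (n : nat) : A := match n with O => a1 | _ => a0 end.

Lemma gsum_ext f g n : (forall k, (k < n)%nat -> f k = g k) -> gsum f n = gsum g n.
Proof.
  induction n as [|n IH]; intros H; simpl; [reflexivity|].
  rewrite IH by (intros; apply H; lia). now rewrite H by lia.
Qed.

Lemma gsum_zero f n : (forall k, (k < n)%nat -> f k = a0) -> gsum f n = a0.
Proof.
  induction n as [|n IH]; intros H; simpl; [reflexivity|].
  rewrite IH by (intros; apply H; lia). rewrite H by lia. ring.
Qed.

Lemma gsum_add f g n :
  gsum (fun k => add (f k) (g k)) n = add (gsum f n) (gsum g n).
Proof. induction n as [|n IH]; simpl; [ring|]. rewrite IH. ring. Qed.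

Lemma gsum_mul_l x f n : gsum (fun k => mul x (f k)) n = mul x (gsum f n).
Proof. induction n as [|n IH]; simpl; [ring|]. rewrite IH. ring. Qed.

Lemma gsum_mul_r x f n : gsum (fun k => mul (f k) x) n = mul (gsum f n) x.
Proof. induction n as [|n IH]; simpl; [ring|]. rewrite IH. ring. Qed.

Lemma gsum_Sl f n : gsum f (S n) = add (f O) (gsum (fun k => f (S k)) n).
Proof.
  induction n as [|n IH]; [simpl; ring|].
  change (gsum f (S (S n))) with (add (gsum f (S n)) (f (S n))). rewrite IH. simpl. ring.
Qed.

Lemma gsum_rev f n : gsum f n = gsum (fun k => f (n - 1 - k)%nat) n.
Proof.
  induction n as [|n IH]; [reflexivity|].
  rewrite (gsum_Sl (fun k => f (S n - 1 - k)%nat)).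
  replace (S n - 1 - 0)%nat with n by lia.
  rewrite (gsum_ext (fun k => f (S n - 1 - S k)%nat) (fun k => f (n - 1 - k)%nat)).
  - rewrite <- IH. simpl. ring.
  - intros; f_equal; lia.
Qed.

(** Both sides run over the pairs with i + j < n, by antidiagonals and by rows. Associativity of the
    product and submultiplicativity of the summable norm rest on this reindexing. *)
Lemma gsum_triangle (F : nat -> nat -> A) n :
  gsum (fun k => gsum (fun i => F i (k - i)%nat) (S k)) n
  = gsum (fun i => gsum (fun j => F i j) (n - i)) n.
Proof.
  induction n as [|n IH]; [reflexivity|].
  change (gsum (fun k => gsum (fun i => F i (k - i)%nat) (S k)) (S n)) with
    (add (gsum (fun k => gsum (fun i => F i (k - i)%nat) (S k)) n)
         (gsum (fun i => F i (n - i)%nat) (S n))).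
  rewrite IH.
  transitivity (gsum (fun i => add (gsum (fun j => F i j) (n - i)) (F i (n - i)%nat)) (S n)).
  - rewrite gsum_add. simpl. replace (n - n)%nat with O by lia. simpl. ring.
  - apply gsum_ext; intros i Hi. replace (S n - i)%nat with (S (n - i)) by lia. reflexivity.
Qed.

Lemma gsum_single f n k : (k < n)%nat ->
  (forall i, (i < n)%nat -> i <> k -> f i = a0) -> gsum f n = f k.
Proof.
  induction n as [|n IH]; intros Hk H; [lia|]. simpl.
  destruct (Nat.eq_dec k n) as [->|Hne].
  - rewrite gsum_zero by (intros; apply H; lia). ring.
  - rewrite IH by (lia || (intros; apply H; lia)). rewrite (H n) by lia. ring.
Qed.

Definition gadd (f g : nat -> A) (n : nat) := add (f n) (g n).
Definition gsub (f g : nat -> A) (n : nat) := sub (f n) (g n).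
Definition gopp (f : nat -> A) (n : nat) := opp (f n).
Definition gzero (n : nat) : A := a0.

Lemma gstar_comm f g : gstar f g = gstar g f.
Proof.
  apply functional_extensionality; intros n. unfold gstar.
  rewrite gsum_rev. apply gsum_ext. intros k Hk.
  replace (S n - 1 - k)%nat with (n - k)%nat by lia.
  replace (n - (n - k))%nat with k by lia. ring.
Qed.

Lemma gstar_assoc f g h : gstar f (gstar g h) = gstar (gstar f g) h.
Proof.
  apply functional_extensionality; intros n. unfold gstar. symmetry.
  pose (F := fun i j => mul (f i) (mul (g j) (h (n - i - j)%nat))).
  rewrite (gsum_ext _ (fun k => gsum (fun i => F i (k - i)%nat) (S k))).
  - rewrite gsum_triangle. apply gsum_ext. intros i Hi.
    replace (S n - i)%nat with (S (n - i)) by lia. unfold F. rewrite gsum_mul_l. reflexivity.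
  - intros k Hk. rewrite <- gsum_mul_r. apply gsum_ext. intros i Hi. unfold F.
    replace (n - i - (k - i))%nat with (n - k)%nat by lia. ring.
Qed.

Lemma gstar_one_l f : gstar gone f = f.
Proof.
  apply functional_extensionality; intros n. unfold gstar.
  rewrite gsum_Sl, gsum_zero.
  - simpl. rewrite Nat.sub_0_r. ring.
  - intros; simpl; ring.
Qed.

Lemma gstar_add_l f g h : gstar (gadd f g) h = gadd (gstar f h) (gstar g h).
Proof.
  apply functional_extensionality; intros n. unfold gstar, gadd.
  rewrite <- gsum_add. apply gsum_ext. intros; ring.
Qed.

Lemma fps_ring_theory : ring_theory gzero gone gadd gstar gsub gopp eq.
Proof.
  constructor; intros; try apply gstar_comm; try apply gstar_assoc;
    try apply gstar_one_l; try apply gstar_add_l;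
    apply functional_extensionality; intros n; unfold gadd, gsub, gopp, gzero; ring.
Qed.

(** The operator may depend on the degree, and the Leibniz rule is asked for degrees i and j against
    i + j; multiplication by the degree has this form. *)
Lemma gstar_derivation (D : nat -> A -> A) f g n :
  (forall k x y, D k (add x y) = add (D k x) (D k y)) -> (D n a0 = a0) ->
  (forall i j x y, D (i + j)%nat (mul x y) = add (mul (D i x) y) (mul x (D j y))) ->
  D n (gstar f g n)
  = add (gstar (fun k => D k (f k)) g n) (gstar f (fun k => D k (g k)) n).
Proof.
  intros Hadd H0 Hmul. unfold gstar. rewrite <- gsum_add.
  assert (H : forall h m, D n (gsum h m) = gsum (fun k => D n (h k)) m).
  { intros h m; induction m as [|m IH]; simpl; [apply H0|]. now rewrite Hadd, IH. }
  rewrite H. apply gsum_ext. intros k Hk.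
  rewrite <- Hmul. f_equal. lia.
Qed.

End FormalSeries.

(** * Real series in one and in two variables *)

Definition fps := nat -> R.
Definition rsum : (nat -> R) -> nat -> R := gsum 0 Rplus.
Definition star : fps -> fps -> fps := gstar 0 Rplus Rmult.
Definition fone : fps := gone 0 1.
Definition fzero : fps := gzero 0.
Definition fadd : fps -> fps -> fps := gadd Rplus.
Definition fsub : fps -> fps -> fps := gsub Rminus.
Definition fopp : fps -> fps := gopp Ropp.

Definition fps_ring : ring_theory fzero fone fadd star fsub fopp eq :=
  fps_ring_theory 0 1 Rplus Rmult Rminus Ropp RTheory.
Add Ring fps_ring_inst : fps_ring.

Definition fps2 := nat -> fps.
Definition star2 : fps2 -> fps2 -> fps2 := gstar fzero fadd star.
Definition fone2 : fps2 := gone fzero fone.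
Definition fzero2 : fps2 := gzero fzero.
Definition fadd2 : fps2 -> fps2 -> fps2 := gadd fadd.
Definition fsub2 : fps2 -> fps2 -> fps2 := gsub fsub.
Definition fopp2 : fps2 -> fps2 := gopp fopp.
Definition fps2_ring : ring_theory fzero2 fone2 fadd2 star2 fsub2 fopp2 eq :=
  fps_ring_theory fzero fone fadd star fsub fopp fps_ring.
Add Ring fps2_ring_inst : fps2_ring.

Declare Scope fps_scope.
Delimit Scope fps_scope with fps.
Notation "f * g" := (star f g) : fps_scope.
Notation "f + g" := (fadd f g) : fps_scope.
Notation "f - g" := (fsub f g) : fps_scope.
Notation "- f" := (fopp f) : fps_scope.
Notation "1" := fone : fps_scope.
Notation "0" := fzero : fps_scope.

(** The Euler operator z d/dz. Unlike the derivative it preserves degrees, hence commutes with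
    dilations, and f = exp(g) becomes [theta f = theta g * f]. *)
Definition theta (f : fps) : fps := fun n => INR n * f n.
Definition scal_fps (a : R) (f : fps) : fps := fun n => a * f n.
Definition cst (a : R) : fps := fun n => match n with O => a | _ => 0 end.
Definition zvar : fps := fun n => match n with 1%nat => 1 | _ => 0 end.

Lemma theta_star f g : theta (f * g)%fps = (theta f * g + f * theta g)%fps.
Proof.
  apply functional_extensionality; intros n. unfold theta.
  apply (gstar_derivation 0 1 Rplus Rmult Rminus Ropp RTheory
    (fun k x => INR k * x)); intros; try rewrite plus_INR; ring.
Qed.

Lemma theta_add f g : theta (f + g)%fps = (theta f + theta g)%fps.
Proof. apply functional_extensionality; intros n; unfold theta, fadd, gadd; ring. Qed.
Lemma theta_sub f g : theta (f - g)%fps = (theta f - theta g)%fps.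
Proof. apply functional_extensionality; intros n; unfold theta, fsub, gsub; ring. Qed.
Lemma theta_opp f : theta (- f)%fps = (- theta f)%fps.
Proof. apply functional_extensionality; intros n; unfold theta, fopp, gopp; ring. Qed.
Lemma theta_cst a : theta (cst a) = fzero.
Proof.
  apply functional_extensionality; intros [|n]; unfold theta, cst, fzero, gzero; simpl; ring.
Qed.
Lemma theta_one : theta fone = fzero.
Proof. exact (theta_cst 1). Qed.
Lemma theta_zvar : theta zvar = zvar.
Proof.
  apply functional_extensionality; intros [|[|n]]; unfold theta, zvar; simpl; ring.
Qed.

Lemma cst_star a f : (cst a * f)%fps = scal_fps a f.
Proof.
  apply functional_extensionality; intros n. unfold star, gstar, scal_fps.
  rewrite (gsum_Sl 0 1 Rplus Rmult Rminus Ropp RTheory).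
  rewrite (gsum_zero 0 1 Rplus Rmult Rminus Ropp RTheory) by (intros; simpl; ring).
  simpl. rewrite Nat.sub_0_r. ring.
Qed.

Lemma cst_mul a b : cst (a * b) = (cst a * cst b)%fps.
Proof.
  rewrite cst_star; apply functional_extensionality; intros [|n]; unfold scal_fps; simpl; ring.
Qed.
Lemma cst_add a b : cst (a + b) = (cst a + cst b)%fps.
Proof. apply functional_extensionality; intros [|n]; unfold fadd, gadd; simpl; ring. Qed.
Lemma cst_opp a : cst (- a) = (- cst a)%fps.
Proof. apply functional_extensionality; intros [|n]; unfold fopp, gopp; simpl; ring. Qed.
Lemma cst_one : cst 1 = fone.
Proof. reflexivity. Qed.
Lemma cst_zero : cst 0 = fzero.
Proof. apply functional_extensionality; intros [|n]; reflexivity. Qed.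

Lemma zvar_star_0 f : (zvar * f)%fps O = 0.
Proof. unfold star, gstar; simpl; ring. Qed.
Lemma zvar_star_S f n : (zvar * f)%fps (S n) = f n.
Proof.
  unfold star, gstar.
  rewrite (gsum_single 0 1 Rplus Rmult Rminus Ropp RTheory _ _ 1%nat); try lia.
  - replace (S n - 1)%nat with n by lia. simpl. ring.
  - intros [|[|i]] Hi Hne; simpl; try ring; lia.
Qed.

(** The dilation f(r z): a singularity at r is moved to 1, so that all estimates can be made at
    radius 1. *)
Definition scale (r : R) (f : fps) : fps := fun n => f n * r ^ n.
Lemma scale_star r f g : scale r (f * g)%fps = (scale r f * scale r g)%fps.
Proof.
  apply functional_extensionality; intros n. unfold scale, star, gstar.
  rewrite <- (gsum_mul_r 0 1 Rplus Rmult Rminus Ropp RTheory).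
  apply gsum_ext. intros k Hk. replace n with (k + (n - k))%nat at 2 by lia.
  rewrite pow_add. ring.
Qed.
Lemma scale_theta r f : scale r (theta f) = theta (scale r f).
Proof. apply functional_extensionality; intros n; unfold scale, theta; ring. Qed.
Lemma scale_one r : scale r fone = fone.
Proof.
  apply functional_extensionality; intros [|n]; unfold scale, fone, gone; simpl; ring.
Qed.
Lemma scale_sub r f g : scale r (f - g)%fps = (scale r f - scale r g)%fps.
Proof. apply functional_extensionality; intros n; unfold scale, fsub, gsub; ring. Qed.

Lemma star_0 f g : (f * g)%fps O = f O * g O.
Proof. unfold star, gstar; simpl; ring. Qed.

Lemma star_inj_l f g h : f O <> 0 -> (f * g)%fps = (f * h)%fps -> g = h.
Proof.
  intros Hf H. apply functional_extensionality; intros n.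
  induction n as [n IH] using lt_wf_ind.
  assert (Hn : (f * g)%fps n = (f * h)%fps n) by now rewrite H.
  unfold star, gstar in Hn.
  rewrite !(gsum_Sl 0 1 Rplus Rmult Rminus Ropp RTheory) in Hn.
  rewrite Nat.sub_0_r in Hn.
  rewrite (gsum_ext 0 Rplus _ (fun k => f (S k) * h (n - S k)%nat)) in Hn.
  - apply Rmult_eq_reg_l with (f O); [|assumption].
    apply Rplus_eq_reg_r in Hn. exact Hn.
  - intros k Hk. now rewrite IH by lia.
Qed.

(** * Absolutely summable series *)

Lemma rsum_S f n : rsum f (S n) = rsum f n + f n.
Proof. reflexivity. Qed.
Lemma rsum_ext f g n : (forall k, (k < n)%nat -> f k = g k) -> rsum f n = rsum g n.
Proof. apply gsum_ext. Qed.
Lemma rsum_zero f n : (forall k, (k < n)%nat -> f k = 0) -> rsum f n = 0.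
Proof. apply (gsum_zero 0 1 Rplus Rmult Rminus Ropp RTheory). Qed.
Lemma rsum_plus f g n : rsum (fun k => f k + g k) n = rsum f n + rsum g n.
Proof. apply (gsum_add 0 1 Rplus Rmult Rminus Ropp RTheory). Qed.
Lemma rsum_scal a f n : rsum (fun k => a * f k) n = a * rsum f n.
Proof. apply (gsum_mul_l 0 1 Rplus Rmult Rminus Ropp RTheory). Qed.
Lemma rsum_scal_r a f n : rsum (fun k => f k * a) n = rsum f n * a.
Proof. apply (gsum_mul_r 0 1 Rplus Rmult Rminus Ropp RTheory). Qed.
Lemma rsum_opp f n : rsum (fun k => - f k) n = - rsum f n.
Proof. induction n as [|n IH]; [unfold rsum; simpl; ring|]. rewrite !rsum_S, IH. ring. Qed.
Lemma rsum_minus f g n : rsum (fun k => f k - g k) n = rsum f n - rsum g n.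
Proof. induction n as [|n IH]; [unfold rsum; simpl; ring|]. rewrite !rsum_S, IH. ring. Qed.
Lemma rsum_Sl f n : rsum f (S n) = f O + rsum (fun k => f (S k)) n.
Proof. apply (gsum_Sl 0 1 Rplus Rmult Rminus Ropp RTheory). Qed.
Lemma rsum_rev f n : rsum f n = rsum (fun k => f (n - 1 - k)%nat) n.
Proof. apply (gsum_rev 0 1 Rplus Rmult Rminus Ropp RTheory). Qed.
Lemma rsum_triangle (F : nat -> nat -> R) n :
  rsum (fun k => rsum (fun i => F i (k - i)%nat) (S k)) n
  = rsum (fun i => rsum (fun j => F i j) (n - i)) n.
Proof. apply (gsum_triangle 0 1 Rplus Rmult Rminus Ropp RTheory). Qed.
Lemma rsum_single f n k : (k < n)%nat ->
  (forall i, (i < n)%nat -> i <> k -> f i = 0) -> rsum f n = f k.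
Proof. apply (gsum_single 0 1 Rplus Rmult Rminus Ropp RTheory). Qed.

Lemma rsum_le f g n : (forall k, (k < n)%nat -> f k <= g k) -> rsum f n <= rsum g n.
Proof.
  induction n as [|n IH]; intros H; [unfold rsum; simpl; lra|].
  rewrite !rsum_S. apply Rplus_le_compat; [apply IH; intros; apply H; lia | apply H; lia].
Qed.
Lemma rsum_nonneg f n : (forall k, (k < n)%nat -> 0 <= f k) -> 0 <= rsum f n.
Proof.
  intros H. rewrite <- (rsum_zero (fun _ => 0) n) by reflexivity. now apply rsum_le.
Qed.
Lemma rsum_abs f n : Rabs (rsum f n) <= rsum (fun k => Rabs (f k)) n.
Proof.
  induction n as [|n IH]; [unfold rsum; simpl; rewrite Rabs_R0; lra|].
  rewrite !rsum_S. eapply Rle_trans; [apply Rabs_triang|]. lra.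
Qed.
Lemma rsum_split f m n : rsum f (m + n) = rsum f m + rsum (fun k => f (m + k)%nat) n.
Proof.
  induction n as [|n IH]; [rewrite Nat.add_0_r; unfold rsum; simpl; ring|].
  rewrite Nat.add_succ_r, !rsum_S, IH. ring.
Qed.
Lemma rsum_le_len f m n : (m <= n)%nat -> (forall k, 0 <= f k) -> rsum f m <= rsum f n.
Proof.
  intros Hmn H. replace n with (m + (n - m))%nat by lia. rewrite rsum_split.
  pose proof (rsum_nonneg (fun k => f (m + k)%nat) (n - m) (fun k _ => H _)). lra.
Qed.
Lemma rsum_swap (F : nat -> nat -> R) m n :
  rsum (fun i => rsum (F i) n) m = rsum (fun j => rsum (fun i => F i j) m) n.
Proof.
  induction m as [|m IH].
  - symmetry; apply rsum_zero; reflexivity.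
  - rewrite rsum_S, IH, <- rsum_plus. apply rsum_ext. reflexivity.
Qed.
Lemma rsum_term_le f n k : (forall i, 0 <= f i) -> (k < n)%nat -> f k <= rsum f n.
Proof.
  intros H Hk. apply Rle_trans with (rsum f (S k)).
  - rewrite rsum_S. pose proof (rsum_nonneg f k (fun i _ => H i)). lra.
  - apply rsum_le_len; [lia|assumption].
Qed.
Lemma rsum_const a n : rsum (fun _ => a) n = INR n * a.
Proof.
  induction n as [|n IH]; [unfold rsum; simpl; ring|]. rewrite rsum_S, IH, S_INR. ring.
Qed.
Lemma rsum_sum_n f n : rsum f (S n) = sum_n f n.
Proof.
  induction n as [|n IH].
  - rewrite sum_O. unfold rsum; simpl. ring.
  - rewrite sum_Sn, <- IH. reflexivity.
Qed.
Lemma rsum_sum_f_R0 f n : rsum f (S n) = sum_f_R0 f n.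
Proof. rewrite rsum_sum_n. apply sum_n_Reals. Qed.

Lemma star_def f g n : (f * g)%fps n = rsum (fun k => f k * g (n - k)%nat) (S n).
Proof. reflexivity. Qed.

(** The Wiener algebra of the closed disc. [val] is the value at 1; being total, it carries
    information only for convergent series. *)
Definition l1 (f : fps) := ex_series (fun n => Rabs (f n)).
Definition val (f : fps) := Series f.

Lemma is_lim_seq_rsum f l : is_series f l <-> is_lim_seq (rsum f) l.
Proof.
  rewrite (is_lim_seq_incr_1 (rsum f)).
  split; intros H.
  - eapply is_lim_seq_ext; [|exact H]. intros n. symmetry. apply rsum_sum_n.
  - red. eapply filterlim_ext; [|exact H]. intros n. apply rsum_sum_n.
Qed.

Lemma ex_series_bounded f M :
  (forall n, 0 <= f n) -> (forall n, rsum f n <= M) -> ex_series f.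
Proof.
  intros Hf HM. destruct (ex_finite_lim_seq_incr (rsum f) M) as [l Hl].
  - intros n. rewrite rsum_S. specialize (Hf n). lra.
  - exact HM.
  - exists l. now apply is_lim_seq_rsum.
Qed.

Lemma Series_le_bound f M :
  ex_series f -> (forall n, rsum f n <= M) -> Series f <= M.
Proof.
  intros Hf HM. apply Series_correct in Hf. apply is_lim_seq_rsum in Hf.
  exact (is_lim_seq_le (rsum f) (fun _ => M) (Series f) M HM Hf (is_lim_seq_const M)).
Qed.

Lemma rsum_le_Series f n : (forall k, 0 <= f k) -> ex_series f -> rsum f n <= Series f.
Proof.
  intros H Hf. apply Series_correct in Hf. apply is_lim_seq_rsum in Hf.
  refine (is_lim_seq_le (fun _ => rsum f n) (fun k => rsum f (k + n)) (rsum f n) (Series f) _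
    (is_lim_seq_const _) _).
  - intros k. apply rsum_le_len; [lia|assumption].
  - now apply -> (is_lim_seq_incr_n (rsum f) n).
Qed.

Lemma l1_bounded f M : (forall n, rsum (fun k => Rabs (f k)) n <= M) -> l1 f.
Proof. intros H. apply ex_series_bounded with M; [intros; apply Rabs_pos|exact H]. Qed.

Lemma l1_bound f : l1 f -> exists M, 0 <= M /\ forall n, rsum (fun k => Rabs (f k)) n <= M.
Proof.
  intros H. exists (Series (fun n => Rabs (f n))). split.
  - pose proof (rsum_le_Series _ O (fun k => Rabs_pos (f k)) H). exact H0.
  - intros n. apply rsum_le_Series; [intros; apply Rabs_pos|exact H].
Qed.

Lemma l1_ex f : l1 f -> ex_series f.
Proof. apply ex_series_Rabs. Qed.

Lemma l1_nonneg f : (forall n, 0 <= f n) -> ex_series f -> l1 f.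
Proof.
  intros H Hf. eapply ex_series_ext; [|exact Hf]. intros n; simpl.
  now rewrite Rabs_pos_eq.
Qed.

Lemma l1_le f g : l1 g -> (forall n, Rabs (f n) <= Rabs (g n)) -> l1 f.
Proof.
  intros Hg H. destruct (l1_bound g Hg) as [M [_ HM]]. apply l1_bounded with M.
  intros n. eapply Rle_trans; [apply rsum_le; intros; apply H|apply HM].
Qed.

(** Kept at the level of partial sums, so that it also applies to a series whose summability is
    still to be proved; Wiener's lemma uses it in this way. *)
Lemma rsum_star_abs_le f g n :
  rsum (fun k => Rabs ((f * g)%fps k)) n
  <= rsum (fun k => Rabs (f k)) n * rsum (fun k => Rabs (g k)) n.
Proof.
  apply Rle_trans with (rsum (fun k => rsum (fun i =>
    (fun i j => Rabs (f i) * Rabs (g j)) i (k - i)%nat) (S k)) n).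
  - apply rsum_le. intros k Hk. rewrite star_def.
    eapply Rle_trans; [apply rsum_abs|]. apply Req_le. apply rsum_ext.
    intros; apply Rabs_mult.
  - rewrite (rsum_triangle (fun i j => Rabs (f i) * Rabs (g j))). rewrite <- rsum_scal_r. apply rsum_le. intros i Hi.
    rewrite rsum_scal. apply Rmult_le_compat_l; [apply Rabs_pos|].
    apply rsum_le_len; [lia|]. intros; apply Rabs_pos.
Qed.

Lemma l1_star f g : l1 f -> l1 g -> l1 (f * g)%fps.
Proof.
  intros Hf Hg. destruct (l1_bound f Hf) as [M [M0 HM]], (l1_bound g Hg) as [N [N0 HN]].
  apply l1_bounded with (M * N). intros n.
  eapply Rle_trans; [apply rsum_star_abs_le|].
  apply Rmult_le_compat; auto; apply rsum_nonneg; intros; apply Rabs_pos.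
Qed.

Lemma val_star f g : l1 f -> l1 g -> val (f * g)%fps = val f * val g.
Proof.
  intros Hf Hg. apply is_series_unique.
  eapply is_series_ext; [|apply is_series_mult; [| |exact Hf|exact Hg]].
  - intros n. simpl. rewrite <- rsum_sum_f_R0. reflexivity.
  - now apply Series_correct, l1_ex.
  - now apply Series_correct, l1_ex.
Qed.

Lemma l1_add f g : l1 f -> l1 g -> l1 (f + g)%fps.
Proof.
  intros Hf Hg. destruct (l1_bound f Hf) as [M [_ HM]], (l1_bound g Hg) as [N [_ HN]].
  apply l1_bounded with (M + N). intros n.
  apply Rle_trans with (rsum (fun k => Rabs (f k) + Rabs (g k)) n).
  - apply rsum_le; intros; apply Rabs_triang.
  - rewrite rsum_plus. specialize (HM n); specialize (HN n); lra.
Qed.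
Lemma l1_opp f : l1 f -> l1 (- f)%fps.
Proof.
  intros H. apply l1_le with f; [assumption|]. intros n. unfold fopp, gopp.
  rewrite Rabs_Ropp. lra.
Qed.
Lemma l1_sub f g : l1 f -> l1 g -> l1 (f - g)%fps.
Proof.
  intros Hf Hg. replace (f - g)%fps with (f + - g)%fps by ring.
  apply l1_add; [assumption|now apply l1_opp].
Qed.
Lemma is_series_cst a : is_series (cst a) a.
Proof.
  apply is_lim_seq_rsum. apply is_lim_seq_incr_1.
  apply is_lim_seq_ext with (fun _ => a); [|apply is_lim_seq_const].
  intros n. rewrite rsum_Sl, rsum_zero; [simpl; ring|reflexivity].
Qed.
Lemma val_cst a : val (cst a) = a.
Proof. apply is_series_unique, is_series_cst. Qed.
Lemma l1_cst a : l1 (cst a).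
Proof.
  apply ex_series_ext with (cst (Rabs a)).
  - intros [|n]; simpl; [reflexivity|now rewrite Rabs_R0].
  - eexists; apply is_series_cst.
Qed.
Lemma l1_one : l1 fone.
Proof. exact (l1_cst 1). Qed.
Lemma val_one : val fone = 1.
Proof. exact (val_cst 1). Qed.
Lemma is_series_zvar : is_series zvar 1.
Proof.
  apply is_lim_seq_rsum. apply is_lim_seq_incr_1, is_lim_seq_incr_1.
  apply is_lim_seq_ext with (fun _ => 1); [|apply is_lim_seq_const].
  intros n. rewrite !rsum_Sl, rsum_zero; [simpl; ring|reflexivity].
Qed.
Lemma l1_zvar : l1 zvar.
Proof.
  apply l1_nonneg; [intros [|[|n]]; simpl; lra|]. eexists; apply is_series_zvar.
Qed.
Lemma val_zvar : val zvar = 1.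
Proof. apply is_series_unique, is_series_zvar. Qed.
Lemma val_add f g : l1 f -> l1 g -> val (f + g)%fps = val f + val g.
Proof. intros; apply Series_plus; now apply l1_ex. Qed.
Lemma val_sub f g : l1 f -> l1 g -> val (f - g)%fps = val f - val g.
Proof. intros; apply Series_minus; now apply l1_ex. Qed.
Lemma val_opp f : val (- f)%fps = - val f.
Proof. apply Series_opp. Qed.

(** * Coefficient decay and the square root of 1 - z *)

(** Half-integer orders of decay become natural powers of [rt n], and the shift by 1 keeps the
    bounds meaningful at n = 0. *)
Definition rt (n : nat) : R := sqrt (INR n + 1).

Lemma rt_sq n : rt n * rt n = INR n + 1.
Proof. apply sqrt_sqrt. pose proof (pos_INR n); lra. Qed.
Lemma rt_0 : rt 0 = 1.
Proof. unfold rt. change (INR 0) with 0. rewrite Rplus_0_l. apply sqrt_1. Qed.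
Lemma rt_ge1 n : 1 <= rt n.
Proof.
  unfold rt. apply Rle_trans with (sqrt 1); [rewrite sqrt_1; lra|].
  apply sqrt_le_1_alt. pose proof (pos_INR n); lra.
Qed.
Lemma rt_pos n : 0 < rt n.
Proof. pose proof (rt_ge1 n); lra. Qed.
Lemma rt_pow_pos n m : 0 < rt n ^ m.
Proof. apply pow_lt, rt_pos. Qed.
Ltac rt_nz := repeat split; apply Rgt_not_eq; first [apply rt_pow_pos | apply rt_pos | apply Rlt_gt; lra].
Lemma rt_le m n : (m <= n)%nat -> rt m <= rt n.
Proof. intros H. apply sqrt_le_1_alt. apply le_INR in H. lra. Qed.
Lemma rt_pow_le i j m : (i <= j)%nat -> rt i ^ m <= rt j ^ m.
Proof. intros H. apply pow_incr. split; [apply Rlt_le, rt_pos|now apply rt_le]. Qed.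
Lemma rt_half i n : (n <= 2 * i + 1)%nat -> rt n <= 2 * rt i.
Proof.
  intros H. replace (2 * rt i) with (sqrt (4 * (INR i + 1))).
  - apply sqrt_le_1_alt. apply le_INR in H. rewrite plus_INR, mult_INR in H. simpl in H. 
    pose proof (pos_INR i). lra.
  - rewrite sqrt_mult_alt by lra. replace 4 with (2 * 2) by ring. rewrite sqrt_square by lra.
    reflexivity.
Qed.
Lemma rt_S n : rt (S n) * rt (S n) = rt n * rt n + 1.
Proof. rewrite !rt_sq, S_INR. ring. Qed.

Lemma rinv_le a b : 0 < a -> a <= b -> / b <= / a.
Proof. intros; apply Rinv_le_contravar; assumption. Qed.

Lemma div_rt_half C i n m : 0 <= C -> (n <= 2 * i + 1)%nat ->
  C / rt i ^ m <= 2 ^ m * C / rt n ^ m.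
Proof.
  intros HC H. pose proof (rt_pow_pos n m). pose proof (rt_pow_pos i m).
  assert (E : rt n ^ m <= 2 ^ m * rt i ^ m).
  { rewrite <- Rpow_mult_distr. apply pow_incr. split; [apply Rlt_le, rt_pos|now apply rt_half]. }
  apply Rmult_le_reg_r with (rt n ^ m * rt i ^ m); [nra|].
  replace (C / rt i ^ m * (rt n ^ m * rt i ^ m)) with (C * rt n ^ m) by (field; lra).
  replace (2 ^ m * C / rt n ^ m * (rt n ^ m * rt i ^ m)) with (C * (2 ^ m * rt i ^ m)) by (field; lra).
  now apply Rmult_le_compat_l.
Qed.

(** Telescoping: for x = [rt n] and y = [rt (S n)] the relation y^2 - x^2 = 1 gives y^(-3) <= 2/x -
    2/y. *)
Lemma rsum_rt3 n : rsum (fun k => / rt k ^ 3) n <= 3.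
Proof.
  enough (H : forall n, rsum (fun k => / rt k ^ 3) (S n) <= 3 - 2 / rt n).
  { destruct n as [|n]; [unfold rsum; simpl; lra|]. eapply Rle_trans; [apply H|].
    pose proof (rt_pos n). assert (0 < 2 / rt n) by (apply Rdiv_lt_0_compat; lra). lra. }
  clear n; induction n as [|n IH].
  - rewrite rsum_S, rt_0. unfold rsum; simpl. lra.
  - rewrite rsum_S. pose proof (rt_pos n) as Hx. pose proof (rt_S n) as Hy.
    pose proof (rt_pos (S n)) as Hy0. pose proof (rt_le n (S n) ltac:(lia)) as Hxy.
    set (x := rt n) in *. set (y := rt (S n)) in *.
    enough (/ y ^ 3 <= 2 / x - 2 / y) by lra.
    replace (2 / x - 2 / y) with (2 / (x * y * (x + y))).
    2:{ replace 2 with (2 * (y * y - x * x)) at 1 by (rewrite Hy; ring). field. lra. }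
    apply Rmult_le_reg_r with (y ^ 3 * (x * (x + y))); [apply Rmult_lt_0_compat; [apply pow_lt; lra|nra]|].
    replace (/ y ^ 3 * (y ^ 3 * (x * (x + y)))) with (x * (x + y)) by (field; lra).
    replace (2 / (x * y * (x + y)) * (y ^ 3 * (x * (x + y)))) with (2 * (y * y)) by (field; lra).
    nra.
Qed.

Definition bd (m : nat) (C : R) (f : fps) : Prop := forall n, Rabs (f n) <= C / rt n ^ m.
(* Decay [O(n^(-m/2))]: the cases in use are [m = 3], the rate of sqrt(1-z), and [m = 5], one order better. *)
Definition W (m : nat) (f : fps) : Prop := exists C, bd m C f.

Lemma bd_C_nonneg m C f : bd m C f -> 0 <= C.
Proof.
  intros H. specialize (H O). pose proof (Rabs_pos (f O)). pose proof (rt_pow_pos O m).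
  apply Rmult_le_reg_r with (/ rt 0 ^ m); [now apply Rinv_0_lt_compat|].
  unfold Rdiv in H. lra.
Qed.
Lemma bd_weaken m C D f : C <= D -> bd m C f -> bd m D f.
Proof.
  intros H Hf n. eapply Rle_trans; [apply Hf|]. apply Rmult_le_compat_r; [|assumption].
  apply Rlt_le, Rinv_0_lt_compat, rt_pow_pos.
Qed.
Lemma W_mono m m' f : (m' <= m)%nat -> W m f -> W m' f.
Proof.
  intros H [C HC]. exists C. pose proof (bd_C_nonneg _ _ _ HC). intros n.
  eapply Rle_trans; [apply HC|]. apply Rmult_le_compat_l; [assumption|].
  apply rinv_le; [apply rt_pow_pos|]. apply Rle_pow; [apply rt_ge1|assumption].
Qed.
Lemma W_bd_nonneg m f : W m f -> exists C, 0 <= C /\ bd m C f.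
Proof. intros [C HC]. exists C. split; [now apply bd_C_nonneg in HC|assumption]. Qed.

(** The factor 2^m is the loss in replacing an index at least n/2 by n; 6 is twice the bound 3 of
    [rsum_rt3]. *)
Definition starK (m : nat) : R := 6 * 2 ^ m.

(** In each product the larger index is at least about n/2 and carries the decay n^(-m/2); the
    factor with the smaller index decays at least like k^(-3/2), since 3 <= m, and is summed. *)
Lemma bd_star m C D f g : (3 <= m)%nat -> bd m C f -> bd m D g ->
  bd m (starK m * C * D) (f * g)%fps.
Proof.
  intros Hm Hf Hg n. pose proof (bd_C_nonneg _ _ _ Hf) as HC.
  pose proof (bd_C_nonneg _ _ _ Hg) as HD. rewrite star_def.
  eapply Rle_trans; [apply rsum_abs|].
  apply Rle_trans with (rsum (fun k => (2 ^ m * C * D / rt n ^ m) *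
     (/ rt k ^ 3 + / rt (n - k) ^ 3)) (S n)).
  - apply rsum_le. intros k Hk. rewrite Rabs_mult.
    pose proof (rt_pow_pos n m) as P1.
    assert (E : forall i, 0 < / rt i ^ m <= / rt i ^ 3).
    { intros i. split; [apply Rinv_0_lt_compat, rt_pow_pos|].
      apply rinv_le; [apply rt_pow_pos|]. apply Rle_pow; [apply rt_ge1|assumption]. }
    assert (P0 : 0 <= 2 ^ m * C * D / rt n ^ m).
    { apply Rmult_le_pos; [|apply Rlt_le, Rinv_0_lt_compat, P1].
      pose proof (pow_lt 2 m ltac:(lra)). apply Rmult_le_pos; [nra|assumption]. }
    pose proof (E k). pose proof (E (n - k)%nat).
    destruct (le_lt_dec k (n - k)) as [Hc|Hc].
    + apply Rle_trans with (C * / rt k ^ 3 * (2 ^ m * D / rt n ^ m)).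
      * apply Rmult_le_compat; try apply Rabs_pos.
        -- eapply Rle_trans; [apply Hf|]. unfold Rdiv. apply Rmult_le_compat_l; lra.
        -- eapply Rle_trans; [apply Hg|]. apply div_rt_half; [assumption|lia].
      * rewrite Rmult_plus_distr_l.
        replace (C * / rt k ^ 3 * (2 ^ m * D / rt n ^ m))
          with (2 ^ m * C * D / rt n ^ m * / rt k ^ 3) by (field; rt_nz).
        assert (0 <= 2 ^ m * C * D / rt n ^ m * / rt (n - k) ^ 3) by (apply Rmult_le_pos; lra). lra.
    + apply Rle_trans with ((2 ^ m * C / rt n ^ m) * (D * / rt (n - k) ^ 3)).
      * apply Rmult_le_compat; try apply Rabs_pos.
        -- eapply Rle_trans; [apply Hf|]. apply div_rt_half; [assumption|lia].
        -- eapply Rle_trans; [apply Hg|]. unfold Rdiv. apply Rmult_le_compat_l; lra.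
      * rewrite Rmult_plus_distr_l.
        replace (2 ^ m * C / rt n ^ m * (D * / rt (n - k) ^ 3))
          with (2 ^ m * C * D / rt n ^ m * / rt (n - k) ^ 3) by (field; rt_nz).
        assert (0 <= 2 ^ m * C * D / rt n ^ m * / rt k ^ 3) by (apply Rmult_le_pos; lra). lra.
  - rewrite rsum_scal, rsum_plus.
    assert (E : rsum (fun k => / rt (n - k) ^ 3) (S n) = rsum (fun k => / rt k ^ 3) (S n)).
    { rewrite (rsum_rev (fun k => / rt k ^ 3)). apply rsum_ext. intros k Hk.
      now replace (S n - 1 - k)%nat with (n - k)%nat by lia. }
    rewrite E. pose proof (rsum_rt3 (S n)). unfold starK.
    replace (6 * 2 ^ m * C * D / rt n ^ m) with (2 ^ m * C * D / rt n ^ m * 6)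
      by (field; rt_nz).
    apply Rmult_le_compat_l; [|lra].
    apply Rmult_le_pos; [|apply Rlt_le, Rinv_0_lt_compat, rt_pow_pos].
    pose proof (pow_lt 2 m ltac:(lra)). apply Rmult_le_pos; [nra|assumption].
Qed.

Lemma bd_add m C D f g : bd m C f -> bd m D g -> bd m (C + D) (f + g)%fps.
Proof.
  intros Hf Hg n. unfold fadd, gadd. eapply Rle_trans; [apply Rabs_triang|].
  unfold Rdiv. rewrite Rmult_plus_distr_r. apply Rplus_le_compat; [apply Hf|apply Hg].
Qed.
Lemma bd_scal m C a f : bd m C f -> bd m (Rabs a * C) (scal_fps a f).
Proof.
  intros Hf n. unfold scal_fps. rewrite Rabs_mult. unfold Rdiv. rewrite Rmult_assoc.
  apply Rmult_le_compat_l; [apply Rabs_pos|apply Hf].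
Qed.

Lemma W_star m f g : (3 <= m)%nat -> W m f -> W m g -> W m (f * g)%fps.
Proof. intros Hm [C HC] [D HD]. eexists. apply bd_star; eassumption. Qed.
Lemma W_add m f g : W m f -> W m g -> W m (f + g)%fps.
Proof. intros [C HC] [D HD]. eexists. apply bd_add; eassumption. Qed.
Lemma W_opp m f : W m f -> W m (- f)%fps.
Proof. intros [C HC]. exists C. intros n. unfold fopp, gopp. rewrite Rabs_Ropp. apply HC. Qed.
Lemma W_sub m f g : W m f -> W m g -> W m (f - g)%fps.
Proof.
  intros Hf Hg. replace (f - g)%fps with (f + - g)%fps by ring.
  apply W_add; [assumption|now apply W_opp].
Qed.
Lemma W_finite m f N : (forall n, (N <= n)%nat -> f n = 0) -> W m f.
Proof.
  intros H. exists (rsum (fun k => Rabs (f k) * rt k ^ m) N). intros n.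
  pose proof (rt_pow_pos n m) as P.
  assert (N0 : forall i, 0 <= Rabs (f i) * rt i ^ m).
  { intros; apply Rmult_le_pos; [apply Rabs_pos|apply Rlt_le, rt_pow_pos]. }
  apply Rmult_le_reg_r with (rt n ^ m); [assumption|].
  unfold Rdiv. rewrite Rmult_assoc, Rinv_l, Rmult_1_r by lra.
  destruct (le_lt_dec N n) as [Hn|Hn].
  - rewrite H by assumption. rewrite Rabs_R0, Rmult_0_l. apply rsum_nonneg. auto.
  - apply (rsum_term_le (fun k => Rabs (f k) * rt k ^ m)); auto.
Qed.
Lemma W_cst m a : W m (cst a).
Proof. apply W_finite with 1%nat. intros [|n] H; [lia|reflexivity]. Qed.
Lemma W_one m : W m fone.
Proof. exact (W_cst m 1). Qed.
Lemma W_zero m : W m fzero.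
Proof. apply W_finite with O. reflexivity. Qed.
Lemma W_zvar m : W m zvar.
Proof. apply W_finite with 2%nat. intros [|[|n]] H; try lia; reflexivity. Qed.

Lemma W_theta m f : W (S (S m)) f -> W m (theta f).
Proof.
  intros [C HC]. exists C. intros n. unfold theta. rewrite Rabs_mult, (Rabs_pos_eq (INR n)) by apply pos_INR.
  pose proof (bd_C_nonneg _ _ _ HC).
  apply Rle_trans with (rt n * rt n * (C / rt n ^ S (S m))).
  - apply Rmult_le_compat; [apply pos_INR|apply Rabs_pos| |apply HC]. rewrite rt_sq; lra.
  - apply Req_le. simpl. field. rt_nz.
Qed.

Lemma W_l1 f : W 3 f -> l1 f.
Proof.
  intros H. destruct (W_bd_nonneg _ _ H) as [C [C0 HC]]. apply l1_bounded with (C * 3). intros n.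
  apply Rle_trans with (rsum (fun k => C * / rt k ^ 3) n).
  - apply rsum_le. intros; apply HC.
  - rewrite rsum_scal. apply Rmult_le_compat_l; [assumption|apply rsum_rt3].
Qed.
Lemma W5_3 f : W 5 f -> W 3 f.
Proof. apply W_mono; lia. Qed.
Lemma W5_l1 f : W 5 f -> l1 f.
Proof. intros; now apply W_l1, W5_3. Qed.

Lemma rsum_rt5 n N : rsum (fun k => / rt (S n + k) ^ 5) N <= 2 / rt n ^ 3 - 2 / rt (n + N) ^ 3.
Proof.
  induction N as [|N IH].
  - rewrite Nat.add_0_r. unfold rsum; simpl; lra.
  - rewrite rsum_S. replace (S n + N)%nat with (S (n + N)) by lia.
    replace (n + S N)%nat with (S (n + N)) by lia. set (k := (n + N)%nat) in *.
    pose proof (rt_pos k) as Hx. pose proof (rt_S k) as Hy.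
    pose proof (rt_pos (S k)) as Hy0. pose proof (rt_le k (S k) ltac:(lia)) as Hxy.
    set (x := rt k) in *. set (y := rt (S k)) in *.
    enough (/ y ^ 5 <= 2 / x ^ 3 - 2 / y ^ 3) by lra.
    assert (Hd : y - x = / (x + y)).
    { apply Rmult_eq_reg_r with (x + y); [|lra]. rewrite Rinv_l by lra. nra. }
    replace (2 / x ^ 3 - 2 / y ^ 3) with (2 * ((y - x) * (y * y + x * y + x * x)) / (x ^ 3 * y ^ 3)) by (field; lra).
    rewrite Hd.
    assert (Hq : y / 2 <= / (x + y) * (y * y + x * y + x * x)).
    { apply Rmult_le_reg_l with (x + y); [lra|].
      rewrite <- Rmult_assoc, Rinv_r, Rmult_1_l by lra. nra. }
    apply Rle_trans with (y / (x ^ 3 * y ^ 3)).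
    + apply Rmult_le_reg_r with (x ^ 3 * y ^ 5); [apply Rmult_lt_0_compat; apply pow_lt; lra|].
      replace (/ y ^ 5 * (x ^ 3 * y ^ 5)) with (x ^ 3) by (field; lra).
      replace (y / (x ^ 3 * y ^ 3) * (x ^ 3 * y ^ 5)) with (y ^ 3) by (field; lra).
      apply pow_incr; lra.
    + apply Rmult_le_compat_r; [|lra]. apply Rlt_le, Rinv_0_lt_compat, Rmult_lt_0_compat; apply pow_lt; lra.
Qed.

(** The quotient (f(1) - f(z)) / (1 - z). Dividing out the zero at 1 costs one power of n: decay
    n^(-5/2) becomes n^(-3/2). *)
Definition ftail (f : fps) : fps := fun n => val f - rsum f (S n).

Lemma ftail_decomp f : f = (cst (val f) - (fone - zvar) * ftail f)%fps.
Proof.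
  replace ((fone - zvar) * ftail f)%fps with (ftail f - zvar * ftail f)%fps by ring.
  apply functional_extensionality; intros [|n]; unfold fsub, gsub.
  - rewrite zvar_star_0. unfold ftail. rewrite rsum_S. unfold rsum; simpl. ring.
  - rewrite zvar_star_S. unfold ftail. rewrite (rsum_S f (S n)). simpl. ring.
Qed.

Lemma ftail_bd C f : bd 5 C f -> bd 3 (2 * C) (ftail f).
Proof.
  intros HC n. pose proof (bd_C_nonneg _ _ _ HC) as C0.
  assert (Hl : l1 f) by (apply W5_l1; now exists C).
  assert (Hs : is_lim_seq (fun N => rsum (fun k => f (S n + k)%nat) N) (ftail f n)).
  { apply is_lim_seq_ext with (fun N => rsum f (N + S n) - rsum f (S n)).
    - intros N. replace (N + S n)%nat with (S n + N)%nat by lia. rewrite rsum_split. ring.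
    - unfold ftail. apply is_lim_seq_minus'; [|apply is_lim_seq_const].
      apply (is_lim_seq_incr_n (rsum f) (S n)). apply is_lim_seq_rsum.
      now apply Series_correct, l1_ex. }
  assert (Hb : forall N, Rabs (rsum (fun k => f (S n + k)%nat) N) <= 2 * C / rt n ^ 3).
  { intros N. eapply Rle_trans; [apply rsum_abs|].
    apply Rle_trans with (rsum (fun k => C * / rt (S n + k) ^ 5) N).
    - apply rsum_le. intros; apply HC.
    - rewrite rsum_scal. pose proof (rsum_rt5 n N) as E. pose proof (rt_pow_pos (n + N) 3).
      assert (0 < 2 / rt (n + N) ^ 3) by (apply Rdiv_lt_0_compat; lra).
      replace (2 * C / rt n ^ 3) with (C * (2 / rt n ^ 3)) by (field; rt_nz).
      apply Rmult_le_compat_l; lra. }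
  apply is_lim_seq_abs in Hs.
  exact (is_lim_seq_le _ (fun _ => 2 * C / rt n ^ 3) _ (2 * C / rt n ^ 3) Hb Hs (is_lim_seq_const _)).
Qed.
Lemma W_ftail f : W 5 f -> W 3 (ftail f).
Proof. intros [C HC]. eexists. apply ftail_bd; eassumption. Qed.

(* Taylor coefficients of sqrt(1-z) and 1/sqrt(1-z). *)
Fixpoint sq (n : nat) : R :=
  match n with O => 1 | S k => sq k * ((2 * INR k - 1) / (2 * INR k + 2)) end.
Fixpoint tq (n : nat) : R :=
  match n with O => 1 | S k => tq k * ((2 * INR k + 1) / (2 * INR k + 2)) end.

Lemma tq_pos n : 0 < tq n.
Proof.
  induction n as [|n IH]; simpl; [lra|]. pose proof (pos_INR n).
  apply Rmult_lt_0_compat; [assumption|apply Rdiv_lt_0_compat; lra].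
Qed.

Lemma INR2_neq n : 2 * INR n - 1 <> 0.
Proof.
  destruct n as [|n]; [simpl; lra|]. rewrite S_INR. pose proof (pos_INR n). lra.
Qed.

Lemma sq_tq n : sq n = - tq n / (2 * INR n - 1).
Proof.
  induction n as [|n IH]; [simpl; field|]. pose proof (pos_INR n). pose proof (INR2_neq n).
  change (sq (S n)) with (sq n * ((2 * INR n - 1) / (2 * INR n + 2))).
  change (tq (S n)) with (tq n * ((2 * INR n + 1) / (2 * INR n + 2))).
  rewrite IH, S_INR. field. repeat split; lra.
Qed.

(** The recursion of s = [sq] says 2 (1 - z) theta(s) = - z s, hence (1 - z) theta(s^2) = - z s^2.
    This is a first-order recurrence whose factor n - 1 annihilates all coefficients from degree 2
    on. *)
Lemma sq_sq : (sq * sq)%fps = (fone - zvar)%fps.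
Proof.
  assert (Hs : ((fone - zvar) * (cst 2 * theta sq))%fps = (- (zvar * sq))%fps).
  { replace ((fone - zvar) * (cst 2 * theta sq))%fps
      with (cst 2 * theta sq - zvar * (cst 2 * theta sq))%fps by ring.
    rewrite cst_star. apply functional_extensionality; intros [|n]; unfold fsub, gsub, fopp, gopp.
    - rewrite !zvar_star_0. unfold scal_fps, theta; simpl; ring.
    - rewrite !zvar_star_S. unfold scal_fps, theta. rewrite S_INR. simpl sq. field.
      pose proof (pos_INR n). lra. }
  assert (H : ((fone - zvar) * theta (sq * sq))%fps = (- (zvar * (sq * sq)))%fps).
  { rewrite theta_star.
    replace ((fone - zvar) * (theta sq * sq + sq * theta sq))%fps
      with (((fone - zvar) * ((fone + fone) * theta sq)) * sq)%fps by ring.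
    replace (fone + fone)%fps with (cst 2).
    - rewrite Hs. ring.
    - rewrite <- cst_one, <- cst_add. reflexivity. }
  assert (R : forall n, INR (S n) * (sq * sq)%fps (S n) = (INR n - 1) * (sq * sq)%fps n).
  { intros n. assert (E := f_equal (fun h => h (S n)) H). simpl in E.
    replace ((fone - zvar) * theta (sq * sq))%fps
      with (theta (sq * sq) - zvar * theta (sq * sq))%fps in E by ring.
    unfold fsub, gsub, fopp, gopp in E. rewrite !zvar_star_S in E. unfold theta in E. lra. }
  assert (E0 : (sq * sq)%fps O = 1) by (rewrite star_0; simpl; ring).
  assert (E1 : (sq * sq)%fps 1%nat = - (1)).
  { pose proof (R O) as R0. rewrite E0 in R0. simpl in R0. lra. }
  apply functional_extensionality. intros [|[|n]].
  - rewrite E0. unfold fsub, gsub, fone, gone, zvar. ring.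
  - rewrite E1. unfold fsub, gsub, fone, gone, zvar. ring.
  - transitivity 0; [|unfold fsub, gsub, fone, gone, zvar; ring].
    induction n as [|n IH].
    + pose proof (R 1%nat) as R1. simpl in R1. lra.
    + pose proof (R (S (S n))) as R1. rewrite IH, Rmult_0_r in R1.
      apply Rmult_integral in R1. destruct R1 as [R1|R1]; [|assumption].
      rewrite S_INR in R1. pose proof (pos_INR (S (S n))). lra.
Qed.

Lemma one_sub_z_tq : ((fone - zvar) * tq)%fps = sq.
Proof.
  replace ((fone - zvar) * tq)%fps with (tq - zvar * tq)%fps by ring.
  apply functional_extensionality; intros [|n]; unfold fsub, gsub.
  - rewrite zvar_star_0. simpl. ring.
  - rewrite zvar_star_S, sq_tq, S_INR. simpl tq. pose proof (pos_INR n). field. split; lra.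
Qed.

Lemma sq_star_tq : (sq * tq)%fps = fone.
Proof.
  apply star_inj_l with sq; [simpl; lra|].
  replace (sq * (sq * tq))%fps with ((sq * sq) * tq)%fps by ring.
  rewrite sq_sq, one_sub_z_tq. change ((sq : fps) = (sq * fone)%fps). ring.
Qed.

Lemma tq_sq_le n : tq n * tq n * (INR n + 1) <= 1.
Proof.
  induction n as [|n IH]; [simpl; lra|]. simpl tq. rewrite S_INR.
  pose proof (pos_INR n). pose proof (tq_pos n). set (x := INR n) in *. set (t := tq n) in *.
  apply Rle_trans with (t * t * (x + 1)); [|assumption].
  replace (t * ((2 * x + 1) / (2 * x + 2)) * (t * ((2 * x + 1) / (2 * x + 2))) * (x + 1 + 1))
    with (t * t * ((2 * x + 1) * (2 * x + 1) * (x + 2) / ((2 * x + 2) * (2 * x + 2)))) by (field; lra).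
  apply Rmult_le_compat_l; [nra|].
  apply Rmult_le_reg_r with ((2 * x + 2) * (2 * x + 2)); [nra|].
  unfold Rdiv. rewrite Rmult_assoc, Rinv_l, Rmult_1_r by nra. nra.
Qed.

Lemma tq_le n : tq n <= 1 / rt n.
Proof.
  pose proof (rt_pos n). pose proof (tq_pos n). pose proof (tq_sq_le n) as H1. rewrite <- rt_sq in H1.
  apply Rmult_le_reg_r with (rt n); [assumption|].
  replace (1 / rt n * rt n) with 1 by (field; lra).
  destruct (Rle_lt_dec (tq n * rt n) 1) as [E|E]; [assumption|].
  pose proof (Rmult_gt_0_lt_compat 1 (tq n * rt n) 1 (tq n * rt n)
    ltac:(lra) ltac:(lra) E E). nra.
Qed.

Lemma sq_bd : bd 3 3 sq.
Proof.
  intros n. rewrite sq_tq. pose proof (tq_le n) as Ht. pose proof (tq_pos n) as Ht0. pose proof (rt_pos n) as Hr.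
  replace (3 / rt n ^ 3) with (1 / rt n * (3 / (INR n + 1))).
  2:{ rewrite <- rt_sq. field. lra. }
  unfold Rdiv at 1. rewrite Rabs_mult, Rabs_Ropp, (Rabs_pos_eq (tq n)) by lra.
  apply Rmult_le_compat; [lra|apply Rabs_pos|assumption|].
  destruct n as [|n].
  - change (INR 0) with 0. replace (/ (2 * 0 - 1)) with (- (1)) by (field; lra).
    rewrite Rabs_Ropp, Rabs_R1. lra.
  - rewrite S_INR. pose proof (pos_INR n).
    rewrite Rabs_pos_eq by (apply Rlt_le, Rinv_0_lt_compat; lra).
    apply Rmult_le_reg_r with ((2 * (INR n + 1) - 1) * (INR n + 1 + 1)); [nra|].
    field_simplify; lra.
Qed.

Lemma sq_step n : Rabs (sq n - sq (S n)) <= 9 / rt n ^ 5.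
Proof.
  simpl sq. pose proof (pos_INR n). pose proof (rt_pos n).
  replace (sq n - sq n * ((2 * INR n - 1) / (2 * INR n + 2))) with (sq n * (3 / (2 * INR n + 2))) by (field; lra).
  rewrite Rabs_mult, (Rabs_pos_eq (3 / (2 * INR n + 2))) by (apply Rlt_le, Rdiv_lt_0_compat; lra).
  apply Rle_trans with (3 / rt n ^ 3 * (3 / (INR n + 1))).
  - apply Rmult_le_compat; [apply Rabs_pos|apply Rlt_le, Rdiv_lt_0_compat; lra|apply sq_bd|].
    apply Rmult_le_compat_l; [lra|]. apply rinv_le; lra.
  - rewrite <- rt_sq. apply Req_le. field. lra.
Qed.

Lemma sq_diff n k : Rabs (sq n - sq (n + k)) <= INR k * (9 / rt n ^ 5).
Proof.
  induction k as [|k IH].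
  - rewrite Nat.add_0_r, Rminus_diag, Rabs_R0. simpl. lra.
  - replace (sq n - sq (n + S k)) with ((sq n - sq (n + k)) + (sq (n + k) - sq (S (n + k))))
      by (replace (n + S k)%nat with (S (n + k)) by lia; ring).
    eapply Rle_trans; [apply Rabs_triang|]. rewrite S_INR.
    assert (Rabs (sq (n + k) - sq (S (n + k))) <= 9 / rt n ^ 5); [|lra].
    eapply Rle_trans; [apply sq_step|]. apply Rmult_le_compat_l; [lra|].
    apply rinv_le; [apply rt_pow_pos|]. apply rt_pow_le. lia.
Qed.

Lemma W_sq : W 3 sq.
Proof. exists 3. apply sq_bd. Qed.
Lemma l1_sq : l1 sq.
Proof. apply W_l1, W_sq. Qed.
Lemma val_one_sub_z : val (fone - zvar)%fps = 0.
Proof. rewrite val_sub by (apply l1_one || apply l1_zvar). rewrite val_one, val_zvar. ring. Qed.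
Lemma l1_one_sub_z : l1 (fone - zvar)%fps.
Proof. apply l1_sub; [apply l1_one|apply l1_zvar]. Qed.
Lemma W_one_sub_z m : W m (fone - zvar)%fps.
Proof. apply W_sub; [apply W_one|apply W_zvar]. Qed.
Lemma val_sq : val sq = 0.
Proof.
  pose proof (val_star sq sq l1_sq l1_sq) as H. rewrite sq_sq, val_one_sub_z in H.
  destruct (Rmult_integral _ _ (eq_sym H)); assumption.
Qed.

(** * Series with a square-root singularity *)

(** The transfer step. The defect at n is the sum of Y_k (sq(n-k) - sq(n)) minus a tail of Y times
    sq(n). For small k the difference of [sq] is of order k n^(-5/2); for large k the decay of Y is
    enough. *)
Lemma sq_star_asym Y : W 5 Y -> W 5 (sq * Y - scal_fps (val Y) sq)%fps.
Proof.
  intros HW. destruct (W_bd_nonneg _ _ HW) as [C [C0 HC]].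
  (* Here 54 = 9 * 6, with 9 from [sq_diff] and 6 from two sums of k^(-3/2); the term 6 C is the
     bound 2 C of the tail times the bound 3 of [sq]. *)
  exists (2 ^ 5 * C * 54 + 6 * C). intros n.
  assert (E : (sq * Y - scal_fps (val Y) sq)%fps n
    = rsum (fun k => Y k * (sq (n - k)%nat - sq n)) (S n) + - (ftail Y n * sq n)).
  { unfold fsub, gsub, scal_fps, ftail.
    replace (sq * Y)%fps with (Y * sq)%fps by ring. rewrite star_def.
    rewrite (rsum_ext (fun k => Y k * (sq (n - k)%nat - sq n))
      (fun k => Y k * sq (n - k)%nat - Y k * sq n)) by (intros; ring).
    rewrite rsum_minus, rsum_scal_r. ring. }
  rewrite E. eapply Rle_trans; [apply Rabs_triang|].
  unfold Rdiv at 1. rewrite Rmult_plus_distr_r. apply Rplus_le_compat.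
  - eapply Rle_trans; [apply rsum_abs|].
    apply Rle_trans with (rsum (fun k => (2 ^ 5 * C * 9 / rt n ^ 5) *
     (/ rt k ^ 3 + / rt (n - k) ^ 3)) (S n)).
    + apply rsum_le. intros k Hk. rewrite Rabs_mult.
      assert (P : 0 <= 2 ^ 5 * C * 9 / rt n ^ 5).
      { apply Rmult_le_pos; [lra|apply Rlt_le, Rinv_0_lt_compat, rt_pow_pos]. }
      assert (I3 : forall i, 0 < / rt i ^ 3) by (intros; apply Rinv_0_lt_compat, rt_pow_pos).
      pose proof (I3 k) as Ik. pose proof (I3 (n - k)%nat) as Ink.
      rewrite Rmult_plus_distr_l.
      assert (Q1 : 0 <= 2 ^ 5 * C * 9 / rt n ^ 5 * / rt k ^ 3) by (apply Rmult_le_pos; lra).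
      assert (Q2 : 0 <= 2 ^ 5 * C * 9 / rt n ^ 5 * / rt (n - k) ^ 3) by (apply Rmult_le_pos; lra).
      destruct (le_lt_dec k (n - k)) as [Hc|Hc].
      (* The factor k of [sq_diff] is absorbed by two of the five powers of [rt k], which leaves the
         summable k^(-3/2). *)
      * apply Rle_trans with ((C / rt k ^ 5) * ((rt k * rt k) * (2 ^ 5 * 9 / rt n ^ 5))).
        -- apply Rmult_le_compat; try apply Rabs_pos; [apply HC|].
           replace (sq n) with (sq (n - k + k)%nat) by (f_equal; lia).
           eapply Rle_trans; [apply sq_diff|]. apply Rmult_le_compat.
           ++ apply pos_INR.
           ++ apply Rmult_le_pos; [lra|apply Rlt_le, Rinv_0_lt_compat, rt_pow_pos].
           ++ rewrite rt_sq; lra.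
           ++ apply div_rt_half; [lra|lia].
        -- replace (C / rt k ^ 5 * (rt k * rt k * (2 ^ 5 * 9 / rt n ^ 5)))
             with (2 ^ 5 * C * 9 / rt n ^ 5 * / rt k ^ 3) by (field; rt_nz). lra.
      * apply Rle_trans with ((2 ^ 5 * C / rt n ^ 5) * (6 / rt (n - k) ^ 3)).
        -- apply Rmult_le_compat; try apply Rabs_pos.
           ++ eapply Rle_trans; [apply HC|]. apply div_rt_half; [assumption|lia].
           ++ eapply Rle_trans; [apply Rabs_triang|]. rewrite Rabs_Ropp.
              pose proof (sq_bd (n - k)%nat) as S1. pose proof (sq_bd n) as S2.
              assert (3 / rt n ^ 3 <= 3 / rt (n - k) ^ 3).
              { apply Rmult_le_compat_l; [lra|]. apply rinv_le; [apply rt_pow_pos|].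
                apply rt_pow_le; lia. }
              lra.
        -- assert (T : 2 ^ 5 * C / rt n ^ 5 * (6 / rt (n - k) ^ 3)
             = 6 / 9 * (2 ^ 5 * C * 9 / rt n ^ 5 * / rt (n - k) ^ 3)) by (field; rt_nz).
           rewrite T. lra.
    + rewrite rsum_scal, rsum_plus.
      assert (E2 : rsum (fun k => / rt (n - k) ^ 3) (S n) = rsum (fun k => / rt k ^ 3) (S n)).
      { rewrite (rsum_rev (fun k => / rt k ^ 3)). apply rsum_ext. intros k Hk.
        now replace (S n - 1 - k)%nat with (n - k)%nat by lia. }
      rewrite E2. pose proof (rsum_rt3 (S n)).
      replace (2 ^ 5 * C * 54 * / rt n ^ 5) with (2 ^ 5 * C * 9 / rt n ^ 5 * 6) by (field; rt_nz).
      apply Rmult_le_compat_l; [|lra].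
      apply Rmult_le_pos; [lra|apply Rlt_le, Rinv_0_lt_compat, rt_pow_pos].
  - rewrite Rabs_Ropp, Rabs_mult.
    apply Rle_trans with (2 * C / rt n ^ 3 * (3 / rt n ^ 3)).
    + apply Rmult_le_compat; try apply Rabs_pos; [apply (ftail_bd C Y HC)|apply sq_bd].
    + replace (2 * C / rt n ^ 3 * (3 / rt n ^ 3)) with (6 * C * / rt n ^ 5 * / rt n) by (field; rt_nz).
      rewrite <- (Rmult_1_r (6 * C * / rt n ^ 5)) at 2. apply Rmult_le_compat_l.
      * apply Rmult_le_pos; [lra|apply Rlt_le, Rinv_0_lt_compat, rt_pow_pos].
      * rewrite <- Rinv_1. apply rinv_le; [lra|apply rt_ge1].
Qed.

(* Analogue of "analytic up to a square-root singularity at [1], with coefficient [a] of sqrt(1-z)". *)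
Definition Cls (f : fps) (a : R) : Prop :=
  exists X Y, W 5 X /\ W 5 Y /\ f = (X + sq * Y)%fps /\ a = val Y.

Lemma l1_sq_star Y : W 5 Y -> l1 (sq * Y)%fps.
Proof. intros; apply l1_star; [apply l1_sq|now apply W5_l1]. Qed.
Lemma val_sq_star Y : W 5 Y -> val (sq * Y)%fps = 0.
Proof. intros. rewrite val_star, val_sq by first [apply l1_sq | now apply W5_l1]. ring. Qed.
Lemma Cls_val X Y : W 5 X -> W 5 Y -> val (X + sq * Y)%fps = val X.
Proof.
  intros HX HY. rewrite val_add, val_sq_star by first [now apply W5_l1 | now apply l1_sq_star | assumption].
  ring.
Qed.
Lemma Cls_l1 f a : Cls f a -> l1 f.
Proof.
  intros [X [Y [HX [HY [-> _]]]]]. apply l1_add; [now apply W5_l1|now apply l1_sq_star].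
Qed.
Lemma W_cst_star m a f : (3 <= m)%nat -> W m f -> W m (cst a * f)%fps.
Proof. intros; apply W_star; [assumption|apply W_cst|assumption]. Qed.

Lemma W5_star f g : W 5 f -> W 5 g -> W 5 (f * g)%fps.
Proof. apply W_star; lia. Qed.
Lemma W3_star f g : W 3 f -> W 3 g -> W 3 (f * g)%fps.
Proof. apply W_star; lia. Qed.

(** The class is closed under products because [sq * sq] is the polynomial 1 - z: the product of the
    two singular parts falls back into the smooth part. *)
Lemma Cls_star f g a b : Cls f a -> Cls g b -> Cls (f * g)%fps (val f * b + val g * a).
Proof.
  intros [X [Y [HX [HY [-> ->]]]]] [X' [Y' [HX' [HY' [-> ->]]]]].
  exists (X * X' + (fone - zvar) * (Y * Y'))%fps, (X * Y' + Y * X')%fps.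
  rewrite !Cls_val by assumption.
  split; [|split; [|split]].
  - apply W_add; [now apply W5_star|]. apply W5_star; [apply W_one_sub_z|now apply W5_star].
  - apply W_add; now apply W5_star.
  - rewrite <- sq_sq. ring.
  - rewrite val_add, !val_star by first [now apply W5_l1 | apply W5_l1; now apply W5_star]. ring.
Qed.
Lemma Cls_add f g a b : Cls f a -> Cls g b -> Cls (f + g)%fps (a + b).
Proof.
  intros [X [Y [HX [HY [-> ->]]]]] [X' [Y' [HX' [HY' [-> ->]]]]].
  exists (X + X')%fps, (Y + Y')%fps. repeat split; try (now apply W_add).
  - ring.
  - now rewrite val_add by now apply W5_l1.
Qed.
Lemma Cls_W5 f : W 5 f -> Cls f 0.
Proof.
  intros H. exists f, fzero. repeat split; [assumption|apply W_zero|ring|].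
  rewrite <- cst_zero, val_cst. reflexivity.
Qed.
Lemma Cls_scal f a c : Cls f a -> Cls (cst c * f)%fps (c * a).
Proof.
  intros H. pose proof (Cls_star _ _ _ _ (Cls_W5 _ (W_cst 5 c)) H) as E.
  rewrite val_cst, Rmult_0_r, Rplus_0_r in E. exact E.
Qed.
Lemma Cls_opp f a : Cls f a -> Cls (- f)%fps (- a).
Proof.
  intros H. replace (- f)%fps with (cst (-1) * f)%fps.
  - replace (- a) with (-1 * a) by ring. now apply Cls_scal.
  - replace (-1) with (- (1)) by ring. rewrite cst_opp, cst_one. ring.
Qed.
Lemma Cls_sub f g a b : Cls f a -> Cls g b -> Cls (f - g)%fps (a - b).
Proof.
  intros H H'. replace (f - g)%fps with (f + - g)%fps by ring. unfold Rminus.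
  apply Cls_add; [assumption|now apply Cls_opp].
Qed.
Lemma Cls_zvar f a : Cls f a -> Cls (zvar * f)%fps a.
Proof.
  intros H. pose proof (Cls_star _ _ _ _ (Cls_W5 _ (W_zvar 5)) H) as E.
  rewrite val_zvar, Rmult_0_r, Rplus_0_r, Rmult_1_l in E. exact E.
Qed.

Lemma Cls_asym f a : Cls f a -> W 5 (f - scal_fps a sq)%fps.
Proof.
  intros [X [Y [HX [HY [-> ->]]]]].
  replace (X + sq * Y - scal_fps (val Y) sq)%fps
    with (X + (sq * Y - scal_fps (val Y) sq))%fps by ring.
  apply W_add; [assumption|now apply sq_star_asym].
Qed.
(** With [Cls_asym], membership is equivalent to coefficients a sq(n) + O(n^(-5/2)). The
    decomposition serves the algebra, the coefficient form serves as entry from the local limit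
    theorem and as exit to the asymptotics. *)
Lemma Cls_intro f a : W 5 (f - scal_fps a sq)%fps -> Cls f a.
Proof.
  intros H. exists (f - scal_fps a sq)%fps, (cst a). repeat split.
  - assumption.
  - apply W_cst.
  - rewrite <- cst_star. ring.
  - now rewrite val_cst.
Qed.
Lemma Cls_0_W5 f : Cls f 0 -> W 5 f.
Proof.
  intros H. apply Cls_asym in H. destruct H as [C HC]. exists C. intros n.
  specialize (HC n). unfold fsub, gsub, scal_fps in HC.
  now rewrite Rmult_0_l, Rminus_0_r in HC.
Qed.

Lemma theta_sq : (cst 2 * (sq * theta sq))%fps = (- zvar)%fps.
Proof.
  replace (cst 2) with (fone + fone)%fps by (rewrite <- cst_one, <- cst_add; reflexivity).
  transitivity (theta (sq * sq)%fps).
  - rewrite theta_star. ring.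
  - rewrite sq_sq, theta_sub, theta_one, theta_zvar. ring.
Qed.

(* Multiplying by [2 sqrt(1-z)] makes [theta f] summable and isolates the square-root coefficient. *)
Lemma val_sq_theta f a : Cls f a ->
  l1 (cst 2 * (sq * theta f))%fps /\ val (cst 2 * (sq * theta f))%fps = - a.
Proof.
  intros [X [Y [HX [HY [-> ->]]]]].
  assert (E : (cst 2 * (sq * theta (X + sq * Y)))%fps
    = (cst 2 * (sq * theta X) + cst 2 * ((fone - zvar) * theta Y) - zvar * Y)%fps).
  { rewrite theta_add, theta_star, <- sq_sq.
    replace (cst 2 * (sq * (theta X + (theta sq * Y + sq * theta Y))))%fps
      with (cst 2 * (sq * theta X) + cst 2 * ((sq * sq) * theta Y) + (cst 2 * (sq * theta sq)) * Y)%fps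
      by ring.
    rewrite theta_sq. ring. }
  assert (lX : l1 (theta X)) by (apply W_l1; now apply W_theta).
  assert (lY : l1 (theta Y)) by (apply W_l1; now apply W_theta).
  assert (lY' : l1 Y) by now apply W5_l1.
  pose proof l1_sq as ls. pose proof l1_one_sub_z as lz. pose proof l1_zvar as lzv.
  pose proof (l1_cst 2) as l2.
  assert (l1 (cst 2 * (sq * theta X))%fps) by (repeat apply l1_star; assumption).
  assert (l1 (cst 2 * ((fone - zvar) * theta Y))%fps) by (repeat apply l1_star; assumption).
  assert (l1 (zvar * Y)%fps) by (apply l1_star; assumption).
  rewrite E. split; [apply l1_sub; [apply l1_add|]; assumption|].
  rewrite val_sub, val_add, !val_star, val_sq, val_one_sub_z, val_zvar, val_cst
    by first [assumption | apply l1_add; assumption | apply l1_star; assumption]. ring.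
Qed.

(** * Exponentials in the class [Cls] *)

Lemma ode_unique g f h : g O = 0 -> f O = h O ->
  theta f = (g * f)%fps -> theta h = (g * h)%fps -> f = h.
Proof.
  intros g0 H0 Hf Hh. apply functional_extensionality; intros n.
  induction n as [n IH] using lt_wf_ind. destruct n as [|n]; [assumption|].
  assert (En : INR (S n) * f (S n) = INR (S n) * h (S n)).
  { change (theta f (S n) = theta h (S n)). rewrite Hf, Hh, !star_def.
    apply rsum_ext. intros [|k] Hk; [rewrite g0; ring|]. rewrite IH by lia. reflexivity. }
  apply Rmult_eq_reg_l in En; [assumption|]. apply not_0_INR; lia.
Qed.

(** Each coefficient of a product is a finite sum, so multiplication by f commutes with
    coefficientwise convergence. *)
Lemma Series_star f (G : nat -> fps) n :
  (forall i, ex_series (fun k => G k i)) ->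
  is_series (fun k => (f * G k)%fps n) ((f * (fun i => Series (fun k => G k i)))%fps n).
Proof.
  intros H. change (is_series (fun k => rsum (fun j => f j * G k (n - j)%nat) (S n))
    (rsum (fun j => f j * Series (fun k => G k (n - j)%nat)) (S n))).
  induction (S n) as [|m IH].
  - apply is_lim_seq_rsum. apply is_lim_seq_ext with (fun _ => 0); [|apply is_lim_seq_const].
    intros k. symmetry. apply rsum_zero. reflexivity.
  - rewrite rsum_S. apply (is_series_plus _ _ _ _ IH).
    exact (is_series_scal (V := R_NormedModule) (f m) (fun k => G k (n - m)%nat) _
      (Series_correct _ (H (n - m)%nat))).
Qed.

Section Exponential.
Context (X Y : fps) (M : R).
(** The pair (A_k, B_k) with (X + sq Y)^k / k! = A_k + sq B_k; the recursion uses [sq * sq] = 1 - z,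
    so both components stay free of square roots. *)
Fixpoint expc (k : nat) : fps * fps :=
  match k with
  | O => (fone, fzero)
  | S j => let A := fst (expc j) in let B := snd (expc j) in
      (cst (/ INR (S j)) * (A * X + B * ((fone - zvar) * Y)),
       cst (/ INR (S j)) * (A * Y + B * X))%fps
  end.

(** Passing from k to k + 1 costs two products and a division by k + 1; the bounds are the terms of
    an exponential series. *)
Lemma expc_bd C : bd 5 C X -> bd 5 C Y -> bd 5 C ((fone - zvar) * Y)%fps ->
  forall k, bd 5 ((2 * starK 5 * C) ^ k / INR (fact k)) (fst (expc k)) /\
            bd 5 ((2 * starK 5 * C) ^ k / INR (fact k)) (snd (expc k)).
Proof.
  intros HX HY HZ k. induction k as [|k [IA IB]].
  - simpl. replace (1 / 1) with 1 by field. split.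
    + intros [|n]; unfold fone, gone.
      * rewrite rt_0, pow1, Rabs_R1. lra.
      * rewrite Rabs_R0. apply Rmult_le_pos; [lra|apply Rlt_le, Rinv_0_lt_compat, rt_pow_pos].
    + intros n; unfold fzero, gzero. rewrite Rabs_R0.
      apply Rmult_le_pos; [lra|apply Rlt_le, Rinv_0_lt_compat, rt_pow_pos].
  - assert (E : (2 * starK 5 * C) ^ S k / INR (fact (S k))
      = Rabs (/ INR (S k)) * (starK 5 * ((2 * starK 5 * C) ^ k / INR (fact k)) * C
         + starK 5 * ((2 * starK 5 * C) ^ k / INR (fact k)) * C)).
    { change (fact (S k)) with (S k * fact k)%nat. rewrite mult_INR.
      pose proof (INR_fact_neq_0 k). pose proof (lt_0_INR (S k) ltac:(lia)).
      rewrite Rabs_pos_eq by (apply Rlt_le, Rinv_0_lt_compat; assumption).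
      simpl pow. field. split; [lra|]. apply not_0_INR; lia. }
    rewrite E. split; cbn [expc fst snd]; rewrite cst_star; apply bd_scal; apply bd_add;
      (apply bd_star; [lia| |]); assumption.
Qed.
End Exponential.

Lemma theta_scal c f : theta (cst c * f)%fps = (cst c * theta f)%fps.
Proof. rewrite theta_star, theta_cst. ring. Qed.
Lemma cst_inv_cancel c f g : c <> 0 -> (cst c * f)%fps = (cst c * g)%fps -> f = g.
Proof. intros Hc. apply star_inj_l. exact Hc. Qed.

(** The exponential of L is obtained by summing the two components of the terms L^k / k! separately
    in W 5. Its square-root coefficient is not computed from the sum [BB]: it is read off the
    equation theta E = theta L * E by means of [val_sq_theta]. *)
Lemma Cls_exp L a : Cls L a -> L O = 0 ->
  exists E, E O = 1 /\ theta E = (theta L * E)%fps /\ Cls E (val E * a).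
Proof.
  intros HL L0. assert (HL' := HL). destruct HL' as [X [Y [HX [HY [HXY Ha]]]]].
  assert (HZ : W 5 ((fone - zvar) * Y)%fps) by (apply W5_star; [apply W_one_sub_z|assumption]).
  destruct (W_bd_nonneg _ _ HX) as [C1 [P1 B1]], (W_bd_nonneg _ _ HY) as [C2 [P2 B2]],
    (W_bd_nonneg _ _ HZ) as [C3 [P3 B3]].
  pose (C := C1 + C2 + C3).
  assert (K1 : C1 <= C) by (unfold C; lra). assert (K2 : C2 <= C) by (unfold C; lra).
  assert (K3 : C3 <= C) by (unfold C; lra).
  pose proof (expc_bd X Y C (bd_weaken _ _ _ _ K1 B1) (bd_weaken _ _ _ _ K2 B2)
    (bd_weaken _ _ _ _ K3 B3)) as HB.
  set (M := 2 * starK 5 * C) in *.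
  set (A := fun k => fst (expc X Y k)) in *. set (B := fun k => snd (expc X Y k)) in *.
  assert (HexM : ex_series (fun k => M ^ k / INR (fact k))).
  { exists (exp M). apply is_series_ext with (fun n => scal (pow_n M n) (/ INR (fact n))).
    - intros n. rewrite pow_n_pow. reflexivity.
    - exact (is_exp_Reals M). }
  assert (bdS : forall (G : nat -> fps), (forall k, bd 5 (M ^ k / INR (fact k)) (G k)) ->
    (forall i, ex_series (fun k => G k i)) /\ W 5 (fun i => Series (fun k => G k i))).
  { intros G HG.
    assert (Hex : forall i, ex_series (fun k => M ^ k / INR (fact k) / rt i ^ 5)).
    { intros i. exact (ex_series_scal_r (/ rt i ^ 5) _ HexM). }
    assert (Hab : forall i, l1 (fun k => G k i)).
    { intros i. eapply (ex_series_le (fun k => Rabs (G k i))); [|exact (Hex i)].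
      intros k. unfold norm; simpl. unfold abs; simpl. rewrite Rabs_Rabsolu. apply HG. }
    split; [intros i; now apply l1_ex|].
    exists (Series (fun k => M ^ k / INR (fact k))). intros i.
    eapply Rle_trans; [apply Series_Rabs, Hab|].
    unfold Rdiv at 1. rewrite <- Series_scal_r. apply Series_le; [|exact (Hex i)].
    intros k. split; [apply Rabs_pos|apply HG]. }
  destruct (bdS A (fun k => proj1 (HB k))) as [exA WA].
  destruct (bdS B (fun k => proj2 (HB k))) as [exB WB].
  set (AA := fun i => Series (fun k => A k i)) in *.
  set (BB := fun i => Series (fun k => B k i)) in *.
  pose (E := (AA + sq * BB)%fps). pose (F := fun k => (A k + sq * B k)%fps).
  assert (HF : forall k, (cst (INR (S k)) * F (S k))%fps = (L * F k)%fps).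
  { intros k. unfold F. rewrite HXY. change (A (S k)) with
      (cst (/ INR (S k)) * (A k * X + B k * ((fone - zvar) * Y)))%fps.
    change (B (S k)) with (cst (/ INR (S k)) * (A k * Y + B k * X))%fps.
    rewrite <- sq_sq.
    transitivity ((cst (INR (S k)) * cst (/ INR (S k))) *
       ((X + sq * Y) * (A k + sq * B k)))%fps; [ring|].
    rewrite <- cst_mul, Rinv_r by (apply not_0_INR; lia). rewrite cst_one. ring. }
  assert (HF0 : F O = fone) by (unfold F, A, B; simpl; ring).
  assert (HE : forall n, is_series (fun k => F k n) (E n)).
  { intros n. unfold F, E, fadd, gadd. apply (is_series_plus (fun k => A k n)).
    - apply Series_correct, exA.
    - exact (Series_star sq B n exB). }
  assert (HEn : E = (fun n => Series (fun k => F k n))).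
  { apply functional_extensionality; intros n. symmetry. apply is_series_unique, HE. }
  assert (HthF : forall k, theta (F (S k)) = (theta L * F k)%fps).
  (* The identity theta(L^(k+1)/(k+1)!) = theta(L) L^k/k!, by induction; the match stands for the
     previous term, with F_(-1) = 0. *)
  { assert (base : forall k, theta (F k) = (match k with O => fzero | S j => theta L * F j end)%fps ->
      theta (F (S k)) = (theta L * F k)%fps).
    { intros k Hk. apply cst_inv_cancel with (INR (S k)); [apply not_0_INR; lia|].
      rewrite <- theta_scal, HF, theta_star, Hk. destruct k as [|k].
      - rewrite HF0. change (INR 1) with 1. rewrite cst_one. ring.
      - replace (L * (theta L * F k))%fps with (theta L * (L * F k))%fps by ring.
        rewrite <- HF. rewrite (S_INR (S k)), cst_add, cst_one. ring. }
    intros k; induction k as [|k IH]; apply base; [|exact IH].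
    rewrite HF0. apply theta_one. }
  assert (E0 : E O = 1).
  { rewrite HEn. rewrite <- (val_cst 1). apply Series_ext. intros [|k].
    - rewrite HF0. reflexivity.
    - assert (H0 := f_equal (fun h => h O) (HF k)). cbv beta in H0. rewrite !star_0 in H0.
      rewrite L0, Rmult_0_l in H0. apply Rmult_integral in H0. destruct H0 as [H0|H0]; [|exact H0].
      exfalso. change (INR (S k) = 0) in H0. revert H0. apply not_0_INR. lia. }
  assert (ThE : theta E = (theta L * E)%fps).
  { apply functional_extensionality; intros n. rewrite HEn at 2.
    assert (S1 : is_series (fun k => (theta L * F k)%fps n)
       ((theta L * (fun i => Series (fun k => F k i)))%fps n)).
    { apply Series_star. intros i. eexists. apply HE. }
    apply is_series_unique in S1. rewrite <- S1. symmetry. apply is_series_unique.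
    apply is_lim_seq_rsum.
    assert (S2 : is_lim_seq (rsum (fun k => theta (F k) n)) (theta E n)).
    { apply is_lim_seq_rsum. exact (is_series_scal (V := R_NormedModule) (INR n) (fun k => F k n) _ (HE n)). }
    apply is_lim_seq_incr_1 in S2. eapply is_lim_seq_ext; [|exact S2].
    intros m. cbv beta. rewrite rsum_Sl, HF0, theta_one. unfold fzero, gzero. rewrite Rplus_0_l.
    apply rsum_ext. intros k _. now rewrite HthF. }
  assert (HC : Cls E (val BB)) by (exists AA, BB; repeat split; assumption).
  exists E. split; [exact E0|]. split; [exact ThE|].
  (* Evaluating 2 sqrt(1-z) theta E = (2 sqrt(1-z) theta L) E at 1 expresses [val BB] as E(1) a. *)
  destruct (val_sq_theta _ _ HC) as [lE vE]. destruct (val_sq_theta _ _ HL) as [lL vL].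
  replace (val E * a) with (val BB); [exact HC|].
  rewrite ThE in vE.
  replace (cst 2 * (sq * (theta L * E)))%fps with ((cst 2 * (sq * theta L)) * E)%fps in vE by ring.
  rewrite val_star, vL in vE by first [assumption | eapply Cls_l1; exact HC]. lra.
Qed.

(** * Expansions along the real axis *)

Lemma l1_scale x f : Rabs x <= 1 -> l1 f -> l1 (scale x f).
Proof.
  intros Hx Hf. apply l1_le with f; [assumption|]. intros n. unfold scale.
  rewrite Rabs_mult, <- RPow_abs. rewrite <- (Rmult_1_r (Rabs (f n))) at 2.
  apply Rmult_le_compat_l; [apply Rabs_pos|]. rewrite <- (pow1 n). apply pow_incr.
  split; [apply Rabs_pos|assumption].
Qed.

Lemma one_sub_pow x n : 0 <= x <= 1 -> 0 <= 1 - x ^ n <= INR n * (1 - x).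
Proof.
  intros Hx. induction n as [|n IH]; [simpl; lra|]. rewrite S_INR. simpl.
  assert (0 <= x ^ n <= 1).
  { split; [apply pow_le; lra|]. rewrite <- (pow1 n). apply pow_incr; lra. }
  split; nra.
Qed.

Lemma val_scale_lipschitz f : l1 f -> l1 (theta f) -> exists C, forall x, 0 <= x <= 1 ->
  Rabs (val (scale x f) - val f) <= C * (1 - x).
Proof.
  intros Hf Ht. exists (Series (fun n => Rabs (theta f n))). intros x Hx.
  assert (lx : l1 (scale x f)) by (apply l1_scale; [rewrite Rabs_pos_eq; lra|assumption]).
  rewrite <- (val_sub _ _ lx Hf).
  assert (T : forall n, Rabs ((scale x f - f)%fps n) <= Rabs (theta f n) * (1 - x)).
  { intros n. unfold fsub, gsub, scale, theta.
    replace (f n * x ^ n - f n) with (- (f n * (1 - x ^ n))) by ring.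
    pose proof (one_sub_pow x n Hx). rewrite Rabs_Ropp, !Rabs_mult, (Rabs_pos_eq (1 - x ^ n)) by lra.
    rewrite (Rabs_pos_eq (INR n)) by apply pos_INR.
    replace (INR n * Rabs (f n) * (1 - x)) with (Rabs (f n) * (INR n * (1 - x))) by ring.
    apply Rmult_le_compat_l; [apply Rabs_pos|lra]. }
  eapply Rle_trans; [apply Series_Rabs; exact (l1_sub _ _ lx Hf)|].
  rewrite <- Series_scal_r. apply Series_le.
  - intros n. split; [apply Rabs_pos|apply T].
  - now apply ex_series_scal_r.
Qed.

Lemma sq_neg n : (1 <= n)%nat -> sq n <= 0.
Proof.
  intros H. rewrite sq_tq. pose proof (tq_pos n). apply le_INR in H. simpl in H.
  unfold Rdiv. assert (0 < / (2 * INR n - 1)) by (apply Rinv_0_lt_compat; lra). nra.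
Qed.

(** The square of the value is 1 - x. The sign is settled by writing it as s(x) - s(1), with s(1) =
    0: the coefficients sq(n) (x^n - 1) are nonnegative because sq(n) <= 0 for n >= 1. *)
Lemma val_scale_sq x : 0 <= x <= 1 -> val (scale x sq) = sqrt (1 - x).
Proof.
  intros Hx.
  assert (lx : l1 (scale x sq)) by (apply l1_scale; [rewrite Rabs_pos_eq; lra|apply l1_sq]).
  assert (P : 0 <= val (scale x sq)).
  { replace (val (scale x sq)) with (val (scale x sq - sq)%fps)
      by (rewrite val_sub, val_sq by first [assumption | apply l1_sq]; ring).
    assert (N : forall n, 0 <= (scale x sq - sq)%fps n).
    { intros [|n]; unfold fsub, gsub, scale; [simpl; lra|].
      pose proof (sq_neg (S n) ltac:(lia)). pose proof (one_sub_pow x (S n) Hx). nra. }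
    pose proof (rsum_le_Series _ O N (l1_ex _ (l1_sub _ _ lx l1_sq))) as H. exact H. }
  symmetry. apply sqrt_lem_1; [lra|exact P|].
  rewrite <- val_star by assumption. rewrite <- scale_star, sq_sq, scale_sub, scale_one.
  rewrite val_sub, val_one; [|apply l1_one|apply l1_scale; [rewrite Rabs_pos_eq; lra|apply l1_zvar]].
  f_equal. replace (scale x zvar) with (cst x * zvar)%fps.
  - rewrite val_star, val_cst, val_zvar by first [apply l1_cst | apply l1_zvar]. ring.
  - rewrite cst_star. apply functional_extensionality; intros [|[|n]]; unfold scale, scal_fps, zvar; simpl; ring.
Qed.

(** X and Y have summable Euler derivatives and are therefore Lipschitz up to 1. This is the bridge
    from coefficients to the real expansion that defines eta. *)
Lemma Cls_puiseux f a : Cls f a -> exists C, forall x, 0 <= x <= 1 ->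
  Rabs (val (scale x f) - (val f + a * sqrt (1 - x))) <= C * (1 - x).
Proof.
  intros [X [Y [HX [HY [-> ->]]]]].
  destruct (val_scale_lipschitz X) as [C1 H1]; [now apply W5_l1|apply W_l1; now apply W_theta|].
  destruct (val_scale_lipschitz Y) as [C2 H2]; [now apply W5_l1|apply W_l1; now apply W_theta|].
  exists (C1 + C2). intros x Hx. specialize (H1 x Hx). specialize (H2 x Hx).
  rewrite Cls_val by assumption.
  assert (lX : l1 (scale x X)) by (apply l1_scale; [rewrite Rabs_pos_eq; lra|now apply W5_l1]).
  assert (lY : l1 (scale x Y)) by (apply l1_scale; [rewrite Rabs_pos_eq; lra|now apply W5_l1]).
  assert (ls : l1 (scale x sq)) by (apply l1_scale; [rewrite Rabs_pos_eq; lra|apply l1_sq]).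
  replace (scale x (X + sq * Y)%fps) with (scale x X + scale x sq * scale x Y)%fps.
  2:{ rewrite <- scale_star. apply functional_extensionality; intros n. unfold fadd, gadd, scale. ring. }
  rewrite val_add, val_star, val_scale_sq by first [assumption | now apply l1_star].
  set (r := sqrt (1 - x)). assert (Hr : 0 <= r <= 1).
  { split; [apply sqrt_pos|]. apply Rle_trans with (sqrt 1); [apply sqrt_le_1_alt; lra|rewrite sqrt_1; lra]. }
  replace (val (scale x X) + r * val (scale x Y) - (val X + val Y * r))
    with ((val (scale x X) - val X) + r * (val (scale x Y) - val Y)) by ring.
  eapply Rle_trans; [apply Rabs_triang|]. rewrite Rabs_mult, (Rabs_pos_eq r) by lra.
  pose proof (Rabs_pos (val (scale x Y) - val Y)). nra.
Qed.

(** * Values on the closed unit disc and Fourier coefficients *)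

Lemma Cpow_S (z : Complex.C) n : (z ^ S n = z * z ^ n)%C.
Proof. reflexivity. Qed.
Lemma Cpow_split (z : Complex.C) m n : (z ^ (m + n) = z ^ m * z ^ n)%C.
Proof.
  induction m as [|m IH].
  - simpl. now rewrite Cmult_1_l.
  - change (S m + n)%nat with (S (m + n)). rewrite !Cpow_S, IH. ring.
Qed.

Lemma im_le_Cmod (z : Complex.C) : Rabs (Im z) <= Cmod z.
Proof. eapply Rle_trans; [apply Rmax_r|apply Rmax_Cmod]. Qed.

(** Complex values are encoded by two real series, which multiply like real and imaginary parts; the
    real algebra [l1] then suffices. *)
Definition reS (z : Complex.C) (f : fps) : fps := fun n => f n * Re (z ^ n)%C.
Definition imS (z : Complex.C) (f : fps) : fps := fun n => f n * Im (z ^ n)%C.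
Definition ev (f : fps) (z : Complex.C) : Complex.C := (val (reS z f), val (imS z f)).

Lemma Cmod_pow_le1 (z : Complex.C) n : Cmod z <= 1 -> Cmod (z ^ n)%C <= 1.
Proof.
  intros H. rewrite Cmod_pow. rewrite <- (pow1 n). apply pow_incr. split; [apply Cmod_ge_0|assumption].
Qed.

Lemma reS_le z f n : Cmod z <= 1 -> Rabs (reS z f n) <= Rabs (f n).
Proof.
  intros H. unfold reS. rewrite Rabs_mult. rewrite <- (Rmult_1_r (Rabs (f n))) at 2.
  apply Rmult_le_compat_l; [apply Rabs_pos|].
  eapply Rle_trans; [apply re_le_Cmod|now apply Cmod_pow_le1].
Qed.
Lemma imS_le z f n : Cmod z <= 1 -> Rabs (imS z f n) <= Rabs (f n).
Proof.
  intros H. unfold imS. rewrite Rabs_mult. rewrite <- (Rmult_1_r (Rabs (f n))) at 2.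
  apply Rmult_le_compat_l; [apply Rabs_pos|].
  eapply Rle_trans; [apply im_le_Cmod|now apply Cmod_pow_le1].
Qed.
Lemma l1_reS z f : Cmod z <= 1 -> l1 f -> l1 (reS z f).
Proof. intros Hz Hf. apply l1_le with f; [assumption|]. intros; now apply reS_le. Qed.
Lemma l1_imS z f : Cmod z <= 1 -> l1 f -> l1 (imS z f).
Proof. intros Hz Hf. apply l1_le with f; [assumption|]. intros; now apply imS_le. Qed.

Lemma reS_star z f g : reS z (f * g)%fps = (reS z f * reS z g - imS z f * imS z g)%fps.
Proof.
  apply functional_extensionality; intros n. unfold fsub, gsub. unfold reS at 1.
  rewrite !star_def, <- rsum_minus, <- rsum_scal_r. apply rsum_ext. intros k Hk.
  unfold reS, imS. replace n with (k + (n - k))%nat at 2 by lia.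
  rewrite Cpow_split, re_mult. ring.
Qed.
Lemma imS_star z f g : imS z (f * g)%fps = (reS z f * imS z g + imS z f * reS z g)%fps.
Proof.
  apply functional_extensionality; intros n. unfold fadd, gadd. unfold imS at 1.
  rewrite !star_def, <- rsum_plus, <- rsum_scal_r. apply rsum_ext. intros k Hk.
  unfold reS, imS. replace n with (k + (n - k))%nat at 2 by lia.
  rewrite Cpow_split, im_mult. ring.
Qed.

Lemma ev_star f g z : Cmod z <= 1 -> l1 f -> l1 g -> ev (f * g)%fps z = (ev f z * ev g z)%C.
Proof.
  intros Hz Hf Hg. unfold ev. rewrite reS_star, imS_star.
  pose proof (l1_reS z f Hz Hf). pose proof (l1_reS z g Hz Hg).
  pose proof (l1_imS z f Hz Hf). pose proof (l1_imS z g Hz Hg).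
  rewrite val_sub, val_add, !val_star by first [assumption | now apply l1_star]. reflexivity.
Qed.
Lemma ev_add f g z : Cmod z <= 1 -> l1 f -> l1 g -> ev (f + g)%fps z = (ev f z + ev g z)%C.
Proof.
  intros Hz Hf Hg. unfold ev.
  replace (reS z (f + g)%fps) with (reS z f + reS z g)%fps
    by (apply functional_extensionality; intros n; unfold reS, fadd, gadd; ring).
  replace (imS z (f + g)%fps) with (imS z f + imS z g)%fps
    by (apply functional_extensionality; intros n; unfold imS, fadd, gadd; ring).
  rewrite !val_add by first [now apply l1_reS | now apply l1_imS]. reflexivity.
Qed.
Lemma ev_opp f z : ev (- f)%fps z = (- ev f z)%C.
Proof.
  unfold ev.
  replace (reS z (- f)%fps) with (- reS z f)%fps
    by (apply functional_extensionality; intros n; unfold reS, fopp, gopp; ring).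
  replace (imS z (- f)%fps) with (- imS z f)%fps
    by (apply functional_extensionality; intros n; unfold imS, fopp, gopp; ring).
  rewrite !val_opp. reflexivity.
Qed.
Lemma ev_sub f g z : Cmod z <= 1 -> l1 f -> l1 g -> ev (f - g)%fps z = (ev f z - ev g z)%C.
Proof.
  intros Hz Hf Hg. replace (f - g)%fps with (f + - g)%fps by ring.
  rewrite ev_add, ev_opp by first [assumption | now apply l1_opp]. reflexivity.
Qed.
Lemma ev_cst a z : ev (cst a) z = RtoC a.
Proof.
  unfold ev, RtoC.
  replace (reS z (cst a)) with (cst a).
  2:{ apply functional_extensionality; intros [|n]; unfold reS; simpl; ring. }
  replace (imS z (cst a)) with (cst 0).
  2:{ apply functional_extensionality; intros [|n]; unfold imS; simpl; ring. }
  now rewrite !val_cst.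
Qed.
Lemma ev_one z : ev fone z = RtoC 1.
Proof. exact (ev_cst 1 z). Qed.

Definition nrm (f : fps) : R := Series (fun n => Rabs (f n)).
Lemma nrm_nonneg f : l1 f -> 0 <= nrm f.
Proof. intros H. exact (rsum_le_Series _ O (fun k => Rabs_pos (f k)) H). Qed.
Lemma rsum_le_nrm f N : l1 f -> rsum (fun k => Rabs (f k)) N <= nrm f.
Proof. intros H. apply rsum_le_Series; [intros; apply Rabs_pos|exact H]. Qed.
Lemma nrm_le f M : l1 f -> (forall N, rsum (fun k => Rabs (f k)) N <= M) -> nrm f <= M.
Proof. intros; now apply Series_le_bound. Qed.
Lemma term_le_nrm f n : l1 f -> Rabs (f n) <= nrm f.
Proof.
  intros H. eapply Rle_trans; [|apply (rsum_le_nrm f (S n) H)].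
  apply (rsum_term_le (fun k => Rabs (f k))); [intros; apply Rabs_pos|lia].
Qed.

(** The constant 2 is the price of bounding real and imaginary parts separately; it reappears in the
    choices of eps below. *)
Lemma ev_le f z : Cmod z <= 1 -> l1 f -> Cmod (ev f z) <= 2 * nrm f.
Proof.
  intros Hz Hf. eapply Rle_trans; [apply Cmod_2Rmax|]. unfold ev; simpl fst; simpl snd.
  assert (A1 : Rabs (val (reS z f)) <= nrm f).
  { eapply Rle_trans; [apply Series_Rabs; exact (l1_reS z f Hz Hf)|].
    apply Series_le; [|exact Hf]. intros n; split; [apply Rabs_pos|now apply reS_le]. }
  assert (A2 : Rabs (val (imS z f)) <= nrm f).
  { eapply Rle_trans; [apply Series_Rabs; exact (l1_imS z f Hz Hf)|].
    apply Series_le; [|exact Hf]. intros n; split; [apply Rabs_pos|now apply imS_le]. }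
  apply Rmult_le_compat.
  - apply sqrt_pos.
  - eapply Rle_trans; [apply Rabs_pos|apply Rmax_l].
  - apply Rle_trans with (sqrt (2 * 2)); [apply sqrt_le_1_alt; lra|rewrite sqrt_square; lra].
  - now apply Rmax_lub.
Qed.

Lemma ev_scale r f z : ev (scale r f) z = ev f (RtoC r * z)%C.
Proof.
  assert (E : forall n, ((RtoC r * z) ^ n = RtoC (r ^ n) * z ^ n)%C).
  { induction n as [|n IH]; [simpl; ring|]. rewrite !Cpow_S, IH. simpl pow. rewrite RtoC_mult. ring. }
  unfold ev. f_equal; f_equal; apply functional_extensionality; intros n; unfold reS, imS, scale;
    rewrite E; [rewrite re_scal_l|rewrite im_scal_l]; ring.
Qed.

(** * The unit circle and its Fourier coefficients *)

Definition cis (t : R) : Complex.C := (cos t, sin t).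
Lemma cis_plus a b : cis (a + b) = (cis a * cis b)%C.
Proof. unfold cis, Cmult; simpl. rewrite cos_plus, sin_plus. f_equal; ring. Qed.
Lemma cis_0 : cis 0 = RtoC 1.
Proof. unfold cis. now rewrite cos_0, sin_0. Qed.
Lemma cis_pow t n : (cis t ^ n)%C = cis (INR n * t).
Proof.
  induction n as [|n IH]; [simpl; rewrite Rmult_0_l, cis_0; reflexivity|].
  rewrite Cpow_S, IH, <- cis_plus, S_INR. f_equal; ring.
Qed.
Lemma Cmod_cis t : Cmod (cis t) = 1.
Proof.
  unfold Cmod, cis; simpl. rewrite !Rmult_1_r. pose proof (sin2_cos2 t) as H. unfold Rsqr in H.
  replace (cos t * cos t + sin t * sin t) with 1 by lra. apply sqrt_1.
Qed.

Lemma sin_IZR_PI k : sin (IZR k * PI) = 0.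
Proof. apply sin_eq_0_1. now exists k. Qed.

Lemma is_RInt_cos_int (k : Z) :
  is_RInt (fun t => cos (IZR k * t)) (- PI) PI (if Z.eqb k 0 then 2 * PI else 0).
Proof.
  destruct (Z.eqb_spec k 0) as [->|Hk].
  - apply is_RInt_ext with (fun _ => 1).
    + intros x _. now rewrite Rmult_0_l, cos_0.
    + pose proof (is_RInt_const (- PI) PI 1) as H. unfold scal in H; simpl in H; unfold mult in H; simpl in H.
      replace (2 * PI) with ((PI - - PI) * 1) by ring. exact H.
  - assert (Hk' : IZR k <> 0) by (now apply not_0_IZR).
    replace 0 with (minus (sin (IZR k * PI) / IZR k) (sin (IZR k * - PI) / IZR k)).
    + apply (is_RInt_derive (fun t => sin (IZR k * t) / IZR k)).
      * intros x _. auto_derive; [trivial|field; assumption].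
      * intros x _. apply (continuous_comp (fun t => IZR k * t) cos).
        -- apply (continuous_mult (fun _ => IZR k) (fun t => t)); [apply continuous_const|apply continuous_id].
        -- apply continuity_pt_filterlim, continuity_cos.
    + unfold minus, plus, opp; simpl. replace (IZR k * - PI) with (- (IZR k * PI)) by ring.
      rewrite sin_neg, sin_IZR_PI. field. assumption.
Qed.

Lemma is_RInt_rsum (F : nat -> R -> R) (I : nat -> R) a b N :
  (forall m, (m < N)%nat -> is_RInt (F m) a b (I m)) ->
  is_RInt (fun t => rsum (fun m => F m t) N) a b (rsum I N).
Proof.
  induction N as [|N IH]; intros H.
  - pose proof (is_RInt_const a b (0 : R)) as H0. unfold rsum; simpl.
    unfold scal in H0; simpl in H0; unfold mult in H0; simpl in H0.
    rewrite Rmult_0_r in H0. exact H0.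
  - apply (is_RInt_plus (fun t => rsum (fun m => F m t) N) (F N)); [apply IH; intros; apply H; lia|apply H; lia].
Qed.

Definition trunc (N : nat) (f : fps) : fps := fun n => if (n <? N)%nat then f n else 0.
Lemma trunc_lt N f n : (n < N)%nat -> trunc N f n = f n.
Proof. intros H. unfold trunc. now destruct (Nat.ltb_spec n N); [|lia]. Qed.
Lemma trunc_ge N f n : (N <= n)%nat -> trunc N f n = 0.
Proof. intros H. unfold trunc. now destruct (Nat.ltb_spec n N); [lia|]. Qed.

Lemma is_series_finite f N : (forall n, (N <= n)%nat -> f n = 0) -> is_series f (rsum f N).
Proof.
  intros H. apply is_lim_seq_rsum. apply (is_lim_seq_incr_n (rsum f) N).
  apply is_lim_seq_ext with (fun _ => rsum f N); [|apply is_lim_seq_const].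
  intros n. rewrite Nat.add_comm, rsum_split, (rsum_zero (fun k => f (N + k)%nat)); [ring|].
  intros; apply H; lia.
Qed.
Lemma val_finite f N : (forall n, (N <= n)%nat -> f n = 0) -> val f = rsum f N.
Proof. intros H. apply is_series_unique. now apply is_series_finite. Qed.
Lemma l1_finite f N : (forall n, (N <= n)%nat -> f n = 0) -> l1 f.
Proof.
  intros H. exists (rsum (fun n => Rabs (f n)) N). apply is_series_finite.
  intros n Hn. now rewrite H, Rabs_R0.
Qed.
Lemma l1_trunc N f : l1 (trunc N f).
Proof. apply l1_finite with N. intros; now apply trunc_ge. Qed.

Lemma nrm_tail f eps : l1 f -> 0 < eps -> exists N, (1 <= N)%nat /\ forall n, (N <= n)%nat ->
  nrm (f - trunc n f)%fps <= eps.
Proof.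
  intros Hf He. assert (H := Hf). apply Series_correct in H. apply is_lim_seq_rsum in H.
  apply is_lim_seq_spec in H. destruct (H (mkposreal eps He)) as [N HN].
  exists (S N). split; [lia|]. intros n Hn. apply nrm_le; [apply l1_sub; [assumption|apply l1_trunc]|].
  intros M. specialize (HN n ltac:(lia)). simpl in HN. fold (nrm f) in HN.
  destruct (le_lt_dec M n) as [HM|HM].
  - rewrite rsum_zero; [lra|]. intros k Hk. unfold fsub, gsub. rewrite trunc_lt by lia.
    now rewrite Rminus_diag, Rabs_R0.
  - replace M with (n + (M - n))%nat by lia. rewrite rsum_split, rsum_zero.
    2:{ intros k Hk. unfold fsub, gsub. rewrite trunc_lt by lia. now rewrite Rminus_diag, Rabs_R0. }
    rewrite (rsum_ext _ (fun k => Rabs (f (n + k)%nat))).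
    2:{ intros k Hk. unfold fsub, gsub. rewrite trunc_ge by lia. now rewrite Rminus_0_r. }
    pose proof (rsum_split (fun k => Rabs (f k)) n (M - n)) as E.
    pose proof (rsum_le_nrm f (n + (M - n)) Hf). apply Rabs_def2 in HN. lra.
Qed.

(** Cauchy's estimate on the unit circle. Only a polynomial truncation is integrated, so sum and
    integral need not be exchanged; the discarded tail is paid for by eps. *)
Lemma coef_bound h B : l1 h -> (forall t, Cmod (ev h (cis t)) <= B) -> forall n, Rabs (h n) <= B.
Proof.
  intros Hh HB n. apply le_epsilon. intros eps He.
  destruct (nrm_tail h (eps / 2) Hh ltac:(lra)) as [N [_ HN]].
  (* The truncation length exceeds n, so the polynomial keeps the coefficient of degree n. *)
  specialize (HN (N + S n)%nat ltac:(lia)). set (M := (N + S n)%nat) in *.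
  set (p := trunc M h) in *. pose proof (l1_trunc M h) as Hp. fold p in Hp.
  set (F := fun t => rsum (fun m => p m * cos (IZR (Z.of_nat m - Z.of_nat n) * t)) M).
  assert (HI : is_RInt F (- PI) PI (2 * PI * h n)).
  { replace (2 * PI * h n) with
      (rsum (fun m => p m * (if Z.eqb (Z.of_nat m - Z.of_nat n) 0 then 2 * PI else 0)) M).
    - apply is_RInt_rsum. intros m Hm.
      exact (is_RInt_scal (fun t => cos (IZR (Z.of_nat m - Z.of_nat n) * t)) (- PI) PI (p m) _
        (is_RInt_cos_int (Z.of_nat m - Z.of_nat n))).
    - rewrite (rsum_single _ _ n).
      + rewrite Z.sub_diag. simpl. unfold p. rewrite trunc_lt by (unfold M; lia). ring.
      + unfold M; lia.
      + intros i Hi Hne. destruct (Z.eqb_spec (Z.of_nat i - Z.of_nat n) 0); [lia|ring]. }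
  assert (HF : forall t, F t = Re (ev p (cis t) * cis (- (INR n * t)))%C).
  { intros t. rewrite re_mult. unfold ev, F. simpl Re at 1. simpl Im at 1.
    rewrite (val_finite _ M), (val_finite _ M).
    2,3: intros m Hm; unfold reS, imS, p; rewrite trunc_ge by assumption; ring.
    rewrite <- !rsum_scal_r, <- rsum_minus. apply rsum_ext. intros m _.
    unfold reS, imS. rewrite cis_pow. unfold cis; simpl.
    rewrite minus_IZR, <- !INR_IZR_INZ.
    replace ((INR m - INR n) * t) with (INR m * t + - (INR n * t)) by ring.
    rewrite cos_plus. ring. }
  assert (HFb : forall t, Rabs (F t) <= B + eps).
  { intros t. rewrite HF. eapply Rle_trans; [apply re_le_Cmod|].
    rewrite Cmod_mult, Cmod_cis, Rmult_1_r.
    replace p with (h - (h - p))%fps by ring.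
    assert (Hz : Cmod (cis t) <= 1) by (rewrite Cmod_cis; lra).
    pose proof (l1_sub _ _ Hh Hp) as Hd.
    rewrite ev_sub by assumption. unfold Cminus.
    eapply Rle_trans; [apply Cmod_triangle|]. rewrite Cmod_opp.
    pose proof (ev_le _ _ Hz Hd). specialize (HB t). lra. }
  pose proof PI_RGT_0 as HPI.
  pose proof (abs_RInt_le_const F (- PI) PI (B + eps) ltac:(lra) (ex_intro _ _ HI)
    (fun t _ => HFb t)) as HA.
  rewrite (is_RInt_unique _ _ _ _ HI) in HA.
  rewrite Rabs_mult, (Rabs_pos_eq (2 * PI)) in HA by lra.
  apply Rmult_le_reg_l with (2 * PI); [lra|].
  replace (2 * PI * (B + eps)) with ((PI - - PI) * (B + eps)) by ring. exact HA.
Qed.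

(** Cauchy's estimate for h and for theta^2 h gives |h_n| (1 + n^2) <= B0 + B2, and (n+1)^2 <= 2 (1
    + n^2). The constant 6 is this 2 times the bound 3 for the sum of n^(-3/2). *)
Lemma smooth_rsum_bound h B0 B2 : l1 h -> l1 (theta (theta h)) ->
  (forall t, Cmod (ev h (cis t)) <= B0) -> (forall t, Cmod (ev (theta (theta h)) (cis t)) <= B2) ->
  forall N, rsum (fun n => Rabs (h n)) N <= 6 * (B0 + B2).
Proof.
  intros H0 H2 HB0 HB2 N.
  pose proof (coef_bound _ _ H0 HB0) as K0. pose proof (coef_bound _ _ H2 HB2) as K2.
  apply Rle_trans with (rsum (fun k => 2 * (B0 + B2) * / rt k ^ 3) N).
  - apply rsum_le. intros n _. specialize (K0 n). specialize (K2 n). unfold theta in K2.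
    rewrite !Rabs_mult, (Rabs_pos_eq (INR n)) in K2 by apply pos_INR.
    pose proof (pos_INR n) as Hn. pose proof (Rabs_pos (h n)) as Ha. pose proof (rt_pos n).
    pose proof (rt_sq n) as Hr. pose proof (rt_ge1 n).
    apply Rmult_le_reg_r with (rt n ^ 3); [apply rt_pow_pos|].
    rewrite Rmult_assoc, Rinv_l, Rmult_1_r by rt_nz.
    apply Rle_trans with (Rabs (h n) * ((INR n + 1) * (INR n + 1))).
    + apply Rmult_le_compat_l; [assumption|]. rewrite <- Hr. simpl.
      assert (0 < rt n * (rt n * rt n)) by (repeat apply Rmult_lt_0_compat; lra). nra.
    + pose proof (Rmult_le_pos _ _ Ha (pow2_ge_0 (INR n - 1))). simpl in *. nra.
  - rewrite rsum_scal. pose proof (rsum_rt3 N).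
    pose proof (Rle_trans _ _ _ (Cmod_ge_0 _) (HB0 0)). pose proof (Rle_trans _ _ _ (Cmod_ge_0 _) (HB2 0)). nra.
Qed.

(** * Wiener's lemma *)

Lemma theta_inverse f g : (f * g)%fps = fone -> theta g = (- (theta f * (g * g)))%fps.
Proof.
  intros H. assert (E : (theta f * g + f * theta g)%fps = fzero)
    by (rewrite <- theta_star, H; apply theta_one).
  transitivity ((f * g) * theta g)%fps; [rewrite H; ring|].
  transitivity (g * (theta f * g + f * theta g) - theta f * (g * g))%fps; [ring|].
  rewrite E. ring.
Qed.

Lemma cst_S n : cst (INR (S n)) = (cst (INR n) + fone)%fps.
Proof. rewrite S_INR, cst_add, cst_one. reflexivity. Qed.

Fixpoint fpow (f : fps) (n : nat) : fps :=
  match n with O => fone | S k => (f * fpow f k)%fps end.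

Lemma l1_fpow f n : l1 f -> l1 (fpow f n).
Proof. intros H; induction n; simpl; [apply l1_one|now apply l1_star]. Qed.
Lemma fpow_mul f g n : fpow (f * g)%fps n = (fpow f n * fpow g n)%fps.
Proof. induction n as [|n IH]; simpl; [ring|]. rewrite IH. ring. Qed.
Lemma fpow_1 f : fpow f 1 = f.
Proof. simpl. ring. Qed.
Lemma ev_fpow f n z : Cmod z <= 1 -> l1 f -> ev (fpow f n) z = (ev f z ^ n)%C.
Proof.
  intros Hz Hf. induction n as [|n IH]; simpl; [apply ev_one|].
  rewrite ev_star, IH by first [assumption | now apply l1_fpow]. reflexivity.
Qed.

Lemma theta_fpow_inverse f g n : (f * g)%fps = fone ->
  theta (fpow g n) = (- (cst (INR n) * (theta f * fpow g (S n))))%fps.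
Proof.
  intros H. induction n as [|n IH].
  - simpl fpow at 1. rewrite theta_one. change (INR 0) with 0. rewrite cst_zero. ring.
  - change (fpow g (S n)) with (g * fpow g n)%fps at 1.
    rewrite theta_star, IH, (theta_inverse f g H), cst_S. simpl fpow. ring.
Qed.
Lemma theta2_fpow_inverse f g n : (f * g)%fps = fone ->
  theta (theta (fpow g n)) =
  (cst (INR n) * cst (INR (S n)) * (theta f * theta f * fpow g (S (S n)))
   - cst (INR n) * (theta (theta f) * fpow g (S n)))%fps.
Proof.
  intros H. rewrite (theta_fpow_inverse f g n H), theta_opp, theta_star, theta_cst, theta_star,
    (theta_fpow_inverse f g (S n) H). ring.
Qed.

Section InverseBound.
Context (f g : fps) (eps : R).

(* Uniform in [g]: this is what allows the radius of convergence of [1/f] to be pushed up to 1. *)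
Lemma fpow_inverse_bound n : 0 < eps -> l1 f -> l1 (theta f) -> l1 (theta (theta f)) -> l1 g ->
  (f * g)%fps = fone -> (forall t, eps <= Cmod (ev f (cis t))) -> forall N,
  rsum (fun k => Rabs (fpow g n k)) N <=
  6 * (1 + 4 * nrm (theta f) ^ 2 / eps ^ 2 + 2 * nrm (theta (theta f)) / eps)
    * (INR n + 1) ^ 2 * (/ eps) ^ n.
Proof.
  intros He lf lf1 lf2 lg Hfg Hev N.
  assert (Hz : forall t, Cmod (cis t) <= 1) by (intros; rewrite Cmod_cis; lra).
  assert (Hg : forall t, Cmod (ev g (cis t)) <= / eps).
  { intros t. assert (E := ev_star f g (cis t) (Hz t) lf lg). rewrite Hfg, ev_one in E.
    apply (f_equal Cmod) in E. rewrite Cmod_mult, Cmod_1 in E.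
    pose proof (Cmod_ge_0 (ev g (cis t))). specialize (Hev t).
    apply Rmult_le_reg_l with eps; [assumption|]. rewrite Rinv_r by lra. nra. }
  assert (Hgp : forall k t, Cmod (ev (fpow g k) (cis t)) <= (/ eps) ^ k).
  { intros k t. rewrite ev_fpow, Cmod_pow by auto. apply pow_incr. split; [apply Cmod_ge_0|apply Hg]. }
  set (F1 := nrm (theta f)). set (F2 := nrm (theta (theta f))).
  pose proof (nrm_nonneg _ lf1) as F1p. pose proof (nrm_nonneg _ lf2) as F2p. fold F1 in F1p. fold F2 in F2p.
  assert (Hi : 0 < / eps) by now apply Rinv_0_lt_compat.
  pose proof (pow_lt _ n Hi) as Hin. pose proof (pos_INR n) as Hn.
  assert (L0 : l1 (fpow g n)) by now apply l1_fpow.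
  assert (LA : l1 (cst (INR n) * cst (INR (S n)) * (theta f * theta f * fpow g (S (S n))))%fps)
    by (repeat apply l1_star; try apply l1_cst; try assumption; now apply l1_fpow).
  assert (LB : l1 (cst (INR n) * (theta (theta f) * fpow g (S n)))%fps)
    by (repeat apply l1_star; try apply l1_cst; try assumption; now apply l1_fpow).
  pose (B2 := INR n * (INR n + 1) * (4 * F1 ^ 2 / eps ^ 2 * (/ eps) ^ n) + INR n * (2 * F2 / eps * (/ eps) ^ n)).
  apply Rle_trans with (6 * ((/ eps) ^ n + B2)).
  - apply smooth_rsum_bound; [assumption| |apply Hgp|].
    + rewrite (theta2_fpow_inverse f g n Hfg). now apply l1_sub.
    + intros t. rewrite (theta2_fpow_inverse f g n Hfg), ev_sub by auto.
      eapply Rle_trans; [apply Cmod_triangle|]. rewrite Cmod_opp.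
      rewrite !ev_star by (try apply Hz; repeat apply l1_star; try apply l1_cst; try assumption; now apply l1_fpow).
      rewrite !ev_cst, !Cmod_mult, !Cmod_R, (Rabs_pos_eq (INR n)), (Rabs_pos_eq (INR (S n))) by apply pos_INR.
      pose proof (Hgp (S n) t) as G1. pose proof (Hgp (S (S n)) t) as G2.
      pose proof (ev_le _ _ (Hz t) lf1) as T1. pose proof (ev_le _ _ (Hz t) lf2) as T2.
      fold F1 in T1. fold F2 in T2. unfold B2. rewrite S_INR.
      apply Rplus_le_compat.
      * apply Rmult_le_compat_l; [apply Rmult_le_pos; lra|].
        replace (4 * F1 ^ 2 / eps ^ 2 * (/ eps) ^ n) with ((2 * F1 * (2 * F1)) * (/ eps) ^ S (S n)) by (simpl; field; lra).
        apply Rmult_le_compat; try apply Rmult_le_pos; try apply Cmod_ge_0; [|assumption].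
        apply Rmult_le_compat; try apply Cmod_ge_0; assumption.
      * apply Rmult_le_compat_l; [assumption|].
        replace (2 * F2 / eps * (/ eps) ^ n) with (2 * F2 * (/ eps) ^ S n) by (simpl; field; lra).
        apply Rmult_le_compat; try apply Cmod_ge_0; assumption.
  - unfold B2. set (x := INR n) in *. set (y := (/ eps) ^ n) in *.
    assert (0 <= 4 * F1 ^ 2 / eps ^ 2).
    { apply Rmult_le_pos; [nra|]. apply Rlt_le, Rinv_0_lt_compat, pow_lt, He. }
    assert (0 <= 2 * F2 / eps) by (apply Rmult_le_pos; lra).
    set (u := 4 * F1 ^ 2 / eps ^ 2) in *. set (v := 2 * F2 / eps) in *.
    replace (6 * (y + (x * (x + 1) * (u * y) + x * (v * y)))) with (6 * y * (1 + x * (x + 1) * u + x * v)) by ring.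
    replace (6 * (1 + u + v) * (x + 1) ^ 2 * y) with (6 * y * ((1 + u + v) * (x + 1) ^ 2)) by ring.
    apply Rmult_le_compat_l; [lra|].
    assert (0 <= u * (x + 1)) by nra. assert (0 <= v * (x * x + x + 1)) by nra. nra.
Qed.
End InverseBound.

Lemma pow_diff_le a b n : 0 <= a <= b -> b <= 1 -> 0 <= b ^ n - a ^ n <= INR n * (b - a).
Proof.
  intros Hab Hb. induction n as [|n IH]; [simpl; lra|]. rewrite S_INR. simpl.
  assert (0 <= a ^ n <= 1).
  { split; [apply pow_le; lra|]. rewrite <- (pow1 n). apply pow_incr; lra. }
  replace (b * b ^ n - a * a ^ n) with (b * (b ^ n - a ^ n) + (b - a) * a ^ n) by ring.
  split; [apply Rplus_le_le_0_compat; apply Rmult_le_pos; lra|nra].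
Qed.

Lemma rsum_star3_abs_le f g h N :
  rsum (fun k => Rabs ((f * g * h)%fps k)) N
  <= rsum (fun k => Rabs (f k)) N * rsum (fun k => Rabs (g k)) N * rsum (fun k => Rabs (h k)) N.
Proof.
  eapply Rle_trans; [apply rsum_star_abs_le|]. apply Rmult_le_compat_r; [|apply rsum_star_abs_le].
  apply rsum_nonneg; intros; apply Rabs_pos.
Qed.

(** The resolvent identity H = G - D G H relates the inverses at radii r and r'. On partial sums it
    reads |H| <= |G| + |H|/2, so the summability of H is a result and not an assumption. *)
Lemma dilate_inverse f g r r' C0 : l1 f -> l1 (theta f) -> (f * g)%fps = fone ->
  0 <= r <= r' -> r' <= 1 -> (r' - r) * nrm (theta f) * C0 <= / 2 -> 
  (forall N, rsum (fun k => Rabs (scale r g k)) N <= C0) ->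
  forall N, rsum (fun k => Rabs (scale r' g k)) N <= 2 * C0.
Proof.
  intros lf lf1 Hfg Hr Hr' Hsmall HC N.
  assert (E1 : (scale r f * scale r g)%fps = fone) by (rewrite <- scale_star, Hfg; apply scale_one).
  assert (E2 : (scale r' f * scale r' g)%fps = fone) by (rewrite <- scale_star, Hfg; apply scale_one).
  set (H := scale r' g) in *. set (G := scale r g) in *. set (D := (scale r' f - scale r f)%fps).
  assert (E : H = (G - D * G * H)%fps).
  { unfold D. transitivity (G - ((scale r' f * H) * G - (scale r f * G) * H))%fps; [|ring].
    rewrite E1, E2. ring. }
  assert (HD : rsum (fun k => Rabs (D k)) N <= (r' - r) * nrm (theta f)).
  { apply Rle_trans with (rsum (fun k => (r' - r) * Rabs (theta f k)) N).
    - apply rsum_le. intros n _. unfold D, fsub, gsub, scale, theta.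
      replace (f n * r' ^ n - f n * r ^ n) with (f n * (r' ^ n - r ^ n)) by ring.
      pose proof (pow_diff_le r r' n Hr Hr'). rewrite !Rabs_mult, (Rabs_pos_eq (r' ^ n - r ^ n)) by lra.
      rewrite (Rabs_pos_eq (INR n)) by apply pos_INR. pose proof (Rabs_pos (f n)). nra.
    - rewrite rsum_scal. apply Rmult_le_compat_l; [lra|]. now apply rsum_le_nrm. }
  assert (Hs : rsum (fun k => Rabs (H k)) N <= rsum (fun k => Rabs (G k)) N + rsum (fun k => Rabs ((D * G * H)%fps k)) N).
  { rewrite <- rsum_plus. apply rsum_le. intros k _. assert (Ek := f_equal (fun u => u k) E). cbv beta in Ek.
    rewrite Ek. unfold fsub, gsub, Rminus.
    eapply Rle_trans; [apply Rabs_triang|]. rewrite Rabs_Ropp. lra. }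
  pose proof (rsum_star3_abs_le D G H N) as H3.
  specialize (HC N).
  assert (P : forall h, 0 <= rsum (fun k => Rabs (h k)) N) by (intros; apply rsum_nonneg; intros; apply Rabs_pos).
  assert (rsum (fun k => Rabs (D k)) N * rsum (fun k => Rabs (G k)) N <= / 2).
  { eapply Rle_trans; [|exact Hsmall]. apply Rmult_le_compat; try apply P; assumption. }
  pose proof (P H). nra.
Qed.

Lemma ev_scale_cis_low f eps r : 0 <= r <= 1 -> (forall z, Cmod z <= 1 -> eps <= Cmod (ev f z)) ->
  forall t, eps <= Cmod (ev (scale r f) (cis t)).
Proof.
  intros Hr H t. rewrite ev_scale. apply H. rewrite Cmod_mult, Cmod_R, Cmod_cis, Rabs_pos_eq; lra.
Qed.

Lemma scale_1 f : scale 1 f = f.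
Proof. apply functional_extensionality; intros n. unfold scale. rewrite pow1. ring. Qed.

Lemma nrm_scale_le f r : 0 <= r <= 1 -> l1 f -> nrm (scale r f) <= nrm f.
Proof.
  intros Hr Hf. apply nrm_le; [apply l1_scale; [rewrite Rabs_pos_eq; lra|assumption]|].
  intros N. eapply Rle_trans; [|apply (rsum_le_nrm f N Hf)]. apply rsum_le. intros n _.
  unfold scale. rewrite Rabs_mult, (Rabs_pos_eq (r ^ n)) by (apply pow_le; lra).
  rewrite <- (Rmult_1_r (Rabs (f n))) at 2. apply Rmult_le_compat_l; [apply Rabs_pos|].
  rewrite <- (pow1 n). apply pow_incr; lra.
Qed.

(** Continuation in the radius: as long as the dilated inverse is summable, its norm is at most K
    whatever the radius, so the radius can be increased by a fixed delta, and finitely many steps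
    lead from 0 to 1. *)
Lemma inverse_l1_smooth f g eps : 0 < eps -> l1 f -> l1 (theta f) -> l1 (theta (theta f)) ->
  (forall z, Cmod z <= 1 -> eps <= Cmod (ev f z)) -> (f * g)%fps = fone -> l1 g.
Proof.
  intros He lf lf1 lf2 Hev Hfg.
  (* The constant of [fpow_inverse_bound] for the first power of g, with the norms at radius 1,
     which dominate those at smaller radii. *)
  pose (K := 6 * (1 + 4 * nrm (theta f) ^ 2 / eps ^ 2 + 2 * nrm (theta (theta f)) / eps) * (1 + 1) ^ 2 * (/ eps) ^ 1).
  assert (F1p : 0 <= nrm (theta f)) by now apply nrm_nonneg.
  assert (F2p : 0 <= nrm (theta (theta f))) by now apply nrm_nonneg.
  assert (Hi : 0 < / eps) by now apply Rinv_0_lt_compat.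
  assert (HK : forall r, 0 <= r <= 1 -> l1 (scale r g) -> forall N, rsum (fun k => Rabs (scale r g k)) N <= K).
  { intros r Hr lg N.
    assert (Hr' : Rabs r <= 1) by (rewrite Rabs_pos_eq; lra).
    assert (Hfg' : (scale r f * scale r g)%fps = fone) by (rewrite <- scale_star, Hfg; apply scale_one).
    pose proof (fpow_inverse_bound (scale r f) (scale r g) eps 1 He (l1_scale _ _ Hr' lf)) as B.
    rewrite <- !scale_theta in B.
    specialize (B (l1_scale _ _ Hr' lf1) (l1_scale _ _ Hr' lf2) lg Hfg' (ev_scale_cis_low f eps r Hr Hev) N).
    rewrite fpow_1 in B. eapply Rle_trans; [exact B|]. unfold K. change (INR 1) with 1.
    pose proof (nrm_scale_le _ r Hr lf1) as M1. pose proof (nrm_scale_le _ r Hr lf2) as M2.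
    pose proof (nrm_nonneg _ (l1_scale _ _ Hr' lf1)).
    apply Rmult_le_compat_r; [apply Rlt_le, pow_lt, Hi|]. apply Rmult_le_compat_r; [lra|].
    apply Rmult_le_compat_l; [lra|]. apply Rplus_le_compat.
    - apply Rplus_le_compat_l. unfold Rdiv. apply Rmult_le_compat_r; [apply Rlt_le, Rinv_0_lt_compat, pow_lt, He|].
      apply Rmult_le_compat_l; [lra|]. apply pow_incr; lra.
    - unfold Rdiv. apply Rmult_le_compat_r; lra. }
  assert (Kp : 0 <= K).
  { eapply Rle_trans; [apply (rsum_nonneg (fun k => Rabs (scale 0 g k)) O); intros; apply Rabs_pos|].
    apply HK; [lra|]. apply l1_finite with 1%nat. intros [|n] Hn; [lia|]. unfold scale. simpl; ring. }
  (* Small enough for the hypothesis of [dilate_inverse] with C0 = K; the added 1 avoids a division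
     by zero. *)
  pose (delta := / (2 * (nrm (theta f) * K) + 1)).
  assert (Hd0 : 0 < 2 * (nrm (theta f) * K) + 1) by (pose proof (Rmult_le_pos _ _ F1p Kp); lra).
  assert (Hd : 0 < delta) by now apply Rinv_0_lt_compat.
  assert (Step : forall k, l1 (scale (Rmin 1 (INR k * delta)) g)).
  { induction k as [|k IH].
    - simpl. rewrite Rmult_0_l, Rmin_right by lra.
      apply l1_finite with 1%nat. intros [|n] Hn; [lia|]. unfold scale. simpl; ring.
    - set (r := Rmin 1 (INR k * delta)) in *. set (r' := Rmin 1 (INR (S k) * delta)).
      assert (Hr : 0 <= r <= 1).
      { split; [apply Rmin_glb; [lra|apply Rmult_le_pos; [apply pos_INR|lra]]|apply Rmin_l]. }
      assert (Hrr : r <= r' <= r + delta).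
      { unfold r, r'. rewrite S_INR. unfold Rmin.
        destruct (Rle_dec 1 (INR k * delta)), (Rle_dec 1 ((INR k + 1) * delta)); split; nra. }
      assert (Hr1 : r' <= 1) by apply Rmin_l.
      apply l1_bounded with (2 * K).
      apply dilate_inverse with f r; try assumption; try lra; [|now apply HK].
      apply Rle_trans with (delta * (nrm (theta f) * K)).
      + rewrite Rmult_assoc. apply Rmult_le_compat_r; [now apply Rmult_le_pos|lra].
      + unfold delta. apply Rmult_le_reg_l with (2 * (nrm (theta f) * K) + 1); [lra|].
        rewrite <- Rmult_assoc, Rinv_r by lra. lra. }
  destruct (archimed_cor1 delta Hd) as [k [Hk Hk0]].
  specialize (Step k). rewrite Rmin_left, scale_1 in Step; [assumption|].
  assert (0 < INR k) by now apply lt_0_INR.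
  apply Rmult_le_reg_l with (/ INR k); [now apply Rinv_0_lt_compat|].
  rewrite <- Rmult_assoc, Rinv_l by lra. lra.
Qed.

(** The argument [k] is fuel: the coefficient of degree n is final as soon as k > n, and the zero
    default is not reached then. *)
Fixpoint inv_approx (f : fps) (k : nat) : fps :=
  match k with
  | O => fun _ => 0
  | S j => fun n => (fone n - rsum (fun i => f (S i) * inv_approx f j (n - S i)%nat) n) / f O
  end.

Lemma fps_inverse_ex f : f O <> 0 -> exists g, (f * g)%fps = fone.
Proof.
  intros Hf.
  assert (Hst : forall k j n, (n < k)%nat -> (n < j)%nat -> inv_approx f k n = inv_approx f j n).
  { induction k as [|k IH]; intros [|j] n Hk Hj; try lia. simpl. f_equal. f_equal.
    apply rsum_ext. intros i Hi. rewrite (IH j) by lia. reflexivity. }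
  exists (fun n => inv_approx f (S n) n). apply functional_extensionality; intros n.
  rewrite star_def, rsum_Sl, Nat.sub_0_r. simpl inv_approx.
  rewrite (rsum_ext (fun i => f (S i) * inv_approx f n (n - S i)%nat)
    (fun k => f (S k) * ((fone (n - S k)%nat - rsum (fun i => f (S i) * inv_approx f (n - S k) (n - S k - S i)%nat) (n - S k)) / f O))).
  - field. assumption.
  - intros i Hi. change ((fone (n - S i)%nat - rsum (fun i0 => f (S i0) * inv_approx f (n - S i) (n - S i - S i0)%nat) (n - S i)) / f O)
      with (inv_approx f (S (n - S i)) (n - S i)%nat). f_equal. apply Hst; lia.
Qed.

Lemma sq_le_pow2 n : (INR n + 1) ^ 2 <= 4 * 2 ^ n.
Proof.
  induction n as [|n IH]; [simpl; lra|].
  destruct n as [|[|n]]; [simpl; lra|simpl; lra|].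
  rewrite S_INR. change (2 ^ S (S (S n))) with (2 * 2 ^ S (S n)).
  assert (2 <= INR (S (S n))) by (apply (le_INR 2); lia). set (x := INR (S (S n))) in *. nra.
Qed.

(** The Neumann series stopped after n terms, with its exact remainder, so that nothing has to
    converge beforehand. *)
Lemma geometric_inverse x g H n : H = (g + x * H)%fps ->
  exists S, (l1 x -> l1 g -> l1 S) /\ H = (S + fpow x n * H)%fps.
Proof.
  intros E. induction n as [|n [S [lS HS]]].
  - exists fzero. split; [|simpl; ring]. intros _ _. rewrite <- cst_zero. apply l1_cst.
  - exists (S + fpow x n * g)%fps. split.
    + intros lx lg. apply l1_add; [auto|]. apply l1_star; [now apply l1_fpow|assumption].
    + transitivity (S + fpow x n * (g + x * H))%fps; [rewrite <- E; exact HS|]. simpl. ring.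
Qed.

Lemma rsum_fpow_le' f n N : rsum (fun k => Rabs (fpow f (S n) k)) N <= rsum (fun k => Rabs (f k)) N ^ S n.
Proof.
  induction n as [|n IH].
  - rewrite fpow_1. simpl. lra.
  - change (fpow f (S (S n))) with (f * fpow f (S n))%fps.
    eapply Rle_trans; [apply rsum_star_abs_le|].
    change (rsum (fun k => Rabs (f k)) N ^ S (S n)) with (rsum (fun k => Rabs (f k)) N * rsum (fun k => Rabs (f k)) N ^ S n).
    apply Rmult_le_compat_l; [|exact IH]. apply rsum_nonneg; intros; apply Rabs_pos.
Qed.

(* Newman's argument: [f = p + r] with [p] a polynomial and [r] small, so that
   [1/f = sum (-r)^k p^-(k+1)] with [|p^-k|_1 = O(k^2 sup|1/p|^k)]. *)
Lemma wiener_l1 f g eps : 0 < eps -> l1 f ->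
  (forall z, Cmod z <= 1 -> eps <= Cmod (ev f z)) -> (f * g)%fps = fone -> l1 g.
Proof.
  intros He lf Hev Hfg.
  (* With the factor 2 of [ev_le], the polynomial p stays above 3/4 eps. The ratio (eps/8) / (3/4
     eps) = 1/2 * 1/3 leaves a power of 1/2 to absorb the quadratic factor and a power of 1/3 to
     tend to zero. *)
  destruct (nrm_tail f (eps / 8) lf ltac:(lra)) as [N0 [HN0 HN]].
  specialize (HN N0 (le_n _)). set (p := trunc N0 f) in *. set (r := (f - p)%fps) in *.
  assert (fin : forall h : fps, (forall n, (N0 <= n)%nat -> h n = 0) -> l1 h)
    by (intros h Hh; now apply l1_finite with N0).
  assert (lp : l1 p) by apply l1_trunc.
  assert (lp1 : l1 (theta p)) by (apply fin; intros n Hn; unfold theta, p; rewrite trunc_ge by assumption; ring).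
  assert (lp2 : l1 (theta (theta p))) by (apply fin; intros n Hn; unfold theta, p; rewrite trunc_ge by assumption; ring).
  assert (lr : l1 r) by now apply l1_sub.
  pose (eps' := 3 / 4 * eps). assert (He' : 0 < eps') by (unfold eps'; lra).
  assert (Hevp : forall z, Cmod z <= 1 -> eps' <= Cmod (ev p z)).
  { intros z Hz. specialize (Hev z Hz). pose proof (ev_le r z Hz lr).
    replace f with (p + r)%fps in Hev by (unfold r; ring). rewrite ev_add in Hev by assumption.
    pose proof (Cmod_triangle (ev p z) (ev r z)). unfold eps'. lra. }
  assert (p0 : p O <> 0).
  { unfold p. rewrite trunc_lt by lia. intros H. apply (f_equal (fun h => h O)) in Hfg.
    rewrite star_0, H in Hfg. unfold fone, gone in Hfg. lra. }
  destruct (fps_inverse_ex p p0) as [h Hh].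
  assert (lh : l1 h) by (eapply inverse_l1_smooth; [exact He'| | | | |exact Hh]; assumption).
  assert (Eg : g = (h + (- r * h) * g)%fps).
  { transitivity ((p * h) * g)%fps; [rewrite Hh; ring|].
    transitivity (h * (f * g) + (- r * h) * g)%fps; [|rewrite Hfg; ring].
    unfold r. ring. }
  pose (Cst := 6 * (1 + 4 * nrm (theta p) ^ 2 / eps' ^ 2 + 2 * nrm (theta (theta p)) / eps')).
  assert (Cp : 0 <= Cst).
  { unfold Cst. assert (0 <= 4 * nrm (theta p) ^ 2 / eps' ^ 2).
    { apply Rmult_le_pos; [|apply Rlt_le, Rinv_0_lt_compat, pow_lt, He'].
      pose proof (pow2_ge_0 (nrm (theta p))). lra. }
    assert (0 <= 2 * nrm (theta (theta p)) / eps').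
    { apply Rmult_le_pos; [|apply Rlt_le, Rinv_0_lt_compat, He']. pose proof (nrm_nonneg _ lp2). lra. }
    lra. }
  destruct (pow_lt_1_zero (/ 3) ltac:(rewrite Rabs_pos_eq; lra) (/ (2 * (4 * Cst + 1)))
    ltac:(apply Rinv_0_lt_compat; lra)) as [K HK].
  specialize (HK (S K) ltac:(lia)). rewrite Rabs_pos_eq in HK by (apply pow_le; lra).
  destruct (geometric_inverse (- r * h)%fps h g (S K) Eg) as [T [lT HT]].
  specialize (lT (l1_star _ _ (l1_opp _ lr) lh) lh).
  assert (Hx : forall N, rsum (fun k => Rabs (fpow (- r * h)%fps (S K) k)) N <= / 2).
  { intros N. rewrite fpow_mul. eapply Rle_trans; [apply rsum_star_abs_le|].
    assert (B1 : rsum (fun k => Rabs (fpow (- r)%fps (S K) k)) N <= (eps / 8) ^ S K).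
    { eapply Rle_trans; [apply rsum_fpow_le'|]. apply pow_incr. split.
      - apply rsum_nonneg; intros; apply Rabs_pos.
      - eapply Rle_trans; [|exact HN]. eapply Rle_trans; [|apply (rsum_le_nrm r N lr)].
        apply rsum_le. intros k _. unfold fopp, gopp. rewrite Rabs_Ropp. lra. }
    pose proof (fpow_inverse_bound p h eps' (S K) He' lp lp1 lp2 lh Hh
      (fun t => Hevp (cis t) ltac:(rewrite Cmod_cis; lra)) N) as B2. fold Cst in B2.
    apply Rle_trans with ((eps / 8) ^ S K * (Cst * (INR (S K) + 1) ^ 2 * (/ eps') ^ S K)).
    { apply Rmult_le_compat; try assumption; apply rsum_nonneg; intros; apply Rabs_pos. }
    replace ((eps / 8) ^ S K * (Cst * (INR (S K) + 1) ^ 2 * (/ eps') ^ S K))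
      with (Cst * (INR (S K) + 1) ^ 2 * (eps / 8 * / eps') ^ S K) by (rewrite Rpow_mult_distr; ring).
    replace (eps / 8 * / eps') with (/ 2 * / 3) by (unfold eps'; field; lra).
    rewrite Rpow_mult_distr. pose proof (sq_le_pow2 (S K)) as H2.
    assert (P2 : 0 < (/ 2) ^ S K) by (apply pow_lt; lra).
    assert (E2 : 2 ^ S K * (/ 2) ^ S K = 1) by (rewrite <- Rpow_mult_distr; replace (2 * / 2) with 1 by field; apply pow1).
    assert (H3 : (INR (S K) + 1) ^ 2 * (/ 2) ^ S K <= 4).
    { apply Rle_trans with (4 * 2 ^ S K * (/ 2) ^ S K); [apply Rmult_le_compat_r; lra|]. rewrite Rmult_assoc, E2. lra. }
    assert (P3 : 0 < (/ 3) ^ S K) by (apply pow_lt; lra).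
    apply Rle_trans with (Cst * 4 * (/ 3) ^ S K).
    { replace (Cst * (INR (S K) + 1) ^ 2 * ((/ 2) ^ S K * (/ 3) ^ S K))
        with (Cst * ((INR (S K) + 1) ^ 2 * (/ 2) ^ S K) * (/ 3) ^ S K) by ring.
      apply Rmult_le_compat_r; [lra|]. apply Rmult_le_compat_l; assumption. }
    apply Rle_trans with ((4 * Cst + 1) * / (2 * (4 * Cst + 1))).
    - apply Rle_trans with ((4 * Cst + 1) * (/ 3) ^ S K); [apply Rmult_le_compat_r; lra|].
      apply Rmult_le_compat_l; lra.
    - apply Req_le. field. lra. }
  (* Absorption on partial sums: |g| <= |T| + |g|/2, hence |g| <= 2 |T|. *)
  destruct (l1_bound T lT) as [M [Mp HM]]. apply l1_bounded with (2 * M). intros N.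
  assert (HS : rsum (fun k => Rabs (g k)) N <= rsum (fun k => Rabs (T k)) N
     + rsum (fun k => Rabs ((fpow (- r * h)%fps (S K) * g)%fps k)) N).
  { rewrite <- rsum_plus. apply rsum_le. intros k _. assert (Ek := f_equal (fun u => u k) HT). cbv beta in Ek.
    rewrite Ek. apply Rabs_triang. }
  pose proof (rsum_star_abs_le (fpow (- r * h)%fps (S K)) g N) as H2.
  assert (P : 0 <= rsum (fun k => Rabs (g k)) N) by (apply rsum_nonneg; intros; apply Rabs_pos).
  specialize (Hx N). specialize (HM N). nra.
Qed.

(** * Wiener's lemma with coefficient decay *)

Lemma star_half_bound (a h : fps) n A H :
  (forall k, (n <= 2 * k + 1)%nat -> Rabs (a k) <= A) ->
  (forall k, (n <= 2 * k + 1)%nat -> Rabs (h k) <= H) ->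
  Rabs ((a * h)%fps n)
  <= A * rsum (fun k => Rabs (h k)) (S n) + H * rsum (fun k => Rabs (a k)) (S n).
Proof.
  intros HA HH. rewrite star_def. eapply Rle_trans; [apply rsum_abs|].
  assert (E : rsum (fun k => Rabs (h k)) (S n) = rsum (fun k => Rabs (h (n - k)%nat)) (S n)).
  { rewrite rsum_rev. apply rsum_ext. intros k Hk. now replace (S n - 1 - k)%nat with (n - k)%nat by lia. }
  rewrite E, <- !rsum_scal, <- rsum_plus. apply rsum_le. intros k Hk. rewrite Rabs_mult.
  pose proof (Rabs_pos (a k)). pose proof (Rabs_pos (h (n - k)%nat)).
  destruct (le_lt_dec n (2 * k + 1)) as [Hc|Hc].
  - specialize (HA k Hc).
    assert (0 <= H) by (eapply Rle_trans; [apply Rabs_pos|apply (HH n); lia]). nra.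
  - assert (Hc' : (n <= 2 * (n - k) + 1)%nat) by lia. specialize (HH _ Hc').
    assert (0 <= A) by (eapply Rle_trans; [apply Rabs_pos|apply (HA n); lia]). nra.
Qed.

Lemma rsum_rt1 n : rsum (fun k => / rt k) (S n) <= 2 * rt n.
Proof.
  induction n as [|n IH].
  - rewrite rsum_S, rt_0. unfold rsum; simpl. lra.
  - rewrite rsum_S. pose proof (rt_pos n). pose proof (rt_S n) as Hy. pose proof (rt_pos (S n)).
    pose proof (rt_le n (S n) ltac:(lia)). set (x := rt n) in *. set (y := rt (S n)) in *.
    enough (/ y <= 2 * y - 2 * x) by lra.
    apply Rmult_le_reg_l with y; [assumption|]. rewrite Rinv_r by lra. nra.
Qed.

(** Half a power of n is gained from theta g = - theta f * g^2. When the index of theta f is large,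
    its decay n^(-(m-2)/2) applies and g^2 is summable; when the index of g^2 is large, its decay
    n^(-j/2) applies and the partial sums of theta f are O(sqrt n). Dividing by n gives
    n^(-(j+1)/2). *)
Lemma wiener_step m j f g : (3 <= m)%nat -> (S j <= m)%nat -> W m f -> l1 g ->
  (f * g)%fps = fone -> W j g -> W (S j) g.
Proof.
  intros Hm Hj Hf lg Hfg Hg.
  destruct (W_bd_nonneg _ _ Hf) as [F [F0 HF]], (W_bd_nonneg _ _ Hg) as [C [C0 HC]].
  pose proof (nrm_nonneg _ lg) as N0. set (N := nrm g) in *.
  assert (HF' : bd (m - 2) F (theta f)).
  { intros n. unfold theta. rewrite Rabs_mult, (Rabs_pos_eq (INR n)) by apply pos_INR.
    apply Rle_trans with (rt n * rt n * (F / rt n ^ m)).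
    - apply Rmult_le_compat; [apply pos_INR|apply Rabs_pos| |apply HF]. rewrite rt_sq; lra.
    - apply Req_le. replace m with (2 + (m - 2))%nat at 1 by lia. rewrite pow_add. simpl. field. rt_nz. }
  assert (Hh : bd j (2 * (2 ^ j * C) * N) (g * g)%fps).
  { intros n. eapply Rle_trans; [apply (star_half_bound g g n (2 ^ j * C / rt n ^ j) (2 ^ j * C / rt n ^ j))|].
    1,2: intros k Hk; eapply Rle_trans; [apply HC|now apply div_rt_half].
    pose proof (rsum_le_nrm g (S n) lg) as B. fold N in B.
    assert (0 <= 2 ^ j * C / rt n ^ j).
    { apply Rmult_le_pos; [apply Rmult_le_pos; [apply pow_le; lra|assumption]|apply Rlt_le, Rinv_0_lt_compat, rt_pow_pos]. }
    replace (2 * (2 ^ j * C) * N / rt n ^ j) with (2 ^ j * C / rt n ^ j * N + 2 ^ j * C / rt n ^ j * N) by (field; rt_nz).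
    apply Rplus_le_compat; apply Rmult_le_compat_l; assumption. }
  set (H := 2 * (2 ^ j * C) * N) in *.
  assert (lh : l1 (g * g)%fps) by now apply l1_star.
  pose proof (bd_C_nonneg _ _ _ Hh) as H0. pose proof (nrm_nonneg _ lh) as Nh0.
  exists (2 * (2 ^ (m - 2) * F * nrm (g * g)%fps + 2 ^ j * H * (2 * F)) + Rabs (g O)). intros n.
  assert (HP : 0 <= 2 ^ (m - 2) * F * nrm (g * g)%fps + 2 ^ j * H * (2 * F)).
  { apply Rplus_le_le_0_compat; repeat apply Rmult_le_pos; try apply pow_le; lra. }
  pose proof (Rabs_pos (g O)) as Hg0.
  destruct n as [|n].
  { rewrite rt_0, pow1. lra. }
  pose proof (theta_inverse f g Hfg) as Ht. apply (f_equal (fun u => u (S n))) in Ht.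
  unfold theta at 1, fopp, gopp in Ht.
  assert (E : INR (S n) * Rabs (g (S n)) <= (2 ^ (m - 2) * F * nrm (g * g)%fps + 2 ^ j * H * (2 * F)) * rt (S n) / rt (S n) ^ j).
  { rewrite <- (Rabs_pos_eq (INR (S n))) by apply pos_INR. rewrite <- Rabs_mult, Ht, Rabs_Ropp.
    eapply Rle_trans; [apply (star_half_bound (theta f) (g * g)%fps (S n) (2 ^ (m - 2) * F / rt (S n) ^ (m - 2)) (2 ^ j * H / rt (S n) ^ j))|].
    - intros k Hk; eapply Rle_trans; [apply HF'|now apply div_rt_half].
    - intros k Hk; eapply Rle_trans; [apply Hh|now apply div_rt_half].
    - unfold Rdiv at 3. rewrite !Rmult_plus_distr_r. apply Rplus_le_compat.
      + apply Rle_trans with (2 ^ (m - 2) * F / rt (S n) ^ (m - 2) * nrm (g * g)%fps).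
        * apply Rmult_le_compat_l; [|now apply rsum_le_nrm].
          apply Rmult_le_pos; [apply Rmult_le_pos; [apply pow_le; lra|assumption]|apply Rlt_le, Rinv_0_lt_compat, rt_pow_pos].
        * assert (Hi : / rt (S n) ^ (m - 2) <= rt (S n) * / rt (S n) ^ j).
          { pose proof (rt_pos (S n)) as Hr.
            apply Rmult_le_reg_r with (rt (S n) ^ (m - 2) * rt (S n) ^ j).
            - apply Rmult_lt_0_compat; apply rt_pow_pos.
            - replace (/ rt (S n) ^ (m - 2) * (rt (S n) ^ (m - 2) * rt (S n) ^ j)) with (rt (S n) ^ j) by (field; rt_nz).
              replace (rt (S n) * / rt (S n) ^ j * (rt (S n) ^ (m - 2) * rt (S n) ^ j)) with (rt (S n) ^ S (m - 2)) by (simpl; field; rt_nz).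
              apply Rle_pow; [apply rt_ge1|lia]. }
          replace (2 ^ (m - 2) * F / rt (S n) ^ (m - 2) * nrm (g * g)%fps)
            with (2 ^ (m - 2) * F * nrm (g * g)%fps * / rt (S n) ^ (m - 2)) by (field; rt_nz).
          rewrite (Rmult_assoc _ (rt (S n))). apply Rmult_le_compat_l; [|assumption].
          repeat apply Rmult_le_pos; try apply pow_le; lra.
      + assert (B : rsum (fun k => Rabs (theta f k)) (S (S n)) <= F * (2 * rt (S n))).
        { apply Rle_trans with (rsum (fun k => F * / rt k) (S (S n))).
          - apply rsum_le. intros k _. eapply Rle_trans; [apply HF'|]. apply Rmult_le_compat_l; [assumption|].
            apply rinv_le; [apply rt_pos|]. rewrite <- (pow_1 (rt k)) at 1. apply Rle_pow; [apply rt_ge1|lia].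
          - rewrite rsum_scal. apply Rmult_le_compat_l; [assumption|apply rsum_rt1]. }
        apply Rle_trans with (2 ^ j * H / rt (S n) ^ j * (F * (2 * rt (S n)))).
        * apply Rmult_le_compat_l; [|assumption].
          apply Rmult_le_pos; [apply Rmult_le_pos; [apply pow_le; lra|assumption]|apply Rlt_le, Rinv_0_lt_compat, rt_pow_pos].
        * apply Req_le. field. rt_nz. }
  set (P := 2 ^ (m - 2) * F * nrm (g * g)%fps + 2 ^ j * H * (2 * F)) in *.
  pose proof (rt_pos (S n)) as Hr. pose proof (rt_sq (S n)) as Hr2. pose proof (rt_pow_pos (S n) j) as Hrj.
  assert (Hn : 1 <= INR (S n)) by (apply (le_INR 1); lia).
  assert (E2 : rt (S n) * rt (S n) * Rabs (g (S n)) <= 2 * (P * rt (S n) / rt (S n) ^ j)).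
  { rewrite Hr2. pose proof (Rabs_pos (g (S n))). nra. }
  assert (P0 : Rabs (g (S n)) <= 2 * P / rt (S n) ^ S j).
  { apply Rmult_le_reg_l with (rt (S n) * rt (S n)); [nra|]. eapply Rle_trans; [exact E2|].
    apply Req_le. simpl. field. rt_nz. }
  eapply Rle_trans; [exact P0|]. apply Rmult_le_compat_r; [|lra].
  apply Rlt_le, Rinv_0_lt_compat, rt_pow_pos.
Qed.

(** Summability of g is the case j = 0 of the decay; [wiener_step] is then iterated up to m. *)
Lemma wiener_W m f g eps : (3 <= m)%nat -> 0 < eps -> W m f ->
  (forall z, Cmod z <= 1 -> eps <= Cmod (ev f z)) -> (f * g)%fps = fone -> W m g.
Proof.
  intros Hm He Hf Hev Hfg.
  assert (lg : l1 g).
  { apply wiener_l1 with f eps; try assumption. apply W_l1. now apply W_mono with m. }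
  assert (H : forall j, (j <= m)%nat -> W j g).
  { induction j as [|j IH]; intros Hj.
    - exists (nrm g). intros n. simpl. unfold Rdiv. rewrite Rinv_1, Rmult_1_r. now apply term_le_nrm.
    - apply wiener_step with m f; try assumption. apply IH; lia. }
  apply H; lia.
Qed.

(** * Lower bounds on the closed disc *)

Lemma Cpow_sub_one (z : Complex.C) n : Cmod z <= 1 -> Cmod (z ^ n - RtoC 1)%C <= INR n * Cmod (z - RtoC 1)%C.
Proof.
  intros Hz. induction n as [|n IH].
  - simpl. replace (RtoC 1 - RtoC 1)%C with (RtoC 0) by ring. rewrite Cmod_0. lra.
  - rewrite Cpow_S, S_INR. replace (z * z ^ n - RtoC 1)%C with (z * (z ^ n - RtoC 1) + (z - RtoC 1))%C by ring.
    eapply Rle_trans; [apply Cmod_triangle|]. rewrite Cmod_mult.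
    pose proof (Cmod_ge_0 (z ^ n - RtoC 1)%C). pose proof (Cmod_ge_0 z). nra.
Qed.

Lemma Cmod_le_sum (z : Complex.C) : Cmod z <= Rabs (Re z) + Rabs (Im z).
Proof.
  destruct z as [x y]; unfold Re, Im; simpl fst; simpl snd.
  replace (x, y) with (RtoC x + Ci * RtoC y)%C.
  - eapply Rle_trans; [apply Cmod_triangle|]. rewrite Cmod_mult, !Cmod_R, Cmod_Ci. lra.
  - unfold RtoC, Ci, Cmult, Cplus; simpl. f_equal; ring.
Qed.

Lemma ev_continuous_at_1 f e : l1 f -> 0 < e -> exists delta, 0 < delta /\
  forall z, Cmod z <= 1 -> Cmod (z - RtoC 1)%C < delta -> Cmod (ev f z - RtoC (val f))%C <= e.
Proof.
  intros lf He. destruct (nrm_tail f (e / 8) lf ltac:(lra)) as [N [_ HN]]. specialize (HN N (le_n _)).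
  set (p := trunc N f) in *. set (r := (f - p)%fps) in *.
  assert (lp : l1 p) by apply l1_trunc. assert (lr : l1 r) by now apply l1_sub.
  set (M := rsum (fun n => Rabs (theta p n)) N).
  assert (M0 : 0 <= M) by (apply rsum_nonneg; intros; apply Rabs_pos).
  exists (e / (4 * M + 4)). split; [apply Rdiv_lt_0_compat; lra|]. intros z Hz Hd.
  assert (Hp : Cmod (ev p z - RtoC (val p))%C <= 2 * (M * Cmod (z - RtoC 1)%C)).
  { eapply Rle_trans; [apply Cmod_le_sum|].
    assert (B : forall n, Cmod (z ^ n - RtoC 1)%C <= INR n * Cmod (z - RtoC 1)%C) by (intros; now apply Cpow_sub_one).
    set (dz := Cmod (z - RtoC 1)%C) in *.
    assert (pN : forall n, (N <= n)%nat -> p n = 0) by (intros; now apply trunc_ge).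
    unfold ev. rewrite (val_finite p N), (val_finite (reS z p) N), (val_finite (imS z p) N)
      by (intros n Hn; unfold reS, imS; rewrite ?(pN n Hn); ring).
    unfold RtoC, Cminus, Cplus, Copp, Re, Im; simpl fst; simpl snd.
    rewrite Ropp_0, Rplus_0_r.
    replace (rsum (reS z p) N + - rsum p N) with (rsum (fun n => reS z p n - p n) N) by (rewrite rsum_minus; ring).
    assert (B1 : Rabs (rsum (fun n => reS z p n - p n) N) <= M * dz).
    { eapply Rle_trans; [apply rsum_abs|]. unfold M. rewrite <- rsum_scal_r. apply rsum_le. intros n _.
      unfold reS, theta. replace (p n * Re (z ^ n)%C - p n) with (p n * Re (z ^ n - RtoC 1)%C)
        by (unfold Cminus, Cplus, Copp, RtoC, Re; simpl; ring).
      rewrite !Rabs_mult, (Rabs_pos_eq (INR n)) by apply pos_INR.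
      pose proof (re_le_Cmod (z ^ n - RtoC 1)%C). specialize (B n). pose proof (Rabs_pos (p n)). nra. }
    assert (B2 : Rabs (rsum (imS z p) N) <= M * dz).
    { eapply Rle_trans; [apply rsum_abs|]. unfold M. rewrite <- rsum_scal_r. apply rsum_le. intros n _.
      unfold imS, theta. replace (Im (z ^ n)%C) with (Im (z ^ n - RtoC 1)%C)
        by (unfold Cminus, Cplus, Copp, RtoC, Im; simpl; ring).
      rewrite !Rabs_mult, (Rabs_pos_eq (INR n)) by apply pos_INR.
      pose proof (im_le_Cmod (z ^ n - RtoC 1)%C). specialize (B n). pose proof (Rabs_pos (p n)). nra. }
    lra. }
  assert (Hv : Rabs (val r) <= nrm r) by (apply Series_Rabs; exact lr).
  pose proof (ev_le r z Hz lr) as Hr.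
  replace (ev f z - RtoC (val f))%C with ((ev p z - RtoC (val p)) + (ev r z - RtoC (val r)))%C.
  2:{ assert (Ef : f = (p + r)%fps) by (unfold r; ring). rewrite Ef.
      rewrite ev_add, val_add by assumption. rewrite RtoC_plus. ring. }
  eapply Rle_trans; [apply Cmod_triangle|].
  assert (Cmod (ev r z - RtoC (val r))%C <= 2 * nrm r + nrm r).
  { eapply Rle_trans; [apply Cmod_triangle|]. rewrite Cmod_opp, Cmod_R. lra. }
  assert (2 * (M * Cmod (z - RtoC 1)%C) <= e / 2).
  { apply Rle_trans with (2 * ((M + 1) * (e / (4 * M + 4)))).
    - pose proof (Cmod_ge_0 (z - RtoC 1)%C). nra.
    - apply Req_le. field. lra. }
  lra.
Qed.

Lemma Cmod_sq (w : Complex.C) : Cmod w ^ 2 = Re w ^ 2 + Im w ^ 2.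
Proof.
  unfold Cmod. rewrite pow2_sqrt; [reflexivity|].
  apply Rplus_le_le_0_compat; apply pow2_ge_0.
Qed.

Lemma Cmod_one_sub_sq (w : Complex.C) : Cmod w <= 1 -> Cmod (RtoC 1 - w)%C ^ 2 <= 2 * (1 - Re w).
Proof.
  intros H. assert (H2 : Cmod w ^ 2 <= 1).
  { rewrite <- (pow1 2). apply pow_incr. split; [apply Cmod_ge_0|assumption]. }
  rewrite Cmod_sq in *. destruct w as [x y].
  unfold Cminus, Cplus, Copp, RtoC, Re, Im in *; simpl in *. nra.
Qed.

Section LowerBound.
Context (Q : fps) (m : nat).

(** When Q(1) = 1, the real part of 1 - Q(z) is the sum of the nonnegative terms Q_n (1 - Re z^n),
    of which two are kept. *)
Lemma one_sub_Q_low z : (forall n, 0 <= Q n) -> l1 Q -> val Q = 1 -> Cmod z <= 1 ->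
  Q m * (1 - Re (z ^ m)%C) + Q (S m) * (1 - Re (z ^ S m)%C) <= Cmod (RtoC 1 - ev Q z)%C.
Proof.
  intros HQ lQ HQ1 Hz. eapply Rle_trans; [|apply re_le_Cmod]. eapply Rle_trans; [|apply Rle_abs].
  replace (Re (RtoC 1 - ev Q z)%C) with (Series (fun n => Q n * (1 - Re (z ^ n)%C))).
  - assert (P : forall n, 0 <= Q n * (1 - Re (z ^ n)%C)).
    { intros n. apply Rmult_le_pos; [apply HQ|]. pose proof (re_le_Cmod (z ^ n)%C) as H.
      pose proof (Cmod_pow_le1 z n Hz). pose proof (Rle_abs (Re (z ^ n)%C)). lra. }
    eapply Rle_trans; [|apply (rsum_le_Series _ (S (S m)) P)].
    + rewrite !rsum_S. pose proof (rsum_nonneg (fun n => Q n * (1 - Re (z ^ n)%C)) m (fun n _ => P n)). lra.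
    + eapply ex_series_ext; [|apply (l1_ex _ (l1_sub _ _ lQ (l1_reS z Q Hz lQ)))].
      intros n. unfold fsub, gsub, reS.
      match goal with |- @eq _ ?a ?b => change (@eq R a b) end. ring.
  - transitivity (val (Q - reS z Q)%fps).
    + apply Series_ext. intros n. unfold fsub, gsub, reS. ring.
    + rewrite val_sub by first [assumption | now apply l1_reS]. rewrite HQ1. reflexivity.
Qed.

(** Near 1, T is close to T(1). Elsewhere |T| |H| = |1 - Q| with H bounded, and 1 - Q is bounded
    below: since (1 - z^m) - (1 - z^(m+1)) = (z - 1) z^m, the powers z^m and z^(m+1) cannot both be
    close to 1. *)
Lemma lower_bound_disc T H : (forall n, 0 <= Q n) -> l1 Q -> val Q = 1 -> 0 < Q m -> 0 < Q (S m) ->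
  l1 T -> l1 H -> (T * H)%fps = (fone - Q)%fps -> val T <> 0 ->
  exists eps, 0 < eps /\ forall z, Cmod z <= 1 -> eps <= Cmod (ev T z).
Proof.
  intros HQ lQ HQ1 Qm Qm1 lT lH HTH HT.
  assert (Ha : 0 < Rabs (val T)) by now apply Rabs_pos_lt.
  destruct (ev_continuous_at_1 T (Rabs (val T) / 2) lT ltac:(lra)) as [delta [Hd Hc]].
  pose (q := Rmin (Q m) (Q (S m))). assert (Hq : 0 < q) by (now apply Rmin_glb_lt).
  pose (B := Rmin (q / 4 * delta ^ 2 * (/ 4) ^ m) (q / 2)).
  assert (HB : 0 < B).
  { apply Rmin_glb_lt; [|lra]. repeat apply Rmult_lt_0_compat; try apply pow_lt; lra. }
  pose proof (nrm_nonneg _ lH) as NH.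
  exists (Rmin (Rabs (val T) / 2) (B / (2 * nrm H + 1))). split.
  { apply Rmin_glb_lt; [lra|apply Rdiv_lt_0_compat; lra]. }
  intros z Hz. destruct (Rlt_le_dec (Cmod (z - RtoC 1)%C) delta) as [Hz1|Hz1].
  - eapply Rle_trans; [apply Rmin_l|]. specialize (Hc z Hz Hz1).
    pose proof (Cmod_triangle (ev T z) (- (ev T z - RtoC (val T)))%C) as Tr. rewrite Cmod_opp in Tr.
    replace (ev T z + - (ev T z - RtoC (val T)))%C with (RtoC (val T)) in Tr by ring.
    rewrite Cmod_R in Tr. lra.
  - eapply Rle_trans; [apply Rmin_r|].
    assert (HE : Cmod (ev T z) * Cmod (ev H z) = Cmod (RtoC 1 - ev Q z)%C).
    { rewrite <- Cmod_mult, <- ev_star, HTH, ev_sub, ev_one by first [assumption | apply l1_one]. reflexivity. }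
    pose proof (ev_le H z Hz lH) as HH. pose proof (Cmod_ge_0 (ev T z)) as HT0.
    assert (HBz : B <= Cmod (RtoC 1 - ev Q z)%C).
    { eapply Rle_trans; [|now apply one_sub_Q_low].
      assert (q1 : q <= Q m) by apply Rmin_l. assert (q2 : q <= Q (S m)) by apply Rmin_r.
      pose proof (Cmod_one_sub_sq _ (Cmod_pow_le1 z m Hz)) as S1.
      pose proof (Cmod_one_sub_sq _ (Cmod_pow_le1 z (S m) Hz)) as S2.
      set (x := Cmod (RtoC 1 - z ^ m)%C) in *. set (y := Cmod (RtoC 1 - z ^ S m)%C) in *.
      assert (x0 : 0 <= x) by apply Cmod_ge_0. assert (y0 : 0 <= y) by apply Cmod_ge_0.
      (* For |z| < 1/2 the factor z^m is not bounded below, but Re z^(m+1) <= 1/2 alone gives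
         q/2. *)
      destruct (Rlt_le_dec (Cmod z) (/ 2)) as [Hzs|Hzs].
      - eapply Rle_trans; [apply Rmin_r|].
        assert (R1 : Re (z ^ S m)%C <= / 2).
        { eapply Rle_trans; [apply Rle_abs|]. eapply Rle_trans; [apply re_le_Cmod|].
          rewrite Cpow_S, Cmod_mult. pose proof (Cmod_pow_le1 z m Hz). pose proof (Cmod_ge_0 z). nra. }
        assert (0 <= 1 - Re (z ^ m)%C) by nra. nra.
      - eapply Rle_trans; [apply Rmin_l|].
        assert (Hxy : Cmod (z - RtoC 1)%C * Cmod z ^ m <= x + y).
        { rewrite <- Cmod_pow, <- Cmod_mult.
          replace ((z - RtoC 1) * z ^ m)%C with ((RtoC 1 - z ^ m) + - (RtoC 1 - z ^ S m))%C by (rewrite Cpow_S; ring).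
          eapply Rle_trans; [apply Cmod_triangle|]. rewrite Cmod_opp. apply Rle_refl. }
        assert (Hl : delta * (/ 2) ^ m <= x + y).
        { eapply Rle_trans; [|exact Hxy]. apply Rmult_le_compat; [lra|apply pow_le; lra|assumption|].
          apply pow_incr; lra. }
        assert (P2 : 0 < (/ 2) ^ m) by (apply pow_lt; lra).
        replace ((/ 4) ^ m) with ((/ 2) ^ m * (/ 2) ^ m)
          by (rewrite <- Rpow_mult_distr; f_equal; field).
        assert (Hsq : (delta * (/ 2) ^ m) ^ 2 <= (x + y) ^ 2) by (apply pow_incr; split; [nra|assumption]).
        assert (0 <= q) by lra. set (u := 1 - Re (z ^ m)%C) in *. set (v := 1 - Re (z ^ S m)%C) in *.
        assert (0 <= u) by nra. assert (0 <= v) by nra.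
        replace (q / 4 * delta ^ 2 * ((/ 2) ^ m * (/ 2) ^ m)) with (q * ((delta * (/ 2) ^ m) ^ 2 / 4)) by field.
        apply Rle_trans with (q * (u + v)); [|nra]. apply Rmult_le_compat_l; [assumption|].
        assert ((x + y) ^ 2 <= 2 * x ^ 2 + 2 * y ^ 2) by (pose proof (pow2_ge_0 (x - y)); nra). lra. }
    apply Rmult_le_reg_r with (2 * nrm H + 1); [lra|].
    unfold Rdiv. rewrite Rmult_assoc, Rinv_l, Rmult_1_r by lra.
    apply Rle_trans with (Cmod (ev T z) * Cmod (ev H z)); [lra|]. apply Rmult_le_compat_l; lra.
Qed.
End LowerBound.

(** * Wallis' formula *)

Lemma nonneg_of_derive (f f' : R -> R) : f 0 = 0 ->
  (forall x, is_derive f x (f' x)) -> (forall x, 0 <= x -> 0 <= f' x) -> forall x, 0 <= x -> 0 <= f x.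
Proof.
  intros H0 Hd Hp x Hx. destruct (MVT_gen f 0 x f') as [y [Hy E]].
  - intros; apply Hd.
  - intros y _. apply continuity_pt_filterlim. apply (ex_derive_continuous f). eexists; apply Hd.
  - rewrite Rmin_left, Rmax_right in Hy by lra. rewrite H0, !Rminus_0_r in E. rewrite E.
    apply Rmult_le_pos; [apply Hp; lra|assumption].
Qed.

Lemma sin_le x : 0 <= x -> sin x <= x.
Proof.
  intros Hx. enough (0 <= x - sin x) by lra. revert x Hx.
  apply (nonneg_of_derive _ (fun x => 1 - cos x)).
  - rewrite sin_0; ring.
  - intros x. auto_derive; [trivial|ring].
  - intros x _. pose proof (COS_bound x). lra.
Qed.
Lemma cos_ge x : 0 <= x -> 1 - x ^ 2 / 2 <= cos x.
Proof.
  intros Hx. enough (0 <= cos x - (1 - x ^ 2 / 2)) by lra. revert x Hx.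
  apply (nonneg_of_derive _ (fun x => x - sin x)).
  - rewrite cos_0; field.
  - intros x. auto_derive; [trivial|field].
  - intros x Hx. pose proof (sin_le x Hx). lra.
Qed.
Lemma sin_ge x : 0 <= x -> x - x ^ 3 / 6 <= sin x.
Proof.
  intros Hx. enough (0 <= sin x - (x - x ^ 3 / 6)) by lra. revert x Hx.
  apply (nonneg_of_derive _ (fun x => cos x - (1 - x ^ 2 / 2))).
  - rewrite sin_0; field.
  - intros x. auto_derive; [trivial|field].
  - intros x Hx. pose proof (cos_ge x Hx). lra.
Qed.
Lemma cos_le x : 0 <= x -> cos x <= 1 - x ^ 2 / 2 + x ^ 4 / 24.
Proof.
  intros Hx. enough (0 <= 1 - x ^ 2 / 2 + x ^ 4 / 24 - cos x) by lra. revert x Hx.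
  apply (nonneg_of_derive _ (fun x => sin x - (x - x ^ 3 / 6))).
  - rewrite cos_0; field.
  - intros x. auto_derive; [trivial|field].
  - intros x Hx. pose proof (sin_ge x Hx). lra.
Qed.
Lemma sin_le5 x : 0 <= x -> sin x <= x - x ^ 3 / 6 + x ^ 5 / 120.
Proof.
  intros Hx. enough (0 <= x - x ^ 3 / 6 + x ^ 5 / 120 - sin x) by lra. revert x Hx.
  apply (nonneg_of_derive _ (fun x => 1 - x ^ 2 / 2 + x ^ 4 / 24 - cos x)).
  - rewrite sin_0; field.
  - intros x. auto_derive; [trivial|field].
  - intros x Hx. pose proof (cos_le x Hx). lra.
Qed.

Lemma cos_abs x : cos (Rabs x) = cos x.
Proof. unfold Rabs; destruct (Rcase_abs x); [apply cos_neg|reflexivity]. Qed.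

(** The Taylor bound works up to 3; beyond, cos t <= cos 3 <= -1/8, while PI <= 4 makes the left
    side at most 1. *)
Lemma one_sub_cos_ge t : - PI <= t <= PI -> t ^ 2 / 16 <= 1 - cos t.
Proof.
  intros Ht. rewrite <- cos_abs. rewrite <- (pow2_abs t). pose proof (Rabs_pos t) as H0.
  assert (H1 : Rabs t <= PI) by (apply Rabs_le; lra). pose proof PI_4 as H4.
  set (x := Rabs t) in *. destruct (Rle_lt_dec x 3) as [H3|H3].
  - pose proof (cos_le x H0). assert (x ^ 2 <= 9) by nra. nra.
  - assert (cos x <= cos 3) by (apply cos_decr_1; lra).
    pose proof (cos_le 3 ltac:(lra)). nra.
Qed.

Lemma cos_taylor1 x : Rabs (cos x - 1) <= Rabs x ^ 2 / 2.
Proof.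
  rewrite <- cos_abs. pose proof (cos_ge _ (Rabs_pos x)). pose proof (COS_bound (Rabs x)).
  apply Rabs_le; lra.
Qed.
Lemma cos_taylor3 x : Rabs (cos x - (1 - x ^ 2 / 2)) <= Rabs x ^ 4 / 24.
Proof.
  rewrite <- cos_abs. rewrite <- (pow2_abs x). pose proof (cos_ge _ (Rabs_pos x)). pose proof (cos_le _ (Rabs_pos x)).
  pose proof (pow_le (Rabs x) 4 (Rabs_pos x)). apply Rabs_le; lra.
Qed.
Lemma odd_abs (f : R -> R) x : (forall y, f (- y) = - f y) -> Rabs (f x) = Rabs (f (Rabs x)).
Proof.
  intros H. unfold Rabs at 3. destruct (Rcase_abs x); [|reflexivity]. now rewrite H, Rabs_Ropp.
Qed.
Lemma sin_taylor1 x : Rabs (sin x - x) <= Rabs x ^ 3 / 6.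
Proof.
  rewrite (odd_abs (fun x => sin x - x)) by (intros; rewrite sin_neg; ring).
  pose proof (sin_ge _ (Rabs_pos x)). pose proof (sin_le _ (Rabs_pos x)).
  pose proof (pow_le (Rabs x) 3 (Rabs_pos x)). apply Rabs_le; lra.
Qed.
Lemma sin_taylor1' x : Rabs (sin x - x) <= Rabs x ^ 2.
Proof.
  pose proof (sin_taylor1 x) as H1. pose proof (Rabs_pos x) as H0.
  destruct (Rle_lt_dec (Rabs x) 6) as [H|H].
  - eapply Rle_trans; [exact H1|]. simpl. nra.
  - eapply Rle_trans; [apply Rabs_triang|]. rewrite Rabs_Ropp.
    pose proof (SIN_bound x). assert (Rabs (sin x) <= 1) by (apply Rabs_le; lra). simpl. nra.
Qed.
Lemma sin_taylor3 x : Rabs (sin x - (x - x ^ 3 / 6)) <= Rabs x ^ 5 / 120.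
Proof.
  rewrite (odd_abs (fun x => sin x - (x - x ^ 3 / 6))) by (intros; rewrite sin_neg; field).
  pose proof (sin_ge _ (Rabs_pos x)). pose proof (sin_le5 _ (Rabs_pos x)).
  pose proof (pow_le (Rabs x) 5 (Rabs_pos x)). apply Rabs_le; lra.
Qed.

Definition wal (n : nat) : R := RInt (fun t => sin t ^ n) 0 PI.

Lemma ex_RInt_cont (f : R -> R) a b : (forall t, continuous f t) -> ex_RInt f a b.
Proof. intros H. apply (ex_RInt_continuous (V := R_CompleteNormedModule)). intros; apply H. Qed.

Lemma ex_wal n a b : ex_RInt (fun t => sin t ^ n) a b.
Proof.
  apply ex_RInt_cont. intros t. apply (ex_derive_continuous (fun t => sin t ^ n)). auto_derive; trivial.
Qed.

Lemma wal_step n : INR (S (S n)) * wal (S (S n)) = INR (S n) * wal n.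
Proof.
  assert (H : is_RInt (fun t => INR (S (S n)) * sin t ^ S (S n) - INR (S n) * sin t ^ n) 0 PI
     (minus (- cos PI * sin PI ^ S n) (- cos 0 * sin 0 ^ S n))).
  { apply (is_RInt_derive (fun t => - cos t * sin t ^ S n)).
    - intros t _. auto_derive; [trivial|]. pose proof (sin2_cos2 t) as E. unfold Rsqr in E.
      change (match n with O => 1 | S _ => INR n + 1 end) with (INR (S n)).
      rewrite (S_INR (S n)). change (sin t ^ S (S n)) with (sin t * (sin t * sin t ^ n)).
      transitivity (sin t * (sin t * sin t ^ n) - INR (S n) * (cos t * cos t) * sin t ^ n); [ring|].
      replace (cos t * cos t) with (1 - sin t * sin t) by lra. ring.
    - intros t _. apply (ex_derive_continuous (fun t => INR (S (S n)) * sin t ^ S (S n) - INR (S n) * sin t ^ n)).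
      auto_derive; trivial. }
  rewrite sin_PI, sin_0 in H. rewrite pow_i, !Rmult_0_r in H by lia.
  change (minus 0 0) with (0 - 0) in H. rewrite Rminus_0_r in H.
  assert (H2 : is_RInt (fun t => INR (S (S n)) * sin t ^ S (S n) - INR (S n) * sin t ^ n) 0 PI
     (INR (S (S n)) * wal (S (S n)) - INR (S n) * wal n)).
  { apply (is_RInt_minus (fun t => INR (S (S n)) * sin t ^ S (S n)) (fun t => INR (S n) * sin t ^ n));
    apply (is_RInt_scal (V := R_NormedModule)); apply (RInt_correct (V := R_CompleteNormedModule)), ex_wal. }
  pose proof (is_RInt_unique _ _ _ _ H) as U. pose proof (is_RInt_unique _ _ _ _ H2) as U2.
  rewrite U in U2. lra.
Qed.

Lemma wal_0 : wal 0 = PI.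
Proof.
  unfold wal. simpl. rewrite RInt_const. unfold scal; simpl; unfold mult; simpl. ring.
Qed.
Lemma wal_1 : wal 1 = 2.
Proof.
  apply is_RInt_unique. replace 2 with (minus (- cos PI) (- cos 0)).
  - apply (is_RInt_derive (fun t => - cos t)).
    + intros t _. auto_derive; [trivial|ring].
    + intros t _. apply (ex_derive_continuous (fun t => sin t ^ 1)). auto_derive; trivial.
  - rewrite cos_PI, cos_0. unfold minus, plus, opp; simpl. ring.
Qed.
Lemma wal_decr n : wal (S n) <= wal n.
Proof.
  apply RInt_le; [apply Rlt_le, PI_RGT_0|apply ex_wal|apply ex_wal|].
  intros t Ht. pose proof (sin_gt_0 t ltac:(lra) ltac:(lra)). pose proof (SIN_bound t).
  pose proof (pow_le (sin t) n ltac:(lra)). simpl. nra.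
Qed.
Lemma wal_even n : wal (2 * n) = PI * tq n.
Proof.
  induction n as [|n IH]; [change (wal 0 = PI * 1); rewrite wal_0; ring|].
  replace (2 * S n)%nat with (S (S (2 * n))) by lia.
  pose proof (wal_step (2 * n)) as H. rewrite IH in H. rewrite !S_INR, mult_INR in H. replace (INR 2) with 2 in H by (simpl; ring).
  simpl tq. pose proof (pos_INR n).
  apply Rmult_eq_reg_l with (2 * INR n + 1 + 1); [|lra]. rewrite H. field. lra.
Qed.
Lemma wal_odd n : wal (S (2 * n)) = 2 / ((2 * INR n + 1) * tq n).
Proof.
  induction n as [|n IH]; [change (wal 1 = 2 / ((2 * 0 + 1) * 1)); rewrite wal_1; field|].
  replace (2 * S n)%nat with (S (S (2 * n))) by lia.
  pose proof (wal_step (S (2 * n))) as H. rewrite IH in H. rewrite !S_INR, mult_INR in H. replace (INR 2) with 2 in H by (simpl; ring).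
  simpl tq. rewrite S_INR. pose proof (pos_INR n). pose proof (tq_pos n).
  apply Rmult_eq_reg_l with (2 * INR n + 1 + 1 + 1); [|lra]. rewrite H. field. repeat split; lra.
Qed.

(** The Wallis integrals are PI tq(n) at 2n and 2 / ((2n+1) tq(n)) at 2n+1; their monotonicity
    encloses tq(n)^2 from both sides. *)
Lemma tq_sq_lower n : 1 <= PI * (INR n + / 2) * (tq n * tq n).
Proof.
  pose proof (wal_decr (2 * n)) as H. rewrite wal_even, wal_odd in H.
  pose proof (tq_pos n). pose proof (pos_INR n). pose proof PI_RGT_0.
  apply Rmult_le_compat_r with (r := (2 * INR n + 1) * tq n / 2) in H; [|apply Rmult_le_pos; [nra|lra]].
  replace (2 / ((2 * INR n + 1) * tq n) * ((2 * INR n + 1) * tq n / 2)) with 1 in H by (field; split; lra).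
  lra.
Qed.
Lemma tq_sq_upper n : PI * INR n * (tq n * tq n) <= 1.
Proof.
  destruct n as [|n]; [simpl; lra|].
  pose proof (wal_decr (S (2 * n))) as H. rewrite wal_odd in H.
  replace (S (S (2 * n))) with (2 * S n)%nat in H by lia. rewrite wal_even in H.
  pose proof (tq_pos n). pose proof (tq_pos (S n)). pose proof (pos_INR n). pose proof PI_RGT_0.
  assert (E : tq n = tq (S n) * (2 * INR n + 2) / (2 * INR n + 1)) by (simpl tq; field; lra).
  rewrite E in H.
  apply Rmult_le_compat_r with (r := tq (S n) * INR (S n)) in H; [|apply Rmult_le_pos; [lra|apply pos_INR]].
  rewrite S_INR in *.
  replace (2 / ((2 * INR n + 1) * (tq (S n) * (2 * INR n + 2) / (2 * INR n + 1))) * (tq (S n) * (INR n + 1))) with 1 in H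
    by (field; repeat split; lra).
  lra.
Qed.

Lemma tq_wallis n : (1 <= n)%nat ->
  Rabs (tq n - / sqrt (PI * INR n)) <= / INR n * / sqrt (PI * INR n).
Proof.
  intros Hn. assert (H1 : 1 <= INR n) by (apply (le_INR 1); lia). pose proof PI_RGT_0 as HP.
  pose proof (tq_sq_lower n) as HL. pose proof (tq_sq_upper n) as HU. pose proof (tq_pos n) as Ht.
  assert (Hs : 0 < sqrt (PI * INR n)) by (apply sqrt_lt_R0; nra).
  assert (Hss : sqrt (PI * INR n) * sqrt (PI * INR n) = PI * INR n) by (apply sqrt_sqrt; nra).
  set (s := sqrt (PI * INR n)) in *. set (x := INR n) in *. set (t := tq n) in *.
  assert (U : t * s <= 1).
  { destruct (Rle_lt_dec (t * s) 1) as [E|E]; [assumption|].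
    assert (1 < (t * s) * (t * s)) by nra. nra. }
  assert (L : 1 - / x <= t * s).
  { assert (E : (t * s) * (t * s) >= x / (x + / 2)).
    { replace ((t * s) * (t * s)) with (PI * x * (t * t)) by (rewrite <- Hss; ring).
      apply Rle_ge. apply Rmult_le_reg_r with (x + / 2); [lra|].
      unfold Rdiv. rewrite Rmult_assoc, Rinv_l, Rmult_1_r by lra.
      apply Rle_trans with (x * (PI * (x + / 2) * (t * t))); [|apply Req_le; ring]. nra. }
    assert (E3 : 0 < t * s) by nra.
    assert (E2 : 1 - / x <= x / (x + / 2)).
    { apply Rmult_le_reg_r with (x * (x + / 2)); [nra|].
      replace ((1 - / x) * (x * (x + / 2))) with ((x - 1) * (x + / 2)) by (field; lra).
      replace (x / (x + / 2) * (x * (x + / 2))) with (x * x) by (field; lra). nra. }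
    nra. }
  assert (Hi : 0 < / s) by now apply Rinv_0_lt_compat.
  replace (t - / s) with ((t * s - 1) * / s) by (field; lra).
  rewrite Rabs_mult, (Rabs_pos_eq (/ s)) by lra. apply Rmult_le_compat_r; [lra|].
  assert (0 < / x) by (apply Rinv_0_lt_compat; lra). apply Rabs_le; lra.
Qed.

Lemma tq_ge n : / (2 * rt n) <= tq n.
Proof.
  pose proof (tq_sq_lower n) as H. pose proof (tq_pos n). pose proof (rt_pos n). pose proof (pos_INR n).
  pose proof (rt_sq n) as E. pose proof PI_4. pose proof PI_RGT_0.
  apply Rmult_le_reg_r with (2 * rt n); [lra|]. rewrite Rinv_l by lra.
  destruct (Rle_lt_dec 1 (tq n * (2 * rt n))) as [K|K]; [assumption|].
  assert (K0 : 0 <= tq n * (2 * rt n)) by (apply Rmult_le_pos; lra).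
  set (y := tq n * (2 * rt n)) in *.
  assert (K2 : y * y < 1) by nra. unfold y in K2.
  replace ((tq n * (2 * rt n)) * (tq n * (2 * rt n))) with (4 * (tq n * tq n) * (rt n * rt n)) in K2 by ring.
  rewrite E in K2. assert (0 <= tq n * tq n) by nra.
  assert (PI * (INR n + / 2) <= 4 * (INR n + 1)) by nra. nra.
Qed.

(** * Calculus on a period *)

(** Differentiation and continuity of complex functions go through real and imaginary parts, so that
    only the real calculus is used. *)
Definition cder (f f' : R -> Complex.C) : Prop := forall t,
  is_derive (fun t => Re (f t)) t (Re (f' t)) /\ is_derive (fun t => Im (f t)) t (Im (f' t)).
Definition ccont (f : R -> Complex.C) : Prop := forall t,
  continuous (fun t => Re (f t)) t /\ continuous (fun t => Im (f t)) t.

Lemma cder_ccont f f' : cder f f' -> ccont f.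
Proof.
  intros H t. destruct (H t) as [H1 H2].
  split; [apply (ex_derive_continuous (fun t => Re (f t)))|apply (ex_derive_continuous (fun t => Im (f t)))];
    eexists; eassumption.
Qed.
Lemma cder_ext f f' g' : (forall t, f' t = g' t) -> cder f f' -> cder f g'.
Proof. intros E H t. rewrite <- E. apply H. Qed.
Lemma cder_const w : cder (fun _ => w) (fun _ => RtoC 0).
Proof. intros t. split; apply (is_derive_const (V := R_NormedModule)). Qed.
Lemma cder_mult f f' g g' : cder f f' -> cder g g' ->
  cder (fun t => f t * g t)%C (fun t => f' t * g t + f t * g' t)%C.
Proof.
  intros Hf Hg t. destruct (Hf t) as [F1 F2], (Hg t) as [G1 G2]. split.
  - apply is_derive_ext with (fun t => Re (f t) * Re (g t) - Im (f t) * Im (g t)).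
    { intros; now rewrite re_mult. }
    replace (Re (f' t * g t + f t * g' t)%C)
      with ((Re (f' t) * Re (g t) + Re (f t) * Re (g' t)) - (Im (f' t) * Im (g t) + Im (f t) * Im (g' t)))
      by (unfold Cplus, Cmult, Re, Im; simpl; ring).
    apply (is_derive_minus (V := R_NormedModule));
      apply (is_derive_mult (K := R_AbsRing)); assumption || apply Rmult_comm.
  - apply is_derive_ext with (fun t => Re (f t) * Im (g t) + Im (f t) * Re (g t)).
    { intros; now rewrite im_mult. }
    replace (Im (f' t * g t + f t * g' t)%C)
      with ((Re (f' t) * Im (g t) + Re (f t) * Im (g' t)) + (Im (f' t) * Re (g t) + Im (f t) * Re (g' t)))
      by (unfold Cplus, Cmult, Re, Im; simpl; ring).
    apply (is_derive_plus (V := R_NormedModule));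
      apply (is_derive_mult (K := R_AbsRing)); assumption || apply Rmult_comm.
Qed.
Lemma cder_pow f f' n : cder f f' ->
  cder (fun t => f t ^ S n)%C (fun t => RtoC (INR (S n)) * f t ^ n * f' t)%C.
Proof.
  intros Hf. induction n as [|n IH].
  - apply cder_ext with (fun t => f' t * RtoC 1 + f t * RtoC 0)%C.
    + intros t. simpl. ring.
    + exact (cder_mult f f' _ _ Hf (cder_const (RtoC 1))).
  - eapply cder_ext; [|exact (cder_mult f f' _ _ Hf IH)]. intros t. cbv beta.
    rewrite (S_INR (S n)), RtoC_plus, !Cpow_S. ring.
Qed.

Lemma ccont_mult f g : ccont f -> ccont g -> ccont (fun t => f t * g t)%C.
Proof.
  intros Hf Hg t. destruct (Hf t) as [F1 F2], (Hg t) as [G1 G2]. split.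
  - apply continuous_ext with (fun t => Re (f t) * Re (g t) - Im (f t) * Im (g t)).
    { intros; now rewrite re_mult. }
    apply (continuous_minus (V := R_NormedModule)); now apply (continuous_mult (K := R_AbsRing)).
  - apply continuous_ext with (fun t => Re (f t) * Im (g t) + Im (f t) * Re (g t)).
    { intros; now rewrite im_mult. }
    apply (continuous_plus (V := R_NormedModule)); now apply (continuous_mult (K := R_AbsRing)).
Qed.
Lemma ccont_plus f g : ccont f -> ccont g -> ccont (fun t => f t + g t)%C.
Proof.
  intros Hf Hg t. destruct (Hf t) as [F1 F2], (Hg t) as [G1 G2].
  split; apply (continuous_plus (V := R_NormedModule)); assumption.
Qed.
Lemma ccont_const w : ccont (fun _ => w).
Proof. exact (cder_ccont _ _ (cder_const w)). Qed.
Lemma ccont_scal w f : ccont f -> ccont (fun t => w * f t)%C.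
Proof. intros; apply ccont_mult; [apply ccont_const|assumption]. Qed.
Lemma ccont_ext f g : (forall t, f t = g t) -> ccont f -> ccont g.
Proof. intros E H. replace g with f; [assumption|]. apply functional_extensionality, E. Qed.
Lemma ccont_minus f g : ccont f -> ccont g -> ccont (fun t => f t - g t)%C.
Proof.
  intros Hf Hg. apply ccont_ext with (fun t => f t + (- RtoC 1) * g t)%C.
  - intros; ring.
  - apply ccont_plus; [assumption|now apply ccont_scal].
Qed.
Lemma ccont_pow f n : ccont f -> ccont (fun t => f t ^ n)%C.
Proof.
  intros H. induction n as [|n IH]; [exact (ccont_const (RtoC 1))|].
  apply (ccont_mult f (fun t => f t ^ n)%C); assumption.
Qed.

(** The mean of the real part over a period: the coefficients to be extracted are real. *)
Definition Itg (f : R -> Complex.C) : R := RInt (fun t => Re (f t)) (- PI) PI / (2 * PI).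

Lemma ccont_ex f a b : ccont f -> ex_RInt (fun t => Re (f t)) a b.
Proof. intros H. apply ex_RInt_cont. intros t; apply H. Qed.
Lemma Itg_ext f g : (forall t, f t = g t) -> Itg f = Itg g.
Proof. intros H. unfold Itg. f_equal. apply RInt_ext. intros t _. now rewrite H. Qed.
Lemma Itg_plus f g : ccont f -> ccont g -> Itg (fun t => f t + g t)%C = Itg f + Itg g.
Proof.
  intros Hf Hg. unfold Itg. unfold Rdiv. rewrite <- Rmult_plus_distr_r. f_equal.
  apply (RInt_plus (V := R_CompleteNormedModule)); now apply ccont_ex.
Qed.
Lemma Itg_scal a f : ccont f -> Itg (fun t => RtoC a * f t)%C = a * Itg f.
Proof.
  intros Hf. unfold Itg, Rdiv. rewrite <- Rmult_assoc. f_equal.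
  transitivity (RInt (fun t => scal a (Re (f t))) (- PI) PI).
  - apply RInt_ext. intros t _. rewrite re_scal_l. reflexivity.
  - apply (RInt_scal (V := R_CompleteNormedModule)); now apply ccont_ex.
Qed.
Lemma Itg_minus f g : ccont f -> ccont g -> Itg (fun t => f t - g t)%C = Itg f - Itg g.
Proof.
  intros Hf Hg. transitivity (Itg (fun t => f t + RtoC (-1) * g t)%C).
  - apply Itg_ext. intros t. replace (RtoC (-1)) with (- RtoC 1)%C by (unfold RtoC, Copp; simpl; f_equal; ring). ring.
  - rewrite Itg_plus, Itg_scal by first [assumption | now apply ccont_scal]. ring.
Qed.
Lemma Itg_bound f (g : R -> R) I : ccont f -> is_RInt g (- PI) PI I ->
  (forall t, - PI <= t <= PI -> Cmod (f t) <= g t) -> Rabs (Itg f) <= I / (2 * PI).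
Proof.
  intros Hf Hg H. pose proof PI_RGT_0. unfold Itg, Rdiv. rewrite Rabs_mult.
  rewrite (Rabs_pos_eq (/ (2 * PI))) by (apply Rlt_le, Rinv_0_lt_compat; lra).
  apply Rmult_le_compat_r; [apply Rlt_le, Rinv_0_lt_compat; lra|].
  refine (norm_RInt_le (V := R_NormedModule) (fun t => Re (f t)) g (- PI) PI _ I _ _ _ Hg); [lra| |].
  - intros t Ht. eapply Rle_trans; [apply re_le_Cmod|now apply H].
  - apply (RInt_correct (V := R_CompleteNormedModule)). now apply ccont_ex.
Qed.
Lemma Itg_derive F F' : cder F F' -> ccont F' -> F PI = F (- PI) -> Itg F' = 0.
Proof.
  intros Hd Hc Hp. unfold Itg.
  rewrite (is_RInt_unique _ _ _ (minus (Re (F PI)) (Re (F (- PI))))).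
  - rewrite Hp. unfold minus, plus, opp; simpl. field. apply PI_neq0.
  - apply (is_RInt_derive (fun t => Re (F t))); intros t _; [apply Hd|apply Hc].
Qed.

Lemma exp_mono x y : x <= y -> exp x <= exp y.
Proof. intros [H| ->]; [now apply Rlt_le, exp_increasing|apply Rle_refl]. Qed.

Lemma exp_neg_le y : 0 <= y -> exp (- y) <= 27 / (1 + y) ^ 3.
Proof.
  intros Hy. pose proof (exp_ineq1_le (y / 3)) as H. pose proof (exp_pos y).
  assert (E : exp y = exp (y / 3) ^ 3) by (simpl; rewrite Rmult_1_r, <- !exp_plus; f_equal; field).
  assert (H3 : (1 + y) ^ 3 <= 27 * exp y).
  { rewrite E. replace (27 * exp (y / 3) ^ 3) with ((3 * exp (y / 3)) ^ 3) by ring. apply pow_incr. lra. }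
  rewrite exp_Ropp. pose proof (pow_lt (1 + y) 3 ltac:(lra)).
  apply Rmult_le_reg_r with (exp y * (1 + y) ^ 3); [now apply Rmult_lt_0_compat|].
  replace (/ exp y * (exp y * (1 + y) ^ 3)) with ((1 + y) ^ 3) by (field; lra).
  replace (27 / (1 + y) ^ 3 * (exp y * (1 + y) ^ 3)) with (27 * exp y) by (field; lra). exact H3.
Qed.

Lemma pow_le_1sq s k : 0 <= s -> (k <= 4)%nat -> s ^ k <= (1 + s ^ 2) ^ 2.
Proof.
  intros Hs Hk. destruct (Rle_lt_dec s 1) as [H|H].
  - apply Rle_trans with 1; [rewrite <- (pow1 k); apply pow_incr; lra|].
    pose proof (pow2_ge_0 s). nra.
  - apply Rle_trans with (s ^ 4); [apply Rle_pow; [lra|assumption]|]. pose proof (pow2_ge_0 s). nra.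
Qed.

Lemma is_RInt_lorentz b : 0 < b ->
  is_RInt (fun t => / (1 + (b * t) ^ 2)) (- PI) PI (2 * atan (b * PI) / b).
Proof.
  intros Hb. replace (2 * atan (b * PI) / b) with (minus (atan (b * PI) / b) (atan (b * - PI) / b)).
  - apply (is_RInt_derive (fun t => atan (b * t) / b)).
    + intros t _. auto_derive; [trivial|]. pose proof (pow2_ge_0 (b * t)). simpl in *. unfold Rsqr. field. split; nra.
    + intros t _. apply (ex_derive_continuous (fun t => / (1 + (b * t) ^ 2))). auto_derive.
      pose proof (pow2_ge_0 (b * t)). simpl in *. nra.
  - unfold minus, plus, opp; simpl. replace (b * - PI) with (- (b * PI)) by ring. rewrite atan_opp. field. lra.
Qed.

(** With s = b sqrt(n+1) t, the Gaussian is dominated by 27 (1 + s^2)^(-3), and s^k <= (1 + s^2)^2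
    for k <= 4. What remains is the Lorentzian 1 / (1 + s^2), whose primitive is an arctangent. *)
Lemma Itg_gauss k kap : (k <= 4)%nat -> 0 < kap -> exists K, 0 <= K /\ forall f C n, ccont f -> 0 <= C ->
  (forall t, - PI <= t <= PI -> Cmod (f t) <= C * Rabs t ^ k * exp (- (kap * INR n * t ^ 2))) ->
  Rabs (Itg f) <= C * K / rt n ^ S k.
Proof.
  intros Hk Hkap. set (b := sqrt kap). assert (Hb : 0 < b) by now apply sqrt_lt_R0.
  assert (Hbb : b * b = kap) by (apply sqrt_sqrt; lra).
  (* The factor exp(16 kap) pays for replacing n by n + 1 in the exponent, as t^2 <= 16 on the
     period. *)
  exists (exp (16 * kap) * 27 / b ^ S k). pose proof (exp_pos (16 * kap)) as He. split.
  { apply Rmult_le_pos; [lra|]. apply Rlt_le, Rinv_0_lt_compat, pow_lt, Hb. }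
  intros f C n Hf HC H. pose proof (rt_pos n) as Hr. pose proof (rt_sq n) as Hr2.
  set (be := b * rt n). assert (Hbe : 0 < be) by now apply Rmult_lt_0_compat.
  assert (Hbek : 0 < be ^ k) by now apply pow_lt.
  pose proof PI_RGT_0 as HP. pose proof PI_4 as HP4.
  set (D := C * exp (16 * kap) * 27 / be ^ k).
  assert (HD : 0 <= D).
  { apply Rmult_le_pos; [|apply Rlt_le, Rinv_0_lt_compat, Hbek]. repeat apply Rmult_le_pos; lra. }
  assert (HB : Rabs (Itg f) <= D * (2 * atan (be * PI) / be) / (2 * PI)).
  { apply Itg_bound with (fun t => D * / (1 + (be * t) ^ 2)); [assumption| |].
    - exact (is_RInt_scal (V := R_NormedModule) (fun t => / (1 + (be * t) ^ 2)) (- PI) PI D _ (is_RInt_lorentz be Hbe)).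
    - intros t Ht. eapply Rle_trans; [now apply H|].
      assert (Hs : 0 <= be * Rabs t) by (apply Rmult_le_pos; [lra|apply Rabs_pos]).
      assert (Hs2 : (be * Rabs t) ^ 2 = (be * t) ^ 2) by (rewrite !Rpow_mult_distr, pow2_abs; reflexivity).
      assert (E1 : exp (- (kap * INR n * t ^ 2)) <= exp (16 * kap) * (27 / (1 + (be * t) ^ 2) ^ 3)).
      { replace (- (kap * INR n * t ^ 2)) with (kap * t ^ 2 + - ((be * t) ^ 2)).
        - rewrite exp_plus. apply Rmult_le_compat; try apply Rlt_le, exp_pos.
          + apply exp_mono. assert (t ^ 2 <= 16) by nra. nra.
          + apply exp_neg_le, pow2_ge_0.
        - unfold be. replace ((b * rt n * t) ^ 2) with ((b * b) * (rt n * rt n) * t ^ 2) by ring.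
          rewrite Hbb, Hr2. ring. }
      pose proof (pow_le_1sq _ k Hs Hk) as E2. rewrite Hs2, Rpow_mult_distr in E2.
      set (y := 1 + (be * t) ^ 2) in *. assert (Hy : 0 < y) by (unfold y; pose proof (pow2_ge_0 (be * t)); lra).
      apply Rle_trans with (C * Rabs t ^ k * (exp (16 * kap) * (27 / y ^ 3))).
      + apply Rmult_le_compat_l; [|exact E1]. apply Rmult_le_pos; [assumption|apply pow_le, Rabs_pos].
      + apply Rmult_le_reg_r with (be ^ k * y ^ 3); [apply Rmult_lt_0_compat; [assumption|now apply pow_lt]|].
        unfold D. replace (C * Rabs t ^ k * (exp (16 * kap) * (27 / y ^ 3)) * (be ^ k * y ^ 3))
          with (C * exp (16 * kap) * 27 * (be ^ k * Rabs t ^ k)) by (field; lra).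
        replace (C * exp (16 * kap) * 27 / be ^ k * / y * (be ^ k * y ^ 3))
          with (C * exp (16 * kap) * 27 * y ^ 2) by (field; split; lra).
        apply Rmult_le_compat_l; [|exact E2]. repeat apply Rmult_le_pos; lra. }
  eapply Rle_trans; [exact HB|]. pose proof (atan_bound (be * PI)) as Ha.
  apply Rle_trans with (D * (PI / be) / (2 * PI)).
  - unfold Rdiv. apply Rmult_le_compat_r; [apply Rlt_le, Rinv_0_lt_compat; lra|].
    apply Rmult_le_compat_l; [assumption|]. apply Rmult_le_compat_r; [apply Rlt_le, Rinv_0_lt_compat; lra|lra].
  - apply Rle_trans with (D / be).
    + replace (D * (PI / be) / (2 * PI)) with (D / be * / 2) by (field; lra).
      assert (0 <= D / be) by (apply Rmult_le_pos; [assumption|apply Rlt_le, Rinv_0_lt_compat; lra]). lra.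
    + apply Req_le. unfold D, be. rewrite Rpow_mult_distr. simpl. field. repeat split; try lra; apply Rgt_not_eq, pow_lt; lra.
Qed.

(** Orders of vanishing at 0, required uniformly on the whole period so that they can be inserted
    directly into the integrals. *)
Definition rbo (r : nat) (f : R -> R) : Prop :=
  exists C, 0 <= C /\ forall t, - PI <= t <= PI -> Rabs (f t) <= C * Rabs t ^ r.
Definition bo (r : nat) (f : R -> Complex.C) : Prop :=
  exists C, 0 <= C /\ forall t, - PI <= t <= PI -> Cmod (f t) <= C * Rabs t ^ r.

Lemma rbo_weaken r r' f : (r' <= r)%nat -> rbo r f -> rbo r' f.
Proof.
  intros Hr [C [C0 H]]. exists (C * 4 ^ (r - r')). split.
  { apply Rmult_le_pos; [assumption|apply pow_le; lra]. }
  intros t Ht. eapply Rle_trans; [now apply H|]. rewrite Rmult_assoc. apply Rmult_le_compat_l; [assumption|].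
  replace r with ((r - r') + r')%nat at 1 by lia. rewrite pow_add.
  apply Rmult_le_compat_r; [apply pow_le, Rabs_pos|]. apply pow_incr. split; [apply Rabs_pos|].
  pose proof PI_4. apply Rabs_le; lra.
Qed.
Lemma rbo_scal r a f : rbo r f -> rbo r (fun t => a * f t).
Proof.
  intros [C [C0 H]]. exists (Rabs a * C). split; [apply Rmult_le_pos; [apply Rabs_pos|assumption]|].
  intros t Ht. rewrite Rabs_mult, Rmult_assoc. apply Rmult_le_compat_l; [apply Rabs_pos|now apply H].
Qed.
Lemma rbo_rsum r (F : nat -> R -> R) N : (forall j, rbo r (F j)) -> rbo r (fun t => rsum (fun j => F j t) N).
Proof.
  intros H. induction N as [|N [C [C0 HC]]].
  - exists 0. split; [lra|]. intros t _. unfold rsum; simpl. rewrite Rabs_R0. lra.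
  - destruct (H N) as [D [D0 HD]]. exists (C + D). split; [lra|]. intros t Ht. rewrite rsum_S.
    eapply Rle_trans; [apply Rabs_triang|]. specialize (HC t Ht). specialize (HD t Ht). lra.
Qed.
Lemma rbo_ext r f g : (forall t, f t = g t) -> rbo r f -> rbo r g.
Proof. intros E [C [C0 H]]. exists C. split; [assumption|]. intros. rewrite <- E. now apply H. Qed.
Lemma bo_pair r f : rbo r (fun t => Re (f t)) -> rbo r (fun t => Im (f t)) -> bo r f.
Proof.
  intros [C [C0 H]] [D [D0 H']]. exists (C + D). split; [lra|]. intros t Ht.
  eapply Rle_trans; [apply Cmod_le_sum|]. specialize (H t Ht). specialize (H' t Ht). lra.
Qed.
Lemma bo_ext r f g : (forall t, f t = g t) -> bo r f -> bo r g.
Proof. intros E [C [C0 H]]. exists C. split; [assumption|]. intros. rewrite <- E. now apply H. Qed.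
Lemma bo_plus r f g : bo r f -> bo r g -> bo r (fun t => f t + g t)%C.
Proof.
  intros [C [C0 H]] [D [D0 H']]. exists (C + D). split; [lra|]. intros t Ht.
  eapply Rle_trans; [apply Cmod_triangle|]. specialize (H t Ht). specialize (H' t Ht). lra.
Qed.
Lemma bo_mult r r' f g : bo r f -> bo r' g -> bo (r + r') (fun t => f t * g t)%C.
Proof.
  intros [C [C0 H]] [D [D0 H']]. exists (C * D). split; [now apply Rmult_le_pos|]. intros t Ht.
  rewrite Cmod_mult, pow_add. replace (C * D * (Rabs t ^ r * Rabs t ^ r')) with ((C * Rabs t ^ r) * (D * Rabs t ^ r')) by ring.
  apply Rmult_le_compat; try apply Cmod_ge_0; [now apply H|now apply H'].
Qed.
Lemma bo_const w : bo 0 (fun _ => w).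
Proof. exists (Cmod w). split; [apply Cmod_ge_0|]. intros; simpl; lra. Qed.
Lemma bo_scal r w f : bo r f -> bo r (fun t => w * f t)%C.
Proof. intros H. exact (bo_mult 0 r _ _ (bo_const w) H). Qed.
Lemma bo_minus r f g : bo r f -> bo r g -> bo r (fun t => f t - g t)%C.
Proof.
  intros Hf Hg. apply bo_ext with (fun t => f t + (- RtoC 1) * g t)%C; [intros; ring|].
  apply bo_plus; [assumption|now apply bo_scal].
Qed.
Lemma rbo_pow a r : rbo r (fun t => a * t ^ r).
Proof.
  exists (Rabs a). split; [apply Rabs_pos|]. intros t _. rewrite Rabs_mult, <- RPow_abs. lra.
Qed.
Lemma rbo_zero r : rbo r (fun _ => 0).
Proof. exists 0. split; [lra|]. intros. rewrite Rabs_R0. lra. Qed.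

Lemma rbo_comp_lin r (f : R -> R) C x : 0 <= C -> (forall y, Rabs (f y) <= C * Rabs y ^ r) -> rbo r (fun t => f (x * t)).
Proof.
  intros HC H. exists (C * Rabs x ^ r). split; [apply Rmult_le_pos; [assumption|apply pow_le, Rabs_pos]|].
  intros t _. eapply Rle_trans; [apply H|]. rewrite Rabs_mult, Rpow_mult_distr. lra.
Qed.
Lemma rbo_cos1 x : rbo 2 (fun t => cos (x * t) - 1).
Proof. apply (rbo_comp_lin 2 (fun y => cos y - 1) (/ 2)); [lra|]. intros y. pose proof (cos_taylor1 y). lra. Qed.
Lemma rbo_cos3 x : rbo 4 (fun t => cos (x * t) - (1 - (x * t) ^ 2 / 2)).
Proof. apply (rbo_comp_lin 4 (fun y => cos y - (1 - y ^ 2 / 2)) (/ 24)); [lra|]. intros y. pose proof (cos_taylor3 y). lra. Qed.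
Lemma rbo_sin1 x : rbo 3 (fun t => sin (x * t) - x * t).
Proof. apply (rbo_comp_lin 3 (fun y => sin y - y) (/ 6)); [lra|]. intros y. pose proof (sin_taylor1 y). lra. Qed.
Lemma rbo_sin3 x : rbo 5 (fun t => sin (x * t) - (x * t - (x * t) ^ 3 / 6)).
Proof. apply (rbo_comp_lin 5 (fun y => sin y - (y - y ^ 3 / 6)) (/ 120)); [lra|]. intros y. pose proof (sin_taylor3 y). lra. Qed.

(** * Powers of a characteristic function *)

(** The sequences r_n - 2C/(n+1) and r_n + 2C/(n+1) are adjacent, because 1/(n+1)^2 <= 2/(n+1) -
    2/(n+2). The limit comes with its rate. *)
Lemma adjacent_limit (r : nat -> R) C : 0 <= C ->
  (forall n, Rabs (r (S n) - r n) <= C / (INR n + 1) ^ 2) ->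
  exists l, forall n, Rabs (r n - l) <= 2 * C / (INR n + 1).
Proof.
  intros HC H.
  assert (S2 : forall n, C / (INR n + 1) ^ 2 <= 2 * C / (INR n + 1) - 2 * C / (INR (S n) + 1)).
  { intros n. pose proof (pos_INR n). rewrite S_INR.
    replace (2 * C / (INR n + 1) - 2 * C / (INR n + 1 + 1)) with (C * (2 / ((INR n + 1) * (INR n + 2)))) by (field; lra).
    unfold Rdiv at 1. apply Rmult_le_compat_l; [assumption|].
    apply Rmult_le_reg_r with ((INR n + 1) ^ 2 * (INR n + 2)); [apply Rmult_lt_0_compat; [apply pow_lt|]; lra|].
    replace (/ (INR n + 1) ^ 2 * ((INR n + 1) ^ 2 * (INR n + 2))) with (INR n + 2) by (field; lra).
    replace (2 / ((INR n + 1) * (INR n + 2)) * ((INR n + 1) ^ 2 * (INR n + 2))) with (2 * (INR n + 1)) by (field; lra). lra. }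
  set (u := fun n => r n - 2 * C / (INR n + 1)). set (w := fun n => r n + 2 * C / (INR n + 1)).
  assert (Hu : forall n, u n <= u (S n)).
  { intros n. unfold u. specialize (H n). specialize (S2 n). apply Rabs_le_between in H. lra. }
  assert (Hw : forall n, w (S n) <= w n).
  { intros n. unfold w. specialize (H n). specialize (S2 n). apply Rabs_le_between in H. lra. }
  assert (Hp : forall n, 0 <= 2 * C / (INR n + 1)).
  { intros n. pose proof (pos_INR n). apply Rmult_le_pos; [lra|]. apply Rlt_le, Rinv_0_lt_compat; lra. }
  assert (Hum : forall n k, u n <= u (k + n)%nat).
  { intros n k. induction k as [|k IH]; [simpl; lra|]. eapply Rle_trans; [exact IH|apply Hu]. }
  assert (Hwm : forall n k, w (k + n)%nat <= w n).
  { intros n k. induction k as [|k IH]; [simpl; lra|]. eapply Rle_trans; [apply Hw|exact IH]. }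
  assert (Huw : forall n, u n <= w n) by (intros n; unfold u, w; specialize (Hp n); lra).
  destruct (ex_finite_lim_seq_incr u (w O) Hu) as [l Hl].
  { intros n. eapply Rle_trans; [apply Huw|]. rewrite <- (Nat.add_0_r n). apply Hwm. }
  exists l. intros n.
  assert (L1 : u n <= l).
  { refine (is_lim_seq_le (fun _ => u n) (fun k => u (k + n)%nat) (u n) l (Hum n) (is_lim_seq_const _) _).
    now apply -> (is_lim_seq_incr_n u n). }
  assert (L2 : l <= w n).
  { refine (is_lim_seq_le (fun k => u (k + n)%nat) (fun _ => w n) l (w n) _ _ (is_lim_seq_const _)).
    - intros k. eapply Rle_trans; [apply Huw|apply Hwm].
    - now apply -> (is_lim_seq_incr_n u n). }
  unfold u, w in *. apply Rabs_le. lra.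
Qed.

Lemma exp_pow y n : exp y ^ n = exp (INR n * y).
Proof.
  induction n as [|n IH]; [simpl; rewrite Rmult_0_l, exp_0; reflexivity|].
  rewrite S_INR. simpl. rewrite IH, <- exp_plus. f_equal; ring.
Qed.

Lemma is_derive_rsum (F F' : nat -> R -> R) N t : (forall j, is_derive (F j) t (F' j t)) ->
  is_derive (fun t => rsum (fun j => F j t) N) t (rsum (fun j => F' j t) N).
Proof.
  intros H. induction N as [|N IH].
  - exact (is_derive_const (V := R_NormedModule) 0 t).
  - apply (is_derive_plus (V := R_NormedModule) (fun t => rsum (fun j => F j t) N) (F N)); [exact IH|apply H].
Qed.

Lemma inv_rt_le n m k : (n <= m)%nat -> / rt m ^ k <= / rt n ^ k.
Proof. intros H. apply rinv_le; [apply rt_pow_pos|]. now apply rt_pow_le. Qed.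
Lemma inv_rt_le' i j n : (i <= j)%nat -> / rt n ^ j <= / rt n ^ i.
Proof. intros H. apply rinv_le; [apply rt_pow_pos|]. apply Rle_pow; [apply rt_ge1|assumption]. Qed.

Lemma Ci_Ci : (Ci * Ci)%C = (- RtoC 1)%C.
Proof. unfold Ci, Cmult, Copp, RtoC; simpl. f_equal; ring. Qed.

Lemma re_Ci_mult w : Re (Ci * w)%C = - Im w.
Proof. unfold Ci, Cmult, Re, Im; simpl. ring. Qed.
Lemma im_Ci_mult w : Im (Ci * w)%C = Re w.
Proof. unfold Ci, Cmult, Re, Im; simpl. ring. Qed.

Section CharacteristicFunction.
Context (N : nat) (v : nat -> R) (x : nat -> Z).

(** The k-th derivative of the characteristic function, divided by i^k; its value at 0 is
    [mom k]. *)
Definition phi (k : nat) (t : R) : Complex.C :=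
  (rsum (fun j => v j * IZR (x j) ^ k * cos (IZR (x j) * t)) N,
   rsum (fun j => v j * IZR (x j) ^ k * sin (IZR (x j) * t)) N).
Definition mom (k : nat) : R := rsum (fun j => v j * IZR (x j) ^ k) N.

Lemma phi_cder k : cder (phi k) (fun t => Ci * phi (S k) t)%C.
Proof.
  intros t. split; cbv beta.
  - replace (Re (Ci * phi (S k) t)%C) with (rsum (fun j => - (v j * IZR (x j) ^ k * IZR (x j) * sin (IZR (x j) * t))) N).
    + apply (is_derive_rsum (fun j t => v j * IZR (x j) ^ k * cos (IZR (x j) * t))
        (fun j t => - (v j * IZR (x j) ^ k * IZR (x j) * sin (IZR (x j) * t)))).
      intros j. auto_derive; [trivial|ring].
    + rewrite re_Ci_mult, rsum_opp. unfold phi, Im, snd. f_equal. apply rsum_ext; intros; simpl; ring.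
  - replace (Im (Ci * phi (S k) t)%C) with (rsum (fun j => v j * IZR (x j) ^ k * IZR (x j) * cos (IZR (x j) * t)) N).
    + apply (is_derive_rsum (fun j t => v j * IZR (x j) ^ k * sin (IZR (x j) * t))
        (fun j t => v j * IZR (x j) ^ k * IZR (x j) * cos (IZR (x j) * t))).
      intros j. auto_derive; [trivial|ring].
    + rewrite im_Ci_mult. unfold phi, Re, fst. apply rsum_ext; intros; simpl; ring.
Qed.
Lemma phi_ccont k : ccont (phi k).
Proof. exact (cder_ccont _ _ (phi_cder k)). Qed.
Lemma phi_periodic k : phi k PI = phi k (- PI).
Proof.
  unfold phi. f_equal; apply rsum_ext; intros j _; replace (IZR (x j) * - PI) with (- (IZR (x j) * PI)) by ring.
  - now rewrite cos_neg.
  - rewrite sin_neg, sin_IZR_PI. ring.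
Qed.

Lemma phi_taylor2 k : bo 2 (fun t => phi k t - (mom k, mom (S k) * t)%R)%C.
Proof.
  apply bo_pair.
  - apply rbo_ext with (fun t => rsum (fun j => v j * IZR (x j) ^ k * (cos (IZR (x j) * t) - 1)) N).
    + intros t. unfold phi, mom, Cminus, Cplus, Copp, Re; cbv [fst snd]. fold Rminus. rewrite <- rsum_opp, <- rsum_plus.
      apply rsum_ext; intros; ring.
    + apply rbo_rsum. intros j. apply rbo_scal, rbo_cos1.
  - apply rbo_ext with (fun t => rsum (fun j => v j * IZR (x j) ^ k * (sin (IZR (x j) * t) - IZR (x j) * t)) N).
    + intros t. unfold phi, mom, Cminus, Cplus, Copp, Im; cbv [fst snd].
      rewrite <- rsum_scal_r, <- rsum_opp, <- rsum_plus. apply rsum_ext; intros; simpl; ring.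
    + apply rbo_rsum. intros j. apply rbo_scal. apply rbo_weaken with 3%nat; [lia|apply rbo_sin1].
Qed.
Lemma phi_taylor3 k : bo 3 (fun t => phi k t - (mom k - mom (S (S k)) * t ^ 2 / 2, mom (S k) * t)%R)%C.
Proof.
  apply bo_pair.
  - apply rbo_ext with (fun t => rsum (fun j => v j * IZR (x j) ^ k * (cos (IZR (x j) * t) - (1 - (IZR (x j) * t) ^ 2 / 2))) N).
    + intros t. unfold phi, mom, Cminus, Cplus, Copp, Re; cbv [fst snd]. unfold Rdiv. rewrite Rmult_assoc.
      rewrite <- rsum_scal_r, <- rsum_minus, <- rsum_opp, <- rsum_plus. apply rsum_ext; intros; simpl; field.
    + apply rbo_rsum. intros j. apply rbo_scal. apply rbo_weaken with 4%nat; [lia|apply rbo_cos3].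
  - apply rbo_ext with (fun t => rsum (fun j => v j * IZR (x j) ^ k * (sin (IZR (x j) * t) - IZR (x j) * t)) N).
    + intros t. unfold phi, mom, Cminus, Cplus, Copp, Im; cbv [fst snd].
      rewrite <- rsum_scal_r, <- rsum_opp, <- rsum_plus. apply rsum_ext; intros; simpl; ring.
    + apply rbo_rsum. intros j. apply rbo_scal, rbo_sin1.
Qed.
Lemma phi_taylor4 k : bo 4 (fun t => phi k t - (mom k - mom (S (S k)) * t ^ 2 / 2, mom (S k) * t - mom (S (S (S k))) * t ^ 3 / 6)%R)%C.
Proof.
  apply bo_pair.
  - apply rbo_ext with (fun t => rsum (fun j => v j * IZR (x j) ^ k * (cos (IZR (x j) * t) - (1 - (IZR (x j) * t) ^ 2 / 2))) N).
    + intros t. unfold phi, mom, Cminus, Cplus, Copp, Re; cbv [fst snd]. unfold Rdiv. rewrite Rmult_assoc.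
      rewrite <- rsum_scal_r, <- rsum_minus, <- rsum_opp, <- rsum_plus. apply rsum_ext; intros; simpl; field.
    + apply rbo_rsum. intros j. apply rbo_scal, rbo_cos3.
  - apply rbo_ext with (fun t => rsum (fun j => v j * IZR (x j) ^ k * (sin (IZR (x j) * t) - (IZR (x j) * t - (IZR (x j) * t) ^ 3 / 6))) N).
    + intros t. unfold phi, mom, Cminus, Cplus, Copp, Im; cbv [fst snd]. unfold Rdiv. rewrite (Rmult_assoc _ (t ^ 3)).
      rewrite <- !rsum_scal_r, <- rsum_minus, <- rsum_opp, <- rsum_plus. apply rsum_ext; intros; simpl; field.
    + apply rbo_rsum. intros j. apply rbo_scal. apply rbo_weaken with 5%nat; [lia|apply rbo_sin3].
Qed.

Definition Icoef (n : nat) (g : R -> Complex.C) : R := Itg (fun t => phi 0 t ^ n * g t)%C.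

Let one : R -> Complex.C := fun _ => RtoC 1.

Ltac ccont_tac := repeat match goal with
  | |- ccont (fun t => (@?f t - @?g t)%C) => apply (ccont_minus f g)
  | |- ccont (fun t => (@?f t + @?g t)%C) => apply (ccont_plus f g)
  | |- ccont (fun t => (@?f t * @?g t)%C) => apply (ccont_mult f g)
  | |- ccont (phi _) => apply phi_ccont
  | |- ccont (fun t => phi ?k t) => apply (phi_ccont k)
  | |- ccont one => exact (ccont_const (RtoC 1))
  | |- ccont (fun t => one t) => exact (ccont_const (RtoC 1))
  | |- ccont (fun _ => ?w) => apply (ccont_const w)
  | |- _ => assumption
  end.

Lemma Icoef_ccont n g : ccont g -> ccont (fun t => phi 0 t ^ n * g t)%C.
Proof. intros; apply (ccont_mult (fun t => phi 0 t ^ n)%C); [apply ccont_pow, phi_ccont|assumption]. Qed.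
Lemma Icoef_plus n f g : ccont f -> ccont g -> Icoef n (fun t => f t + g t)%C = Icoef n f + Icoef n g.
Proof.
  intros. unfold Icoef. rewrite <- Itg_plus by now apply Icoef_ccont. apply Itg_ext; intros; ring.
Qed.
Lemma Icoef_minus n f g : ccont f -> ccont g -> Icoef n (fun t => f t - g t)%C = Icoef n f - Icoef n g.
Proof.
  intros. unfold Icoef. rewrite <- Itg_minus by now apply Icoef_ccont. apply Itg_ext; intros; ring.
Qed.
Lemma Icoef_scal n a f : ccont f -> Icoef n (fun t => RtoC a * f t)%C = a * Icoef n f.
Proof.
  intros. unfold Icoef. rewrite <- Itg_scal by now apply Icoef_ccont. apply Itg_ext; intros; ring.
Qed.
Lemma Icoef_ext n f g : (forall t, f t = g t) -> Icoef n f = Icoef n g.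
Proof. intros H. apply Itg_ext. intros; now rewrite H. Qed.
Lemma Icoef_phi0 n g : Icoef n (fun t => phi 0 t * g t)%C = Icoef (S n) g.
Proof. apply Itg_ext. intros t. rewrite Cpow_S. ring. Qed.

(* Integration by parts; [phi 1] vanishes at the saddle point [t = 0], so this gains a factor [1/n]. *)
Lemma Icoef_ibp n h h' : cder h (fun t => Ci * h' t)%C -> ccont h' -> h PI = h (- PI) ->
  INR (S n) * Icoef n (fun t => phi 1 t * h t)%C = - Icoef (S n) h'.
Proof.
  intros Hd Hc Hp.
  assert (Hh : ccont h) by exact (cder_ccont _ _ Hd).
  pose (F' := fun t => (RtoC (INR (S n)) * (phi 0 t ^ n * (phi 1 t * h t)) + phi 0 t ^ S n * h' t)%C).
  assert (E : Itg F' = 0).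
  { apply Itg_derive with (fun t => (- Ci) * (phi 0 t ^ S n * h t))%C.
    - eapply cder_ext; [|exact (cder_mult _ _ _ _ (cder_const (- Ci)%C) (cder_mult _ _ _ _ (cder_pow _ _ n (phi_cder 0)) Hd))].
      intros t. unfold F'. cbv beta.
      transitivity ((- (Ci * Ci)) * (RtoC (INR (S n)) * (phi 0 t ^ n * (phi 1 t * h t)) + phi 0 t ^ S n * h' t))%C; [ring|].
      rewrite Ci_Ci. ring.
    - apply ccont_plus; [apply ccont_scal, Icoef_ccont|].
      + now apply ccont_mult; [apply phi_ccont|].
      + apply (ccont_mult (fun t => phi 0 t ^ S n)%C); [apply ccont_pow, phi_ccont|assumption].
    - now rewrite phi_periodic, Hp. }
  unfold F' in E. rewrite Itg_plus, Itg_scal in E.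
  - unfold Icoef. lra.
  - apply Icoef_ccont. apply ccont_mult; [apply phi_ccont|assumption].
  - apply ccont_scal, Icoef_ccont. apply ccont_mult; [apply phi_ccont|assumption].
  - apply (ccont_mult (fun t => phi 0 t ^ S n)%C); [apply ccont_pow, phi_ccont|assumption].
Qed.

Context (kap : R).
Hypothesis (hm0 : mom 0 = 1) (hm1 : mom 1 = 0) (hs : 0 < mom 2) (hkap : 0 < kap).
Hypothesis hphi : forall t, - PI <= t <= PI -> Cmod (phi 0 t) <= exp (- (kap * t ^ 2)).

Lemma Icoef_bound k : (k <= 4)%nat -> exists K, 0 <= K /\ forall g C n, ccont g -> 0 <= C ->
  (forall t, - PI <= t <= PI -> Cmod (g t) <= C * Rabs t ^ k) -> Rabs (Icoef n g) <= C * K / rt n ^ S k.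
Proof.
  intros Hk. destruct (Itg_gauss k kap Hk hkap) as [K [K0 HK]]. exists K. split; [assumption|].
  intros g C n Hg HC H. apply HK; [now apply Icoef_ccont|assumption|].
  intros t Ht. rewrite Cmod_mult, Cmod_pow, Rmult_comm.
  apply Rmult_le_compat; [apply Cmod_ge_0|apply pow_le, Cmod_ge_0|now apply H|].
  replace (- (kap * INR n * t ^ 2)) with (INR n * - (kap * t ^ 2)) by ring. rewrite <- exp_pow.
  apply pow_incr. split; [apply Cmod_ge_0|now apply hphi].
Qed.
Lemma Icoef_bo k g : (k <= 4)%nat -> bo k g -> ccont g ->
  exists M, 0 <= M /\ forall n, Rabs (Icoef n g) <= M / rt n ^ S k.
Proof.
  intros Hk [C [C0 HC]] Hg. destruct (Icoef_bound k Hk) as [K [K0 HK]]. exists (C * K).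
  split; [now apply Rmult_le_pos|]. intros n. now apply HK.
Qed.

(** Integration by parts with h = 1: the integrand is a total derivative. Multiples of [phi 1] can
    therefore be added at no cost to cancel a linear term in t. *)
Lemma Icoef_phi1 n : Icoef n (phi 1) = 0.
Proof.
  assert (E : INR (S n) * Icoef n (fun t => phi 1 t * RtoC 1)%C = - Icoef (S n) (fun _ => RtoC 0)).
  { apply Icoef_ibp; [|apply ccont_const|reflexivity].
    eapply cder_ext; [|apply cder_const]. intros; simpl. ring. }
  rewrite (Icoef_ext n _ (phi 1)) in E by (intros; ring).
  rewrite (Icoef_ext (S n) _ (fun _ => RtoC 0 * RtoC 0)%C) in E by (intros; ring).
  rewrite Icoef_scal in E by apply ccont_const. 
  apply Rmult_eq_reg_l with (INR (S n)); [lra|]. apply not_0_INR; lia.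
Qed.

Let A (n : nat) := Icoef n one.

(** The linear term of [phi 2] at 0 is removed by a multiple of [phi 1], whose integral vanishes;
    the remainder is of order t^2. *)
Lemma Icoef_phi2 : exists M, 0 <= M /\ forall n, Rabs (Icoef n (phi 2) - mom 2 * A n) <= M / rt n ^ 3.
Proof.
  pose (g := fun t => (phi 2 t - RtoC (mom 2) * one t - RtoC (mom 3 / mom 2) * phi 1 t)%C).
  assert (cg : ccont g) by (unfold g; ccont_tac).
  destruct (Icoef_bo 2 g ltac:(lia)) as [M [M0 HM]]; [|assumption|].
  - apply bo_ext with (fun t => (phi 2 t - (mom 2, mom 3 * t)%R) - RtoC (mom 3 / mom 2) * (phi 1 t - (mom 1, mom 2 * t)%R))%C.
    + intros t. rewrite hm1. unfold g, one.
      replace (mom 2, mom 3 * t)%R with (RtoC (mom 2) + RtoC (mom 3 / mom 2) * (0, mom 2 * t)%R)%C.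
      * ring.
      * unfold RtoC, Cmult, Cplus; simpl. f_equal; field; lra.
    + apply bo_minus; [|apply bo_scal]; apply phi_taylor2.
  - exists M. split; [assumption|]. intros n. specialize (HM n).
    unfold g in HM. rewrite !Icoef_minus, !Icoef_scal, Icoef_phi1 in HM
      by ccont_tac.
    fold (A n) in HM. rewrite Rmult_0_r, Rminus_0_r in HM. exact HM.
Qed.

Lemma bo_phi0_sub_one : bo 2 (fun t => phi 0 t - one t)%C.
Proof.
  apply bo_ext with (fun t => phi 0 t - (mom 0, mom 1 * t)%R)%C; [|apply phi_taylor2].
  intros t. rewrite hm0, hm1. unfold one, RtoC. now rewrite Rmult_0_l.
Qed.

(** Powers of [phi 1] replace powers of t, since they can be integrated by parts. The square
    contributes - i mom3 t^3 / 2 where - i mom3 t^3 / 6 is wanted; the coefficient of the cube is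
    chosen to correct this. *)
Lemma bo_cubic : bo 4 (fun t => phi 0 t - one t - RtoC (/ (2 * mom 2)) * (phi 1 t * phi 1 t)
   - RtoC (- mom 3 / (3 * mom 2 ^ 3)) * (phi 1 t * (phi 1 t * phi 1 t)))%C.
Proof.
  pose (P1 := fun t : R => (- mom 3 * t ^ 2 / 2, mom 2 * t) : Complex.C).
  pose (L1 := fun t : R => (0, mom 2 * t) : Complex.C).
  assert (B1 : bo 3 (fun t => phi 1 t - P1 t)%C).
  { apply bo_ext with (fun t => phi 1 t - (mom 1 - mom 3 * t ^ 2 / 2, mom 2 * t)%R)%C; [|apply phi_taylor3].
    intros t. unfold P1. rewrite hm1. f_equal. f_equal. field. }
  assert (BL : bo 2 (fun t => phi 1 t - L1 t)%C).
  { apply bo_ext with (fun t => phi 1 t - (mom 1, mom 2 * t)%R)%C; [|apply phi_taylor2].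
    intros t. unfold L1. now rewrite hm1. }
  assert (oL : bo 1 L1).
  { apply bo_pair; unfold L1; simpl; [apply rbo_zero|]. apply rbo_ext with (fun t => mom 2 * t ^ 1); [intros; ring|apply rbo_pow]. }
  assert (weak : forall r r' f, (r' <= r)%nat -> bo r f -> bo r' f).
  { intros r r' f Hr [C [C0 H]]. destruct (rbo_weaken r r' (fun t => C * Rabs t ^ r) Hr) as [D [D0 HD]].
    - exists C. split; [assumption|]. intros t _. rewrite Rabs_pos_eq; [lra|]. apply Rmult_le_pos; [assumption|apply pow_le, Rabs_pos].
    - exists D. split; [assumption|]. intros t Ht. eapply Rle_trans; [now apply H|]. eapply Rle_trans; [apply Rle_abs|now apply HD]. }
  assert (oP : bo 1 P1).
  { apply bo_pair; unfold P1; simpl.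
    - apply rbo_weaken with 2%nat; [lia|]. apply rbo_ext with (fun t => - mom 3 / 2 * t ^ 2); [intros; field|apply rbo_pow].
    - apply rbo_ext with (fun t => mom 2 * t ^ 1); [intros; ring|apply rbo_pow]. }
  assert (o1 : bo 1 (phi 1)).
  { apply bo_ext with (fun t => (phi 1 t - L1 t) + L1 t)%C; [intros; ring|]. apply bo_plus; [now apply weak with 2%nat; [lia|]|assumption]. }
  apply bo_ext with (fun t =>
     (phi 0 t - (mom 0 - mom 2 * t ^ 2 / 2, mom 1 * t - mom 3 * t ^ 3 / 6)%R)
     - RtoC (/ (2 * mom 2)) * ((phi 1 t - P1 t) * (phi 1 t + P1 t))
     - RtoC (- mom 3 / (3 * mom 2 ^ 3)) * ((phi 1 t - L1 t) * (phi 1 t * phi 1 t + phi 1 t * L1 t + L1 t * L1 t))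
     - RtoC (mom 3 ^ 2 / (8 * mom 2) * t ^ 4))%C.
  - intros t. rewrite hm0, hm1. 
    (* The term in t^4 is the square of the real part - mom3 t^2 / 2 of [P1], divided by 2 mom2;
       with it the identity between polynomials is exact. *)
    assert (E : ((1 - mom 2 * t ^ 2 / 2, 0 * t - mom 3 * t ^ 3 / 6)%R : Complex.C)
      = (one t + RtoC (/ (2 * mom 2)) * (P1 t * P1 t) + RtoC (- mom 3 / (3 * mom 2 ^ 3)) * (L1 t * (L1 t * L1 t)) - RtoC (mom 3 ^ 2 / (8 * mom 2) * t ^ 4))%C).
    { unfold one, P1, L1. apply injective_projections; simpl; field; lra. }
    rewrite E. ring.
  - apply bo_minus; [apply bo_minus; [apply bo_minus|]|].
    + apply phi_taylor4.
    + apply bo_scal. apply (bo_mult 3 1); [assumption|now apply bo_plus].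
    + apply bo_scal. apply (bo_mult 2 2); [assumption|].
      apply bo_plus; [apply bo_plus|]; now apply (bo_mult 1 1).
    + apply bo_pair; simpl; [|apply rbo_zero]. exact (rbo_pow (mom 3 * (mom 3 * 1) / (8 * mom 2)) 4).
Qed.

Lemma A_diff : exists M, 0 <= M /\ forall n, Rabs (A (S n) - A n) <= M / rt n ^ 3.
Proof.
  assert (c : ccont (fun t => phi 0 t - one t)%C) by (apply ccont_minus; [apply phi_ccont|apply ccont_const]).
  destruct (Icoef_bo 2 _ ltac:(lia) bo_phi0_sub_one c) as [M [M0 HM]].
  exists M. split; [assumption|]. intros n. specialize (HM n).
  rewrite Icoef_minus in HM by ccont_tac.
  replace (A (S n)) with (Icoef n (phi 0)); [exact HM|].
  unfold A. rewrite <- Icoef_phi0. apply Icoef_ext. intros; unfold one; ring.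
Qed.

(** Integrated by parts, the cubic expansion becomes A(n+1) - A(n) = - A(n) / (2n+2) + O(n^(-5/2)),
    which is the recursion of [tq] up to the error. *)
Lemma A_recursion : exists M, 0 <= M /\ forall n,
  Rabs (A (S n) - A n * ((2 * INR n + 1) / (2 * INR n + 2))) <= M / rt n ^ 5.
Proof.
  destruct Icoef_phi2 as [M2 [M20 H2]]. destruct A_diff as [M1 [M10 H1]].
  destruct (Icoef_bo 0 (phi 3) ltac:(lia)) as [M3 [M30 H3]]; [|apply phi_ccont|].
  { apply bo_pair; apply rbo_rsum; intros j; apply rbo_scal; exists 1; (split; [lra|]); intros t _; simpl; rewrite Rmult_1_r;
      [pose proof (COS_bound (IZR (x j) * t))|pose proof (SIN_bound (IZR (x j) * t))]; apply Rabs_le; lra. }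
  set (k3 := - mom 3 / (3 * mom 2 ^ 3)). set (k2 := / (2 * mom 2)).
  assert (c11 : ccont (fun t => phi 1 t * phi 1 t)%C) by (apply ccont_mult; apply phi_ccont).
  assert (c111 : ccont (fun t => phi 1 t * (phi 1 t * phi 1 t))%C) by (apply ccont_mult; [apply phi_ccont|assumption]).
  assert (c12 : ccont (fun t => phi 1 t * phi 2 t)%C) by (apply ccont_mult; apply phi_ccont).
  assert (c1 : ccont one) by apply ccont_const.
  pose (g3 := fun t => (phi 0 t - one t - RtoC k2 * (phi 1 t * phi 1 t) - RtoC k3 * (phi 1 t * (phi 1 t * phi 1 t)))%C).
  assert (cg : ccont g3) by (unfold g3; ccont_tac).
  destruct (Icoef_bo 4 g3 ltac:(lia) bo_cubic cg) as [M4 [M40 H4]].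
  exists (M4 + M1 + k2 * M2 + 2 * Rabs k3 * M3).
  assert (k20 : 0 < k2) by (apply Rinv_0_lt_compat; lra). pose proof (Rabs_pos k3) as k30.
  split; [nra|]. intros n. pose proof (pos_INR n) as Hn.
  assert (E4 : Icoef n g3 = A (S n) - A n - k2 * Icoef n (fun t => phi 1 t * phi 1 t)%C
     - k3 * Icoef n (fun t => phi 1 t * (phi 1 t * phi 1 t))%C).
  { unfold g3. rewrite !Icoef_minus, !Icoef_scal by ccont_tac.
    fold (A n). replace (A (S n)) with (Icoef n (phi 0)); [reflexivity|].
    unfold A. rewrite <- Icoef_phi0. apply Icoef_ext. intros; unfold one; ring. }
  assert (E11 : INR (S n) * Icoef n (fun t => phi 1 t * phi 1 t)%C = - Icoef (S n) (phi 2)).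
  { apply Icoef_ibp; [apply phi_cder|apply phi_ccont|apply phi_periodic]. }
  assert (E111 : INR (S n) * Icoef n (fun t => phi 1 t * (phi 1 t * phi 1 t))%C = - (2 * Icoef (S n) (fun t => phi 1 t * phi 2 t)%C)).
  { rewrite <- (Icoef_scal _ 2) by assumption. apply Icoef_ibp.
    - eapply cder_ext; [|exact (cder_mult _ _ _ _ (phi_cder 1) (phi_cder 1))]. intros t. cbv beta.
      replace (RtoC 2) with (RtoC 1 + RtoC 1)%C by (rewrite <- RtoC_plus; f_equal; ring). ring.
    - now apply ccont_scal.
    - cbv beta. now rewrite phi_periodic. }
  assert (E12 : INR (S (S n)) * Icoef (S n) (fun t => phi 1 t * phi 2 t)%C = - Icoef (S (S n)) (phi 3)).
  { apply Icoef_ibp; [apply phi_cder|apply phi_ccont|apply phi_periodic]. }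
  specialize (H4 n). specialize (H1 n). specialize (H2 (S n)). specialize (H3 (S (S n))).
  rewrite !S_INR in *. set (y := INR n + 1) in *. assert (Hy : 0 < y) by (unfold y; lra).
  set (i11 := Icoef n (fun t => phi 1 t * phi 1 t)%C) in *.
  set (i111 := Icoef n (fun t => phi 1 t * (phi 1 t * phi 1 t))%C) in *.
  set (i12 := Icoef (S n) (fun t => phi 1 t * phi 2 t)%C) in *.
  set (i2 := Icoef (S n) (phi 2)) in *. set (i3 := Icoef (S (S n)) (phi 3)) in *.
  assert (F11 : i11 = - i2 / y) by (apply Rmult_eq_reg_l with y; [rewrite E11; field|]; lra).
  assert (F12 : i12 = - i3 / (y + 1)) by (apply Rmult_eq_reg_l with (y + 1); [rewrite E12; field|]; lra).
  assert (F111 : i111 = 2 * i3 / (y * (y + 1))) by (apply Rmult_eq_reg_l with y; [rewrite E111, F12; field|]; lra).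
  (* Four errors: the remainder of order t^4, the replacement of A(n+1) by A(n), that of the
     integral of [phi 2] by mom2 A(n+1), and the cubic term, which is integrated by parts twice. *)
  assert (EE : A (S n) - A n * ((2 * INR n + 1) / (2 * INR n + 2))
    = Icoef n g3 - / (2 * y) * (A (S n) - A n) - k2 / y * (i2 - mom 2 * A (S n)) + 2 * k3 / (y * (y + 1)) * i3).
  { rewrite E4, F11, F111. unfold k2. replace (2 * INR n + 1) with (2 * y - 1) by (unfold y; ring).
    replace (2 * INR n + 2) with (2 * y) by (unfold y; ring). field. lra. }
  rewrite EE. pose proof (rt_sq n) as Hr. fold y in Hr. pose proof (rt_pos n) as Hr0. pose proof (rt_ge1 n) as Hr1.
  assert (B5 : forall k, (k <= 5)%nat -> 0 < / rt n ^ 5 <= / rt n ^ k).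
  { intros k Hk. split; [apply Rinv_0_lt_compat, rt_pow_pos|now apply inv_rt_le']. }
  assert (T2 : Rabs (/ (2 * y) * (A (S n) - A n)) <= M1 / rt n ^ 5).
  { rewrite Rabs_mult, (Rabs_pos_eq (/ (2 * y))) by (apply Rlt_le, Rinv_0_lt_compat; lra).
    apply Rle_trans with (/ y * (M1 / rt n ^ 3)).
    - apply Rmult_le_compat; [apply Rlt_le, Rinv_0_lt_compat; lra|apply Rabs_pos|apply rinv_le; lra|exact H1].
    - apply Req_le. rewrite <- Hr. field. lra. }
  assert (T3 : Rabs (k2 / y * (i2 - mom 2 * A (S n))) <= k2 * M2 / rt n ^ 5).
  { rewrite Rabs_mult, (Rabs_pos_eq (k2 / y)) by (apply Rlt_le, Rdiv_lt_0_compat; lra).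
    apply Rle_trans with (k2 / y * (M2 / rt n ^ 3)).
    - apply Rmult_le_compat_l; [apply Rlt_le, Rdiv_lt_0_compat; lra|]. eapply Rle_trans; [exact H2|].
      apply Rmult_le_compat_l; [assumption|apply inv_rt_le; lia].
    - apply Req_le. rewrite <- Hr. field. lra. }
  assert (T4 : Rabs (2 * k3 / (y * (y + 1)) * i3) <= 2 * Rabs k3 * M3 / rt n ^ 5).
  { assert (Hyy : 0 < y * (y + 1)) by nra.
    unfold Rdiv. rewrite !Rabs_mult, (Rabs_pos_eq 2), (Rabs_pos_eq (/ (y * (y + 1)))) by (try apply Rlt_le, Rinv_0_lt_compat; lra).
    apply Rle_trans with (2 * Rabs k3 * / (y * y) * (M3 / rt n ^ 1)).
    - apply Rmult_le_compat.
      + apply Rmult_le_pos; [lra|]. apply Rlt_le, Rinv_0_lt_compat; lra.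
      + apply Rabs_pos.
      + apply Rmult_le_compat_l; [lra|]. apply rinv_le; nra.
      + eapply Rle_trans; [exact H3|]. apply Rmult_le_compat_l; [assumption|apply inv_rt_le; lia].
    - apply Req_le. rewrite <- Hr. field. lra. }
  unfold Rdiv. rewrite !Rmult_plus_distr_r.
  eapply Rle_trans; [apply Rabs_triang|]. apply Rplus_le_compat; [|exact T4].
  unfold Rminus. eapply Rle_trans; [apply Rabs_triang|]. rewrite Rabs_Ropp. apply Rplus_le_compat; [|exact T3].
  eapply Rle_trans; [apply Rabs_triang|]. rewrite Rabs_Ropp. apply Rplus_le_compat; [exact H4|exact T2].
Qed.

(** The increments of A(n) / tq(n) are O(n^(-5/2) sqrt n) = O(n^(-2)), so the ratio converges at
    rate 1/n. The limit b stays undetermined here. *)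
Lemma A_asym : exists b C, 0 <= C /\ forall n, Rabs (A n - b * tq n) <= C / rt n ^ 3.
Proof.
  destruct A_recursion as [M [M0 HM]].
  destruct (adjacent_limit (fun n => A n / tq n) (8 * M)) as [b Hb]; [lra| |].
  - intros n. pose proof (tq_pos n) as Ht. pose proof (tq_pos (S n)) as Ht'. pose proof (pos_INR n).
    replace (A (S n) / tq (S n) - A n / tq n) with ((A (S n) - A n * ((2 * INR n + 1) / (2 * INR n + 2))) * / tq (S n))
      by (simpl tq; field; repeat split; lra).
    rewrite Rabs_mult, (Rabs_pos_eq (/ tq (S n))) by (apply Rlt_le, Rinv_0_lt_compat; lra).
    apply Rle_trans with (M / rt n ^ 5 * (4 * rt n)).
    + apply Rmult_le_compat; [apply Rabs_pos|apply Rlt_le, Rinv_0_lt_compat; lra|apply HM|].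
      pose proof (tq_ge (S n)) as Hg. pose proof (rt_half n (S n) ltac:(lia)) as Hh. pose proof (rt_pos n). pose proof (rt_pos (S n)).
      rewrite <- (Rinv_inv (4 * rt n)). apply rinv_le; [apply Rinv_0_lt_compat; lra|].
      eapply Rle_trans; [|exact Hg]. apply rinv_le; lra.
    + rewrite <- rt_sq. pose proof (rt_pos n).
      replace (8 * M / (rt n * rt n) ^ 2) with (2 * (M / rt n ^ 5 * (4 * rt n))) by (field; lra).
      assert (0 <= M / rt n ^ 5 * (4 * rt n)).
      { apply Rmult_le_pos; [|lra]. apply Rmult_le_pos; [assumption|apply Rlt_le, Rinv_0_lt_compat, rt_pow_pos]. }
      lra.
  - exists b, (2 * (8 * M)). split; [lra|]. intros n. specialize (Hb n). pose proof (tq_pos n). pose proof (rt_pos n).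
    replace (A n - b * tq n) with ((A n / tq n - b) * tq n) by (field; lra).
    rewrite Rabs_mult, (Rabs_pos_eq (tq n)) by lra.
    apply Rle_trans with (2 * (8 * M) / (INR n + 1) * (1 / rt n)).
    + apply Rmult_le_compat; [apply Rabs_pos|lra|exact Hb|apply tq_le].
    + apply Req_le. rewrite <- rt_sq. field. lra.
Qed.

Definition gcis (j : Z) (t : R) : Complex.C := cis (- (IZR j * t)).
Lemma gcis_ccont j : ccont (gcis j).
Proof.
  intros t. unfold gcis, cis, Re, Im; simpl. split.
  - apply (ex_derive_continuous (fun t => cos (- (IZR j * t)))). auto_derive; trivial.
  - apply (ex_derive_continuous (fun t => sin (- (IZR j * t)))). auto_derive; trivial.
Qed.

(** The linear term - i j t of the exponential is cancelled by (j / mom2) [phi 1]. The error must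
    grow only polynomially in j, as it will be summed over altitudes against tau^(-j). *)
Lemma Icoef_gcis : exists M, 0 <= M /\ forall n j, Rabs (Icoef n (gcis j) - A n) <= M * (1 + IZR j ^ 2) / rt n ^ 3.
Proof.
  destruct (Icoef_bound 2 ltac:(lia)) as [K [K0 HK]].
  destruct (phi_taylor2 1) as [C2 [C20 H2]].
  exists ((2 + C2 / mom 2) * K).
  assert (Hc : 0 <= C2 / mom 2) by (apply Rmult_le_pos; [assumption|apply Rlt_le, Rinv_0_lt_compat, hs]).
  split; [apply Rmult_le_pos; lra|]. intros n j.
  pose (g := fun t => (gcis j t - one t + RtoC (IZR j / mom 2) * phi 1 t)%C).
  assert (cg : ccont g).
  { apply ccont_plus; [apply ccont_minus; [apply gcis_ccont|apply ccont_const]|apply ccont_scal, phi_ccont]. }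
  assert (E : Icoef n g = Icoef n (gcis j) - A n).
  { unfold g. rewrite Icoef_plus, Icoef_minus, Icoef_scal, Icoef_phi1.
    - fold (A n). ring.
    - apply phi_ccont.
    - apply gcis_ccont.
    - apply ccont_const.
    - apply ccont_minus; [apply gcis_ccont|apply ccont_const].
    - apply ccont_scal, phi_ccont. }
  rewrite <- E. replace ((2 + C2 / mom 2) * K * (1 + IZR j ^ 2)) with ((2 + C2 / mom 2) * (1 + IZR j ^ 2) * K) by ring.
  set (z := IZR j) in *. assert (Hz2 : 0 <= z ^ 2) by apply pow2_ge_0.
  apply HK; [assumption|apply Rmult_le_pos; lra|]. intros t Ht.
  replace (g t) with ((gcis j t - one t + RtoC z * (0, t)%R) + RtoC (z / mom 2) * (phi 1 t - (mom 1, mom 2 * t)%R))%C.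
  2:{ unfold g. fold z. rewrite hm1.
      assert (Ez : (RtoC (z / mom 2) * ((0, mom 2 * t)%R : Complex.C))%C = (RtoC z * ((0, t)%R : Complex.C))%C).
      { unfold RtoC, Cmult; simpl. f_equal; field; lra. }
      transitivity (gcis j t - one t + RtoC z * (0, t)%R + RtoC (z / mom 2) * phi 1 t - RtoC (z / mom 2) * (0, mom 2 * t)%R)%C; [ring|].
      rewrite Ez. ring. }
  eapply Rle_trans; [apply Cmod_triangle|].
  assert (T1 : Cmod (gcis j t - one t + RtoC z * (0, t)%R)%C <= 2 * z ^ 2 * Rabs t ^ 2).
  { eapply Rle_trans; [apply Cmod_le_sum|].
    replace (Re (gcis j t - one t + RtoC z * (0, t)%R)%C) with (cos (z * t) - 1)
      by (unfold gcis, one, cis, RtoC, Cmult, Cplus, Cminus, Copp, Re; simpl; rewrite cos_neg; fold z; ring).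
    replace (Im (gcis j t - one t + RtoC z * (0, t)%R)%C) with (- (sin (z * t) - z * t))
      by (unfold gcis, one, cis, RtoC, Cmult, Cplus, Cminus, Copp, Im; simpl; rewrite sin_neg; fold z; ring).
    rewrite Rabs_Ropp. pose proof (cos_taylor1 (z * t)) as c1. pose proof (sin_taylor1' (z * t)) as s1.
    rewrite Rabs_mult, Rpow_mult_distr, (pow2_abs z) in c1, s1.
    pose proof (pow_le (Rabs t) 2 (Rabs_pos t)). nra. }
  assert (T2 : Cmod (RtoC (z / mom 2) * (phi 1 t - (mom 1, mom 2 * t)%R))%C <= C2 / mom 2 * (1 + z ^ 2) * Rabs t ^ 2).
  { rewrite Cmod_mult, Cmod_R. unfold Rdiv. rewrite Rabs_mult, (Rabs_pos_eq (/ mom 2)) by (apply Rlt_le, Rinv_0_lt_compat, hs).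
    assert (Hz : Rabs z <= 1 + z ^ 2) by (rewrite <- pow2_abs; pose proof (pow2_ge_0 (Rabs z - 1)); pose proof (Rabs_pos z); nra).
    specialize (H2 t Ht).
    apply Rle_trans with ((1 + z ^ 2) * / mom 2 * (C2 * Rabs t ^ 2)); [|apply Req_le; ring].
    apply Rmult_le_compat; [|apply Cmod_ge_0| |exact H2].
    - apply Rmult_le_pos; [apply Rabs_pos|apply Rlt_le, Rinv_0_lt_compat, hs].
    - apply Rmult_le_compat_r; [apply Rlt_le, Rinv_0_lt_compat, hs|assumption]. }
  pose proof (pow_le (Rabs t) 2 (Rabs_pos t)). nra.
Qed.

End CharacteristicFunction.

(** * Local limit theorem *)

Lemma exp_taylor y : 0 <= y -> Rabs (exp (- y) - (1 - y)) <= y ^ 2 / 2.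
Proof.
  intros Hy. pose proof (exp_ineq1_le (- y)).
  assert (0 <= 1 - y + y ^ 2 / 2 - exp (- y)).
  { revert y Hy H. intros y Hy _. revert y Hy. apply (nonneg_of_derive _ (fun y => exp (- y) - (1 - y))).
    - rewrite Ropp_0, exp_0. field.
    - intros y. auto_derive; [trivial|field].
    - intros y _. pose proof (exp_ineq1_le (- y)). lra. }
  apply Rabs_le; lra.
Qed.

Lemma Cpow_sub_le (a b : Complex.C) M n : Cmod a <= M -> Cmod b <= M ->
  Cmod (a ^ S n - b ^ S n)%C <= INR (S n) * Cmod (a - b)%C * M ^ n.
Proof.
  intros Ha Hb. assert (M0 : 0 <= M) by (eapply Rle_trans; [apply Cmod_ge_0|exact Ha]).
  induction n as [|n IH].
  - simpl. replace (a * 1 - b * 1)%C with (a - b)%C by ring. lra.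
  - rewrite (S_INR (S n)). replace (a ^ S (S n) - b ^ S (S n))%C with (a * (a ^ S n - b ^ S n) + (a - b) * b ^ S n)%C by (rewrite !Cpow_S; ring).
    eapply Rle_trans; [apply Cmod_triangle|]. rewrite !Cmod_mult.
    assert (H1 : Cmod a * Cmod (a ^ S n - b ^ S n)%C <= M * (INR (S n) * Cmod (a - b)%C * M ^ n))
      by (apply Rmult_le_compat; try apply Cmod_ge_0; assumption).
    assert (H2 : Cmod (a - b)%C * Cmod (b ^ S n)%C <= Cmod (a - b)%C * M ^ S n).
    { apply Rmult_le_compat_l; [apply Cmod_ge_0|]. rewrite Cmod_pow. apply pow_incr. split; [apply Cmod_ge_0|assumption]. }
    change (M ^ S n) with (M * M ^ n) in *. lra.
Qed.

Definition gaus (y t : R) : Complex.C := RtoC (exp (- (y * t ^ 2))).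
Lemma gaus_ccont y : ccont (gaus y).
Proof.
  intros t. unfold gaus, RtoC, Re, Im; simpl fst; simpl snd. split.
  - apply (ex_derive_continuous (fun t => exp (- (y * t ^ 2)))). auto_derive; trivial.
  - apply continuous_const.
Qed.

(** A comparison with the Gaussian to the weaker order O(1/n). It serves to identify the constant
    left open by [A_asym], for which this precision is enough. *)
Lemma A_crude N v x kap : mom N v x 0 = 1 -> mom N v x 1 = 0 -> 0 < mom N v x 2 -> 0 < kap ->
  (forall t, - PI <= t <= PI -> Cmod (phi N v x 0 t) <= exp (- (kap * t ^ 2))) ->
  exists M, 0 <= M /\ forall n,
  Rabs (Icoef N v x (S n) (fun _ => RtoC 1) - Itg (gaus (INR (S n) * (mom N v x 2 / 2)))) <= M / rt n ^ 2.
Proof.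
  intros h0 h1 h2 hk hphi. set (s := mom N v x 2 / 2). assert (Hs : 0 < s) by (unfold s; lra).
  pose (k' := Rmin kap s). assert (Hk' : 0 < k') by now apply Rmin_glb_lt.
  assert (k1 : k' <= kap) by apply Rmin_l. assert (k2 : k' <= s) by apply Rmin_r.
  destruct (phi_taylor3 N v x 0) as [C1 [C10 H1]].
  assert (HD : bo 3 (fun t => phi N v x 0 t - gaus s t)%C).
  { apply bo_ext with (fun t => (phi N v x 0 t - (mom N v x 0 - mom N v x 2 * t ^ 2 / 2, mom N v x 1 * t)%R) - (gaus s t - RtoC (1 - s * t ^ 2)))%C.
    - intros t. rewrite h0, h1. replace ((1 - mom N v x 2 * t ^ 2 / 2, 0 * t)%R : Complex.C) with (RtoC (1 - s * t ^ 2)).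
      + ring.
      + unfold RtoC, s. f_equal; field.
    - apply bo_minus; [apply phi_taylor3|]. apply bo_pair.
      + apply rbo_weaken with 4%nat; [lia|]. exists (s ^ 2 / 2). split; [pose proof (pow2_ge_0 s); lra|].
        intros t _. unfold gaus, RtoC, Cminus, Cplus, Copp, Re; cbv [fst snd].
        assert (Hy : 0 <= s * t ^ 2) by (apply Rmult_le_pos; [lra|apply pow2_ge_0]).
        eapply Rle_trans; [apply (exp_taylor _ Hy)|]. apply Req_le.
        replace (Rabs t ^ 4) with ((Rabs t ^ 2) ^ 2) by ring. rewrite pow2_abs. field.
      + apply rbo_ext with (fun _ => 0); [|apply rbo_zero]. intros t. unfold gaus, RtoC, Cminus, Cplus, Copp, Im; simpl. ring. }
  destruct HD as [C [C0 HC]].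
  destruct (Itg_gauss 3 k' ltac:(lia) Hk') as [K [K0 HK]].
  exists (C * K). split; [now apply Rmult_le_pos|]. intros n.
  assert (cphi : ccont (fun t => phi N v x 0 t ^ S n * RtoC 1)%C) by (apply Icoef_ccont, ccont_const).
  unfold Icoef. rewrite <- Itg_minus by first [exact cphi | apply gaus_ccont].
  apply Rle_trans with ((INR (S n) * C) * K / rt n ^ 4).
  - apply HK; [now apply ccont_minus; [|apply gaus_ccont]|apply Rmult_le_pos; [apply pos_INR|assumption]|].
    intros t Ht.
    replace (phi N v x 0 t ^ S n * RtoC 1 - gaus (INR (S n) * s) t)%C with (phi N v x 0 t ^ S n - gaus s t ^ S n)%C.
    2:{ assert (E : forall m, (gaus s t ^ m)%C = gaus (INR m * s) t).
        { intros m. unfold gaus. rewrite <- RtoC_pow, exp_pow. f_equal. f_equal. ring. }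
        rewrite E. ring. }
    assert (Ha : Cmod (phi N v x 0 t) <= exp (- (k' * t ^ 2))).
    { eapply Rle_trans; [now apply hphi|]. apply exp_mono. pose proof (pow2_ge_0 t). nra. }
    assert (Hb : Cmod (gaus s t) <= exp (- (k' * t ^ 2))).
    { unfold gaus. rewrite Cmod_R, Rabs_pos_eq by apply Rlt_le, exp_pos. apply exp_mono. pose proof (pow2_ge_0 t). nra. }
    eapply Rle_trans; [apply (Cpow_sub_le _ _ _ n Ha Hb)|]. rewrite exp_pow.
    replace (INR n * - (k' * t ^ 2)) with (- (k' * INR n * t ^ 2)) by ring.
    apply Rmult_le_compat_r; [apply Rlt_le, exp_pos|]. rewrite Rmult_assoc. apply Rmult_le_compat_l; [apply pos_INR|now apply HC].
  - apply Req_le. rewrite S_INR, <- rt_sq. field. rt_nz.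
Qed.

Lemma ex_RInt_gauss a b : ex_RInt (fun u => exp (- u ^ 2)) a b.
Proof.
  apply ex_RInt_cont. intros t. apply (ex_derive_continuous (fun u => exp (- u ^ 2))). auto_derive; trivial.
Qed.

Lemma gauss_scaling y : 0 < y ->
  sqrt y * Itg (gaus y) = RInt (fun u => exp (- u ^ 2)) (- (sqrt y * PI)) (sqrt y * PI) / (2 * PI).
Proof.
  intros Hy. unfold Itg. unfold Rdiv. rewrite <- Rmult_assoc. f_equal.
  pose proof (RInt_comp_lin (V := R_CompleteNormedModule) (fun u => exp (- u ^ 2)) (sqrt y) 0 (- PI) PI (ex_RInt_gauss _ _)) as E.
  rewrite !Rplus_0_r in E. replace (sqrt y * - PI) with (- (sqrt y * PI)) in E by ring. rewrite <- E.
  symmetry. transitivity (RInt (fun t => scal (sqrt y) (Re (gaus y t))) (- PI) PI).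
  - apply RInt_ext. intros t _. f_equal. unfold gaus, RtoC, Re; simpl fst. f_equal. f_equal.
    rewrite Rplus_0_r, Rpow_mult_distr, pow2_sqrt by lra. reflexivity.
  - apply (RInt_scal (V := R_CompleteNormedModule)). apply ccont_ex, gaus_ccont.
Qed.

(** From exp(-u^2) <= 1/(1 + u^2): two truncated Gaussian integrals can be compared through
    arctangents, without knowing the value of the full integral. *)
Lemma gauss_RInt_diff z w : 0 < z <= w ->
  Rabs (RInt (fun u => exp (- u ^ 2)) (- w) w - RInt (fun u => exp (- u ^ 2)) (- z) z) <= 2 * (atan w - atan z).
Proof.
  intros H. set (f := fun u => exp (- u ^ 2)).
  assert (B : forall a b, a <= b -> 0 <= RInt f a b <= atan b - atan a).
  { intros a b Hab. assert (HL : is_RInt (fun u => / (1 + u ^ 2)) a b (minus (atan b) (atan a))).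
    { apply (is_RInt_derive atan).
      - intros u _. auto_derive; [trivial|]. unfold Rsqr. simpl. rewrite Rmult_1_r. ring.
      - intros u _. apply (ex_derive_continuous (fun u => / (1 + u ^ 2))). auto_derive. pose proof (pow2_ge_0 u). simpl in *. nra. }
    split.
    - apply RInt_ge_0; [assumption|apply ex_RInt_gauss|]. intros; apply Rlt_le, exp_pos.
    - replace (atan b - atan a) with (RInt (fun u => / (1 + u ^ 2)) a b) by (rewrite (is_RInt_unique _ _ _ _ HL); reflexivity).
      apply RInt_le; [assumption|apply ex_RInt_gauss|eexists; exact HL|].
      intros u _. unfold f. rewrite exp_Ropp. pose proof (exp_ineq1_le (u ^ 2)). pose proof (pow2_ge_0 u).
      apply rinv_le; lra. }
  assert (E : RInt f (- w) w = RInt f (- w) (- z) + (RInt f (- z) z + RInt f z w)).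
  { rewrite <- (RInt_Chasles (V := R_CompleteNormedModule) f (- w) (- z) w) by apply ex_RInt_gauss.
    rewrite <- (RInt_Chasles (V := R_CompleteNormedModule) f (- z) z w) by apply ex_RInt_gauss. reflexivity. }
  rewrite E. pose proof (B (- w) (- z) ltac:(lra)). pose proof (B z w ltac:(lra)).
  rewrite !atan_opp in H0. apply Rabs_le. lra.
Qed.

(* Lazy simple walk, whose return probabilities are exactly [tq n]: comparing with it identifies the constant
   in the local limit theorem. *)
Definition psi_w (j : nat) : R := match j with O => / 4 | 1%nat => / 2 | _ => / 4 end.
Definition psi_x (j : nat) : Z := (Z.of_nat j - 1)%Z.
Lemma psi_phi t : phi 3 psi_w psi_x 0 t = RtoC ((1 + cos t) / 2).
Proof.
  unfold phi, psi_w, psi_x, RtoC. rewrite !rsum_S. unfold rsum; simpl.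
  replace (-1 * t) with (- t) by ring. rewrite cos_neg, sin_neg, !Rmult_0_l, !Rmult_1_l, cos_0, sin_0. f_equal; field.
Qed.
Lemma psi_mom0 : mom 3 psi_w psi_x 0 = 1.
Proof. unfold mom, psi_w, psi_x. rewrite !rsum_S. unfold rsum; simpl. field. Qed.
Lemma psi_mom1 : mom 3 psi_w psi_x 1 = 0.
Proof. unfold mom, psi_w, psi_x. rewrite !rsum_S. unfold rsum; simpl. field. Qed.
Lemma psi_mom2 : mom 3 psi_w psi_x 2 = / 2.
Proof. unfold mom, psi_w, psi_x. rewrite !rsum_S. unfold rsum; simpl. field. Qed.
Lemma psi_le t : - PI <= t <= PI -> Cmod (phi 3 psi_w psi_x 0 t) <= exp (- (/ 32 * t ^ 2)).
Proof.
  intros Ht. rewrite psi_phi, Cmod_R. pose proof (COS_bound t). rewrite Rabs_pos_eq by lra.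
  pose proof (one_sub_cos_ge t Ht). pose proof (exp_ineq1_le (- (/ 32 * t ^ 2))). lra.
Qed.

(** The derivative of sin t ((1 + cos t)/2)^n integrates to zero over a period, and this is the
    recursion of [tq]. *)
Lemma psi_A n : Icoef 3 psi_w psi_x n (fun _ => RtoC 1) = tq n.
Proof.
  induction n as [|n IH].
  - unfold Icoef, Itg. rewrite (RInt_ext _ (fun _ => 1)).
    + rewrite RInt_const. unfold scal; simpl; unfold mult; simpl. field. apply PI_neq0.
    + intros t _. simpl. ring.
  - set (K := fun n => Icoef 3 psi_w psi_x n (fun _ => RtoC 1)) in *.
    pose (F' := fun t => (RtoC (2 * INR n + 2) * (phi 3 psi_w psi_x 0 t ^ S n * RtoC 1) - RtoC (2 * INR n + 1) * (phi 3 psi_w psi_x 0 t ^ n * RtoC 1))%C).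
    assert (c : forall m, ccont (fun t => phi 3 psi_w psi_x 0 t ^ m * RtoC 1)%C) by (intros; apply Icoef_ccont, ccont_const).
    assert (E : Itg F' = 0).
    { assert (EF : forall t, F' t = RtoC ((2 * INR n + 2) * ((1 + cos t) / 2) ^ S n - (2 * INR n + 1) * ((1 + cos t) / 2) ^ n)).
      { intros t. unfold F'. rewrite psi_phi, <- !RtoC_pow, RtoC_minus, !RtoC_mult. ring. }
      apply Itg_derive with (fun t => RtoC (sin t * ((1 + cos t) / 2) ^ n)).
      - intros t. rewrite EF. unfold RtoC, Re, Im; cbv [fst snd]. split.
        + auto_derive; [trivial|]. destruct n as [|m].
          * simpl. field.
          * change (Init.Nat.pred (S m)) with m. pose proof (sin2_cos2 t) as S2. unfold Rsqr in S2.
            set (cc := cos t) in *. set (ss := sin t) in *. generalize (INR (S m)); intros M. simpl pow.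
            unfold Rdiv. set (pp := ((1 + cc) * / 2) ^ m).
            transitivity (cc * ((1 + cc) * / 2 * pp) - ss * ss * / 2 * M * pp); [ring|].
            replace (ss * ss) with (1 - cc * cc) by lra. field.
        + exact (is_derive_const (V := R_NormedModule) 0 t).
      - exact (ccont_minus _ _ (ccont_scal _ _ (c (S n))) (ccont_scal _ _ (c n))).
      - now rewrite sin_PI, sin_neg, sin_PI, Ropp_0, !Rmult_0_l. }
    unfold F' in E. rewrite (Itg_minus _ _ (ccont_scal _ _ (c (S n))) (ccont_scal _ _ (c n))) in E.
    rewrite (Itg_scal _ _ (c (S n))), (Itg_scal _ _ (c n)) in E.
    change ((2 * INR n + 2) * K (S n) - (2 * INR n + 1) * K n = 0) in E. change (K n = tq n) in IH. rewrite IH in E.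
    change (K (S n) = tq (S n)).
    pose proof (pos_INR n). simpl tq. apply Rmult_eq_reg_l with (2 * INR n + 2); [|lra].
    transitivity ((2 * INR n + 1) * tq n); [lra|]. field. lra.
Qed.

(** What remains is the constant b. The return weights of this walk and of the lazy walk are close
    to Gaussian integrals, which after scaling by sqrt s and by 1/2 agree up to vanishing tails. The
    lazy walk has constant 1, so b sqrt s = 1/2. *)
Theorem local_limit N v x kap : mom N v x 0 = 1 -> mom N v x 1 = 0 -> 0 < mom N v x 2 -> 0 < kap ->
  (forall t, - PI <= t <= PI -> Cmod (phi N v x 0 t) <= exp (- (kap * t ^ 2))) ->
  exists C, 0 <= C /\ forall n j,
  Rabs (Icoef N v x n (gcis j) - tq n / sqrt (2 * mom N v x 2)) <= C * (1 + IZR j ^ 2) / rt n ^ 3.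
Proof.
  intros h0 h1 h2 hk hphi.
  destruct (A_asym N v x kap h0 h1 h2 hk hphi) as [b [C1 [C10 H1]]].
  destruct (Icoef_gcis N v x kap h1 h2 hk hphi) as [C2 [C20 H2]].
  enough (Hb : b = / sqrt (2 * mom N v x 2)).
  { exists (C1 + C2). split; [lra|]. intros n j. specialize (H1 n). specialize (H2 n j).
    replace (tq n / sqrt (2 * mom N v x 2)) with (b * tq n) by (rewrite Hb; unfold Rdiv; ring).
    replace (Icoef N v x n (gcis j) - b * tq n) with ((Icoef N v x n (gcis j) - Icoef N v x n (fun _ => RtoC 1))
      + (Icoef N v x n (fun _ => RtoC 1) - b * tq n)) by ring.
    eapply Rle_trans; [apply Rabs_triang|].
    assert (C1 / rt n ^ 3 <= C1 * (1 + IZR j ^ 2) / rt n ^ 3).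
    { unfold Rdiv. apply Rmult_le_compat_r; [apply Rlt_le, Rinv_0_lt_compat, rt_pow_pos|].
      pose proof (pow2_ge_0 (IZR j)). nra. }
    replace ((C1 + C2) * (1 + IZR j ^ 2) / rt n ^ 3) with (C1 * (1 + IZR j ^ 2) / rt n ^ 3 + C2 * (1 + IZR j ^ 2) / rt n ^ 3) by (field; rt_nz).
    lra. }
  destruct (A_crude N v x kap h0 h1 h2 hk hphi) as [M1 [M10 HM1]].
  destruct (A_crude 3 psi_w psi_x (/ 32) psi_mom0 psi_mom1 ltac:(rewrite psi_mom2; lra) ltac:(lra) psi_le) as [M2 [M20 HM2]].
  set (s := mom N v x 2 / 2) in *. assert (Hs : 0 < s) by (unfold s; lra).
  rewrite psi_mom2 in HM2.
  assert (Hss : 0 < sqrt s) by now apply sqrt_lt_R0.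
  assert (Eb : b * sqrt s = / 2).
  { pose (z := fun n => rt n * sqrt s * PI). pose (w := fun n => rt n * / 2 * PI).
    (* The difference is multiplied by rt(n) tq(n+1) >= 1/4, whence the factor 4. The terms are the
       errors for the given walk, for the lazy walk, and between the two truncated Gaussian
       integrals. *)
    assert (key : forall n, Rabs (b * sqrt s - / 2) <= 4 * (sqrt s * (M1 + C1) / rt n + M2 / 2 / rt n + / (2 * PI) * (2 * Rabs (atan (z n) - atan (w n))))).
    { intros n. pose proof (rt_pos n) as Hr. pose proof PI_RGT_0 as HP.
      specialize (HM1 n). specialize (HM2 n). rewrite psi_A in HM2. specialize (H1 (S n)).
      assert (Hr2 : sqrt (INR (S n)) = rt n) by (unfold rt; now rewrite S_INR).
      assert (Hn : 0 < INR (S n)) by (apply lt_0_INR; lia).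
      pose proof (gauss_scaling (INR (S n) * s) ltac:(nra)) as G1.
      pose proof (gauss_scaling (INR (S n) * (/ 2 / 2)) ltac:(lra)) as G2.
      rewrite sqrt_mult_alt in G1, G2 by lra. rewrite Hr2 in G1, G2.
      replace (/ 2 / 2) with (/ 2 * / 2) in G2 at 1 3 4 by field. rewrite sqrt_square in G2 by lra.
      fold (z n) in G1. fold (w n) in G2.
      set (J1 := Itg (gaus (INR (S n) * s))) in *. set (J2 := Itg (gaus (INR (S n) * (/ 2 / 2)))) in *.
      set (a := Icoef N v x (S n) (fun _ => RtoC 1)) in *.
      assert (Hz : 0 < z n) by (unfold z; apply Rmult_lt_0_compat; [apply Rmult_lt_0_compat|]; assumption).
      assert (Hw : 0 < w n) by (unfold w; apply Rmult_lt_0_compat; [apply Rmult_lt_0_compat|]; lra).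
      assert (GD : Rabs (rt n * sqrt s * J1 - rt n * / 2 * J2) <= / (2 * PI) * (2 * Rabs (atan (z n) - atan (w n)))).
      { rewrite G1, G2. set (f := fun u => exp (- u ^ 2)).
        replace (RInt f (- z n) (z n) / (2 * PI) - RInt f (- w n) (w n) / (2 * PI))
          with (/ (2 * PI) * (RInt f (- z n) (z n) - RInt f (- w n) (w n))) by (field; lra).
        rewrite Rabs_mult, (Rabs_pos_eq (/ (2 * PI))) by (apply Rlt_le, Rinv_0_lt_compat; lra).
        apply Rmult_le_compat_l; [apply Rlt_le, Rinv_0_lt_compat; lra|].
        destruct (Rle_lt_dec (z n) (w n)) as [Hzw|Hzw].
        - rewrite Rabs_minus_sym. eapply Rle_trans; [apply gauss_RInt_diff; lra|].
          rewrite (Rabs_minus_sym (atan (z n))). apply Rmult_le_compat_l; [lra|apply Rle_abs].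
        - eapply Rle_trans; [apply gauss_RInt_diff; lra|]. apply Rmult_le_compat_l; [lra|apply Rle_abs]. }
      assert (T1 : Rabs (rt n * sqrt s * (a - J1)) <= sqrt s * M1 / rt n).
      { rewrite Rabs_mult, (Rabs_pos_eq (rt n * sqrt s)) by (apply Rmult_le_pos; lra).
        apply Rle_trans with (rt n * sqrt s * (M1 / rt n ^ 2)); [apply Rmult_le_compat_l; [apply Rmult_le_pos; lra|exact HM1]|].
        apply Req_le. field. lra. }
      assert (T2 : Rabs (rt n * / 2 * (tq (S n) - J2)) <= M2 / 2 / rt n).
      { rewrite Rabs_mult, (Rabs_pos_eq (rt n * / 2)) by (apply Rmult_le_pos; lra).
        apply Rle_trans with (rt n * / 2 * (M2 / rt n ^ 2)); [apply Rmult_le_compat_l; [apply Rmult_le_pos; lra|exact HM2]|].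
        apply Req_le. field. lra. }
      assert (T3 : Rabs (rt n * sqrt s * (a - b * tq (S n))) <= sqrt s * C1 / rt n).
      { rewrite Rabs_mult, (Rabs_pos_eq (rt n * sqrt s)) by (apply Rmult_le_pos; lra).
        apply Rle_trans with (rt n * sqrt s * (C1 / rt n ^ 2)).
        - apply Rmult_le_compat_l; [apply Rmult_le_pos; lra|]. eapply Rle_trans; [exact H1|].
          unfold Rdiv. apply Rmult_le_compat_l; [assumption|].
          apply Rle_trans with (/ rt n ^ 3); [apply inv_rt_le; lia|apply inv_rt_le'; lia].
        - apply Req_le. field. lra. }
      assert (E : (b * sqrt s - / 2) * (rt n * tq (S n)) =
        (rt n * sqrt s * (a - J1) + (rt n * sqrt s * J1 - rt n * / 2 * J2)) - rt n * / 2 * (tq (S n) - J2) - rt n * sqrt s * (a - b * tq (S n))) by ring.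
      assert (Hlow : / 4 <= rt n * tq (S n)).
      { pose proof (tq_ge (S n)) as Hg. pose proof (rt_half n (S n) ltac:(lia)) as Hh. pose proof (rt_pos (S n)).
        apply Rle_trans with (rt n * / (2 * rt (S n))); [|apply Rmult_le_compat_l; lra].
        apply Rmult_le_reg_r with (4 * (2 * rt (S n))); [lra|]. field_simplify; lra. }
      assert (AB : Rabs ((b * sqrt s - / 2) * (rt n * tq (S n))) <= sqrt s * (M1 + C1) / rt n + M2 / 2 / rt n + / (2 * PI) * (2 * Rabs (atan (z n) - atan (w n)))).
      { rewrite E. unfold Rminus at 1 2.
        eapply Rle_trans; [apply Rabs_triang|]. rewrite Rabs_Ropp.
        assert (Q1 := Rabs_triang (rt n * sqrt s * (a - J1) + (rt n * sqrt s * J1 - rt n * / 2 * J2)) (- (rt n * / 2 * (tq (S n) - J2)))).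
        rewrite Rabs_Ropp in Q1.
        assert (Q2 := Rabs_triang (rt n * sqrt s * (a - J1)) (rt n * sqrt s * J1 - rt n * / 2 * J2)).
        replace (sqrt s * (M1 + C1) / rt n) with (sqrt s * M1 / rt n + sqrt s * C1 / rt n) by (field; lra). lra. }
      rewrite Rabs_mult, (Rabs_pos_eq (rt n * tq (S n))) in AB by lra.
      pose proof (Rabs_pos (b * sqrt s - / 2)). nra. }
    assert (Lr : is_lim_seq (fun n => / rt n) 0).
    { apply is_lim_seq_ext with (fun n => / sqrt (INR (S n))); [intros; unfold rt; now rewrite S_INR|].
      replace (Finite 0) with (Rbar_inv p_infty) by reflexivity. apply is_lim_seq_inv; [|discriminate].
      apply (is_lim_seq_incr_1 (fun n => sqrt (INR n))). apply (filterlim_comp _ _ _ INR sqrt _ (Rbar_locally p_infty)); [apply is_lim_seq_INR|apply filterlim_sqrt_p]. }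
    assert (Lat : forall cc, 0 < cc -> is_lim_seq (fun n => atan (rt n * cc)) (PI / 2)).
    { intros cc Hcc. apply is_lim_seq_ext with (fun n => PI / 2 - atan (/ cc * / rt n)).
      - intros n. pose proof (rt_pos n). rewrite <- Rinv_mult. rewrite (Rmult_comm cc). rewrite atan_inv; [ring|]. apply Rmult_lt_0_compat; lra.
      - assert (La : is_lim_seq (fun n => atan (/ cc * / rt n)) (atan (/ cc * 0))).
        { apply (is_lim_seq_continuous atan); [apply derivable_continuous_pt, derivable_pt_atan|].
          exact (is_lim_seq_scal_l _ (/ cc) 0 Lr). }
        pose proof (is_lim_seq_minus' _ _ _ _ (is_lim_seq_const (PI / 2)) La) as L.
        rewrite Rmult_0_r, atan_0, Rminus_0_r in L. exact L. }
    pose proof PI_RGT_0 as HP.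
    assert (Lz : is_lim_seq (fun n => Rabs (atan (z n) - atan (w n))) 0).
    { replace 0 with (Rabs (PI / 2 - PI / 2)) by (rewrite Rminus_diag, Rabs_R0; reflexivity).
      apply (is_lim_seq_abs _ (PI / 2 - PI / 2)). apply is_lim_seq_minus'.
      - apply is_lim_seq_ext with (fun n => atan (rt n * (sqrt s * PI))); [intros; unfold z; f_equal; ring|]. apply Lat. nra.
      - apply is_lim_seq_ext with (fun n => atan (rt n * (/ 2 * PI))); [intros; unfold w; f_equal; ring|]. apply Lat. lra. }
    assert (Lim : is_lim_seq (fun n => 4 * (sqrt s * (M1 + C1) * / rt n + M2 / 2 * / rt n + / (2 * PI) * (2 * Rabs (atan (z n) - atan (w n)))))
       (4 * (sqrt s * (M1 + C1) * 0 + M2 / 2 * 0 + / (2 * PI) * (2 * 0)))).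
    { apply (is_lim_seq_scal_l _ 4 (Finite _)). apply is_lim_seq_plus'; [apply is_lim_seq_plus'|].
      - apply (is_lim_seq_scal_l _ (sqrt s * (M1 + C1)) 0), Lr.
      - apply (is_lim_seq_scal_l _ (M2 / 2) 0), Lr.
      - apply (is_lim_seq_scal_l _ (/ (2 * PI)) (2 * 0)). apply (is_lim_seq_scal_l _ 2 0), Lz. }
    pose proof (is_lim_seq_le _ _ _ _ key (is_lim_seq_const _) Lim) as HL. simpl in HL.
    assert (Rabs (b * sqrt s - / 2) <= 0) by lra.
    pose proof (Rabs_pos (b * sqrt s - / 2)). assert (E0 : Rabs (b * sqrt s - / 2) = 0) by lra.
    destruct (Req_dec (b * sqrt s - / 2) 0) as [E|E]; [lra|]. apply Rabs_no_R0 in E. contradiction. }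
  replace (2 * mom N v x 2) with ((2 * 2) * s) by (unfold s; field).
  rewrite sqrt_mult_alt, sqrt_square by lra. apply Rmult_eq_reg_r with (sqrt s); [|lra]. rewrite Eb. field. lra.
Qed.

(** * Spitzer identities for meanders *)

Lemma fold_rsum f n : fold_right Rplus 0 (map f (seq 0 n)) = rsum f n.
Proof.
  assert (H : forall l x, fold_right Rplus 0 (l ++ x :: nil) = fold_right Rplus 0 l + x).
  { induction l as [|a l IH]; intros x; simpl; [ring|]. rewrite IH. ring. }
  induction n as [|n IH]; [reflexivity|]. rewrite seq_S, map_app. simpl map. rewrite H, IH. reflexivity.
Qed.
Lemma sumZ_rsum lo hi f : sumZ lo hi f = rsum (fun j => f (lo + Z.of_nat j)%Z) (Z.to_nat (hi - lo + 1)).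
Proof. apply fold_rsum. Qed.

Lemma rsum_support f a b : (forall j, (a <= j)%nat -> f j = 0) -> (forall j, (b <= j)%nat -> f j = 0) ->
  rsum f a = rsum f b.
Proof.
  intros Ha Hb. destruct (le_lt_dec a b) as [H|H].
  - replace b with (a + (b - a))%nat by lia. rewrite rsum_split, (rsum_zero (fun k => f (a + k)%nat)); [ring|]. intros; apply Ha; lia.
  - replace a with (b + (a - b))%nat by lia. rewrite rsum_split, (rsum_zero (fun k => f (b + k)%nat)); [ring|]. intros; apply Hb; lia.
Qed.

Lemma gsum_apply (f : nat -> fps) n l : gsum fzero fadd f n l = rsum (fun i => f i l) n.
Proof. induction n as [|n IH]; [reflexivity|]. simpl. unfold fadd at 1, gadd. rewrite IH. reflexivity. Qed.

Lemma star2_def F G n l :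
  star2 F G n l = rsum (fun i => rsum (fun j => F i j * G (n - i)%nat (l - j)%nat) (S l)) (S n).
Proof. unfold star2, gstar. rewrite gsum_apply. apply rsum_ext. reflexivity. Qed.

Declare Scope fps2_scope.
Delimit Scope fps2_scope with fps2.
Notation "f * g" := (star2 f g) : fps2_scope.
Notation "f + g" := (fadd2 f g) : fps2_scope.
Notation "f - g" := (fsub2 f g) : fps2_scope.
Notation "- f" := (fopp2 f) : fps2_scope.

Lemma fps2_ext (F G : fps2) : (forall n l, F n l = G n l) -> F = G.
Proof. intros H. apply functional_extensionality; intros n. apply functional_extensionality; intros l. apply H. Qed.

(** For a weight additive in the exponents this is a derivation: the length gives z d/dz, the
    altitude gives u d/du. *)
Definition wder (w : nat -> nat -> R) (F : fps2) : fps2 := fun n l => w n l * F n l.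
Definition wadd (w : nat -> nat -> R) := forall i j k l, w (i + k)%nat (j + l)%nat = w i j + w k l.
Lemma wder_star w F G : wadd w -> wder w (F * G)%fps2 = (wder w F * G + F * wder w G)%fps2.
Proof.
  intros Hw. apply fps2_ext; intros n l. unfold fadd2, gadd, fadd, gadd. unfold wder at 1.
  rewrite !star2_def, <- rsum_scal, <- rsum_plus. apply rsum_ext. intros i Hi.
  rewrite <- rsum_scal, <- rsum_plus. apply rsum_ext. intros j Hj. unfold wder.
  replace n with (i + (n - i))%nat at 1 by lia. replace l with (j + (l - j))%nat at 1 by lia. rewrite Hw. ring.
Qed.
Lemma wder_sub w F G : wder w (F - G)%fps2 = (wder w F - wder w G)%fps2.
Proof. apply fps2_ext; intros n l. unfold wder, fsub2, gsub, fsub, gsub. ring. Qed.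
Lemma wder_one w : wadd w -> wder w fone2 = fzero2.
Proof.
  intros Hw. assert (H0 : w O O = 0) by (pose proof (Hw O O O O) as H; simpl in H; lra).
  apply fps2_ext; intros [|n] [|l]; unfold wder, fone2, fone, gone, fzero2, fzero, gzero; rewrite ?H0; ring.
Qed.

Section WienerHopf.
Context (c : nat).

(* Entry [(n, l)] of a bivariate series stands for length [n] and altitude [l - c n], which makes all exponents natural. *)
Definition isneg (F : fps2) := forall n l, (c * n <= l)%nat -> F n l = 0.
Definition isnonneg (F : fps2) := forall n l, (l < c * n)%nat -> F n l = 0.
Definition pospart (F : fps2) : fps2 := fun n l => if (c * n <=? l)%nat then F n l else 0.

Lemma isneg_add F G : isneg F -> isneg G -> isneg (F + G)%fps2.
Proof. intros HF HG n l H. unfold fadd2, gadd, fadd, gadd. rewrite HF, HG by assumption. ring. Qed.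
Lemma isneg_star F G : isneg F -> isneg G -> isneg (F * G)%fps2.
Proof.
  intros HF HG n l H. rewrite star2_def. apply rsum_zero. intros i Hi. apply rsum_zero. intros j Hj.
  destruct (le_lt_dec (c * i) j) as [H1|H1]; [rewrite HF by assumption; ring|].
  rewrite (HG (n - i)%nat) by (rewrite Nat.mul_sub_distr_l; nia). ring.
Qed.
Lemma isneg_wder w F : isneg F -> isneg (wder w F).
Proof. intros HF n l H. unfold wder. rewrite HF by assumption. ring. Qed.
Lemma pospart_nonneg F : isnonneg (pospart F).
Proof. intros n l H. unfold pospart. destruct (Nat.leb_spec (c * n) l); [lia|reflexivity]. Qed.
Lemma pospart_neg F : isneg (F - pospart F)%fps2.
Proof. intros n l H. unfold pospart, fsub2, gsub, fsub, gsub. destruct (Nat.leb_spec (c * n) l); [ring|lia]. Qed.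
Lemma isnonneg_star F G : isnonneg F -> isnonneg G -> isnonneg (F * G)%fps2.
Proof.
  intros HF HG n l H. rewrite star2_def. apply rsum_zero. intros i Hi. apply rsum_zero. intros j Hj.
  destruct (le_lt_dec (c * i) j) as [H1|H1]; [|rewrite HF by assumption; ring].
  rewrite (HG (n - i)%nat) by (rewrite Nat.mul_sub_distr_l; nia). ring.
Qed.

Definition one_step (P : fps2) := forall n, n <> 1%nat -> P n = fzero.
Lemma one_step_star_0 P G l : one_step P -> (P * G)%fps2 O l = 0.
Proof.
  intros HP. rewrite star2_def, rsum_S. rewrite (rsum_zero _ (S l)).
  - unfold rsum; simpl; ring.
  - intros j _. rewrite HP by lia. unfold fzero, gzero. ring.
Qed.
Lemma one_step_star_S P G n l : one_step P -> (P * G)%fps2 (S n) l = (P 1%nat * G n)%fps l.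
Proof.
  intros HP. rewrite star2_def, (rsum_single _ _ 1%nat); [|lia|].
  - replace (S n - 1)%nat with n by lia. reflexivity.
  - intros i Hi Hne. apply rsum_zero. intros j _. rewrite HP by assumption. unfold fzero, gzero. ring.
Qed.

(* Wiener-Hopf: [(1-P) M = 1 + (negative part)] forces every derivation [D] to act on [M] as multiplication
   by the nonnegative part of [D (-log (1-P))]. *)
Lemma wiener_hopf_derivation w (P B M : fps2) : wadd w -> one_step P ->
  ((fone2 - P) * B)%fps2 = fone2 -> isnonneg M -> isneg ((fone2 - P) * M - fone2)%fps2 ->
  wder w M = (pospart (B * wder w P) * M)%fps2.
Proof.
  intros Hw HP HB HM HN. set (Neg := ((fone2 - P) * M - fone2)%fps2) in *.
  set (Th := (B * wder w P)%fps2). set (X := (wder w M - pospart Th * M)%fps2).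
  assert (HX : isnonneg X).
  { intros n l H. unfold X, fsub2, gsub, fsub, gsub. unfold wder at 1. rewrite HM by assumption.
    rewrite (isnonneg_star _ _ (pospart_nonneg Th) HM) by assumption. ring. }
  assert (HD : wder w Neg = ((fone2 - P) * wder w M - wder w P * M)%fps2).
  { unfold Neg. rewrite wder_sub, wder_star, wder_sub, wder_one by assumption. ring. }
  assert (HNX : isneg ((fone2 - P) * X)%fps2).
  { replace ((fone2 - P) * X)%fps2 with (wder w Neg + ((Th - pospart Th) + (Th - pospart Th) * Neg))%fps2.
    - apply isneg_add; [now apply isneg_wder|]. apply isneg_add; [apply pospart_neg|].
      apply isneg_star; [apply pospart_neg|assumption].
    - rewrite HD. transitivity ((fone2 - P) * wder w M - wder w P * M + (Th - pospart Th) * (fone2 + Neg))%fps2; [ring|].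
      replace (fone2 + Neg)%fps2 with ((fone2 - P) * M)%fps2 by (unfold Neg; ring).
      unfold X. transitivity ((fone2 - P) * wder w M - wder w P * M + (((fone2 - P) * B) * wder w P) * M - (fone2 - P) * (pospart Th * M))%fps2.
      + unfold Th. ring.
      + rewrite HB. ring. }
  (* X has no negative altitudes while (1 - P) X has only negative ones. Hence X agrees with P X at
     nonnegative altitudes, and since P has length 1, X vanishes by induction on the length. *)
  assert (X0 : forall n, X n = fzero).
  { assert (E : forall n l, (c * n <= l)%nat -> X n l = (P * X)%fps2 n l).
    { intros n l H. specialize (HNX n l H). replace ((fone2 - P) * X)%fps2 with (X - P * X)%fps2 in HNX by ring.
      unfold fsub2, gsub, fsub, gsub in HNX. lra. }
    induction n as [|n IH]; apply functional_extensionality; intros l.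
    - rewrite E by lia. apply one_step_star_0. assumption.
    - destruct (le_lt_dec (c * S n) l) as [H|H]; [|rewrite HX by assumption; reflexivity].
      rewrite E by assumption. rewrite one_step_star_S, IH by assumption.
      rewrite star_def. apply rsum_zero. intros; unfold fzero, gzero; ring. }
  transitivity (X + pospart Th * M)%fps2; [unfold X; ring|].
  replace X with fzero2 by (apply functional_extensionality; intros n; symmetry; apply X0). ring.
Qed.

(** Back to the true altitude k >= 0. The shift c n is additive in n, so this respects products of
    series without negative altitudes. *)
Definition cone (F : fps2) : fps2 := fun n k => F n (c * n + k)%nat.
Lemma cone_star F G : isnonneg F -> isnonneg G -> cone (F * G)%fps2 = (cone F * cone G)%fps2.
Proof.
  intros HF HG. apply fps2_ext; intros n k. unfold cone at 1. rewrite !star2_def.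
  apply rsum_ext. intros i Hi.
  replace (S (c * n + k)) with (c * i + (S k + (c * (n - i))))%nat by (rewrite Nat.mul_sub_distr_l; nia).
  rewrite rsum_split, rsum_split, rsum_zero, (rsum_zero (fun j => F i (c * i + (S k + j))%nat * G (n - i)%nat (c * n + k - (c * i + (S k + j)))%nat)).
  - rewrite Rplus_0_l, Rplus_0_r. apply rsum_ext. intros j Hj. unfold cone. f_equal. f_equal. rewrite Nat.mul_sub_distr_l. nia.
  - intros j Hj. rewrite (HG (n - i)%nat). { ring. } rewrite Nat.mul_sub_distr_l in *. nia.
  - intros j Hj. rewrite HF by assumption. ring.
Qed.
End WienerHopf.

(** The recursion of [mea] without the barrier at 0, that is [u^k] P(u)^n. *)
Fixpoint wk (c d : nat) (p : Z -> R) (n : nat) (k : Z) : R :=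
  match n with
  | O => if Z.eqb k 0%Z then 1 else 0
  | S n' => sumZ (- Z.of_nat c) (Z.of_nat d) (fun i => p i * wk c d p n' (k - i)%Z)
  end.

Section Meanders.
Context (c d : nat) (p : Z -> R).
Hypothesis hp0 : forall i : Z, 0 <= p i.
Hypothesis hsupp : forall i : Z, (i < - Z.of_nat c \/ Z.of_nat d < i)%Z -> p i = 0.

Lemma step_rsum F k : sumZ (- Z.of_nat c) (Z.of_nat d) (fun i => p i * F (k - i)%Z)
  = rsum (fun j => p (Z.of_nat j - Z.of_nat c)%Z * F (k - (Z.of_nat j - Z.of_nat c))%Z) (S (c + d)).
Proof.
  rewrite sumZ_rsum. replace (Z.to_nat (Z.of_nat d - - Z.of_nat c + 1)) with (S (c + d)) by lia.
  apply rsum_ext. intros j _. replace (- Z.of_nat c + Z.of_nat j)%Z with (Z.of_nat j - Z.of_nat c)%Z by lia. reflexivity.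
Qed.
Lemma wk_S n k : wk c d p (S n) k
  = rsum (fun j => p (Z.of_nat j - Z.of_nat c)%Z * wk c d p n (k - (Z.of_nat j - Z.of_nat c))%Z) (S (c + d)).
Proof. apply step_rsum. Qed.
Lemma mea_S n k : (0 <= k)%Z -> mea c d p (S n) k
  = rsum (fun j => p (Z.of_nat j - Z.of_nat c)%Z * mea c d p n (k - (Z.of_nat j - Z.of_nat c))%Z) (S (c + d)).
Proof.
  intros Hk. rewrite <- step_rsum. simpl. destruct (Z.ltb_spec k 0); [lia|reflexivity].
Qed.
Lemma mea_neg n k : (k < 0)%Z -> mea c d p n k = 0.
Proof.
  intros Hk. destruct n; simpl.
  - destruct (Z.eqb_spec k 0); [lia|reflexivity].
  - destruct (Z.ltb_spec k 0); [reflexivity|lia].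
Qed.
Lemma mea_nonneg n k : 0 <= mea c d p n k.
Proof.
  revert k; induction n as [|n IH]; intros k.
  - simpl. destruct (Z.eqb k 0); lra.
  - destruct (Z_lt_le_dec k 0) as [H|H]; [rewrite mea_neg by assumption; lra|].
    rewrite mea_S by assumption. apply rsum_nonneg. intros; apply Rmult_le_pos; auto.
Qed.
Lemma mea_le_wk n k : mea c d p n k <= wk c d p n k.
Proof.
  revert k; induction n as [|n IH]; intros k; [simpl; lra|].
  destruct (Z_lt_le_dec k 0) as [H|H].
  - rewrite mea_neg by assumption. rewrite wk_S. apply rsum_nonneg. intros. apply Rmult_le_pos; [apply hp0|].
    eapply Rle_trans; [apply mea_nonneg|apply IH].
  - rewrite mea_S, wk_S by assumption. apply rsum_le. intros. apply Rmult_le_compat_l; auto.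
Qed.
Lemma wk_support_low n k : (k < - (Z.of_nat c * Z.of_nat n))%Z -> wk c d p n k = 0.
Proof.
  revert k; induction n as [|n IH]; intros k Hk.
  - simpl. destruct (Z.eqb_spec k 0); [lia|reflexivity].
  - rewrite wk_S. apply rsum_zero. intros j Hj. rewrite IH by lia. ring.
Qed.
Lemma wk_support_high n k : (Z.of_nat d * Z.of_nat n < k)%Z -> wk c d p n k = 0.
Proof.
  revert k; induction n as [|n IH]; intros k Hk.
  - simpl. destruct (Z.eqb_spec k 0); [lia|reflexivity].
  - rewrite wk_S. apply rsum_zero. intros j Hj. rewrite IH by lia. ring.
Qed.
Lemma mea_support_high n k : (Z.of_nat d * Z.of_nat n < k)%Z -> mea c d p n k = 0.
Proof.
  intros Hk. pose proof (mea_nonneg n k). pose proof (mea_le_wk n k). rewrite (wk_support_high n k Hk) in *. lra.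
Qed.

Definition P1 : fps2 := fun n l => match n with 1%nat => p (Z.of_nat l - Z.of_nat c)%Z | _ => 0 end.
Definition shifted (F : nat -> Z -> R) : fps2 := fun n l => F n (Z.of_nat l - Z.of_nat c * Z.of_nat n)%Z.

Lemma P1_one_step : one_step P1.
Proof. intros [|[|n]] H; try reflexivity. lia. Qed.

Lemma P1_star F n l : (forall k, (k < - (Z.of_nat c * Z.of_nat n))%Z -> F n k = 0) ->
  (P1 * shifted F)%fps2 (S n) l
  = rsum (fun j => p (Z.of_nat j - Z.of_nat c)%Z * F n (Z.of_nat l - Z.of_nat c * Z.of_nat (S n) - (Z.of_nat j - Z.of_nat c))%Z) (S (c + d)).
Proof.
  intros HF. rewrite one_step_star_S by apply P1_one_step. rewrite star_def. simpl P1.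
  rewrite (rsum_support (fun j => p (Z.of_nat j - Z.of_nat c)%Z * F n (Z.of_nat l - Z.of_nat c * Z.of_nat (S n) - (Z.of_nat j - Z.of_nat c))%Z) (S (c + d)) (S l)).
  - apply rsum_ext. intros j Hj. unfold shifted. f_equal. f_equal. lia.
  - intros j Hj. rewrite hsupp by lia. ring.
  - intros j Hj. rewrite HF by lia. ring.
Qed.

Lemma shifted_wk : ((fone2 - P1) * shifted (wk c d p))%fps2 = fone2.
Proof.
  replace ((fone2 - P1) * shifted (wk c d p))%fps2 with (shifted (wk c d p) - P1 * shifted (wk c d p))%fps2 by ring.
  apply fps2_ext; intros [|n] l; unfold fsub2, gsub, fsub, gsub.
  - rewrite one_step_star_0 by apply P1_one_step. unfold shifted. rewrite Z.mul_0_r, Z.sub_0_r. simpl.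
    destruct l as [|l]; simpl; unfold fone, gone; ring.
  - rewrite P1_star by apply wk_support_low. unfold shifted at 1. rewrite wk_S. simpl fone2. unfold fzero, gzero. ring.
Qed.

Lemma shifted_mea_nonneg : isnonneg c (shifted (mea c d p)).
Proof. intros n l H. apply mea_neg. lia. Qed.
(** The kernel equation: (1 - zP) M - 1 collects, with a minus sign, the jumps that would take a
    meander below zero. *)
Lemma shifted_mea : isneg c ((fone2 - P1) * shifted (mea c d p) - fone2)%fps2.
Proof.
  replace ((fone2 - P1) * shifted (mea c d p) - fone2)%fps2 with (shifted (mea c d p) - P1 * shifted (mea c d p) - fone2)%fps2 by ring.
  intros [|n] l H; unfold fsub2, gsub, fsub, gsub.
  - rewrite one_step_star_0 by apply P1_one_step. unfold shifted. rewrite Z.mul_0_r, Z.sub_0_r. simpl.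
    destruct l as [|l]; simpl; unfold fone, gone; ring.
  - rewrite P1_star by (intros; apply mea_neg; lia). unfold shifted at 1. rewrite mea_S by lia. simpl fone2. unfold fzero, gzero. ring.
Qed.

Definition mk (k : nat) : fps := fun n => mea c d p n (Z.of_nat k).
(* The coefficient of [u^j] in [- log (1 - z P(u))]. *)
Definition Lk (j : nat) : fps := fun n => match n with O => 0 | S _ => wk c d p n (Z.of_nat j) / INR n end.

Let wz (n l : nat) : R := INR n.
Let wa (n l : nat) : R := INR l - INR c * INR n.
Lemma wz_add : wadd wz.
Proof. intros i j k l. unfold wz. apply plus_INR. Qed.
Lemma wa_add : wadd wa.
Proof. intros i j k l. unfold wa. rewrite !plus_INR. ring. Qed.

Lemma cone_shifted_mea : cone c (shifted (mea c d p)) = (fun n k => mk k n).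
Proof. apply fps2_ext; intros n k. unfold cone, shifted, mk. f_equal. lia. Qed.

Let Bt := shifted (wk c d p).

Lemma Bt_star_P1 : (Bt * P1)%fps2 = (Bt - fone2)%fps2.
Proof. rewrite <- shifted_wk. fold Bt. ring. Qed.

Lemma wder_wz_P1 : wder wz P1 = P1.
Proof. apply fps2_ext; intros [|[|n]] l; unfold wder, wz, P1; simpl; ring. Qed.
Lemma wder_Bt w : wadd w -> wder w Bt = (Bt * Bt * wder w P1)%fps2.
Proof.
  intros Hw. pose proof shifted_wk as H. fold Bt in H.
  assert (E : wder w ((fone2 - P1) * Bt)%fps2 = fzero2) by (rewrite H; now apply wder_one).
  rewrite wder_star, wder_sub, wder_one in E by assumption.
  transitivity (((fone2 - P1) * Bt) * wder w Bt)%fps2; [rewrite H; ring|].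
  transitivity (Bt * ((fzero2 - wder w P1) * Bt + (fone2 - P1) * wder w Bt) + Bt * Bt * wder w P1)%fps2; [ring|].
  rewrite E. ring.
Qed.

(** For the length, B theta(P) = B P = B - 1 with B = 1/(1 - zP). Its coefficients are the
    unconstrained weights, that is n times those of - log(1 - zP). *)
Lemma spitzer_length n k : INR n * mk k n
  = ((fun i j => theta (Lk j) i) * (fun i j => mk j i))%fps2 n k.
Proof.
  pose proof (wiener_hopf_derivation c wz P1 Bt (shifted (mea c d p)) wz_add P1_one_step shifted_wk shifted_mea_nonneg shifted_mea) as H.
  rewrite wder_wz_P1, Bt_star_P1 in H. apply (f_equal (cone c)) in H.
  rewrite cone_star, cone_shifted_mea in H by (apply pospart_nonneg || apply shifted_mea_nonneg).
  apply (f_equal (fun F => F n k)) in H.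
  replace (cone c (wder wz (shifted (mea c d p))) n k) with (INR n * mk k n) in H
    by (unfold cone, wder, wz, shifted, mk; f_equal; f_equal; lia).
  rewrite H. f_equal. apply fps2_ext; intros i j. unfold cone, pospart, theta, Lk.
  destruct (Nat.leb_spec (c * i) (c * i + j)); [|lia]. unfold fsub2, gsub, fsub, gsub.
  destruct i as [|i].
  - unfold Bt, shifted. replace (Z.of_nat (c * 0 + j) - Z.of_nat c * Z.of_nat 0)%Z with (Z.of_nat j) by lia.
    replace (c * 0 + j)%nat with j by lia. destruct j; simpl; unfold fone, gone; ring.
  - unfold Bt, shifted. simpl fone2. unfold fzero, gzero. replace (Z.of_nat (c * S i + j) - Z.of_nat c * Z.of_nat (S i))%Z with (Z.of_nat j) by lia.
    field. apply not_0_INR. lia.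
Qed.

(** For the altitude derivation, the coefficient of B u d(zP)/du is j times that of - log(1 - zP).
    This second identity supplies the single series M_k, of which the first one isolates only
    M_0. *)
Lemma spitzer_altitude n k : INR k * mk k n
  = ((fun i j => INR j * Lk j i)%R * (fun i j => mk j i))%fps2 n k.
Proof.
  pose proof (wiener_hopf_derivation c wa P1 Bt (shifted (mea c d p)) wa_add P1_one_step shifted_wk shifted_mea_nonneg shifted_mea) as H.
  apply (f_equal (cone c)) in H.
  rewrite cone_star, cone_shifted_mea in H by (apply pospart_nonneg || apply shifted_mea_nonneg).
  apply (f_equal (fun F => F n k)) in H.
  replace (cone c (wder wa (shifted (mea c d p))) n k) with (INR k * mk k n) in H.
  2:{ unfold cone, wder, wa, shifted, mk. rewrite plus_INR, mult_INR. f_equal; [ring|]. f_equal; lia. }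
  rewrite H. f_equal. apply fps2_ext; intros i j. unfold cone, pospart.
  destruct (Nat.leb_spec (c * i) (c * i + j)); [|lia].
  (* The two derivations commute: the length derivative of B times the altitude derivative of P is
     the altitude derivative of B. *)
  assert (E : wder wz (Bt * wder wa P1)%fps2 = wder wa Bt).
  { rewrite wder_star, !wder_Bt, wder_wz_P1 by (apply wz_add || apply wa_add).
    replace (wder wz (wder wa P1)) with (wder wa P1).
    - transitivity (((Bt * P1) + fone2) * Bt * wder wa P1)%fps2; [ring|]. rewrite Bt_star_P1. ring.
    - apply fps2_ext; intros [|[|m]] l; unfold wder, wz, P1; simpl; ring. }
  apply (f_equal (fun F => F i (c * i + j)%nat)) in E. unfold wder at 1 3, wz, wa at 2 in E.
  rewrite plus_INR, mult_INR in E. unfold Bt at 2, shifted in E.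
  replace (Z.of_nat (c * i + j) - Z.of_nat c * Z.of_nat i)%Z with (Z.of_nat j) in E by lia.
  destruct i as [|i].
  - unfold Lk. rewrite Rmult_0_r. rewrite star2_def, rsum_S. rewrite (rsum_zero _ (S (c * 0 + j))); [unfold rsum; simpl; ring|].
    intros l _. unfold wder, P1. simpl. ring.
  - unfold Lk. apply Rmult_eq_reg_l with (INR (S i)); [|apply not_0_INR; lia].
    rewrite E. field. apply not_0_INR; lia.
Qed.

Lemma spitzer_E : theta (mk 0) = (theta (Lk 0) * mk 0)%fps.
Proof.
  apply functional_extensionality; intros n. unfold theta at 1. rewrite spitzer_length, star2_def, star_def.
  apply rsum_ext. intros i _. rewrite rsum_S. unfold rsum; simpl. ring.
Qed.

(** A recursion on altitude: the term j = 0 has factor 0, so M_k is determined by M_0, ..., M_(k-1)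
    for k >= 1. *)
Lemma spitzer_k k : (cst (INR k) * mk k)%fps = (fun n => rsum (fun j => (cst (INR j) * (Lk j * mk (k - j)))%fps n) (S k)).
Proof.
  apply functional_extensionality; intros n. rewrite cst_star. unfold scal_fps. rewrite spitzer_altitude, star2_def, rsum_swap.
  apply rsum_ext. intros j _. rewrite cst_star. unfold scal_fps. rewrite star_def, <- rsum_scal. apply rsum_ext. intros; ring.
Qed.

Definition Apos : fps := fun n => match n with O => 0 | S _ => rsum (fun j => wk c d p n (Z.of_nat j)) (S (n * d)) end.

Lemma Mcoef_val n : Mcoef c d p n = val (fun k => mk k n) /\ l1 (fun k => mk k n).
Proof.
  assert (H : forall k, (S (n * d) <= k)%nat -> mk k n = 0) by (intros; apply mea_support_high; lia).
  split; [|now apply l1_finite with (S (n * d))].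
  rewrite (val_finite _ _ H). unfold Mcoef. rewrite sumZ_rsum.
  replace (Z.to_nat (Z.of_nat n * Z.of_nat d - 0 + 1)) with (S (n * d)) by lia. reflexivity.
Qed.

Lemma Apos_val n : Apos n = val (fun j => theta (Lk j) n) /\ l1 (fun j => theta (Lk j) n).
Proof.
  assert (E : forall j, theta (Lk j) n = match n with O => 0 | S _ => wk c d p n (Z.of_nat j) end).
  { intros j. unfold theta, Lk. destruct n as [|n]; [simpl; ring|]. field. apply not_0_INR; lia. }
  assert (H : forall j, (S (n * d) <= j)%nat -> theta (Lk j) n = 0).
  { intros j Hj. rewrite E. destruct n; [reflexivity|]. apply wk_support_high. lia. }
  split; [|now apply l1_finite with (S (n * d))].
  rewrite (val_finite _ _ H). unfold Apos. destruct n as [|n].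
  - symmetry. apply rsum_zero. intros. apply E.
  - apply rsum_ext. intros. symmetry. apply E.
Qed.

Lemma val_gsum (f : nat -> fps) n : (forall i, l1 (f i)) ->
  l1 (fun l => rsum (fun i => f i l) n) /\ val (fun l => rsum (fun i => f i l) n) = rsum (fun i => val (f i)) n.
Proof.
  intros H. induction n as [|n [IH1 IH2]].
  - split.
    + exact (l1_finite fzero O (fun n _ => eq_refl)).
    + exact (val_finite fzero O (fun n _ => eq_refl)).
  - split.
    + exact (l1_add _ _ IH1 (H n)).
    + rewrite rsum_S, <- IH2. exact (val_add _ _ IH1 (H n)).
Qed.

(** The length identity at u = 1. For each length only altitudes up to n d occur, so summing over
    altitudes involves no convergence question. *)
Lemma spitzer_M : theta (Mcoef c d p) = (Apos * Mcoef c d p)%fps.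
Proof.
  apply functional_extensionality; intros n. unfold theta, scal_fps. rewrite (proj1 (Mcoef_val n)).
  unfold val at 1. rewrite <- Series_scal_l.
  rewrite (Series_ext _ (fun k => ((fun i j => theta (Lk j) i) * (fun i j => mk j i))%fps2 n k)) by (intros; apply spitzer_length).
  rewrite star_def.
  transitivity (val (fun k => rsum (fun i => ((fun j => theta (Lk j) i) * (fun j => mk j (n - i)%nat))%fps k) (S n))).
  - apply Series_ext. intros k. rewrite star2_def. reflexivity.
  - rewrite (proj2 (val_gsum _ (S n) (fun i => l1_star _ _ (proj2 (Apos_val i)) (proj2 (Mcoef_val (n - i)))))).
    apply rsum_ext. intros i _. rewrite val_star by (apply Apos_val || apply Mcoef_val).
    now rewrite <- (proj1 (Apos_val i)), <- (proj1 (Mcoef_val (n - i))).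
Qed.
End Meanders.

(** * Tilted step weights *)

(** By 1 - cos(2x) = 2 sin^2 x and (s + s')^2 <= 2 s^2 + 2 s'^2. It makes the set [G] of
    [aperiodic_phi_bound] closed under addition. *)
Lemma one_sub_cos_add a b : 1 - cos (a + b) <= 2 * (1 - cos a) + 2 * (1 - cos b).
Proof.
  replace a with (2 * (a / 2)) by field. replace b with (2 * (b / 2)) by field.
  set (x := a / 2). set (y := b / 2). replace (2 * x + 2 * y) with (2 * (x + y)) by ring.
  rewrite !cos_2a_sin, sin_plus.
  pose proof (sin2_cos2 x) as Hx. pose proof (sin2_cos2 y) as Hy. unfold Rsqr in *.
  set (s := sin x) in *. set (c := cos x) in *. set (s' := sin y) in *. set (c' := cos y) in *.
  assert (0 <= s * s) by nra. assert (0 <= s' * s') by nra. assert (0 <= c * c) by nra. assert (0 <= c' * c') by nra.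
  assert (Hq : (s * c' + c * s') * (s * c' + c * s') <= 2 * (s * s) * (c' * c') + 2 * (c * c) * (s' * s'))
    by (pose proof (pow2_ge_0 (s * c' - c * s')); nra).
  assert (s * s * (c' * c') <= s * s) by nra. assert (c * c * (s' * s') <= s' * s') by nra. lra.
Qed.

(** Membership in the subgroup is not decidable, so its least positive element is found classically;
    Euclidean division does the rest. *)
Lemma subgroup_generator (G : Z -> Prop) (z : Z) : G z -> z <> 0%Z ->
  (forall x y, G x -> G y -> G (x + y)%Z) -> (forall x, G x -> G (- x)%Z) ->
  exists g, (0 < g)%Z /\ G g /\ forall x, G x -> (g | x)%Z.
Proof.
  intros Hz Hnz Hadd Hopp.
  assert (Hex : exists n : nat, (0 < n)%nat /\ G (Z.of_nat n)).
  { exists (Z.to_nat (Z.abs z)). split; [lia|]. rewrite Z2Nat.id by lia.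
    destruct (Z.abs_spec z) as [[_ ->]|[_ ->]]; auto. }
  assert (Hmin : exists n : nat, (0 < n)%nat /\ G (Z.of_nat n) /\ forall m : nat, (0 < m)%nat -> G (Z.of_nat m) -> (n <= m)%nat).
  { destruct Hex as [n Hn]. induction n as [n IH] using lt_wf_ind.
    destruct (classic (exists m, (m < n)%nat /\ (0 < m)%nat /\ G (Z.of_nat m))) as [[m [Hm Hm']]|H].
    - exact (IH m Hm Hm').
    - exists n. destruct Hn as [H1 H2]. repeat split; try assumption. intros m Hm HG.
      destruct (le_lt_dec n m); [assumption|]. exfalso. apply H. now exists m. }
  destruct Hmin as [n [Hn [HGn Hle]]]. exists (Z.of_nat n). split; [lia|]. split; [assumption|].
  assert (Hmul : forall k : nat, G (Z.of_nat n * Z.of_nat k)%Z).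
  { induction k as [|k IH].
    - replace (Z.of_nat n * Z.of_nat 0)%Z with (Z.of_nat n + - Z.of_nat n)%Z by lia. auto.
    - replace (Z.of_nat n * Z.of_nat (S k))%Z with (Z.of_nat n * Z.of_nat k + Z.of_nat n)%Z by lia. auto. }
  assert (HmulZ : forall k : Z, G (Z.of_nat n * k)%Z).
  { intros k. destruct (Z_le_gt_dec 0 k).
    - rewrite <- (Z2Nat.id k) by assumption. apply Hmul.
    - replace (Z.of_nat n * k)%Z with (- (Z.of_nat n * Z.of_nat (Z.to_nat (- k))))%Z by lia. auto. }
  intros x Hx. apply Z.mod_divide; [lia|].
  assert (Hr : G (x mod Z.of_nat n)%Z).
  { rewrite Z.mod_eq by lia. replace (x - Z.of_nat n * (x / Z.of_nat n))%Z with (x + - (Z.of_nat n * (x / Z.of_nat n)))%Z by lia. auto. }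
  pose proof (Z.mod_pos_bound x (Z.of_nat n) ltac:(lia)) as Hb.
  destruct (Z.eq_dec (x mod Z.of_nat n) 0) as [E|E]; [assumption|].
  specialize (Hle (Z.to_nat (x mod Z.of_nat n)) ltac:(lia)). rewrite Z2Nat.id in Hle by lia. specialize (Hle Hr). lia.
Qed.

Lemma Cmod_phi_sq N v x t : mom N v x 0 = 1 ->
  1 - Cmod (phi N v x 0 t) ^ 2 = rsum (fun i => rsum (fun j => v i * v j * (1 - cos (IZR (x i - x j) * t))) N) N.
Proof.
  intros H0. rewrite Cmod_sq. unfold phi, Re, Im; cbv [fst snd].
  replace 1 with (mom N v x 0 * mom N v x 0) at 1 by (rewrite H0; ring). unfold mom.
  set (A := fun j => v j * IZR (x j) ^ 0). set (B := fun j => v j * IZR (x j) ^ 0 * cos (IZR (x j) * t)).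
  set (D := fun j => v j * IZR (x j) ^ 0 * sin (IZR (x j) * t)).
  transitivity (rsum (fun i => A i * rsum A N - (B i * rsum B N + D i * rsum D N)) N).
  - rewrite rsum_minus, rsum_plus, !rsum_scal_r. ring.
  - apply rsum_ext. intros i _. rewrite <- !rsum_scal, <- rsum_plus, <- rsum_minus. apply rsum_ext. intros j _.
    unfold A, B, D. rewrite minus_IZR. replace ((IZR (x i) - IZR (x j)) * t) with (IZR (x i) * t - IZR (x j) * t) by ring.
    rewrite cos_minus. simpl. ring.
Qed.

(** Let [G] be the integers z for which 1 - cos(z t) is at most a constant times 1 - |phi|^2,
    uniformly in t. It is a subgroup containing all differences of jumps, so aperiodicity forces 1
    into it. The bound is explicit and uses no compactness. *)
Lemma aperiodic_phi_bound N v x : (forall j, (j < N)%nat -> 0 <= v j) -> mom N v x 0 = 1 ->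
  (exists i j, (i < N)%nat /\ (j < N)%nat /\ 0 < v i /\ 0 < v j /\ x i <> x j) ->
  (forall g : Z, (2 <= g)%Z -> ~ (forall i j, (i < N)%nat -> (j < N)%nat -> 0 < v i -> 0 < v j -> (g | x i - x j)%Z)) ->
  exists kap, 0 < kap /\ forall t, - PI <= t <= PI -> Cmod (phi N v x 0 t) <= exp (- (kap * t ^ 2)).
Proof.
  intros Hv H0 [i0 [j0 [Hi0 [Hj0 [Vi0 [Vj0 Hx0]]]]]] Hap.
  pose (De := fun t => 1 - Cmod (phi N v x 0 t) ^ 2).
  assert (HDe : forall t, De t = rsum (fun i => rsum (fun j => v i * v j * (1 - cos (IZR (x i - x j) * t))) N) N)
    by (intros; now apply Cmod_phi_sq).
  assert (Pc : forall y, 0 <= 1 - cos y) by (intros y; pose proof (COS_bound y); lra).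
  assert (Hterm : forall i j t, (i < N)%nat -> (j < N)%nat -> v i * v j * (1 - cos (IZR (x i - x j) * t)) <= De t).
  { intros i j t Hi Hj. rewrite HDe.
    pose (vv := fun i => if (i <? N)%nat then v i else 0).
    assert (Vp : forall i, 0 <= vv i) by (intros k; unfold vv; destruct (Nat.ltb_spec k N); [now apply Hv|lra]).
    assert (Ve : forall i, (i < N)%nat -> vv i = v i) by (intros k Hk; unfold vv; destruct (Nat.ltb_spec k N); [reflexivity|lia]).
    rewrite (rsum_ext _ (fun i => rsum (fun j => vv i * vv j * (1 - cos (IZR (x i - x j) * t))) N)).
    2:{ intros k Hk. apply rsum_ext. intros l Hl. now rewrite !Ve. }
    rewrite <- (Ve i Hi), <- (Ve j Hj).
    assert (Pt : forall i j, 0 <= vv i * vv j * (1 - cos (IZR (x i - x j) * t))).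
    { intros; apply Rmult_le_pos; [apply Rmult_le_pos; apply Vp|apply Pc]. }
    eapply Rle_trans; [|apply (rsum_term_le (fun i => rsum (fun j => vv i * vv j * (1 - cos (IZR (x i - x j) * t))) N) N i)].
    - apply (rsum_term_le (fun j => vv i * vv j * (1 - cos (IZR (x i - x j) * t))) N j); [intros; apply Pt|assumption].
    - intros k. apply rsum_nonneg. intros; apply Pt.
    - assumption. }
  assert (De0 : forall t, 0 <= De t).
  { intros t. rewrite HDe. apply rsum_nonneg. intros i Hi. apply rsum_nonneg. intros j Hj.
    apply Rmult_le_pos; [apply Rmult_le_pos; now apply Hv|apply Pc]. }
  pose (G := fun z : Z => exists C, 0 <= C /\ forall t, 1 - cos (IZR z * t) <= C * De t).
  assert (Gd : forall i j, (i < N)%nat -> (j < N)%nat -> 0 < v i -> 0 < v j -> G (x i - x j)%Z).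
  { intros i j Hi Hj Vi Vj. assert (Hvv : 0 < v i * v j) by now apply Rmult_lt_0_compat.
    exists (/ (v i * v j)). split; [now apply Rlt_le, Rinv_0_lt_compat|]. intros t.
    apply Rmult_le_reg_l with (v i * v j); [assumption|].
    rewrite <- Rmult_assoc, Rinv_r, Rmult_1_l by lra. now apply Hterm. }
  assert (Gadd : forall y z, G y -> G z -> G (y + z)%Z).
  { intros y z [C [C0 HC]] [D [D0 HD]]. exists (2 * C + 2 * D). split; [lra|]. intros t.
    rewrite plus_IZR, Rmult_plus_distr_r. eapply Rle_trans; [apply one_sub_cos_add|].
    specialize (HC t). specialize (HD t). lra. }
  assert (Gopp : forall y, G y -> G (- y)%Z).
  { intros y [C [C0 HC]]. exists C. split; [assumption|]. intros t. rewrite opp_IZR, Ropp_mult_distr_l_reverse, cos_neg. apply HC. }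
  destruct (subgroup_generator G (x i0 - x j0)%Z (Gd _ _ Hi0 Hj0 Vi0 Vj0) ltac:(lia) Gadd Gopp) as [g [Hg [HGg Hdiv]]].
  assert (Hg1 : g = 1%Z).
  { destruct (Z_lt_le_dec g 2) as [H|H]; [lia|]. exfalso. apply (Hap g H). intros; apply Hdiv; now apply Gd. }
  subst g. destruct HGg as [C [C0 HC]].
  (* From t^2/16 <= 1 - cos t <= C (1 - |phi|^2) one gets |phi|^2 <= 1 - 2 kap t^2 <= exp(- 2 kap
     t^2). *)
  exists (/ (32 * (C + 1))). assert (Hk : 0 < / (32 * (C + 1))) by (apply Rinv_0_lt_compat; lra). split; [assumption|].
  intros t Ht. specialize (HC t). rewrite Rmult_1_l in HC. pose proof (one_sub_cos_ge t Ht) as H1.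
  assert (H2 : 2 * (/ (32 * (C + 1)) * t ^ 2) <= De t).
  { specialize (De0 t). apply Rmult_le_reg_l with (16 * (C + 1)); [lra|].
    replace (16 * (C + 1) * (2 * (/ (32 * (C + 1)) * t ^ 2))) with (t ^ 2) by (field; lra). nra. }
  unfold De in H2. set (y := / (32 * (C + 1)) * t ^ 2) in *.
  pose proof (exp_ineq1_le (- (2 * y))) as H3.
  assert (H4 : exp (- (2 * y)) = exp (- y) ^ 2) by (rewrite exp_pow; f_equal; simpl; ring).
  assert (H5 : Cmod (phi N v x 0 t) ^ 2 <= exp (- y) ^ 2) by lra.
  pose proof (exp_pos (- y)). pose proof (Cmod_ge_0 (phi N v x 0 t)).
  destruct (Rle_lt_dec (Cmod (phi N v x 0 t)) (exp (- y))) as [K|K]; [assumption|]. nra.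
Qed.

Lemma is_derive_powerRZ (i : Z) u : 0 < u -> is_derive (fun u => powerRZ u i) u (IZR i * powerRZ u (i - 1)).
Proof.
  intros Hu. destruct i as [|n|n].
  - rewrite Rmult_0_l. exact (is_derive_const (V := R_NormedModule) 1 u).
  - simpl powerRZ at 1. assert (E : (Z.pos n - 1)%Z = Z.of_nat (pred (Pos.to_nat n))) by lia.
    rewrite E, <- pow_powerRZ. replace (IZR (Z.pos n)) with (INR (Pos.to_nat n)) by (rewrite INR_IZR_INZ; f_equal; lia).
    auto_derive; [trivial|]. ring.
  - simpl powerRZ at 1. assert (E : (Z.neg n - 1)%Z = (- Z.of_nat (S (Pos.to_nat n)))%Z) by lia.
    rewrite E, powerRZ_neg', <- pow_powerRZ. replace (IZR (Z.neg n)) with (- INR (Pos.to_nat n)) by (rewrite INR_IZR_INZ, <- opp_IZR; f_equal; lia).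
    assert (Hp : forall m, u ^ m <> 0) by (intros; apply pow_nonzero; lra).
    auto_derive; [apply Hp|]. 
    destruct (Pos.to_nat n) as [|m] eqn:En; [lia|]. change (pred (S m)) with m. simpl (u ^ S m). simpl (u ^ S (S m)).
    pose proof (Hp m) as Hm. generalize (INR (S m)); intros y. set (w := u ^ m) in *. field. split; [assumption|lra].
Qed.

Section Tilting.
Context (c d : nat) (p : Z -> R).
Hypothesis hp0 : forall i : Z, 0 <= p i.
Hypothesis hsupp : forall i : Z, (i < - Z.of_nat c \/ Z.of_nat d < i)%Z -> p i = 0.
Hypothesis (hc : (1 <= c)%nat) (hd : (1 <= d)%nat).
Hypothesis (hpc : p (- Z.of_nat c)%Z <> 0) (hpd : p (Z.of_nat d) <> 0).
Hypothesis haper : aperiodic p.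

Definition xs (j : nat) : Z := (Z.of_nat j - Z.of_nat c)%Z.

Lemma Pol_rsum u : Pol c d p u = rsum (fun j => p (xs j) * powerRZ u (xs j)) (S (c + d)).
Proof.
  unfold Pol. rewrite sumZ_rsum. replace (Z.to_nat (Z.of_nat d - - Z.of_nat c + 1)) with (S (c + d)) by lia.
  apply rsum_ext. intros j _. unfold xs. replace (- Z.of_nat c + Z.of_nat j)%Z with (Z.of_nat j - Z.of_nat c)%Z by lia. reflexivity.
Qed.
Lemma Pol_derive u : 0 < u -> is_derive (Pol c d p) u (rsum (fun j => p (xs j) * (IZR (xs j) * powerRZ u (xs j - 1))) (S (c + d))).
Proof.
  intros Hu. apply is_derive_ext with (fun u => rsum (fun j => p (xs j) * powerRZ u (xs j)) (S (c + d))); [intros; symmetry; apply Pol_rsum|].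
  apply (is_derive_rsum (fun j u => p (xs j) * powerRZ u (xs j)) (fun j u => p (xs j) * (IZR (xs j) * powerRZ u (xs j - 1)))).
  intros j. apply (is_derive_scal (fun u => powerRZ u (xs j))). now apply is_derive_powerRZ.
Qed.
Lemma Pol_derive2 u : 0 < u ->
  Derive_n (Pol c d p) 2 u = rsum (fun j => p (xs j) * (IZR (xs j) * (IZR (xs j - 1) * powerRZ u (xs j - 1 - 1)))) (S (c + d)).
Proof.
  intros Hu. simpl Derive_n. rewrite (Derive_ext_loc _ (fun u => rsum (fun j => p (xs j) * (IZR (xs j) * powerRZ u (xs j - 1))) (S (c + d)))).
  - apply is_derive_unique.
    apply (is_derive_rsum (fun j u => p (xs j) * (IZR (xs j) * powerRZ u (xs j - 1)))
       (fun j u => p (xs j) * (IZR (xs j) * (IZR (xs j - 1) * powerRZ u (xs j - 1 - 1))))).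
    intros j. apply (is_derive_scal (fun u => IZR (xs j) * powerRZ u (xs j - 1))).
    apply (is_derive_scal (fun u => powerRZ u (xs j - 1))). now apply is_derive_powerRZ.
  - exists (mkposreal u Hu). intros y Hy. apply is_derive_unique, Pol_derive.
    unfold ball in Hy; simpl in Hy; unfold AbsRing_ball, abs, minus, plus, opp in Hy; simpl in Hy. apply Rabs_def2 in Hy. lra.
Qed.

Lemma powerRZ_pos u i : 0 < u -> 0 < powerRZ u i.
Proof. apply powerRZ_lt. Qed.
Lemma Pol_pos u : 0 < u -> 0 < Pol c d p u.
Proof.
  intros Hu. rewrite Pol_rsum. apply Rlt_le_trans with (p (xs O) * powerRZ u (xs O)).
  - apply Rmult_lt_0_compat; [|now apply powerRZ_pos]. unfold xs. change (Z.of_nat 0 - Z.of_nat c)%Z with (- Z.of_nat c)%Z.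
    destruct (hp0 (- Z.of_nat c)); [assumption|now exfalso; apply hpc].
  - apply (rsum_term_le (fun j => p (xs j) * powerRZ u (xs j))); [|lia]. intros i. apply Rmult_le_pos; [apply hp0|apply Rlt_le, powerRZ_pos, Hu].
Qed.

(* Step law tilted by [u]: it has mean zero exactly at the saddle points of [P]. *)
Definition tw (u : R) (j : nat) : R := p (xs j) * powerRZ u (xs j) / Pol c d p u.

Lemma tw_mom0 u : 0 < u -> mom (S (c + d)) (tw u) xs 0 = 1.
Proof.
  intros Hu. pose proof (Pol_pos u Hu) as HP. unfold mom, tw.
  rewrite (rsum_ext _ (fun j => p (xs j) * powerRZ u (xs j) * / Pol c d p u)) by (intros; simpl; field; lra).
  rewrite rsum_scal_r, <- Pol_rsum. field. lra.
Qed.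
Lemma powerRZ_pred u i : 0 < u -> u * powerRZ u (i - 1) = powerRZ u i.
Proof.
  intros Hu. rewrite <- (powerRZ_1 u) at 1. rewrite <- powerRZ_add by lra. f_equal. lia.
Qed.
Lemma tw_mom1 u : 0 < u -> mom (S (c + d)) (tw u) xs 1 = u * Derive (Pol c d p) u / Pol c d p u.
Proof.
  intros Hu. rewrite (is_derive_unique _ _ _ (Pol_derive u Hu)). unfold mom, tw, Rdiv.
  rewrite <- rsum_scal, <- rsum_scal_r. apply rsum_ext. intros j _. rewrite <- (powerRZ_pred u (xs j) Hu) at 1. ring.
Qed.
Lemma tw_mom2 u : 0 < u -> Derive (Pol c d p) u = 0 ->
  mom (S (c + d)) (tw u) xs 2 = u ^ 2 * Derive_n (Pol c d p) 2 u / Pol c d p u.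
Proof.
  intros Hu H0. pose proof (tw_mom1 u Hu) as H1. rewrite H0 in H1. unfold Rdiv in H1. rewrite Rmult_0_r, Rmult_0_l in H1.
  rewrite <- (Rminus_0_r (mom _ _ _ 2)), <- H1. rewrite Pol_derive2 by assumption. unfold mom, tw, Rdiv.
  rewrite <- rsum_minus, <- rsum_scal, <- rsum_scal_r. apply rsum_ext. intros j _.
  rewrite <- (powerRZ_pred u (xs j) Hu), <- (powerRZ_pred u (xs j - 1) Hu), minus_IZR. ring.
Qed.
Lemma tw_nonneg u j : 0 < u -> 0 <= tw u j.
Proof.
  intros Hu. unfold tw. apply Rmult_le_pos; [apply Rmult_le_pos; [apply hp0|apply Rlt_le, powerRZ_pos, Hu]|].
  apply Rlt_le, Rinv_0_lt_compat, Pol_pos, Hu.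
Qed.
Lemma tw_pos u j : 0 < u -> p (xs j) <> 0 -> 0 < tw u j.
Proof.
  intros Hu Hp. unfold tw. apply Rmult_lt_0_compat; [apply Rmult_lt_0_compat; [|now apply powerRZ_pos]|apply Rinv_0_lt_compat, Pol_pos, Hu].
  destruct (hp0 (xs j)) as [H|H]; [assumption|]. now exfalso; apply Hp.
Qed.
Lemma xs_top : xs (c + d) = Z.of_nat d.
Proof using. clear. unfold xs. lia. Qed.
Lemma xs_bot : xs 0 = (- Z.of_nat c)%Z.
Proof using. clear. unfold xs. lia. Qed.
Lemma tw_mom2_pos u : 0 < u -> 0 < mom (S (c + d)) (tw u) xs 2.
Proof.
  intros Hu. unfold mom. apply Rlt_le_trans with (tw u (c + d) * IZR (xs (c + d)) ^ 2).
  - apply Rmult_lt_0_compat; [apply tw_pos; [assumption|now rewrite xs_top]|]. rewrite xs_top. apply pow_lt. apply IZR_lt. lia.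
  - apply (rsum_term_le (fun j => tw u j * IZR (xs j) ^ 2)); [|lia]. intros i.
    apply Rmult_le_pos; [now apply tw_nonneg|apply pow2_ge_0].
Qed.

Lemma tw_phi_bound u : 0 < u -> exists kap, 0 < kap /\
  forall t, - PI <= t <= PI -> Cmod (phi (S (c + d)) (tw u) xs 0 t) <= exp (- (kap * t ^ 2)).
Proof.
  intros Hu. apply aperiodic_phi_bound.
  - intros; now apply tw_nonneg.
  - now apply tw_mom0.
  - exists O, (c + d)%nat. repeat split; try lia; try (apply tw_pos; [assumption|]).
    + now rewrite xs_bot.
    + now rewrite xs_top.
    + rewrite xs_bot, xs_top. lia.
  (* A common divisor g >= 2 of all differences of jumps would give P(u) = u^(-c) H(u^g). *)
  - intros g Hg Hall. apply haper. exists (- Z.of_nat c)%Z, g, (fun k => p (- Z.of_nat c + g * k)%Z). split; [assumption|].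
    intros i. destruct (Z.eqb_spec ((i - - Z.of_nat c) mod g) 0) as [E|E].
    + f_equal. pose proof (Z.div_mod (i - - Z.of_nat c) g ltac:(lia)). lia.
    + destruct (Req_dec (p i) 0) as [H0|H0]; [assumption|]. exfalso. apply E. apply Z.mod_divide; [lia|].
      assert (Hi : (- Z.of_nat c <= i <= Z.of_nat d)%Z).
      { split.
        - destruct (Z_lt_le_dec i (- Z.of_nat c)); [exfalso; apply H0, hsupp; lia|lia].
        - destruct (Z_lt_le_dec (Z.of_nat d) i); [exfalso; apply H0, hsupp; lia|lia]. }
      pose proof (Hall (Z.to_nat (i + Z.of_nat c)) O ltac:(lia) ltac:(lia)) as H.
      assert (Ex : xs (Z.to_nat (i + Z.of_nat c)) = i) by (unfold xs; lia). rewrite Ex, xs_bot in H.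
      apply H; (apply tw_pos; [assumption|]); [now rewrite Ex|now rewrite xs_bot].
Qed.

Lemma Icoef_expand v x (f : R -> Complex.C) k M : ccont f ->
  Itg (fun t => f t * (phi M v x 0 t * gcis k t))%C = rsum (fun j => v j * Itg (fun t => f t * gcis (k - x j) t)%C) M.
Proof.
  intros Hf. induction M as [|M IH].
  - transitivity (Itg (fun t => RtoC 0 * RtoC 0)%C).
    + apply Itg_ext. intros t. replace (phi 0 v x 0 t) with (RtoC 0) by reflexivity. ring.
    + rewrite Itg_scal by apply ccont_const. unfold rsum; simpl. ring.
  - assert (cM : ccont (fun t => f t * (phi M v x 0 t * gcis k t))%C)
      by (apply ccont_mult; [assumption|apply ccont_mult; [apply phi_ccont|apply gcis_ccont]]).
    assert (cg : ccont (fun t => f t * gcis (k - x M) t)%C) by (apply ccont_mult; [assumption|apply gcis_ccont]).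
    rewrite rsum_S, <- IH, <- (Itg_scal (v M) _ cg), <- (Itg_plus _ _ cM (ccont_scal _ _ cg)).
    apply Itg_ext. intros t.
    replace (phi (S M) v x 0 t) with (phi M v x 0 t + RtoC (v M) * cis (IZR (x M) * t))%C.
    + assert (E : (cis (IZR (x M) * t) * gcis k t)%C = gcis (k - x M) t).
      { unfold gcis. rewrite <- cis_plus. f_equal. rewrite minus_IZR. ring. }
      rewrite <- E. ring.
    + apply injective_projections; unfold phi; rewrite ?rsum_S; simpl; rewrite ?rsum_S; ring.
Qed.

(** Fourier inversion for the tilted walk, by induction on n: a factor of the characteristic
    function is expanded into one step of the walk. *)
Lemma wk_Icoef u n k : 0 < u -> wk c d p n k * powerRZ u k / Pol c d p u ^ n = Icoef (S (c + d)) (tw u) xs n (gcis k).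
Proof.
  intros Hu. pose proof (Pol_pos u Hu) as HP. revert k; induction n as [|n IH]; intros k.
  - simpl wk. unfold Icoef, Itg. pose proof (is_RInt_cos_int k) as H.
    rewrite (RInt_ext _ (fun t => cos (IZR k * t))).
    + rewrite (is_RInt_unique _ _ _ _ H). pose proof PI_neq0. clear H. destruct (Z.eqb_spec k 0) as [E|E]; [rewrite E|]; simpl; field; assumption.
    + intros t _. simpl Cpow. rewrite Cmult_1_l. unfold gcis, cis, Re; simpl. apply cos_neg.
  - rewrite wk_S. rewrite <- Icoef_phi0. unfold Icoef. rewrite Icoef_expand by (apply ccont_pow, phi_ccont).
    unfold Rdiv. rewrite <- !rsum_scal_r. apply rsum_ext. intros j _. fold (xs j).
    change (Itg (fun t => phi (S (c + d)) (tw u) xs 0 t ^ n * gcis (k - xs j) t)%C) with (Icoef (S (c + d)) (tw u) xs n (gcis (k - xs j))).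
    rewrite <- IH. unfold tw. assert (Ek : powerRZ u k = powerRZ u (xs j) * powerRZ u (k - xs j)).
    { rewrite <- powerRZ_add by lra. f_equal. lia. }
    rewrite Ek. simpl pow. field. split; [apply pow_nonzero|]; lra.
Qed.
End Tilting.

(** * Singular behaviour of the generating functions *)

(** Since sq(n) = - tq(n) / (2n - 1), the quotient tq(n)/n is - 2 sq(n) up to n^(-5/2). A logarithm
    thus enters the class through its Euler derivative. *)
Lemma Cls_of_theta f be C : 0 <= C -> f O = 0 ->
  (forall n, (1 <= n)%nat -> Rabs (theta f n - be * tq n) <= C / rt n ^ 3) -> Cls f (- 2 * be).
Proof.
  intros HC f0 H. apply Cls_intro. exists (4 * Rabs be + 2 * C). intros n. unfold fsub, gsub, scal_fps.
  pose proof (Rabs_pos be) as Hb.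
  destruct n as [|n].
  - rewrite f0, rt_0, pow1. simpl sq. replace (0 - - 2 * be * 1) with (2 * be) by ring.
    rewrite Rabs_mult, (Rabs_pos_eq 2) by lra. lra.
  - specialize (H (S n) ltac:(lia)). unfold theta in H. set (y := INR (S n)) in *.
    assert (Hy : 1 <= y) by (apply (le_INR 1); lia).
    pose proof (rt_sq (S n)) as Hr. fold y in Hr. pose proof (rt_pos (S n)) as Hr0.
    pose proof (tq_pos (S n)) as Ht. pose proof (tq_le (S n)) as Ht'.
    rewrite sq_tq. fold y. set (t := tq (S n)) in *. set (r := rt (S n)) in *.
    replace (f (S n) - - 2 * be * (- t / (2 * y - 1))) with (/ y * (y * f (S n) - be * t) + - (be * t * / (y * (2 * y - 1)))) by (field; lra).
    eapply Rle_trans; [apply Rabs_triang|]. rewrite Rabs_Ropp, !Rabs_mult, (Rabs_pos_eq (/ y)), (Rabs_pos_eq t), (Rabs_pos_eq (/ (y * (2 * y - 1))))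
      by (try apply Rlt_le; try apply Rinv_0_lt_compat; nra).
    assert (I1 : / y <= 2 / (r * r)).
    { rewrite Hr. apply Rmult_le_reg_r with (y * (y + 1)); [nra|]. field_simplify; lra. }
    assert (I2 : / (y * (2 * y - 1)) <= 4 / (r * r * (r * r))).
    { rewrite Hr. apply Rmult_le_reg_r with (y * (2 * y - 1) * ((y + 1) * (y + 1))); [repeat apply Rmult_lt_0_compat; lra|].
      replace (/ (y * (2 * y - 1)) * (y * (2 * y - 1) * ((y + 1) * (y + 1)))) with ((y + 1) * (y + 1)) by (field; lra).
      replace (4 / ((y + 1) * (y + 1)) * (y * (2 * y - 1) * ((y + 1) * (y + 1)))) with (4 * (y * (2 * y - 1))) by (field; lra). nra. }
    replace ((4 * Rabs be + 2 * C) / r ^ 5) with (2 / (r * r) * (C / r ^ 3) + Rabs be * (1 / r) * (4 / (r * r * (r * r)))) by (field; lra).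
    apply Rplus_le_compat.
    + apply Rmult_le_compat; [apply Rlt_le, Rinv_0_lt_compat; lra|apply Rabs_pos|assumption|exact H].
    + apply Rmult_le_compat; [apply Rmult_le_pos; lra|apply Rlt_le, Rinv_0_lt_compat; nra| |assumption].
      apply Rmult_le_compat_l; assumption.
Qed.

Lemma scale_cst r a : scale r (cst a) = cst a.
Proof. apply functional_extensionality; intros [|n]; unfold scale; simpl; ring. Qed.
Lemma scale_zvar r : scale r zvar = (cst r * zvar)%fps.
Proof. rewrite cst_star. apply functional_extensionality; intros [|[|n]]; unfold scale, scal_fps, zvar; simpl; ring. Qed.

Lemma Cls_ode g f a : g O = 0 -> f O = 1 -> theta f = (theta g * f)%fps -> Cls g a -> Cls f (val f * a).
Proof.
  intros g0 f0 Hf Hg. destruct (Cls_exp g a Hg g0) as [E [E0 [HE HC]]].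
  replace f with E; [assumption|]. apply (ode_unique (theta g)); try assumption.
  - unfold theta. simpl. ring.
  - now rewrite E0, f0.
Qed.

Lemma Cls_rsum (F : nat -> fps) N : (forall j, (j < N)%nat -> exists a, Cls (F j) a) ->
  exists a, Cls (fun n => rsum (fun j => F j n) N) a.
Proof.
  induction N as [|N IH]; intros H.
  - exists 0. apply (Cls_W5 fzero), W_zero.
  - destruct IH as [a Ha]; [intros; apply H; lia|]. destruct (H N ltac:(lia)) as [b Hb].
    exists (a + b). exact (Cls_add _ _ _ _ Ha Hb).
Qed.

Lemma linear_geometric v j : 0 <= v < 1 -> (INR j + 1) * v ^ j <= / (1 - v).
Proof.
  intros Hv.
  assert (H : forall j, (INR j + 1) * v ^ j <= rsum (fun i => v ^ i) (S j)).
  { intros k. replace (INR k + 1) with (INR (S k)) by apply S_INR. rewrite <- rsum_const. apply rsum_le. intros i Hi.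
    replace k with (i + (k - i))%nat by lia. rewrite pow_add. rewrite <- (Rmult_1_r (v ^ i)) at 2.
    apply Rmult_le_compat_l; [apply pow_le; lra|]. rewrite <- (pow1 (k - i)). apply pow_incr; lra. }
  eapply Rle_trans; [apply H|].
  assert (E : forall n, (1 - v) * rsum (fun i => v ^ i) n = 1 - v ^ n).
  { induction n as [|n IH]; [unfold rsum; simpl; ring|]. rewrite rsum_S, Rmult_plus_distr_l, IH. simpl. ring. }
  apply Rmult_le_reg_l with (1 - v); [lra|]. rewrite E, Rinv_r by lra. pose proof (pow_le v (S j) ltac:(lra)). lra.
Qed.

Lemma geometric_sq_sum y : 0 < y < 1 -> exists M, 0 <= M /\ forall n, rsum (fun j => y ^ j * (1 + INR j ^ 2)) n <= M.
Proof.
  (* With y = w^2 and w = v^2 one has y^j = v^j v^j w^j; each v^j absorbs one factor j + 1 by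
     [linear_geometric], and w^j is summed. *)
  intros Hy. pose (w := sqrt y). pose (v := sqrt w).
  assert (Hw : 0 < w < 1).
  { split; [apply sqrt_lt_R0; lra|]. unfold w. apply Rlt_le_trans with (sqrt 1); [apply sqrt_lt_1_alt; lra|rewrite sqrt_1; lra]. }
  assert (Hv : 0 < v < 1).
  { split; [apply sqrt_lt_R0; lra|]. unfold v. apply Rlt_le_trans with (sqrt 1); [apply sqrt_lt_1_alt; lra|rewrite sqrt_1; lra]. }
  assert (Ew : w * w = y) by (apply sqrt_sqrt; lra). assert (Ev : v * v = w) by (apply sqrt_sqrt; lra).
  assert (H1 : 0 < / (1 - v)) by (apply Rinv_0_lt_compat; lra). assert (H2 : 0 < / (1 - w)) by (apply Rinv_0_lt_compat; lra).
  exists (/ (1 - v) * / (1 - v) * / (1 - w)). split; [apply Rlt_le; repeat apply Rmult_lt_0_compat; assumption|].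
  intros n. apply Rle_trans with (rsum (fun j => / (1 - v) * / (1 - v) * w ^ j) n).
  - apply rsum_le. intros j _. pose proof (linear_geometric v j ltac:(lra)) as L.
    rewrite <- Ew, <- Ev at 1. rewrite !Rpow_mult_distr. rewrite <- Ev, Rpow_mult_distr.
    assert (Hp : 0 < v ^ j) by (apply pow_lt; lra). pose proof (pos_INR j). set (V := v ^ j) in *. set (x := INR j) in *.
    assert (L0 : 0 <= (x + 1) * V) by (apply Rmult_le_pos; lra).
    assert (L2 : ((x + 1) * V) * ((x + 1) * V) <= / (1 - v) * / (1 - v)) by (apply Rmult_le_compat; assumption).
    apply Rle_trans with (((x + 1) * V) * ((x + 1) * V) * (V * V)); [|apply Rmult_le_compat_r; [nra|assumption]].
    replace (V * V * (V * V) * (1 + x ^ 2)) with ((1 + x ^ 2) * (V * V) * (V * V)) by ring.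
    apply Rmult_le_compat_r; [nra|]. replace ((x + 1) * V * ((x + 1) * V)) with ((x + 1) ^ 2 * (V * V)) by ring.
    apply Rmult_le_compat_r; [nra|]. nra.
  - rewrite rsum_scal. apply Rmult_le_compat_l; [apply Rlt_le, Rmult_lt_0_compat; assumption|].
    assert (E : forall n, (1 - w) * rsum (fun i => w ^ i) n = 1 - w ^ n).
    { clear n; induction n as [|n IH]; [unfold rsum; simpl; ring|]. rewrite rsum_S, Rmult_plus_distr_l, IH. simpl. ring. }
    apply Rmult_le_reg_l with (1 - w); [lra|]. rewrite E, Rinv_r by lra. pose proof (pow_le w n ltac:(lra)). lra.
Qed.

Lemma rsum_geom y n : y <> 1 -> rsum (fun i => y ^ i) n = (1 - y ^ n) / (1 - y).
Proof.
  intros Hy. induction n as [|n IH]; [unfold rsum; simpl; field; lra|]. rewrite rsum_S, IH. simpl. field. lra.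
Qed.

Section Asymptotics.
Context (c d : nat) (p : Z -> R) (q : R).
Hypothesis hp0 : forall i : Z, 0 <= p i.
Hypothesis hsupp : forall i : Z, (i < - Z.of_nat c \/ Z.of_nat d < i)%Z -> p i = 0.
Hypothesis (hc : (1 <= c)%nat) (hd : (1 <= d)%nat).
Hypothesis (hpc : p (- Z.of_nat c)%Z <> 0) (hpd : p (Z.of_nat d) <> 0).
Hypothesis haper : aperiodic p.
Hypothesis hq : 0 < q.

Definition Ssub : fps := fun n => rsum (fun j => (if Req_EM_T (p (- Z.of_nat (S j))%Z) 0 then fzero else mk c d p (S j)) n) c.

Lemma Qcoef_fps : Qcoef c d p q = (zvar * (cst q * (Mcoef c d p - mk c d p 0 - Ssub)))%fps.
Proof.
  apply functional_extensionality; intros [|n]; [rewrite zvar_star_0; reflexivity|].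
  rewrite zvar_star_S, cst_star. unfold scal_fps, fsub, gsub. simpl Qcoef. f_equal. f_equal.
  rewrite sumZ_rsum. replace (Z.to_nat (Z.of_nat c - 1 + 1)) with c by lia.
  unfold Ssub. apply rsum_ext. intros j _. replace (1 + Z.of_nat j)%Z with (Z.of_nat (S j)) by lia.
  destruct (Req_EM_T (p (- Z.of_nat (S j))%Z) 0); reflexivity.
Qed.

Lemma mk_nonneg k n : 0 <= mk c d p k n.
Proof. now apply mea_nonneg. Qed.

(** Above altitude c no jump leads directly to 0, so every meander ending at an altitude from c + 1
    to K - 1 can be followed by a catastrophe. *)
Lemma Qcoef_ge n K : (S c <= K)%nat ->
  q * (rsum (fun k => mk c d p k n) K - rsum (fun k => mk c d p k n) (S c)) <= Qcoef c d p q (S n).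
Proof.
  intros HK. rewrite Qcoef_fps, zvar_star_S, cst_star. unfold scal_fps, fsub, gsub.
  apply Rmult_le_compat_l; [lra|]. destruct (Mcoef_val c d p hp0 n) as [E l]. rewrite E.
  pose proof (rsum_le_Series _ K (fun k => mk_nonneg k n) (l1_ex _ l)) as H. fold (val (fun k => mk c d p k n)) in H.
  rewrite (rsum_Sl (fun k => mk c d p k n) c).
  assert (HS : Ssub n <= rsum (fun k => mk c d p (S k) n) c).
  { apply rsum_le. intros j _. destruct (Req_EM_T _ 0); [apply mk_nonneg|lra]. }
  lra.
Qed.
Lemma Qcoef_nonneg n : 0 <= Qcoef c d p q n.
Proof.
  destruct n as [|n]; [simpl; lra|]. eapply Rle_trans; [|apply (Qcoef_ge n (S c)); lia].
  rewrite Rminus_diag. lra.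
Qed.
Lemma Qcoef_le n : Qcoef c d p q (S n) <= q * Mcoef c d p n.
Proof.
  rewrite Qcoef_fps, zvar_star_S, cst_star. unfold scal_fps, fsub, gsub. apply Rmult_le_compat_l; [lra|].
  pose proof (mk_nonneg 0 n). assert (0 <= Ssub n); [|lra].
  apply rsum_nonneg. intros j _. destruct (Req_EM_T _ 0); [unfold fzero, gzero; lra|apply mk_nonneg].
Qed.

Lemma pd_pos : 0 < p (Z.of_nat d).
Proof. destruct (hp0 (Z.of_nat d)) as [H|H]; [assumption|]. now exfalso; apply hpd. Qed.

Lemma mk_climb n l : p (Z.of_nat d) ^ l * mk c d p 0 n <= mk c d p (l * d)%nat (l + n)%nat.
Proof.
  pose proof pd_pos as Hd. induction l as [|l IH]; [simpl; lra|].
  simpl Nat.add. unfold mk at 2. rewrite mea_S by lia.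
  apply Rle_trans with (p (xs c (c + d)) * mea c d p (l + n) (Z.of_nat (S l * d) - xs c (c + d))%Z).
  - rewrite xs_top. replace (Z.of_nat (S l * d) - Z.of_nat d)%Z with (Z.of_nat (l * d)) by lia.
    simpl pow. rewrite Rmult_assoc. apply Rmult_le_compat_l; [lra|exact IH].
  - apply (rsum_term_le (fun j => p (xs c j) * mea c d p (l + n) (Z.of_nat (S l * d) - xs c j)%Z)); [|lia].
    intros j. apply Rmult_le_pos; [apply hp0|now apply mea_nonneg].
Qed.

(** An excursion followed by c + 1 jumps of size d ends above altitude c and may be closed by a
    catastrophe. This carries lower bounds from E over to Q. *)
Lemma Qcoef_ge_E n : q * p (Z.of_nat d) ^ S c * Ecoef c d p n <= Qcoef c d p q (S (S c + n)).
Proof.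
  eapply Rle_trans; [|apply (Qcoef_ge (S c + n)%nat (S (S c * d))); nia].
  rewrite Rmult_assoc. apply Rmult_le_compat_l; [lra|]. rewrite rsum_S.
  pose proof (mk_climb n (S c)) as H. fold (mk c d p 0) in *.
  assert (H2 : rsum (fun k => mk c d p k (S c + n)%nat) (S c) <= rsum (fun k => mk c d p k (S c + n)%nat) (S c * d))
    by (apply rsum_le_len; [nia|intros; apply mk_nonneg]).
  unfold Ecoef. change (mea c d p n 0%Z) with (mk c d p 0 n). lra.
Qed.

Context (tau : R) (Htau : 0 < tau) (Hder : Derive (Pol c d p) tau = 0).
Let rho := / Pol c d p tau.
Let sg2 := mom (S (c + d)) (tw c d p tau) (xs c) 2.
Let bb := / sqrt (2 * sg2).

Lemma rho_pos : 0 < rho.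
Proof. apply Rinv_0_lt_compat. now apply Pol_pos. Qed.
Lemma sg2_pos : 0 < sg2.
Proof. now apply tw_mom2_pos. Qed.
Lemma bb_pos : 0 < bb.
Proof. apply Rinv_0_lt_compat, sqrt_lt_R0. pose proof sg2_pos. lra. Qed.

Lemma wk_local_limit : exists C, 0 <= C /\ forall n (j : nat),
  Rabs (wk c d p n (Z.of_nat j) * rho ^ n - bb * tq n * (/ tau) ^ j) <= C * ((/ tau) ^ j * (1 + INR j ^ 2)) / rt n ^ 3.
Proof.
  destruct (tw_phi_bound c d p hp0 hsupp hc hd hpc hpd haper tau Htau) as [kap [Hk Hphi]].
  destruct (local_limit (S (c + d)) (tw c d p tau) (xs c) kap) as [C [C0 HC]]; try assumption.
  - now apply tw_mom0.
  - rewrite tw_mom1, Hder by assumption. unfold Rdiv. ring.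
  - apply sg2_pos.
  - exists C. split; [assumption|]. intros n j. specialize (HC n (Z.of_nat j)).
    rewrite <- wk_Icoef in HC by assumption. rewrite <- pow_powerRZ, <- INR_IZR_INZ in HC.
    assert (Hj : 0 < tau ^ j) by now apply pow_lt. assert (HP : 0 < Pol c d p tau) by now apply Pol_pos.
    assert (HPn : 0 < Pol c d p tau ^ n) by now apply pow_lt.
    unfold rho. rewrite !pow_inv.
    replace (wk c d p n (Z.of_nat j) * / Pol c d p tau ^ n - bb * tq n * / tau ^ j)
      with (/ tau ^ j * (wk c d p n (Z.of_nat j) * tau ^ j / Pol c d p tau ^ n - tq n / sqrt (2 * sg2))).
    + rewrite Rabs_mult, (Rabs_pos_eq (/ tau ^ j)) by (apply Rlt_le, Rinv_0_lt_compat, Hj).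
      replace (C * (/ tau ^ j * (1 + INR j ^ 2)) / rt n ^ 3) with (/ tau ^ j * (C * (1 + INR j ^ 2) / rt n ^ 3)) by (unfold Rdiv; ring).
      apply Rmult_le_compat_l; [apply Rlt_le, Rinv_0_lt_compat, Hj|exact HC].
    + unfold bb. pose proof sg2_pos. assert (0 < sqrt (2 * sg2)) by (apply sqrt_lt_R0; lra). field. repeat split; lra.
Qed.

Lemma Cls_Lk j : Cls (scale rho (Lk c d p j)) (- 2 * (bb * (/ tau) ^ j)).
Proof.
  destruct wk_local_limit as [C [C0 HC]].
  assert (Hj : 0 < (/ tau) ^ j) by (apply pow_lt, Rinv_0_lt_compat, Htau).
  apply Cls_of_theta with (C * ((/ tau) ^ j * (1 + INR j ^ 2))).
  - apply Rmult_le_pos; [assumption|]. apply Rmult_le_pos; [lra|]. pose proof (pow2_ge_0 (INR j)). lra.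
  - unfold scale, Lk. ring.
  - intros [|n] Hn; [lia|]. specialize (HC (S n) j). unfold theta, scale, Lk.
    replace (INR (S n) * (wk c d p (S n) (Z.of_nat j) / INR (S n) * rho ^ S n)) with (wk c d p (S n) (Z.of_nat j) * rho ^ S n)
      by (field; apply not_0_INR; lia).
    replace (bb * (/ tau) ^ j * tq (S n)) with (bb * tq (S n) * (/ tau) ^ j) by ring. exact HC.
Qed.

Lemma Cls_E : Cls (scale rho (Ecoef c d p)) (val (scale rho (Ecoef c d p)) * (- 2 * bb)).
Proof.
  replace (- 2 * bb) with (- 2 * (bb * (/ tau) ^ 0)) by (simpl; ring).
  apply Cls_ode with (scale rho (Lk c d p 0)).
  - unfold scale, Lk. ring.
  - unfold scale, Ecoef. simpl. ring.
  - rewrite <- !scale_theta, <- scale_star. f_equal. exact (spitzer_E c d p hsupp).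
  - apply Cls_Lk.
Qed.

Lemma Cls_mk k : exists a, Cls (scale rho (mk c d p k)) a.
Proof.
  induction k as [k IH] using lt_wf_ind. destruct k as [|k]; [eexists; exact Cls_E|].
  assert (Hk : INR (S k) <> 0) by (apply not_0_INR; lia).
  destruct (Cls_rsum (fun j => scale rho (cst (INR j) * (Lk c d p j * mk c d p (S k - j)))%fps) (S (S k))) as [a Ha].
  - intros j Hj. destruct j as [|j].
    (* The term j = 0 contains M_k itself, about which nothing is known yet; it disappears because
       of its factor 0. *)
    + exists 0. replace (scale rho (cst (INR 0) * (Lk c d p 0 * mk c d p (S k - 0)))%fps) with fzero; [apply Cls_W5, W_zero|].
      rewrite cst_star. apply functional_extensionality; intros n. unfold scale, scal_fps, fzero, gzero. simpl. ring.
    + destruct (IH (S k - S j)%nat ltac:(lia)) as [b Hb]. eexists. rewrite !scale_star, scale_cst.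
      apply Cls_scal. apply Cls_star; [apply Cls_Lk|exact Hb].
  - exists (/ INR (S k) * a). replace (scale rho (mk c d p (S k))) with
      (cst (/ INR (S k)) * (fun n => rsum (fun j => scale rho (cst (INR j) * (Lk c d p j * mk c d p (S k - j)))%fps n) (S (S k))))%fps.
    + now apply Cls_scal.
    + transitivity (cst (/ INR (S k)) * scale rho (cst (INR (S k)) * mk c d p (S k)))%fps.
      * f_equal. rewrite (spitzer_k c d p hsupp (S k)). apply functional_extensionality; intros n. unfold scale. now rewrite rsum_scal_r.
      * rewrite scale_star, scale_cst.
        transitivity ((cst (/ INR (S k)) * cst (INR (S k))) * scale rho (mk c d p (S k)))%fps; [ring|].
        rewrite <- cst_mul, Rinv_l, cst_one by assumption. ring.
Qed.

(** The local limit theorem is summed over altitudes. With 1 < tau the weights tau^(-j) form a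
    convergent geometric series, which also absorbs the factor 1 + j^2 of the error. *)
Lemma Cls_Apos : 1 < tau -> exists C, 0 <= C /\ forall n, (1 <= n)%nat ->
  Rabs (scale rho (Apos c d p) n - bb / (1 - / tau) * tq n) <= C / rt n ^ 3.
Proof.
  intros Ht. destruct wk_local_limit as [C [C0 HC]]. set (y := / tau) in *.
  assert (Hy : 0 < y < 1) by (unfold y; split; [apply Rinv_0_lt_compat; lra|rewrite <- Rinv_1; apply Rinv_lt_contravar; lra]).
  destruct (geometric_sq_sum y Hy) as [M [M0 HM]]. pose proof bb_pos as Hb.
  pose (B := bb / (1 - y) * / (tau - 1)).
  assert (HB : 0 < B) by (unfold B; apply Rmult_lt_0_compat; [apply Rdiv_lt_0_compat|apply Rinv_0_lt_compat]; lra).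
  exists (C * M + B). split; [pose proof (Rmult_le_pos _ _ C0 M0); lra|]. intros [|n] Hn; [lia|].
  unfold scale, Apos. rewrite <- rsum_scal_r. set (m := S (S n * d)).
  assert (E : rsum (fun k => wk c d p (S n) (Z.of_nat k) * rho ^ S n) m - bb / (1 - y) * tq (S n)
    = rsum (fun k => wk c d p (S n) (Z.of_nat k) * rho ^ S n - bb * tq (S n) * y ^ k) m + - (bb / (1 - y) * tq (S n) * y ^ m)).
  { rewrite rsum_minus, rsum_scal, rsum_geom by lra. field. lra. }
  rewrite E. eapply Rle_trans; [apply Rabs_triang|]. unfold Rdiv at 2. rewrite Rmult_plus_distr_r. apply Rplus_le_compat.
  - eapply Rle_trans; [apply rsum_abs|].
    apply Rle_trans with (rsum (fun k => C / rt (S n) ^ 3 * (y ^ k * (1 + INR k ^ 2))) m).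
    + apply rsum_le. intros k _. eapply Rle_trans; [apply HC|]. apply Req_le. unfold Rdiv; ring.
    + rewrite rsum_scal. replace (C * M * / rt (S n) ^ 3) with (C / rt (S n) ^ 3 * M) by (unfold Rdiv; ring).
      apply Rmult_le_compat_l; [|apply HM]. apply Rmult_le_pos; [assumption|apply Rlt_le, Rinv_0_lt_compat, rt_pow_pos].
  - rewrite Rabs_Ropp. pose proof (tq_pos (S n)). pose proof (tq_le (S n)) as Htq. pose proof (rt_pos (S n)) as Hr.
    assert (Hbq : 0 < bb / (1 - y)) by (apply Rdiv_lt_0_compat; lra).
    assert (Hym : 0 < y ^ m) by (apply pow_lt; lra).
    rewrite Rabs_pos_eq by (apply Rmult_le_pos; [apply Rmult_le_pos|]; lra).
    assert (Hm : y ^ m <= / (tau - 1) / (rt (S n) * rt (S n))).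
    { unfold y. rewrite pow_inv, rt_sq. unfold Rdiv. rewrite <- Rinv_mult. apply rinv_le.
      - apply Rmult_lt_0_compat; [lra|]. pose proof (pos_INR (S n)); lra.
      (* Bernoulli's inequality tau^m >= 1 + m (tau - 1): the part of the geometric series beyond
         the highest altitude n d is O(1/n). *)
      - pose proof (poly m (tau - 1) ltac:(lra)) as Pm. replace (1 + (tau - 1)) with tau in Pm by ring.
        assert (INR (S n) + 1 <= INR m) by (rewrite <- S_INR; apply le_INR; unfold m; nia). nra. }
    unfold B. replace (bb / (1 - y) * / (tau - 1) * / rt (S n) ^ 3)
      with (bb / (1 - y) * (1 / rt (S n)) * (/ (tau - 1) / (rt (S n) * rt (S n)))) by (field; repeat split; lra).
    apply Rmult_le_compat; [apply Rmult_le_pos; lra|lra| |assumption].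
    apply Rmult_le_compat_l; lra.
Qed.

Lemma Cls_M : 1 < tau -> exists a, Cls (scale rho (Mcoef c d p)) a.
Proof.
  intros Ht. destruct (Cls_Apos Ht) as [C [C0 HC]].
  pose (L := fun n => match n with O => 0 | S _ => Apos c d p n / INR n end).
  assert (HL : theta L = Apos c d p).
  { apply functional_extensionality; intros [|n]; unfold theta, L; [simpl; ring|]. field. apply not_0_INR; lia. }
  eexists. apply Cls_ode with (scale rho L).
  - unfold scale, L. ring.
  - unfold scale, Mcoef. simpl. unfold sumZ; simpl. ring.
  - rewrite <- !scale_theta, HL, <- scale_star. f_equal. now apply spitzer_M.
  - apply Cls_of_theta with C; [assumption|unfold scale, L; ring|].
    intros n Hn. rewrite <- scale_theta, HL. now apply HC.
Qed.

Lemma Cls_Q : 1 < tau -> exists a, Cls (scale rho (Qcoef c d p q)) a.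
Proof.
  intros Ht. destruct (Cls_M Ht) as [a Ha]. destruct (Cls_mk 0) as [b Hb].
  destruct (Cls_rsum (fun j => scale rho (if Req_EM_T (p (- Z.of_nat (S j))%Z) 0 then fzero else mk c d p (S j))) c) as [e He].
  { intros j _. destruct (Req_EM_T _ 0); [|apply Cls_mk]. exists 0. apply Cls_W5.
    replace (scale rho fzero) with fzero; [apply W_zero|]. apply functional_extensionality; intros n. unfold scale, fzero, gzero. ring. }
  assert (HS : scale rho Ssub = (fun n => rsum (fun j => scale rho (if Req_EM_T (p (- Z.of_nat (S j))%Z) 0 then fzero else mk c d p (S j)) n) c)).
  { apply functional_extensionality; intros n. unfold scale, Ssub. now rewrite rsum_scal_r. }
  rewrite <- HS in He. eexists. rewrite Qcoef_fps, !scale_star, scale_zvar, scale_cst, !scale_sub.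
  replace (cst rho * zvar * (cst q * (scale rho (Mcoef c d p) - scale rho (mk c d p 0) - scale rho Ssub)))%fps
    with (zvar * (cst rho * (cst q * (scale rho (Mcoef c d p) - scale rho (mk c d p 0) - scale rho Ssub))))%fps by ring.
  apply Cls_zvar, Cls_scal, Cls_scal, Cls_sub; [apply Cls_sub|]; eassumption.
Qed.

Lemma E_nonneg n : 0 <= scale rho (Ecoef c d p) n.
Proof. unfold scale. apply Rmult_le_pos; [apply (mk_nonneg 0)|apply pow_le, Rlt_le, rho_pos]. Qed.
Lemma E_val_ge1 : 1 <= val (scale rho (Ecoef c d p)).
Proof.
  eapply Rle_trans; [|apply (rsum_le_Series _ 1 E_nonneg), (l1_ex _ (Cls_l1 _ _ Cls_E))].
  rewrite rsum_S. unfold rsum, scale, Ecoef; simpl. lra.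
Qed.

(** The square-root coefficient of E is negative, and so is sq(n); the main term is thus positive of
    order n^(-3/2) and dominates the remainder n^(-5/2). *)
Lemma E_lower : exists K N, 0 < K /\ forall n, (N <= n)%nat -> K / rt n ^ 3 <= scale rho (Ecoef c d p) n.
Proof.
  set (V := val (scale rho (Ecoef c d p))). pose proof E_val_ge1 as HV. fold V in HV. pose proof bb_pos as Hb.
  destruct (Cls_asym _ _ Cls_E) as [C HC]. fold V in HC. pose proof (bd_C_nonneg _ _ _ HC) as C0.
  set (al := 2 * (V * bb)). assert (Hal : 0 < al) by (unfold al; nra).
  destruct (archimed_cor1 (al / (8 * (C + 1))) ltac:(apply Rdiv_lt_0_compat; lra)) as [N [HN HN0]].
  exists (al / 8), N. split; [lra|]. intros n Hn. specialize (HC n). unfold fsub, gsub, scal_fps in HC.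
  set (e := scale rho (Ecoef c d p) n) in *.
  pose proof (rt_sq n) as Hr. pose proof (rt_pos n) as Hr0. pose proof (tq_ge n) as Ht. pose proof (tq_pos n) as Ht0.
  assert (Hn1 : 1 <= INR n) by (apply (le_INR 1); lia).
  assert (Hs : / (4 * rt n ^ 3) <= - sq n).
  { rewrite sq_tq. replace (- (- tq n / (2 * INR n - 1))) with (tq n * / (2 * INR n - 1)) by (field; lra).
    replace (/ (4 * rt n ^ 3)) with (/ (2 * rt n) * / (2 * (INR n + 1))) by (rewrite <- Hr; field; lra).
    apply Rmult_le_compat; try (apply Rlt_le, Rinv_0_lt_compat; lra); [assumption|]. apply rinv_le; lra. }
  assert (HCn : C / rt n ^ 5 <= al / 8 / rt n ^ 3).
  { replace (C / rt n ^ 5) with (C / (INR n + 1) / rt n ^ 3) by (rewrite <- Hr; field; lra).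
    unfold Rdiv at 1 3. apply Rmult_le_compat_r; [apply Rlt_le, Rinv_0_lt_compat, rt_pow_pos|].
    assert (HiN : / INR n <= / INR N) by (apply rinv_le; [now apply lt_0_INR|now apply le_INR]).
    assert (Hin : / (INR n + 1) <= / INR n) by (apply rinv_le; lra).
    assert (H3 : / (INR n + 1) <= al / (8 * (C + 1))) by lra.
    apply Rle_trans with (C * (al / (8 * (C + 1)))); [apply Rmult_le_compat_l; assumption|].
    apply Rmult_le_reg_r with (8 * (C + 1)); [lra|].
    replace (C * (al / (8 * (C + 1))) * (8 * (C + 1))) with (C * al) by (field; lra). nra. }
  apply Rabs_le_between in HC.
  assert (Hm : al * / (4 * rt n ^ 3) <= al * - sq n) by (apply Rmult_le_compat_l; lra).
  replace (al * / (4 * rt n ^ 3)) with (al / 8 / rt n ^ 3 + al / 8 / rt n ^ 3) in Hm by (field; lra).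
  replace (V * (- 2 * bb) * sq n) with (al * - sq n) in HC by (unfold al; ring). lra.
Qed.

(** Supplies the two consecutive positive coefficients on which [lower_bound_disc] depends. *)
Lemma Q_eventually_pos : exists m, forall n, (m <= n)%nat -> 0 < Qcoef c d p q n.
Proof.
  destruct E_lower as [K [N [HK HN]]]. exists (S (S c + N)). intros n Hn.
  replace n with (S (S c + (n - S (S c)))) by lia. eapply Rlt_le_trans; [|apply Qcoef_ge_E].
  specialize (HN (n - S (S c))%nat ltac:(lia)). pose proof rho_pos as Hr.
  assert (HE : 0 < scale rho (Ecoef c d p) (n - S (S c))%nat).
  { eapply Rlt_le_trans; [|exact HN]. apply Rdiv_lt_0_compat; [assumption|apply rt_pow_pos]. }
  apply Rmult_lt_0_compat; [apply Rmult_lt_0_compat; [assumption|apply pow_lt, pd_pos]|].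
  unfold scale in HE. pose proof (pow_lt rho (n - S (S c)) Hr).
  destruct (Rle_lt_dec (Ecoef c d p (n - S (S c))) 0) as [H0|H0]; [nra|assumption].
Qed.

(** If a were nonnegative, the coefficients of Q would be at most O(n^(-5/2)), against the lower
    bound of order n^(-3/2) inherited from E. Hence eta = - a is positive, and dividing by it is
    legitimate. *)
Lemma Q_coef_neg a : Cls (scale rho (Qcoef c d p q)) a -> a < 0.
Proof.
  intros Ha. destruct (Rlt_le_dec a 0) as [H|H]; [assumption|]. exfalso.
  destruct (Cls_asym _ _ Ha) as [C HC]. pose proof (bd_C_nonneg _ _ _ HC) as C0.
  destruct E_lower as [K [N [HK HN]]]. pose proof rho_pos as Hr.
  set (m := S (S c)). pose (w := q * p (Z.of_nat d) ^ S c * rho ^ m).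
  assert (Hw : 0 < w) by (unfold w; apply Rmult_lt_0_compat; [apply Rmult_lt_0_compat; [assumption|apply pow_lt, pd_pos]|now apply pow_lt]).
  destruct (archimed_cor1 (w * K / (C + 1)) ltac:(apply Rdiv_lt_0_compat; [now apply Rmult_lt_0_compat|lra])) as [N' [HN' HN0]].
  set (n := (N + N')%nat). specialize (HN n ltac:(unfold n; lia)). specialize (HC (m + n)%nat).
  pose proof (Qcoef_ge_E n) as HQ. change (S (S c + n)) with (m + n)%nat in HQ.
  unfold fsub, gsub, scal_fps in HC. apply Rabs_le_between in HC.
  assert (Hsq : sq (m + n)%nat <= 0) by (apply sq_neg; unfold m; lia).
  assert (H1 : w * (K / rt n ^ 3) <= scale rho (Qcoef c d p q) (m + n)%nat).
  { apply Rle_trans with (w * scale rho (Ecoef c d p) n); [apply Rmult_le_compat_l; lra|].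
    unfold scale, w. rewrite pow_add.
    replace (q * p (Z.of_nat d) ^ S c * rho ^ m * (Ecoef c d p n * rho ^ n)) with (q * p (Z.of_nat d) ^ S c * Ecoef c d p n * (rho ^ m * rho ^ n)) by ring.
    apply Rmult_le_compat_r; [apply Rmult_le_pos; apply pow_le; lra|exact HQ]. }
  assert (H2 : scale rho (Qcoef c d p q) (m + n)%nat <= C / rt n ^ 5).
  { apply Rle_trans with (C / rt (m + n) ^ 5); [nra|]. apply Rmult_le_compat_l; [assumption|]. apply inv_rt_le. lia. }
  pose proof (rt_sq n) as Hr2. pose proof (rt_pos n) as Hr0.
  assert (H3 : w * K * (INR n + 1) <= C).
  { apply Rmult_le_reg_r with (/ rt n ^ 5); [apply Rinv_0_lt_compat, rt_pow_pos|].
    replace (w * K * (INR n + 1) * / rt n ^ 5) with (w * (K / rt n ^ 3)) by (rewrite <- Hr2; field; lra).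
    unfold Rdiv in H2. lra. }
  assert (HnN : INR N' <= INR n) by (apply le_INR; unfold n; lia).
  assert (HN'0 : 0 < INR N') by now apply lt_0_INR.
  assert (H4 : C + 1 < w * K * INR N').
  { apply Rmult_lt_reg_r with (/ INR N'); [now apply Rinv_0_lt_compat|]. rewrite Rmult_assoc, Rinv_r, Rmult_1_r by lra.
    apply Rmult_lt_reg_l with (/ (C + 1)); [apply Rinv_0_lt_compat; lra|].
    rewrite <- Rmult_assoc, Rinv_l, Rmult_1_l by lra. unfold Rdiv in HN'. lra. }
  assert (0 < w * K) by nra. nra.
Qed.

End Asymptotics.

(** * Catastrophes: the series 1 / (1 - Q) *)

(** Far enough out, each block from k to 2k contributes at least kap/2, which contradicts Cauchy's
    criterion. *)
Lemma harmonic_diverges a kap N : 0 < kap -> (forall n, (N <= n)%nat -> kap / (INR n + 1) <= a n) -> ~ ex_series a.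
Proof.
  intros Hk H [l Hl]. apply is_lim_seq_rsum in Hl.
  assert (H2 : is_lim_seq (fun m => rsum a (2 * m)) l).
  { apply (is_lim_seq_subseq (rsum a) l (fun m => (2 * m)%nat)); [|assumption].
    intros P [M HM]. exists M. intros n Hn. apply HM. lia. }
  pose proof (is_lim_seq_minus' _ _ _ _ H2 Hl) as H3. rewrite Rminus_diag in H3.
  apply (is_lim_seq_incr_n _ (S N)) in H3.
  assert (Hge : forall m, kap / 2 <= rsum a (2 * (m + S N)) - rsum a (m + S N)).
  { intros m. set (k := (m + S N)%nat). replace (2 * k)%nat with (k + k)%nat by lia. rewrite rsum_split.
    assert (Hk0 : 0 < INR k) by (apply lt_0_INR; unfold k; lia).
    apply Rle_trans with (rsum (fun _ => kap / (2 * INR k)) k).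
    - rewrite rsum_const. apply Req_le. field. lra.
    - replace (rsum a k + rsum (fun j => a (k + j)%nat) k - rsum a k) with (rsum (fun j => a (k + j)%nat) k) by ring.
      apply rsum_le. intros j Hj. eapply Rle_trans; [|apply H; unfold k; lia].
      unfold Rdiv. apply Rmult_le_compat_l; [lra|]. pose proof (pos_INR (k + j)). apply rinv_le; [lra|].
      assert (INR (k + j) + 1 <= INR k + INR k) by (rewrite <- S_INR, <- plus_INR; apply le_INR; lia). lra. }
  pose proof (is_lim_seq_le _ _ _ _ Hge (is_lim_seq_const _) H3) as HF. simpl in HF. lra.
Qed.

Section DerivedSeries.
Context (c d : nat) (p : Z -> R) (q : R).

Lemma Dlist_length n : length (Dlist c d p q n) = S n.
Proof. induction n as [|n IH]; [reflexivity|]. simpl Dlist. rewrite length_app, IH. simpl. lia. Qed.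
Lemma Dlist_nth n k : (k <= n)%nat -> nth k (Dlist c d p q n) 0 = Dcoef c d p q k.
Proof.
  intros H. induction n as [|n IH].
  - replace k with O by lia. reflexivity.
  - destruct (Nat.eq_dec k (S n)) as [->|Hne]; [reflexivity|].
    simpl Dlist. rewrite app_nth1 by (rewrite Dlist_length; lia). apply IH. lia.
Qed.
Lemma Dcoef_S n : Dcoef c d p q (S n) = rsum (fun k => Qcoef c d p q (S k) * Dcoef c d p q (n - k)%nat) (S n).
Proof.
  unfold Dcoef at 1.
  change (Dlist c d p q (S n)) with (Dlist c d p q n ++ fold_right Rplus 0
    (map (fun k => Qcoef c d p q k * nth (S n - k) (Dlist c d p q n) 0) (seq 1 (S n))) :: nil).
  rewrite app_nth2 by (rewrite Dlist_length; lia). rewrite Dlist_length, Nat.sub_diag.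
  rewrite <- seq_shift, map_map, fold_rsum. change (rsum (fun k => Qcoef c d p q (S k) * nth (S n - S k) (Dlist c d p q n) 0) (S n) = rsum (fun k => Qcoef c d p q (S k) * Dcoef c d p q (n - k)%nat) (S n)).
  apply rsum_ext. intros k Hk. simpl Nat.sub. now rewrite Dlist_nth by lia.
Qed.
Lemma Dcoef_inverse : ((fone - Qcoef c d p q) * Dcoef c d p q)%fps = fone.
Proof.
  replace ((fone - Qcoef c d p q) * Dcoef c d p q)%fps with (Dcoef c d p q - Qcoef c d p q * Dcoef c d p q)%fps by ring.
  apply functional_extensionality; intros [|n]; unfold fsub, gsub.
  - rewrite star_0. unfold Dcoef, fone, gone. simpl. ring.
  - rewrite Dcoef_S, star_def, (rsum_Sl _ (S n)). simpl (Qcoef c d p q 0). unfold fone, gone.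
    match goal with |- ?x - (?y + ?z) = _ => change z with x end.
    ring.
Qed.
Lemma ecoef_star : ecoef c d p q = (Dcoef c d p q * Ecoef c d p)%fps.
Proof. apply functional_extensionality; intros n. unfold ecoef. rewrite fold_rsum. reflexivity. Qed.
End DerivedSeries.

Section Growth.
Context (c d : nat) (p : Z -> R) (q : R).
Hypothesis hp0 : forall i : Z, 0 <= p i.
Hypothesis hsupp : forall i : Z, (i < - Z.of_nat c \/ Z.of_nat d < i)%Z -> p i = 0.
Hypothesis (hc : (1 <= c)%nat) (hd : (1 <= d)%nat).
Hypothesis (hpc : p (- Z.of_nat c)%Z <> 0) (hpd : p (Z.of_nat d) <> 0).
Hypothesis haper : aperiodic p.
Hypothesis hq : 0 < q.

Lemma mk_S k n : mk c d p k (S n) = rsum (fun j => p (xs c j) * mea c d p n (Z.of_nat k - xs c j)%Z) (S (c + d)).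
Proof. unfold mk. rewrite mea_S by lia. reflexivity. Qed.

Lemma mea_shift_weight_le v n z : 1 <= v -> (z <= Z.of_nat d)%Z ->
  rsum (fun k => mea c d p n (Z.of_nat k - z)%Z * v ^ k) (S (S n * d))
  <= powerRZ v z * rsum (fun l => mk c d p l n * v ^ l) (S (n * d)).
Proof.
  intros Hv Hz. assert (Hv0 : 0 < v) by lra.
  assert (P : forall l, 0 <= mk c d p l n * v ^ l) by (intros; apply Rmult_le_pos; [now apply mk_nonneg|apply pow_le; lra]).
  assert (Sup : forall l, (S (n * d) <= l)%nat -> mk c d p l n * v ^ l = 0).
  { intros l Hl. unfold mk. rewrite mea_support_high by (assumption || lia). ring. }
  destruct (Z_lt_le_dec z 0) as [Hz0|Hz0].
  - set (w := Z.to_nat (- z)). assert (Hw : z = (- Z.of_nat w)%Z) by (unfold w; lia).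
    rewrite Hw, powerRZ_neg', <- pow_powerRZ. assert (Hvw : 0 < v ^ w) by now apply pow_lt.
    apply Rle_trans with (/ v ^ w * rsum (fun l => mk c d p l n * v ^ l) (w + S (S n * d))).
    + rewrite rsum_split, Rmult_plus_distr_l.
      pose proof (rsum_nonneg (fun l => mk c d p l n * v ^ l) w (fun l _ => P l)).
      assert (0 <= / v ^ w * rsum (fun l => mk c d p l n * v ^ l) w) by (apply Rmult_le_pos; [apply Rlt_le, Rinv_0_lt_compat|]; assumption).
      rewrite <- (rsum_scal (/ v ^ w) (fun k => mk c d p (w + k) n * v ^ (w + k))).
      rewrite (rsum_ext _ (fun k => / v ^ w * (mk c d p (w + k) n * v ^ (w + k)))); [lra|].
      intros k _. unfold mk. rewrite pow_add. replace (Z.of_nat k - - Z.of_nat w)%Z with (Z.of_nat (w + k)) by lia. field. lra.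
    + apply Rmult_le_compat_l; [apply Rlt_le, Rinv_0_lt_compat, Hvw|]. apply Req_le.
      destruct (le_lt_dec (S (n * d)) (w + S (S n * d))) as [H|H]; [|nia].
      replace (w + S (S n * d))%nat with (S (n * d) + (w + S (S n * d) - S (n * d)))%nat by lia.
      rewrite rsum_split, (rsum_zero (fun k => mk c d p (S (n * d) + k) n * v ^ (S (n * d) + k))); [ring|]. intros; apply Sup; lia.
  - set (w := Z.to_nat z). assert (Hw : z = Z.of_nat w) by (unfold w; lia).
    rewrite Hw, <- pow_powerRZ.
    replace (S (S n * d)) with (w + (S (n * d) + (d - w)))%nat by (simpl; lia).
    rewrite rsum_split, rsum_split, rsum_zero, (rsum_zero (fun k => mea c d p n (Z.of_nat (w + (S (n * d) + k)) - Z.of_nat w)%Z * v ^ (w + (S (n * d) + k)))).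
    + rewrite Rplus_0_l, Rplus_0_r, <- rsum_scal. apply Req_le, rsum_ext. intros k _. unfold mk. rewrite pow_add.
      replace (Z.of_nat (w + k) - Z.of_nat w)%Z with (Z.of_nat k) by lia. ring.
    + intros k _. rewrite mea_support_high by (assumption || lia). ring.
    + intros k Hk. rewrite mea_neg by lia. ring.
Qed.

(** Weighting altitude k by v^k, each step multiplies the total by at most P(v), paths killed below
    zero being the loss. The free parameter v >= 1 is what locates the radius of convergence of
    M. *)
Lemma mk_weight_le v n : 1 <= v -> rsum (fun l => mk c d p l n * v ^ l) (S (n * d)) <= Pol c d p v ^ n.
Proof.
  intros Hv. induction n as [|n IH].
  - rewrite rsum_S. unfold rsum, mk; simpl. lra.
  - rewrite (rsum_ext _ (fun k => rsum (fun j => p (xs c j) * (mea c d p n (Z.of_nat k - xs c j)%Z * v ^ k)) (S (c + d)))).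
    2:{ intros k _. rewrite mk_S, <- rsum_scal_r. apply rsum_ext; intros; ring. }
    rewrite rsum_swap. simpl pow. rewrite (Pol_rsum c d p hc hd), <- rsum_scal_r. rewrite <- (Pol_rsum c d p hc hd). apply rsum_le. intros j Hj.
    rewrite rsum_scal, Rmult_assoc. apply Rmult_le_compat_l; [apply hp0|].
    eapply Rle_trans; [apply mea_shift_weight_le; [assumption|unfold xs; lia]|].
    apply Rmult_le_compat_l; [apply powerRZ_le; lra|exact IH].
Qed.

Lemma Mcoef_rsum n : Mcoef c d p n = rsum (fun k => mk c d p k n) (S (n * d)).
Proof.
  unfold Mcoef. rewrite sumZ_rsum. replace (Z.to_nat (Z.of_nat n * Z.of_nat d - 0 + 1)) with (S (n * d)) by lia. reflexivity.
Qed.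
Lemma Mcoef_le v n : 1 <= v -> Mcoef c d p n <= Pol c d p v ^ n.
Proof.
  intros Hv. rewrite Mcoef_rsum. eapply Rle_trans; [|apply (mk_weight_le v n Hv)]. apply rsum_le. intros k _.
  rewrite <- (Rmult_1_r (mk c d p k n)) at 1. apply Rmult_le_compat_l; [now apply mk_nonneg|]. apply pow_R1_Rle. assumption.
Qed.

Lemma Q_summable_below v r : 1 <= v -> 0 <= r -> r * Pol c d p v < 1 -> ex_series (scale r (Qcoef c d p q)).
Proof.
  intros Hv Hr HrP. pose proof (Pol_pos c d p hp0 hc hd hpc v ltac:(lra)) as HP.
  assert (G : ex_series (fun n => q * r * (r * Pol c d p v) ^ n)).
  { apply (ex_series_scal_l (K := R_AbsRing) (q * r) (fun n => (r * Pol c d p v) ^ n)). apply ex_series_geom. rewrite Rabs_pos_eq; [assumption|]. apply Rmult_le_pos; lra. }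
  apply ex_series_incr_1. apply (ex_series_le (fun n => scale r (Qcoef c d p q) (S n)) _) with (2 := G).
  intros n. unfold norm; simpl; unfold abs; simpl.
  rewrite Rabs_pos_eq by (unfold scale; apply Rmult_le_pos; [now apply Qcoef_nonneg|apply pow_le; assumption]).
  unfold scale. simpl pow. rewrite Rpow_mult_distr.
  replace (q * r * (r ^ n * Pol c d p v ^ n)) with (q * Pol c d p v ^ n * (r * r ^ n)) by ring.
  apply Rmult_le_compat_r; [apply Rmult_le_pos; [assumption|now apply pow_le]|].
  eapply Rle_trans; [now apply Qcoef_le|]. apply Rmult_le_compat_l; [lra|now apply Mcoef_le].
Qed.

Definition altsum (n : nat) : R := rsum (fun k => INR k * mk c d p k n) (S (n * d)).

Lemma mea_shift_alt_ge n z : (z <= Z.of_nat d)%Z ->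
  rsum (fun l => (INR l + IZR z) * mk c d p l n) (S (n * d)) <= rsum (fun k => INR k * mea c d p n (Z.of_nat k - z)%Z) (S (S n * d)).
Proof.
  intros Hz.
  assert (P : forall k, 0 <= INR k * mea c d p n (Z.of_nat k - z)%Z) by (intros; apply Rmult_le_pos; [apply pos_INR|now apply mea_nonneg]).
  destruct (Z_lt_le_dec z 0) as [Hz0|Hz0].
  - set (w := Z.to_nat (- z)). assert (Hw : z = (- Z.of_nat w)%Z) by (unfold w; lia).
    assert (Hneg : forall l, (l <= w)%nat -> (INR l + IZR z) * mk c d p l n <= 0).
    { intros l Hl. rewrite Hw, opp_IZR, <- INR_IZR_INZ. apply le_INR in Hl. pose proof (mk_nonneg c d p hp0 l n). nra. }
    assert (Hneg_sum : forall m, (m <= w)%nat -> rsum (fun l => (INR l + IZR z) * mk c d p l n) m <= 0).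
    { intros m Hm. rewrite <- (rsum_zero (fun _ => 0) m) by reflexivity. apply rsum_le. intros; apply Hneg; lia. }
    destruct (le_lt_dec (S (n * d)) w) as [H|H].
    + eapply Rle_trans; [now apply Hneg_sum|]. apply rsum_nonneg. intros; apply P.
    + replace (S (n * d)) with (w + (S (n * d) - w))%nat by lia. rewrite rsum_split.
      pose proof (Hneg_sum w (le_n _)).
      apply Rle_trans with (rsum (fun k => INR k * mea c d p n (Z.of_nat k - z)%Z) (S (n * d) - w)).
      * rewrite (rsum_ext (fun k => INR k * mea c d p n (Z.of_nat k - z)%Z) (fun k => (INR (w + k) + IZR z) * mk c d p (w + k) n)); [lra|].
        intros k _. unfold mk. rewrite plus_INR, Hw, opp_IZR, <- INR_IZR_INZ. f_equal; [ring|f_equal; lia].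
      * apply rsum_le_len; [change (S n * d)%nat with (d + n * d)%nat; lia|exact P].
  - set (w := Z.to_nat z). assert (Hw : z = Z.of_nat w) by (unfold w; lia).
    apply Rle_trans with (rsum (fun k => INR k * mea c d p n (Z.of_nat k - z)%Z) (w + S (n * d))).
    + rewrite rsum_split. pose proof (rsum_nonneg _ w (fun k _ => P k)).
      rewrite (rsum_ext (fun k => INR (w + k) * mea c d p n (Z.of_nat (w + k) - z)%Z) (fun l => (INR l + IZR z) * mk c d p l n)); [lra|].
      intros k _. unfold mk. rewrite plus_INR, Hw, <- INR_IZR_INZ. f_equal; [ring|f_equal; lia].
    + apply rsum_le_len; [change (S n * d)%nat with (d + n * d)%nat; lia|exact P].
Qed.

(** A jump adds its size to the altitude, and paths that would go below zero contribute negative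
    terms, so discarding them only raises the first moment. With nonnegative drift it grows at least
    by the factor P(1). *)
Lemma altsum_S n : 0 <= rsum (fun j => p (xs c j) * IZR (xs c j)) (S (c + d)) ->
  Pol c d p 1 * altsum n <= altsum (S n).
Proof.
  intros Hdrift. unfold altsum at 2.
  rewrite (rsum_ext _ (fun k => rsum (fun j => p (xs c j) * (INR k * mea c d p n (Z.of_nat k - xs c j)%Z)) (S (c + d)))).
  2:{ intros k _. rewrite mk_S, <- rsum_scal. apply rsum_ext; intros; ring. }
  rewrite rsum_swap.
  apply Rle_trans with (rsum (fun j => p (xs c j) * rsum (fun l => (INR l + IZR (xs c j)) * mk c d p l n) (S (n * d))) (S (c + d))).
  - rewrite (rsum_ext _ (fun j => p (xs c j) * altsum n + p (xs c j) * IZR (xs c j) * rsum (fun l => mk c d p l n) (S (n * d)))).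
    + rewrite rsum_plus, !rsum_scal_r, (Pol_rsum c d p hc hd).
      rewrite (rsum_ext (fun j => p (xs c j) * powerRZ 1 (xs c j)) (fun j => p (xs c j))).
      * pose proof (rsum_nonneg (fun l => mk c d p l n) (S (n * d)) (fun l _ => mk_nonneg c d p hp0 l n)). nra.
      * intros. replace (powerRZ 1 (xs c k)) with 1 by (symmetry; rewrite powerRZ_Rpower by lra; unfold Rpower; rewrite ln_1, Rmult_0_r; apply exp_0). ring.
    + intros j _. unfold altsum. rewrite <- !rsum_scal, <- rsum_plus. apply rsum_ext; intros; ring.
  - apply rsum_le. intros j Hj. rewrite rsum_scal. apply Rmult_le_compat_l; [apply hp0|]. apply mea_shift_alt_ge. unfold xs; lia.
Qed.

Lemma altsum_1 : 0 < altsum 1%nat.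
Proof.
  unfold altsum. apply Rlt_le_trans with (INR d * mk c d p d 1%nat).
  - apply Rmult_lt_0_compat; [apply lt_0_INR; lia|].
    pose proof (mk_climb c d p hp0 hc hd hpd 0%nat 1%nat) as H. replace (1 * d)%nat with d in H by lia.
    eapply Rlt_le_trans; [|exact H]. pose proof (pd_pos d p hp0 hpd). unfold mk; simpl; lra.
  - apply (rsum_term_le (fun k => INR k * mk c d p k 1%nat)); [|lia]. intros k. apply Rmult_le_pos; [apply pos_INR|now apply mk_nonneg].
Qed.

Context (tau : R) (Htau : 0 < tau) (Hder : Derive (Pol c d p) tau = 0).

Lemma mean_zero : rsum (fun j => p (xs c j) * IZR (xs c j) * powerRZ tau (xs c j)) (S (c + d)) = 0.
Proof.
  pose proof (tw_mom1 c d p hc hd tau Htau) as H. rewrite Hder in H. unfold Rdiv in H. rewrite Rmult_0_r, Rmult_0_l in H.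
  pose proof (Pol_pos c d p hp0 hc hd hpc tau Htau) as HP. unfold mom, tw, Rdiv in H.
  rewrite (rsum_ext _ (fun j => (p (xs c j) * IZR (xs c j) * powerRZ tau (xs c j)) * / Pol c d p tau)) in H by (intros; ring).
  rewrite rsum_scal_r in H. apply Rmult_integral in H. destruct H as [H|H]; [assumption|].
  pose proof (Rinv_0_lt_compat _ HP). lra.
Qed.

Lemma powerRZ_exp i : powerRZ tau i = exp (IZR i * ln tau).
Proof. rewrite powerRZ_Rpower by assumption. reflexivity. Qed.

Lemma Pol_1_rsum : Pol c d p 1 = rsum (fun j => p (xs c j)) (S (c + d)).
Proof.
  rewrite (Pol_rsum c d p hc hd). apply rsum_ext. intros j _. rewrite powerRZ_Rpower by lra. unfold Rpower. rewrite ln_1, Rmult_0_r, exp_0. ring.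
Qed.

(** With y = i ln(tau), every jump i satisfies e^y (1 - y) <= 1; the terms in y cancel in the
    weighted sum by P'(tau) = 0. *)
Lemma Pol_tau_le_1 : Pol c d p tau <= Pol c d p 1.
Proof.
  rewrite Pol_1_rsum, (Pol_rsum c d p hc hd).
  apply Rle_trans with (rsum (fun j => p (xs c j) * powerRZ tau (xs c j)) (S (c + d)) - ln tau * 0); [lra|].
  rewrite <- mean_zero, <- rsum_scal, <- rsum_minus. apply rsum_le. intros j _.
  replace (p (xs c j) * powerRZ tau (xs c j) - ln tau * (p (xs c j) * IZR (xs c j) * powerRZ tau (xs c j)))
    with (p (xs c j) * (powerRZ tau (xs c j) * (1 - IZR (xs c j) * ln tau))) by ring.
  rewrite <- (Rmult_1_r (p (xs c j))) at 2. apply Rmult_le_compat_l; [apply hp0|].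
  rewrite powerRZ_exp. set (y := IZR (xs c j) * ln tau). pose proof (exp_ineq1_le (- y)) as H. pose proof (exp_pos y).
  assert (H1 : exp y * exp (- y) = 1) by (rewrite <- exp_plus, Rplus_opp_r; apply exp_0). rewrite <- H1. apply Rmult_le_compat_l; lra.
Qed.

(** If tau <= 1 then i tau^i <= i for every integer i, positive or negative, and the left sides have
    weighted sum 0. *)
Lemma drift_nonneg : tau <= 1 -> 0 <= rsum (fun j => p (xs c j) * IZR (xs c j)) (S (c + d)).
Proof.
  intros Ht. rewrite <- mean_zero. apply rsum_le. intros j _. rewrite Rmult_assoc. apply Rmult_le_compat_l; [apply hp0|].
  rewrite powerRZ_exp. assert (Hln : ln tau <= 0) by (rewrite <- ln_1; destruct Ht as [Ht| ->]; [apply Rlt_le, ln_increasing; lra|apply Rle_refl]).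
  set (z := IZR (xs c j)).
  destruct (Rle_lt_dec 0 z) as [Hz|Hz].
  - assert (exp (z * ln tau) <= 1) by (rewrite <- exp_0; apply exp_mono; nra). nra.
  - assert (1 <= exp (z * ln tau)) by (rewrite <- exp_0; apply exp_mono; nra). nra.
Qed.

(* Stopping the (tilted-to-1) walk when it becomes negative keeps [E S_n] bounded below, while [S_n <= d n];
   so survival at altitude [> c] has weight at least of order [1/n]. *)
Lemma Q_diverges : tau <= 1 -> ~ ex_series (scale (/ Pol c d p 1) (Qcoef c d p q)).
Proof.
  intros Ht. set (r1 := / Pol c d p 1).
  pose proof (Pol_pos c d p hp0 hc hd hpc 1 ltac:(lra)) as HP1. pose proof (Pol_pos c d p hp0 hc hd hpc tau Htau) as HPt.
  assert (Hr1 : 0 < r1) by now apply Rinv_0_lt_compat.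
  assert (Hle : r1 <= / Pol c d p tau) by (apply rinv_le; [assumption|apply Pol_tau_le_1]).
  set (h0 := altsum 1%nat * r1). assert (Hh0 : 0 < h0) by (apply Rmult_lt_0_compat; [apply altsum_1|assumption]).
  assert (HA : forall n, h0 <= altsum (S n) * r1 ^ S n).
  { induction n as [|n IH]; [unfold h0; simpl; lra|]. eapply Rle_trans; [exact IH|].
    pose proof (altsum_S (S n) (drift_nonneg Ht)) as H. pose proof (pow_lt r1 (S n) Hr1).
    change (r1 ^ S (S n)) with (r1 * r1 ^ S n).
    replace (altsum (S n) * r1 ^ S n) with (Pol c d p 1 * altsum (S n) * (r1 * r1 ^ S n)) by (unfold r1; field; lra).
    apply Rmult_le_compat_r; [apply Rmult_le_pos; lra|assumption]. }
  destruct (wk_local_limit c d p hp0 hsupp hc hd hpc hpd haper tau Htau Hder) as [C [C0 HC]].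
  set (bb := / sqrt (2 * mom (S (c + d)) (tw c d p tau) (xs c) 2)) in *.
  assert (Hbb : 0 < bb) by now apply bb_pos.
  pose (B := rsum (fun j => (bb + C) * ((/ tau) ^ j * (1 + INR j ^ 2))) (S c)).
  assert (Hterm : forall j, 0 <= (/ tau) ^ j * (1 + INR j ^ 2)).
  { intros j. apply Rmult_le_pos; [apply pow_le, Rlt_le, Rinv_0_lt_compat, Htau|]. pose proof (pow2_ge_0 (INR j)). lra. }
  assert (HB : 0 <= B) by (apply rsum_nonneg; intros; apply Rmult_le_pos; [lra|apply Hterm]).
  (* Since 1/P(1) <= 1/P(tau), the local limit theorem bounds the weight at altitudes at most c by
     O(n^(-1/2)). *)
  assert (Hlow : forall n, rsum (fun k => mk c d p k n) (S c) * r1 ^ n <= B / rt n).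
  { intros n. rewrite <- rsum_scal_r. unfold B, Rdiv. rewrite <- rsum_scal_r. apply rsum_le. intros j _.
    specialize (HC n j). pose proof (rt_pos n) as Hr. pose proof (rt_ge1 n). pose proof (Hterm j) as Hj.
    assert (H1 : mk c d p j n * r1 ^ n <= wk c d p n (Z.of_nat j) * (/ Pol c d p tau) ^ n).
    { apply Rmult_le_compat; [now apply mk_nonneg|apply pow_le; lra|now apply mea_le_wk|apply pow_incr; lra]. }
    pose proof (Rle_abs (wk c d p n (Z.of_nat j) * (/ Pol c d p tau) ^ n - bb * tq n * (/ tau) ^ j)) as H2.
    assert (H3 : bb * tq n * (/ tau) ^ j <= bb * ((/ tau) ^ j * (1 + INR j ^ 2)) * / rt n).
    { pose proof (tq_le n) as Htq. unfold Rdiv in Htq. rewrite Rmult_1_l in Htq. pose proof (tq_pos n).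
      assert (Hp : 0 < (/ tau) ^ j) by (apply pow_lt, Rinv_0_lt_compat, Htau). pose proof (pow2_ge_0 (INR j)).
      assert (Hir : 0 < / rt n) by now apply Rinv_0_lt_compat.
      apply Rle_trans with (bb * (/ tau) ^ j * / rt n).
      - replace (bb * tq n * (/ tau) ^ j) with (bb * (/ tau) ^ j * tq n) by ring. apply Rmult_le_compat_l; [apply Rmult_le_pos; lra|assumption].
      - apply Rmult_le_compat_r; [lra|]. apply Rmult_le_compat_l; [lra|]. nra. }
    assert (H4 : C * ((/ tau) ^ j * (1 + INR j ^ 2)) / rt n ^ 3 <= C * ((/ tau) ^ j * (1 + INR j ^ 2)) * / rt n).
    { unfold Rdiv. apply Rmult_le_compat_l; [now apply Rmult_le_pos|]. rewrite <- (pow_1 (rt n)) at 2. apply inv_rt_le'. lia. }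
    lra. }
  assert (Hd0 : 0 < INR d) by (apply lt_0_INR; lia).
  (* Beyond N the altitudes at most c account for at most half of h0, the lower bound for the
     normalised first moment. *)
  destruct (archimed_cor1 ((h0 / (2 * (INR c * B + 1))) ^ 2) ltac:(apply pow_lt, Rdiv_lt_0_compat; [assumption|pose proof (pos_INR c); nra])) as [N [HN HN0]].
  apply (harmonic_diverges _ (q * r1 * h0 / (2 * INR d)) (S (S c + N))).
  { apply Rdiv_lt_0_compat; [|lra]. apply Rmult_lt_0_compat; [apply Rmult_lt_0_compat|]; assumption. }
  intros [|n] Hn; [lia|]. destruct n as [|n]; [lia|]. set (m := S n) in *.
  specialize (HA n). fold m in HA. specialize (Hlow m). pose proof (rt_pos m) as Hr. pose proof (rt_sq m) as Hr2.
  assert (Hm : 0 < INR m) by (apply lt_0_INR; unfold m; lia).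
  set (S1 := rsum (fun k => mk c d p k m) (S c)) in *. set (S2 := rsum (fun k => mk c d p k m) (S (m * d))).
  assert (Hcm : (S c <= S (m * d))%nat) by (unfold m in *; nia).
  (* Altitudes never exceed m d, so the first moment is at most m d times the weight above c, plus c
     times the weight up to c. The weight above c is therefore at least of order 1/m. *)
  assert (Hup : altsum m <= INR m * INR d * (S2 - S1) + INR c * S1).
  { unfold altsum, S2, S1. replace (S (m * d)) with (S c + (m * d - c))%nat by lia. rewrite !rsum_split.
    replace (rsum (fun k => mk c d p k m) (S c) + rsum (fun k => mk c d p (S c + k) m) (m * d - c) - rsum (fun k => mk c d p k m) (S c))
      with (rsum (fun k => mk c d p (S c + k) m) (m * d - c)) by ring.
    rewrite <- !rsum_scal. rewrite Rplus_comm. apply Rplus_le_compat; apply rsum_le; intros k Hk; (apply Rmult_le_compat_r; [now apply mk_nonneg|]).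
    - rewrite <- mult_INR. apply le_INR. lia.
    - apply le_INR. lia. }
  assert (Hrm : 0 < r1 ^ m) by now apply pow_lt.
  assert (Hsmall : INR c * (S1 * r1 ^ m) <= h0 / 2).
  { apply Rle_trans with (INR c * (B / rt m)); [apply Rmult_le_compat_l; [apply pos_INR|exact Hlow]|].
    set (y := h0 / (2 * (INR c * B + 1))) in *. pose proof (pos_INR c) as Hc0.
    assert (HcB : 0 <= INR c * B) by now apply Rmult_le_pos.
    assert (Hy : 0 < y) by (apply Rdiv_lt_0_compat; lra).
    assert (Hiy : / rt m <= y).
    { assert (HmN : INR N <= INR m) by (apply le_INR; unfold m in *; lia).
      assert (HN1 : 0 < INR N) by now apply lt_0_INR.
      assert (Hi : (/ rt m) ^ 2 < y ^ 2).
      { eapply Rle_lt_trans; [|exact HN]. rewrite pow_inv. apply rinv_le; [assumption|]. simpl. rewrite Rmult_1_r, Hr2. lra. }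
      destruct (Rle_lt_dec (/ rt m) y) as [K|K]; [assumption|]. pose proof (Rinv_0_lt_compat _ Hr). nra. }
    replace (INR c * (B / rt m)) with (INR c * B * / rt m) by (unfold Rdiv; ring).
    apply Rle_trans with (INR c * B * y); [apply Rmult_le_compat_l; assumption|].
    apply Rle_trans with ((INR c * B + 1) * y); [apply Rmult_le_compat_r; lra|]. apply Req_le. unfold y. field. lra. }
  assert (Hmain : h0 / 2 <= INR m * INR d * ((S2 - S1) * r1 ^ m)).
  { assert (altsum m * r1 ^ m <= (INR m * INR d * (S2 - S1) + INR c * S1) * r1 ^ m) by (apply Rmult_le_compat_r; lra). nra. }
  pose proof (Qcoef_ge c d p q hp0 hc hd hq m (S (m * d)) Hcm) as HQ. fold S1 S2 in HQ.
  unfold scale. change (r1 ^ S m) with (r1 * r1 ^ m).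
  apply Rle_trans with (q * (S2 - S1) * (r1 * r1 ^ m)); [|apply Rmult_le_compat_r; [apply Rmult_le_pos; lra|exact HQ]].
  replace (q * (S2 - S1) * (r1 * r1 ^ m)) with (q * r1 * ((S2 - S1) * r1 ^ m)) by ring.
  set (z := (S2 - S1) * r1 ^ m) in *.
  assert (Hz : h0 / (2 * INR d) / INR m <= z).
  { apply Rmult_le_reg_l with (INR m * INR d); [now apply Rmult_lt_0_compat|].
    replace (INR m * INR d * (h0 / (2 * INR d) / INR m)) with (h0 / 2) by (field; lra). exact Hmain. }
  assert (Hqr : 0 < q * r1) by now apply Rmult_lt_0_compat.
  apply Rle_trans with (q * r1 * (h0 / (2 * INR d) / INR m)); [|apply Rmult_le_compat_l; lra].
  replace (q * r1 * h0 / (2 * INR d) / (INR (S m) + 1)) with (q * r1 * (h0 / (2 * INR d) * / (INR (S m) + 1))) by (unfold Rdiv; ring).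
  apply Rmult_le_compat_l; [lra|]. unfold Rdiv at 2.
  assert (0 < h0 / (2 * INR d)) by (apply Rdiv_lt_0_compat; lra).
  apply Rmult_le_compat_l; [lra|]. apply rinv_le; [assumption|]. rewrite S_INR. lra.
Qed.
End Growth.

(** * Simple poles *)

Lemma l1_of_scale f R : 1 <= R -> l1 (scale R f) -> l1 f.
Proof.
  intros HR H. apply l1_le with (scale R f); [assumption|]. intros n. unfold scale. rewrite Rabs_mult.
  rewrite <- (Rmult_1_r (Rabs (f n))) at 1. apply Rmult_le_compat_l; [apply Rabs_pos|].
  eapply Rle_trans; [|apply Rle_abs]. now apply pow_R1_Rle.
Qed.

Lemma l1_scale_le f r R : 0 <= r <= R -> l1 (scale R f) -> l1 (scale r f).
Proof.
  intros Hr H. apply l1_le with (scale R f); [assumption|]. intros n. unfold scale. rewrite !Rabs_mult.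
  apply Rmult_le_compat_l; [apply Rabs_pos|]. rewrite !Rabs_pos_eq by (apply pow_le; lra). now apply pow_incr.
Qed.

Lemma l1_geometric f B y : 0 < y < 1 -> 0 <= B -> (forall n, Rabs (f n) <= B * (y ^ n * (1 + INR n ^ 2))) -> l1 f.
Proof.
  intros Hy HB H. destruct (geometric_sq_sum y Hy) as [M [M0 HM]]. apply l1_bounded with (B * M). intros n.
  apply Rle_trans with (B * rsum (fun j => y ^ j * (1 + INR j ^ 2)) n).
  - rewrite <- rsum_scal. apply rsum_le. intros; apply H.
  - now apply Rmult_le_compat_l.
Qed.

Lemma is_lim_seq_ftail f n : ex_series f -> is_lim_seq (fun N => rsum (fun k => f (S n + k)%nat) N) (ftail f n).
Proof.
  intros H. apply Series_correct in H. apply is_lim_seq_rsum in H.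
  apply (is_lim_seq_incr_n _ (S n)) in H. unfold ftail.
  apply is_lim_seq_ext with (fun N => rsum f (N + S n) - rsum f (S n)).
  - intros N. rewrite Nat.add_comm, rsum_split. ring.
  - apply is_lim_seq_minus'; [exact H|apply is_lim_seq_const].
Qed.

Lemma ftail_geometric f R n : 1 <= R -> l1 (scale R f) -> Rabs (ftail f n) <= nrm (scale R f) / R ^ n.
Proof.
  intros HR H. pose proof (l1_of_scale f R HR H) as Hf.
  assert (HRn : 0 < R ^ n) by (apply pow_lt; lra).
  pose proof (is_lim_seq_abs _ _ (is_lim_seq_ftail f n (l1_ex _ Hf))) as L.
  refine (is_lim_seq_le _ (fun _ => nrm (scale R f) / R ^ n) (Rabs (ftail f n)) (nrm (scale R f) / R ^ n) _ L (is_lim_seq_const _)).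
  intros N. apply Rle_trans with (rsum (fun k => Rabs (scale R f (S n + k)%nat)) N / R ^ n).
  - eapply Rle_trans; [apply rsum_abs|]. unfold Rdiv. rewrite <- rsum_scal_r. apply rsum_le. intros k _.
    unfold scale. rewrite Rabs_mult, (Rabs_pos_eq (R ^ _)) by (apply pow_le; lra).
    replace (S n + k)%nat with (n + S k)%nat by lia. rewrite pow_add.
    replace (Rabs (f (n + S k)%nat) * (R ^ n * R ^ S k) * / R ^ n) with (Rabs (f (n + S k)%nat) * R ^ S k) by (field; lra).
    rewrite <- (Rmult_1_r (Rabs _)) at 1. apply Rmult_le_compat_l; [apply Rabs_pos|now apply pow_R1_Rle].
  - apply Rmult_le_compat_r; [now apply Rlt_le, Rinv_0_lt_compat|].
    eapply Rle_trans; [|apply (rsum_le_nrm _ (S n + N) H)]. rewrite rsum_split.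
    pose proof (rsum_nonneg (fun k => Rabs (scale R f k)) (S n) (fun k _ => Rabs_pos _)). lra.
Qed.

Lemma one_sub_z_sum f u n : ((fone - zvar) * f)%fps = u -> f n = rsum u (S n).
Proof.
  intros <-. replace ((fone - zvar) * f)%fps with (f - zvar * f)%fps by ring.
  induction n as [|n IH].
  - unfold rsum, fsub, gsub; simpl. change (gsum 0 Rplus) with rsum. rewrite zvar_star_0. ring.
  - rewrite rsum_S, <- IH. unfold fsub, gsub. rewrite zvar_star_S. ring.
Qed.

Lemma pow_sub_one_le x n : 1 <= x -> x ^ n - 1 <= INR n * (x - 1) * x ^ n.
Proof.
  intros Hx. induction n as [|n IH]; [simpl; lra|]. rewrite S_INR. simpl.
  pose proof (pow_R1_Rle x n Hx) as H1. pose proof (pos_INR n) as Hn.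
  assert (0 <= (INR n + 1) * (x - 1) * x ^ n * (x - 1)) by (apply Rmult_le_pos; [apply Rmult_le_pos; [apply Rmult_le_pos|]|]; lra).
  lra.
Qed.

(* At the simple zero [z = 1] of [1 - Q], the cofactor [ftail Q] of [1 - z] stays bounded away from zero on
   a slightly larger disc, so that by Wiener's lemma its inverse converges there. *)
Lemma simple_pole (Q D E : fps) (m : nat) (R : R) :
  (forall n, 0 <= Q n) -> Q O = 0 -> val Q = 1 -> 0 < Q m -> 0 < Q (S m) -> 1 < R ->
  l1 (scale R Q) -> l1 (scale R E) -> ((fone - Q) * D)%fps = fone ->
  exists R' C, 1 < R' /\ forall n, Rabs ((D * E)%fps n - val E / val (theta Q)) <= C / R' ^ n.
Proof.
  intros HQ Q0 HQ1 Qm Qm1 HR lRQ lRE HD.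
  assert (lQ : l1 Q) by (apply (l1_of_scale Q R); [lra|assumption]).
  set (T := ftail Q). set (B := nrm (scale R Q)).
  assert (HB : 0 <= B) by now apply nrm_nonneg.
  assert (HT : forall n, Rabs (T n) <= B / R ^ n) by (intros n; apply ftail_geometric; [lra|assumption]).
  assert (T0 : forall n, 0 <= T n).
  { intros n. unfold T, ftail. pose proof (rsum_le_Series Q (S n) HQ (l1_ex _ lQ)). unfold val. lra. }
  assert (T00 : T O = 1) by (unfold T, ftail; rewrite HQ1, rsum_S, Q0; unfold rsum; simpl; ring).
  assert (Hdec : ((fone - zvar) * T)%fps = (fone - Q)%fps).
  { pose proof (ftail_decomp Q) as H. rewrite HQ1, cst_one in H. fold T in H. rewrite H. ring. }
  (* Radii up to the midpoint (1 + R)/2 are at ratio at most y < 1 to R, which leaves geometric room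
     for factors polynomial in n. *)
  set (y := (1 + R) / 2 / R).
  assert (Hy : 0 < y < 1).
  { unfold y. split; [apply Rdiv_lt_0_compat; lra|]. apply Rmult_lt_reg_r with R; [lra|]. unfold Rdiv at 1. rewrite Rmult_assoc, Rinv_l by lra. lra. }
  assert (HTy : forall R1 n, 1 <= R1 <= (1 + R) / 2 -> Rabs (T n) * R1 ^ n <= B * y ^ n).
  { intros R1 n H1. apply Rle_trans with (B / R ^ n * ((1 + R) / 2) ^ n).
    - apply Rmult_le_compat; [apply Rabs_pos|apply pow_le; lra|apply HT|apply pow_incr; lra].
    - apply Req_le. unfold y, Rdiv. rewrite (Rpow_mult_distr _ (/ R)), pow_inv. ring. }
  assert (Hn2 : forall n, 1 <= 1 + INR n ^ 2 /\ INR n <= 1 + INR n ^ 2).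
  { intros n. pose proof (pow2_ge_0 (INR n)). pose proof (pow2_ge_0 (INR n - 1)). pose proof (pos_INR n). split; nra. }
  assert (lT1 : forall R1, 1 <= R1 <= (1 + R) / 2 -> l1 (scale R1 T)).
  { intros R1 H1. apply (l1_geometric _ B y Hy HB). intros n. unfold scale.
    rewrite Rabs_mult, (Rabs_pos_eq (R1 ^ n)) by (apply pow_le; lra). eapply Rle_trans; [now apply HTy|].
    apply Rmult_le_compat_l; [assumption|]. rewrite <- (Rmult_1_r (y ^ n)) at 1. apply Rmult_le_compat_l; [apply pow_le; lra|apply Hn2]. }
  assert (lT : l1 T) by (rewrite <- (scale_1 T); apply lT1; lra).
  assert (lthT : l1 (theta T)).
  { apply (l1_geometric _ B y Hy HB). intros n. unfold theta. rewrite Rabs_mult, (Rabs_pos_eq (INR n)) by apply pos_INR.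
    pose proof (HTy 1 n ltac:(lra)) as H. rewrite pow1, Rmult_1_r in H.
    assert (0 <= y ^ n) by (apply pow_le; lra). pose proof (Hn2 n). pose proof (pos_INR n).
    apply Rle_trans with (INR n * (B * y ^ n)); [now apply Rmult_le_compat_l|].
    replace (INR n * (B * y ^ n)) with (B * (y ^ n * INR n)) by ring.
    apply Rmult_le_compat_l; [assumption|]. apply Rmult_le_compat_l; lra. }
  assert (HvT : 0 < val T).
  { pose proof (rsum_le_Series T 1 T0 (l1_ex _ lT)) as H. rewrite rsum_S, T00 in H. unfold rsum in H; simpl in H. unfold val. lra. }
  (* Differentiating 1 - Q = (1 - z) T at 1 gives Q'(1) = T(1). *)
  assert (HvQ : val (theta Q) = val T).
  { replace (theta Q) with (zvar * T - (fone - zvar) * theta T)%fps.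
    - rewrite val_sub, !val_star, val_zvar, val_one_sub_z by first [assumption|apply l1_zvar|apply l1_one_sub_z|apply l1_star;first [assumption|apply l1_zvar|apply l1_one_sub_z]].
      ring.
    - replace Q with (fone - (fone - zvar) * T)%fps by (rewrite Hdec; ring).
      rewrite theta_sub, theta_star, theta_sub, theta_one, theta_zvar. ring. }
  destruct (lower_bound_disc Q m T (fone - zvar)%fps) as [eps [He Hev]]; try assumption.
  { apply l1_one_sub_z. } { rewrite <- Hdec. ring. } { lra. }
  destruct (geometric_sq_sum y Hy) as [M [M0 HM]].
  assert (HBM : 0 <= B * M) by now apply Rmult_le_pos.
  (* Enlarging the radius by dl changes T by at most eps/4 in norm, hence by at most eps/2 in value
     because of the factor 2 in [ev_le]. *)
  set (dl := Rmin ((R - 1) / 2) (eps / (4 * (B * M + 1)))).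
  assert (Hd0 : 0 < dl) by (apply Rmin_glb_lt; [lra|apply Rdiv_lt_0_compat; lra]).
  assert (Hd1 : dl <= (R - 1) / 2) by apply Rmin_l.
  assert (Hd2 : dl * (B * M) <= eps / 4).
  { apply Rle_trans with (eps / (4 * (B * M + 1)) * (B * M + 1)); [|apply Req_le; field; lra].
    apply Rmult_le_compat; [lra|lra|apply Rmin_r|lra]. }
  set (R' := 1 + dl).
  pose proof (lT1 R' ltac:(unfold R'; lra)) as lT'.
  assert (Hnrm : nrm (scale R' T - T)%fps <= eps / 4).
  { apply nrm_le; [now apply l1_sub|]. intros N. eapply Rle_trans; [|exact Hd2].
    apply Rle_trans with (dl * (B * rsum (fun j => y ^ j * (1 + INR j ^ 2)) N)).
    - rewrite <- !rsum_scal. apply rsum_le. intros n _. unfold fsub, gsub, scale.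
      pose proof (pow_R1_Rle R' n ltac:(unfold R'; lra)) as H1.
      replace (T n * R' ^ n - T n) with (T n * (R' ^ n - 1)) by ring. rewrite Rabs_mult, (Rabs_pos_eq (R' ^ n - 1)) by lra.
      pose proof (pow_sub_one_le R' n ltac:(unfold R'; lra)) as H2.
      pose proof (HTy R' n ltac:(unfold R'; lra)) as H3. replace (R' - 1) with dl in H2 by (unfold R'; ring).
      apply Rle_trans with (Rabs (T n) * (INR n * dl * R' ^ n)); [apply Rmult_le_compat_l; [apply Rabs_pos|lra]|].
      replace (Rabs (T n) * (INR n * dl * R' ^ n)) with (dl * (INR n * (Rabs (T n) * R' ^ n))) by ring.
      apply Rmult_le_compat_l; [lra|]. pose proof (pos_INR n). assert (0 <= y ^ n) by (apply pow_le; lra). pose proof (Hn2 n).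
      apply Rle_trans with (INR n * (B * y ^ n)); [now apply Rmult_le_compat_l|].
      replace (INR n * (B * y ^ n)) with (B * (y ^ n * INR n)) by ring.
      apply Rmult_le_compat_l; [assumption|]. apply Rmult_le_compat_l; lra.
    - apply Rmult_le_compat_l; [lra|]. now apply Rmult_le_compat_l. }
  destruct (fps_inverse_ex T ltac:(lra)) as [G HG].
  assert (lG' : l1 (scale R' G)).
  { apply (wiener_l1 (scale R' T) _ (eps / 2)); [lra|assumption| |].
    - intros z Hz. specialize (Hev z Hz).
      replace (scale R' T) with (T + (scale R' T - T))%fps by ring.
      rewrite ev_add by first [assumption|now apply l1_sub].
      pose proof (ev_le (scale R' T - T)%fps z Hz ltac:(now apply l1_sub)) as H.
      pose proof (Cmod_triangle (ev T z + ev (scale R' T - T)%fps z) (- ev (scale R' T - T)%fps z))%C as H2.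
      rewrite Cmod_opp in H2. replace (ev T z + ev (scale R' T - T)%fps z + - ev (scale R' T - T)%fps z)%C with (ev T z) in H2 by ring. lra.
    - rewrite <- scale_star, HG. apply scale_one. }
  assert (lE' : l1 (scale R' E)) by (apply (l1_scale_le E R' R); [unfold R'; lra|assumption]).
  set (U := (G * E)%fps).
  assert (lU' : l1 (scale R' U)) by (unfold U; rewrite scale_star; now apply l1_star).
  (* After multiplication by 1 - z, the product D E becomes U, which is summable at radius R' > 1.
     The coefficients of D E are partial sums of U, and they differ from U(1) by a geometrically
     small tail. *)
  assert (HU : ((fone - zvar) * (D * E))%fps = U).
  { unfold U. replace G with ((fone - zvar) * D)%fps; [ring|].
    apply star_inj_l with T; [lra|]. transitivity ((fone - zvar) * T * D)%fps; [ring|]. rewrite Hdec, HD, HG. reflexivity. }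
  exists R', (nrm (scale R' U)). split; [unfold R'; lra|]. intros n.
  assert (HvU : val U = val E / val (theta Q)).
  { unfold U. assert (lG : l1 G) by (apply (l1_of_scale G R'); [unfold R'; lra|assumption]).
    assert (lE : l1 E) by (apply (l1_of_scale E R); [lra|assumption]).
    rewrite val_star, HvQ by assumption. pose proof (val_star T G lT lG) as H. rewrite HG, val_one in H.
    apply Rmult_eq_reg_l with (val T); [|lra]. rewrite <- Rmult_assoc, <- H. field. lra. }
  rewrite <- HvU, (one_sub_z_sum _ _ n HU).
  replace (rsum U (S n) - val U) with (- ftail U n) by (unfold ftail; ring). rewrite Rabs_Ropp.
  apply ftail_geometric; [unfold R'; lra|assumption].
Qed.

(** * A zero of 1 - Q inside the disc *)

Lemma PSeries_val a x : PSeries a x = val (scale x a).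
Proof. reflexivity. Qed.

Lemma scale_scale r s f : scale r (scale s f) = scale (s * r) f.
Proof. apply functional_extensionality; intros n. unfold scale. rewrite Rpow_mult_distr. ring. Qed.

Lemma zero_1mQ_val c d p q r : zero_1mQ c d p q r <->
  0 < r /\ ex_series (scale r (Qcoef c d p q)) /\ val (scale r (Qcoef c d p q)) = 1.
Proof.
  unfold zero_1mQ. rewrite is_pseries_R. split; (intros [Hr H]; split; [assumption|]).
  - split; [now exists 1|now apply is_series_unique].
  - destruct H as [H1 H2]. rewrite <- H2. now apply Series_correct.
Qed.

Lemma Derive_PSeries_theta a x y : 0 < x < y -> l1 (scale y a) -> x * Derive (PSeries a) x = val (theta (scale x a)).
Proof.
  intros Hx Hy.
  assert (HC : Rbar_lt (Rabs x) (CV_radius a)).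
  { rewrite Rabs_pos_eq by lra. apply Rbar_lt_le_trans with y; [simpl; lra|].
    apply (proj1 (Lub_Rbar_correct (CV_disk a))). exact Hy. }
  rewrite Derive_PSeries by assumption. unfold PSeries, val. rewrite <- Series_scal_l.
  rewrite (Series_ext _ (fun n => theta (scale x a) (S n))).
  - symmetry. rewrite Series_incr_1_aux; [reflexivity|]. unfold theta; simpl; ring.
  - intros n. unfold theta, scale, PS_derive. simpl pow. ring.
Qed.

Section Cases.
Context (c d : nat) (p : Z -> R) (q : R).
Hypothesis hp0 : forall i : Z, 0 <= p i.
Hypothesis hsupp : forall i : Z, (i < - Z.of_nat c \/ Z.of_nat d < i)%Z -> p i = 0.
Hypothesis (hc : (1 <= c)%nat) (hd : (1 <= d)%nat).
Hypothesis (hpc : p (- Z.of_nat c)%Z <> 0) (hpd : p (Z.of_nat d) <> 0).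
Hypothesis haper : aperiodic p.
Hypothesis hq : 0 < q.
Context (tau : R) (Htau : 0 < tau) (Hder : Derive (Pol c d p) tau = 0).
Let rho := / Pol c d p tau.

Lemma scale_ecoef r : scale r (ecoef c d p q) = (scale r (Dcoef c d p q) * scale r (Ecoef c d p))%fps.
Proof. rewrite ecoef_star. apply scale_star. Qed.
Lemma scale_Dcoef r : ((fone - scale r (Qcoef c d p q)) * scale r (Dcoef c d p q))%fps = fone.
Proof. rewrite <- (scale_one r) at 1. rewrite <- scale_sub, <- scale_star, Dcoef_inverse. apply scale_one. Qed.

Lemma scale_Q_nonneg r n : 0 <= r -> 0 <= scale r (Qcoef c d p q) n.
Proof. intros Hr. unfold scale. apply Rmult_le_pos; [now apply Qcoef_nonneg|now apply pow_le]. Qed.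
Lemma l1_scale_Q r : 0 <= r -> ex_series (scale r (Qcoef c d p q)) -> l1 (scale r (Qcoef c d p q)).
Proof. intros Hr. apply l1_nonneg. intros; now apply scale_Q_nonneg. Qed.

(** For tau <= 1 the series Q diverges already at 1/P(1) <= rho; its convergence at rho thus makes
    the class [Cls] available for M and Q. *)
Lemma tau_gt_1 r : rho <= r -> ex_series (scale r (Qcoef c d p q)) -> 1 < tau.
Proof.
  intros Hr H. destruct (Rlt_le_dec 1 tau) as [Ht|Ht]; [assumption|]. exfalso.
  assert (H0 : 0 < rho) by (apply rho_pos; assumption).
  assert (HP : / Pol c d p 1 <= rho) by (apply rinv_le; [now apply Pol_pos|now apply Pol_tau_le_1]).
  assert (0 < / Pol c d p 1) by (apply Rinv_0_lt_compat, Pol_pos; assumption || lra).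
  apply (Q_diverges c d p q hp0 hsupp hc hd hpc hpd haper hq tau Htau Hder Ht).
  apply l1_ex, l1_scale_le with r; [lra|]. apply l1_scale_Q; [lra|assumption].
Qed.

(** The exponential bound gives convergence below 1/P(v) for each v >= 1. For tau >= 1 take v = tau.
    For tau < 1 take v = 1: convergence at r forces r < 1/P(1), because Q diverges at 1/P(1). *)
Lemma Q_radius r : 0 < r < rho -> ex_series (scale r (Qcoef c d p q)) ->
  exists R, 1 < R /\ r * R <= rho /\ ex_series (scale (r * R) (Qcoef c d p q)).
Proof.
  intros Hr H.
  assert (Hv : exists v, 1 <= v /\ r * Pol c d p v < 1 /\ Pol c d p tau <= Pol c d p v).
  { pose proof (Pol_pos c d p hp0 hc hd hpc tau Htau) as HPt.
    destruct (Rle_lt_dec 1 tau) as [Ht|Ht].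
    - exists tau. split; [assumption|]. split; [|lra].
      replace 1 with (rho * Pol c d p tau) by (unfold rho; field; lra). apply Rmult_lt_compat_r; lra.
    - exists 1. split; [lra|]. split; [|now apply Pol_tau_le_1].
      destruct (Rlt_le_dec (r * Pol c d p 1) 1) as [K|K]; [assumption|]. exfalso.
      pose proof (Pol_pos c d p hp0 hc hd hpc 1 ltac:(lra)) as HP1.
      pose proof (Rinv_0_lt_compat _ HP1).
      assert (/ Pol c d p 1 <= r).
      { apply Rmult_le_reg_r with (Pol c d p 1); [assumption|]. rewrite Rinv_l by lra. assumption. }
      apply (Q_diverges c d p q hp0 hsupp hc hd hpc hpd haper hq tau Htau Hder ltac:(lra)).
      apply l1_ex, l1_scale_le with r; [lra|]. apply l1_scale_Q; [lra|assumption]. }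
  destruct Hv as [v [Hv1 [HvP HvT]]].
  pose proof (Pol_pos c d p hp0 hc hd hpc v ltac:(lra)) as HPv. pose proof (Pol_pos c d p hp0 hc hd hpc tau Htau) as HPt.
  set (s := r * Pol c d p v) in *. assert (Hs : 0 < s) by (apply Rmult_lt_0_compat; lra).
  assert (HRP : r * ((1 + s) / 2 / s) * Pol c d p v < 1).
  { replace (r * ((1 + s) / 2 / s) * Pol c d p v) with ((1 + s) / 2); [lra|]. unfold s. field. split; lra. }
  exists ((1 + s) / 2 / s). split; [|split].
  - apply Rmult_lt_reg_r with s; [assumption|]. unfold Rdiv at 1. rewrite Rmult_assoc, Rinv_l by lra. lra.
  - apply Rle_trans with (/ Pol c d p v); [|apply rinv_le; assumption].
    apply Rmult_le_reg_r with (Pol c d p v); [assumption|]. rewrite Rinv_l by lra. lra.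
  - apply (Q_summable_below c d p q hp0 hc hd hpc hq v); [assumption| |assumption].
    apply Rmult_le_pos; [lra|]. apply Rlt_le. apply Rdiv_lt_0_compat; lra.
Qed.

Lemma l1_scale_E r : 0 <= r <= rho -> l1 (scale r (Ecoef c d p)).
Proof. intros Hr. apply l1_scale_le with rho; [assumption|]. eapply Cls_l1. apply Cls_E; eassumption. Qed.

Lemma scale_Q_pos r : 0 < r -> exists m, 0 < scale r (Qcoef c d p q) m /\ 0 < scale r (Qcoef c d p q) (S m).
Proof.
  intros Hr. destruct (Q_eventually_pos c d p q hp0 hsupp hc hd hpc hpd haper hq tau Htau Hder) as [m Hm].
  exists m. split; (apply Rmult_lt_0_compat; [apply Hm; lia|now apply pow_lt]).
Qed.

Lemma ecoef_pole r : zero_1mQ c d p q r -> r < rho -> exists K, 0 < K < / r /\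
  is_lim_seq (fun n => (ecoef c d p q n - Ef c d p r / (r * Derive (Qf c d p q) r) * / r ^ n) / K ^ n) 0.
Proof.
  intros Hz Hlt. apply zero_1mQ_val in Hz. destruct Hz as [Hr [Hex Hval]].
  destruct (Q_radius r (conj Hr Hlt) Hex) as [R [HR [HRr HRex]]].
  destruct (scale_Q_pos r Hr) as [m [Hm Hm']].
  assert (HrR : 0 < r * R) by (apply Rmult_lt_0_compat; lra).
  assert (lQR : l1 (scale (r * R) (Qcoef c d p q))) by (apply l1_scale_Q; [lra|assumption]).
  destruct (simple_pole (scale r (Qcoef c d p q)) (scale r (Dcoef c d p q)) (scale r (Ecoef c d p)) m R) as [R' [C [HR' HC]]]; try assumption.
  - intros; apply scale_Q_nonneg; lra.
  - unfold scale; simpl; ring.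
  - rewrite scale_scale. assumption.
  - rewrite scale_scale. apply l1_scale_E. lra.
  - apply scale_Dcoef.
  - assert (HA : Ef c d p r / (r * Derive (Qf c d p q) r) = val (scale r (Ecoef c d p)) / val (theta (scale r (Qcoef c d p q)))).
    { unfold Qf. rewrite (Derive_PSeries_theta _ r (r * R)) by (assumption || (split; [assumption|nra])). reflexivity. }
    rewrite HA. clear HA. set (A := val (scale r (Ecoef c d p)) / val (theta (scale r (Qcoef c d p q)))) in *.
    (* K = 1/(r sqrt R') lies strictly between 1/(r R') and 1/r, so an error O((r R')^(-n)) is
       o(K^n). *)
    set (w := sqrt R'). assert (Hw2 : w * w = R') by (apply sqrt_sqrt; lra).
    assert (Hw : 1 < w) by (rewrite <- sqrt_1; apply sqrt_lt_1; lra).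
    exists (/ (r * w)). split.
    + split; [apply Rinv_0_lt_compat, Rmult_lt_0_compat; lra|]. apply Rinv_lt_contravar; [apply Rmult_lt_0_compat; [assumption|apply Rmult_lt_0_compat; lra]|nra].
    + apply is_lim_seq_abs_0.
      apply (is_lim_seq_le_le (fun _ => 0) _ (fun n => C * (/ w) ^ n)).
      * intros n. split; [apply Rabs_pos|]. specialize (HC n). rewrite <- scale_ecoef in HC. unfold scale at 1 in HC.
        assert (Hrn : 0 < r ^ n) by now apply pow_lt. assert (Hwn : 0 < w ^ n) by (apply pow_lt; lra).
        rewrite pow_inv, Rpow_mult_distr. unfold Rdiv. rewrite Rinv_inv.
        replace ((ecoef c d p q n - A * / r ^ n) * (r ^ n * w ^ n)) with ((ecoef c d p q n * r ^ n - A) * w ^ n) by (field; lra).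
        rewrite Rabs_mult, (Rabs_pos_eq (w ^ n)) by lra.
        replace (C * (/ w) ^ n) with (C / R' ^ n * w ^ n); [apply Rmult_le_compat_r; lra|].
        rewrite <- Hw2, Rpow_mult_distr, pow_inv. field. lra.
      * apply is_lim_seq_const.
      * replace (Finite 0) with (Rbar_mult C 0) by (simpl; now rewrite Rmult_0_r).
        apply is_lim_seq_scal_l. apply is_lim_seq_geom.
        rewrite Rabs_pos_eq by (apply Rlt_le, Rinv_0_lt_compat; lra). rewrite <- Rinv_1. apply Rinv_lt_contravar; lra.
Qed.
End Cases.

(** * Inverses of square-root singularities *)

Lemma Cls_sq : Cls sq 1.
Proof.
  apply Cls_intro. exists 0. intros n. replace ((sq - scal_fps 1 sq)%fps n) with 0 by (unfold fsub, gsub, scal_fps; ring).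
  rewrite Rabs_R0. unfold Rdiv. rewrite Rmult_0_l. lra.
Qed.

(* [exp (kappa (sq - 1))] with [kappa = - a / val f] cancels the square-root term of [f]. *)
Lemma Cls_inverse f g a eps : Cls f a -> val f <> 0 -> 0 < eps ->
  (forall z, Cmod z <= 1 -> eps <= Cmod (ev f z)) -> (f * g)%fps = fone ->
  Cls g (- a / (val f * val f)) /\ val g = / val f.
Proof.
  intros Hf Hvf He Hev Hfg. set (k := - a / val f).
  assert (HL : forall k, Cls (cst k * (sq - fone))%fps k).
  { intros k0. pose proof (Cls_scal _ _ k0 (Cls_sub _ _ _ _ Cls_sq (Cls_W5 _ (W_one 5)))) as H.
    replace (k0 * (1 - 0)) with k0 in H by ring. exact H. }
  assert (HL0 : forall k, (cst k * (sq - fone))%fps O = 0).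
  { intros k0. rewrite star_0. unfold fsub, gsub, fone, gone; simpl. ring. }
  destruct (Cls_exp _ _ (HL k) (HL0 k)) as [V [V0 [HV CV]]].
  destruct (Cls_exp _ _ (HL (- k)) (HL0 (- k))) as [V' [V'0 [HV' CV']]].
  assert (HVV : (V * V')%fps = fone).
  { apply (ode_unique fzero); [reflexivity|rewrite star_0, V0, V'0; unfold fone, gone; ring| |].
    - rewrite theta_star, HV, HV', cst_opp.
      replace (- cst k * (sq - fone))%fps with (- (cst k * (sq - fone)))%fps by ring. rewrite theta_opp. ring.
    - rewrite theta_one. ring. }
  pose proof (Cls_l1 _ _ CV) as lV. pose proof (Cls_l1 _ _ CV') as lV'. pose proof (Cls_l1 _ _ Hf) as lf.
  assert (HF : W 5 (f * V)%fps).
  { apply Cls_0_W5. pose proof (Cls_star _ _ _ _ Hf CV) as H.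
    replace (val f * (val V * k) + val V * a) with 0 in H by (unfold k; field; assumption). exact H. }
  assert (HG : W 5 (V' * g)%fps).
  { pose proof (nrm_nonneg V' lV') as Hn.
    apply (wiener_W 5 (f * V)%fps _ (eps / (2 * nrm V' + 1))); [lia|apply Rdiv_lt_0_compat; lra|assumption| |].
    (* From V V' = 1 and the boundedness of V' on the disc, V and with it f V stay away from
       zero. *)
    - intros z Hz. rewrite ev_star, Cmod_mult by assumption. unfold Rdiv.
      pose proof (ev_le V' z Hz lV') as H1.
      assert (H2 : Cmod (ev V z) * Cmod (ev V' z) = 1) by (rewrite <- Cmod_mult, <- ev_star, HVV, ev_one by assumption; apply Cmod_1).
      apply Rmult_le_compat; [lra|apply Rlt_le, Rinv_0_lt_compat; lra|now apply Hev|].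
      apply Rmult_le_reg_r with (2 * nrm V' + 1); [lra|]. rewrite Rinv_l by lra. rewrite <- H2.
      apply Rmult_le_compat_l; [apply Cmod_ge_0|lra].
    - replace (f * V * (V' * g))%fps with ((f * g) * (V * V'))%fps by ring. rewrite Hfg, HVV. ring. }
  assert (Eg : g = (V * (V' * g))%fps) by (transitivity ((V * V') * g)%fps; [rewrite HVV; ring|ring]).
  pose proof (Cls_star _ _ _ _ CV (Cls_W5 _ HG)) as Hg. rewrite <- Eg in Hg.
  pose proof (Cls_l1 _ _ Hg) as lg.
  assert (Hvg : val g = / val f).
  { pose proof (val_star f g lf lg) as H. rewrite Hfg, val_one in H. apply Rmult_eq_reg_l with (val f); [|assumption].
    rewrite <- H. field. assumption. }
  split; [|assumption].
  replace (- a / (val f * val f)) with (val V * 0 + val (V' * g)%fps * (val V * k)); [assumption|].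
  rewrite Rmult_0_r, Rplus_0_l, <- Rmult_assoc, (Rmult_comm (val (V' * g)%fps)).
  rewrite <- val_star by first [assumption|now apply W5_l1]. rewrite <- Eg, Hvg. unfold k. field. assumption.
Qed.

(** Second-order expansion in powers of sqrt(1-z): the tails of X and Y divide out their values at
    1, at the cost of decay n^(-3/2) for the last remainder. *)
Lemma Cls_sq_expansion f a : Cls f a -> exists M N, W 3 N /\
  f = (cst (val f) + sq * M)%fps /\ M = (cst a + sq * N)%fps.
Proof.
  intros [X [Y [HX [HY [-> ->]]]]]. rewrite Cls_val by assumption.
  exists (Y - sq * ftail X)%fps, (- (ftail X + sq * ftail Y))%fps.
  assert (H1 := ftail_decomp X). assert (H2 := ftail_decomp Y). rewrite <- sq_sq in H1, H2.
  split; [|split].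
  - apply W_opp, W_add; [now apply W_ftail|]. apply W3_star; [apply W_sq|now apply W_ftail].
  - rewrite H1 at 1. ring.
  - rewrite H2 at 1. ring.
Qed.

(** Here 1 - Q = (- M) sqrt(1-z), where - M takes the positive value - a at 1 and is inverted in W
    3. Then D is 1/sqrt(1-z) times that inverse G, and only the value of G E at 1 matters: the
    deviation from it contains a factor sqrt(1-z), which cancels. *)
Lemma sqrt_pole Q D E a b m : (forall n, 0 <= Q n) -> val Q = 1 -> 0 < Q m -> 0 < Q (S m) ->
  Cls Q a -> a < 0 -> Cls E b -> ((fone - Q) * D)%fps = fone ->
  W 3 (D * E - cst (val E / - a) * tq)%fps.
Proof.
  intros HQ HQ1 Qm Qm1 CQ Ha CE HD.
  destruct (Cls_sq_expansion Q a CQ) as [M [N [HN [EQ EM]]]]. rewrite HQ1, cst_one in EQ.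
  destruct (Cls_sq_expansion E b CE) as [M' [N' [HN' [EE EM']]]]. set (V := val E) in *.
  assert (HM : W 3 M) by (rewrite EM; apply W_add; [apply W_cst|apply W3_star; [apply W_sq|assumption]]).
  assert (HM' : W 3 M') by (rewrite EM'; apply W_add; [apply W_cst|apply W3_star; [apply W_sq|assumption]]).
  assert (HT : (- M * sq)%fps = (fone - Q)%fps) by (rewrite EQ; ring).
  assert (HvM : val (- M)%fps = - a).
  { rewrite val_opp, EM, val_add, val_star, val_cst, val_sq by first [apply l1_cst|apply l1_sq|now apply W_l1|apply l1_star; [apply l1_sq|now apply W_l1]]. ring. }
  destruct (lower_bound_disc Q m (- M)%fps sq HQ (Cls_l1 _ _ CQ) HQ1 Qm Qm1 (l1_opp _ (W_l1 _ HM)) l1_sq HT ltac:(lra)) as [eps [He Hev]].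
  set (G := (sq * D)%fps).
  assert (HG : (- M * G)%fps = fone) by (unfold G; rewrite <- HD, <- HT; ring).
  assert (WG : W 3 G) by (apply (wiener_W 3 (- M)%fps _ eps); [lia|assumption|now apply W_opp|assumption|assumption]).
  (* Inserting M = a + sqrt(1-z) N into - M G = 1 splits G into the constant 1/(-a) and a multiple
     of sqrt(1-z). *)
  assert (EG : G = (cst (/ - a) * (fone + sq * N * G))%fps).
  { transitivity (cst (/ - a) * (cst (- a) * G))%fps.
    - transitivity (cst (/ - a * - a) * G)%fps; [|rewrite cst_mul; ring].
      rewrite Rinv_l, cst_one by lra. ring.
    - rewrite <- HG at 1. rewrite EM, cst_opp. ring. }
  assert (ED : D = (tq * G)%fps) by (unfold G; transitivity ((sq * tq) * D)%fps; [rewrite sq_star_tq; ring|ring]).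
  replace (D * E - cst (V / - a) * tq)%fps with (G * M' + cst V * (cst (/ - a) * (N * G)))%fps.
  - apply W_add; [now apply W3_star|]. apply W_cst_star; [lia|]. apply W_cst_star; [lia|]. now apply W3_star.
  - rewrite EE, ED. unfold Rdiv. rewrite cst_mul.
    transitivity ((sq * tq) * (G * M' + cst V * (cst (/ - a) * (N * G))))%fps; [rewrite sq_star_tq; ring|].
    transitivity (tq * (cst V * (cst (/ - a) * (fone + sq * N * G)) + sq * (G * M') - cst V * cst (/ - a)))%fps; [ring|].
    rewrite <- EG. ring.
Qed.

(** Nonnegative coefficients give Re Q(z) <= Q(1) on the closed disc; this replaces
    [lower_bound_disc] when Q(1) < 1. *)
Lemma one_sub_Q_low' Q z : (forall n, 0 <= Q n) -> l1 Q -> Cmod z <= 1 -> 1 - val Q <= Cmod (ev (fone - Q)%fps z).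
Proof.
  intros HQ lQ Hz. rewrite ev_sub, ev_one by first [assumption|apply l1_one].
  eapply Rle_trans; [|apply re_le_Cmod]. eapply Rle_trans; [|apply Rle_abs].
  change (Re (RtoC 1 - ev Q z)%C) with (1 - val (reS z Q)).
  assert (lr : l1 (reS z Q)) by now apply l1_reS.
  assert (H : 0 <= val (Q - reS z Q)%fps).
  { apply (rsum_le_Series _ 0); [|apply l1_ex; now apply l1_sub]. intros n. unfold fsub, gsub.
    pose proof (reS_le z Q n Hz) as H. rewrite (Rabs_pos_eq (Q n)) in H by apply HQ.
    pose proof (Rle_abs (reS z Q n)). lra. }
  rewrite val_sub in H by assumption. lra.
Qed.

(** Both expansions are compared at x = 1 - s^2, divided by s, and s tends to 0. This identifies the
    eta of the statement with minus the square-root coefficient. *)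
Lemma sqrt_expansion_unique f a eta delta C : Cls f a -> 0 < delta ->
  (forall x, 1 - delta < x < 1 -> Rabs (val (scale x f) - (val f - eta * sqrt (1 - x))) <= C * (1 - x)) -> eta = - a.
Proof.
  intros Hf Hd HC. destruct (Cls_puiseux f a Hf) as [C' HC'].
  set (K := Rabs C + Rabs C' + 1). pose proof (Rabs_pos C) as P1. pose proof (Rabs_pos C') as P2.
  pose proof (Rle_abs C) as P3. pose proof (Rle_abs C') as P4.
  assert (H : forall s, 0 < s < 1 -> s * s < delta -> Rabs (a + eta) <= K * s).
  { intros s Hs Hsd. assert (Hss : 0 < s * s < 1) by nra.
    specialize (HC (1 - s * s) ltac:(lra)). specialize (HC' (1 - s * s) ltac:(lra)).
    replace (1 - (1 - s * s)) with (s * s) in HC, HC' by ring. rewrite sqrt_square in HC, HC' by lra.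
    set (v := val (scale (1 - s * s) f)) in *.
    apply Rmult_le_reg_r with s; [lra|].
    replace (Rabs (a + eta) * s) with (Rabs ((v - (val f - eta * s)) - (v - (val f + a * s)))).
    - eapply Rle_trans; [apply Rabs_triang|]. rewrite Rabs_Ropp.
      assert (C * (s * s) <= Rabs C * (s * s)) by (apply Rmult_le_compat_r; lra).
      assert (C' * (s * s) <= Rabs C' * (s * s)) by (apply Rmult_le_compat_r; lra). unfold K. nra.
    - rewrite <- (Rabs_pos_eq s) at 3 by lra. rewrite <- Rabs_mult. f_equal. ring. }
  destruct (Req_dec (a + eta) 0) as [H0|H0]; [lra|]. exfalso. apply Rabs_pos_lt in H0.
  set (r := Rabs (a + eta)) in *. assert (HK : 0 < K) by (unfold K; lra).
  set (s := Rmin (Rmin (/ 2) (delta / 2)) (r / (2 * K))).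
  assert (Hs0 : 0 < s) by (repeat apply Rmin_glb_lt; [lra|lra|apply Rdiv_lt_0_compat; lra]).
  assert (Hs1 : s <= / 2) by (eapply Rle_trans; apply Rmin_l).
  assert (Hs2 : s <= delta / 2) by (eapply Rle_trans; [apply Rmin_l|apply Rmin_r]).
  assert (Hs3 : K * s <= r / 2).
  { apply Rle_trans with (K * (r / (2 * K))); [apply Rmult_le_compat_l; [lra|apply Rmin_r]|]. apply Req_le. field. lra. }
  specialize (H s ltac:(lra) ltac:(nra)). lra.
Qed.

(** * From coefficient decay to relative error 1/n *)

Lemma rel_O_of_scaled u A rho w C : 0 < rho -> 0 < A -> (forall n, (1 <= n)%nat -> 0 < w n) ->
  (forall n, (1 <= n)%nat -> Rabs (scale rho u n - A * / w n) <= C / INR n * / w n) ->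
  rel_O_inv_n u (fun n => A * (/ rho ^ n / w n)).
Proof.
  intros Hr HA Hw H. exists (C / A), 1%nat. split; [lia|]. intros n Hn. specialize (H n Hn). specialize (Hw n Hn).
  unfold scale in H. assert (Hrn : 0 < rho ^ n) by now apply pow_lt.
  assert (Hn0 : 0 < INR n) by (apply lt_0_INR; lia).
  pose proof (Rinv_0_lt_compat _ Hrn). pose proof (Rinv_0_lt_compat _ Hw).
  unfold Rdiv at 1. replace (u n - A * (/ rho ^ n * / w n)) with ((u n * rho ^ n - A * / w n) * / rho ^ n) by (field; lra).
  rewrite Rabs_mult, (Rabs_pos_eq (/ rho ^ n)) by lra.
  rewrite (Rabs_pos_eq (A * _)) by (apply Rmult_le_pos; [lra|]; apply Rmult_le_pos; lra).
  replace (C / A / INR n * (A * (/ rho ^ n / w n))) with (C / INR n * / w n * / rho ^ n) by (field; lra).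
  apply Rmult_le_compat_r; lra.
Qed.

Lemma inv_rt3_le n : (1 <= n)%nat -> / rt n ^ 3 <= sqrt PI * (/ INR n * / sqrt (PI * INR n)).
Proof.
  intros Hn. assert (H1 : 1 <= INR n) by (apply (le_INR 1); lia). pose proof PI_RGT_0 as HP.
  assert (HsP : 0 < sqrt PI) by now apply sqrt_lt_R0. assert (Hsn : 0 < sqrt (INR n)) by (apply sqrt_lt_R0; lra).
  rewrite sqrt_mult by lra. replace (sqrt PI * (/ INR n * / (sqrt PI * sqrt (INR n)))) with (/ (INR n * sqrt (INR n))) by (field; lra).
  apply rinv_le; [apply Rmult_lt_0_compat; lra|]. simpl. rewrite Rmult_1_r.
  assert (sqrt (INR n) <= rt n) by (apply sqrt_le_1_alt; lra).
  replace (rt n * (rt n * rt n)) with ((INR n + 1) * rt n) by (rewrite <- rt_sq; ring).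
  apply Rmult_le_compat; lra.
Qed.

Lemma tq_asym f A : 0 <= A -> W 3 (f - cst A * tq)%fps -> exists C, forall n, (1 <= n)%nat ->
  Rabs (f n - A * / sqrt (PI * INR n)) <= C / INR n * / sqrt (PI * INR n).
Proof.
  intros HA HW. destruct (W_bd_nonneg _ _ HW) as [C [C0 HC]]. exists (C * sqrt PI + A). intros n Hn.
  specialize (HC n). rewrite cst_star in HC. unfold fsub, gsub, scal_fps in HC.
  pose proof (tq_wallis n Hn) as Hw. pose proof (inv_rt3_le n Hn) as H3. set (w := / sqrt (PI * INR n)) in *.
  replace (f n - A * w) with ((f n - A * tq n) + A * (tq n - w)) by ring.
  eapply Rle_trans; [apply Rabs_triang|]. rewrite Rabs_mult, (Rabs_pos_eq A) by assumption.
  unfold Rdiv in *. apply (Rmult_le_compat_l C) in H3; [|assumption]. apply (Rmult_le_compat_l A) in Hw; [|assumption]. lra.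
Qed.

(** By sq(n) = - tq(n)/(2n - 1) and Wallis' formula, - 2 sq(n) is close to 1/sqrt(PI n^3); the
    discrepancy 2/(2n-1) - 1/n = 1/(n (2n-1)) is of relative order 1/n. *)
Lemma sq_asym f A : 0 <= A -> Cls f (- (2 * A)) -> exists C, forall n, (1 <= n)%nat ->
  Rabs (f n - A * / sqrt (PI * INR n ^ 3)) <= C / INR n * / sqrt (PI * INR n ^ 3).
Proof.
  intros HA Hf. apply Cls_asym in Hf. destruct (W_bd_nonneg _ _ Hf) as [C [C0 HC]]. exists (C * sqrt PI + 3 * A). intros n Hn.
  assert (H1 : 1 <= INR n) by (apply (le_INR 1); lia). pose proof PI_RGT_0 as HP.
  assert (HPn : 0 < PI * INR n) by (apply Rmult_lt_0_compat; lra).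
  specialize (HC n). unfold fsub, gsub, scal_fps in HC.
  pose proof (tq_wallis n Hn) as Hw. pose proof (inv_rt3_le n Hn) as H3.
  assert (Hs : / sqrt (PI * INR n ^ 3) = / INR n * / sqrt (PI * INR n)).
  { replace (PI * INR n ^ 3) with (INR n * INR n * (PI * INR n)) by ring.
    rewrite sqrt_mult, sqrt_square by nra. apply Rinv_mult. }
  rewrite Hs. assert (Hw0 : 0 < / sqrt (PI * INR n)) by now apply Rinv_0_lt_compat, sqrt_lt_R0.
  set (w := / sqrt (PI * INR n)) in *. set (i := / INR n) in *.
  assert (Hi : 0 < i <= 1) by (unfold i; split; [apply Rinv_0_lt_compat; lra|rewrite <- Rinv_1; apply rinv_le; lra]).
  set (j := / (2 * INR n - 1)).
  assert (Hj : 0 < j <= i) by (unfold i, j; split; [apply Rinv_0_lt_compat; lra|apply rinv_le; lra]).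
  assert (Eji : 2 * j - i = i * j) by (unfold i, j; field; lra).
  assert (Esq : sq n = - (tq n * j)) by (rewrite sq_tq; unfold j, Rdiv; ring).
  assert (H5 : C / rt n ^ 5 <= C * sqrt PI * i * (i * w)).
  { assert (E5 : / rt n ^ 5 <= / rt n ^ 3 * i).
    { replace (rt n ^ 5) with (rt n ^ 3 * (rt n * rt n)) by ring. rewrite rt_sq, Rinv_mult.
      apply Rmult_le_compat_l; [apply Rlt_le, Rinv_0_lt_compat, rt_pow_pos|]. apply rinv_le; lra. }
    apply (Rmult_le_compat_r i) in H3; [|lra]. unfold Rdiv.
    replace (C * sqrt PI * i * (i * w)) with (C * (sqrt PI * (i * w) * i)) by ring. apply Rmult_le_compat_l; lra. }
  replace (f n - A * (i * w)) with ((f n - - (2 * A) * sq n) + A * (2 * j * (tq n - w) + (2 * j - i) * w)) by (rewrite Esq; ring).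
  eapply Rle_trans; [apply Rabs_triang|]. rewrite Rabs_mult, (Rabs_pos_eq A) by assumption.
  assert (H6 : Rabs (2 * j * (tq n - w) + (2 * j - i) * w) <= 3 * i * (i * w)).
  { eapply Rle_trans; [apply Rabs_triang|]. rewrite Eji, Rabs_mult, (Rabs_pos_eq (2 * j)), (Rabs_pos_eq (i * j * w)) by first [lra|repeat apply Rmult_le_pos; lra].
    assert (Hwi : 0 <= i * w) by (apply Rmult_le_pos; lra).
    assert (2 * j * Rabs (tq n - w) <= 2 * i * (i * w)) by (apply Rmult_le_compat; [lra|apply Rabs_pos|lra|assumption]).
    assert (j * (i * w) <= i * (i * w)) by (apply Rmult_le_compat_r; lra). lra. }
  apply (Rmult_le_compat_l A) in H6; [|assumption]. unfold Rdiv at 1. fold i. lra.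
Qed.

(** * The remaining cases *)

Section Main.
Context (c d : nat) (p : Z -> R) (q : R).
Hypothesis hp0 : forall i : Z, 0 <= p i.
Hypothesis hsupp : forall i : Z, (i < - Z.of_nat c \/ Z.of_nat d < i)%Z -> p i = 0.
Hypothesis (hc : (1 <= c)%nat) (hd : (1 <= d)%nat).
Hypothesis (hpc : p (- Z.of_nat c)%Z <> 0) (hpd : p (Z.of_nat d) <> 0).
Hypothesis haper : aperiodic p.
Hypothesis hq : 0 < q.
Context (tau : R) (Htau : 0 < tau) (Hder : Derive (Pol c d p) tau = 0).
Let rho := / Pol c d p tau.
Let Qs := scale rho (Qcoef c d p q).

Lemma puiseux_eta_Cls a eta : Cls Qs a -> puiseux_eta c d p q rho eta -> eta = - a.
Proof.
  intros Ha [_ [C [delta [Hd HC]]]]. assert (Hr : 0 < rho) by (apply rho_pos; assumption).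
  apply (sqrt_expansion_unique Qs a eta (delta / rho) C Ha); [now apply Rdiv_lt_0_compat|].
  intros x Hx. specialize (HC (rho * x)). unfold Qf in HC. rewrite !PSeries_val in HC.
  unfold Qs at 1. rewrite scale_scale. replace (rho * x / rho) with x in HC by (field; lra).
  apply HC. split; [|nra]. destruct Hx as [Hx _]. apply (Rmult_lt_compat_l rho) in Hx; [|assumption].
  replace (rho * (1 - delta / rho)) with (rho - delta) in Hx by (field; lra). assumption.
Qed.

Lemma Q_strict r z : 0 < z < r -> ex_series (scale r (Qcoef c d p q)) ->
  val (scale z (Qcoef c d p q)) < val (scale r (Qcoef c d p q)).
Proof.
  intros Hz Hr. assert (lr : l1 (scale r (Qcoef c d p q))) by (apply (l1_scale_Q c d p q); assumption || lra).
  assert (lz : l1 (scale z (Qcoef c d p q))) by (apply l1_scale_le with r; [lra|assumption]).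
  destruct (Q_eventually_pos c d p q hp0 hsupp hc hd hpc hpd haper hq tau Htau Hder) as [m Hm].
  set (F := (scale r (Qcoef c d p q) - scale z (Qcoef c d p q))%fps).
  assert (HF : forall n, 0 <= F n).
  { intros n. unfold F, fsub, gsub, scale. pose proof (Qcoef_nonneg c d p q hp0 hc hd hq n).
    assert (z ^ n <= r ^ n) by (apply pow_incr; lra). nra. }
  assert (HFm : 0 < F (S m)).
  { unfold F, fsub, gsub, scale. specialize (Hm (S m) ltac:(lia)).
    assert (z ^ S m < r ^ S m).
    { simpl. assert (z ^ m <= r ^ m) by (apply pow_incr; lra). assert (0 < z ^ m) by (apply pow_lt; lra). nra. }
    nra. }
  assert (lF : l1 F) by now apply l1_sub.
  pose proof (rsum_le_Series F (S (S m)) HF (l1_ex _ lF)) as H1. rewrite rsum_S in H1.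
  pose proof (rsum_nonneg F (S m) (fun k _ => HF k)) as H2. fold (val F) in H1. unfold F at 3 in H1. rewrite val_sub in H1 by assumption. lra.
Qed.

Lemma is_rho0_of_zero r : zero_1mQ c d p q r -> r <= rho -> is_rho0 c d p q rho r.
Proof.
  intros Hz Hr. split; [assumption|]. split; [assumption|]. intros z Hzr Hz'.
  apply zero_1mQ_val in Hz, Hz'. pose proof (Q_strict r z Hzr ltac:(tauto)). lra.
Qed.

(** If Q(rho) = 1, rho is the zero. If Q(rho) > 1, the expansion at rho provides a smaller point
    where Q is still above 1, and the intermediate value theorem is applied inside the disc of
    convergence, where continuity is available. *)
Lemma zero_exists a : Cls Qs a -> 1 <= val Qs -> exists r, is_rho0 c d p q rho r.
Proof.
  intros Ha HQ. assert (Hr : 0 < rho) by (apply rho_pos; assumption). pose proof (Cls_l1 _ _ Ha) as lQ.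
  destruct HQ as [HQ|HQ].
  2:{ exists rho. apply is_rho0_of_zero; [|lra]. apply zero_1mQ_val. split; [assumption|]. split; [now apply l1_ex|now symmetry]. }
  destruct (Cls_puiseux Qs a Ha) as [C HC].
  assert (Hx : exists x, 0 < x < 1 /\ 1 < val (scale x Qs)).
  { set (K := Rabs a + Rabs C + 1). pose proof (Rabs_pos a) as P1. pose proof (Rabs_pos C) as P2.
    pose proof (Rle_abs (- a)) as P3. rewrite Rabs_Ropp in P3. pose proof (Rle_abs C) as P4.
    assert (HK : 0 < K) by (unfold K; lra).
    set (s := Rmin (/ 2) ((val Qs - 1) / (2 * K))).
    assert (Hs0 : 0 < s) by (apply Rmin_glb_lt; [lra|apply Rdiv_lt_0_compat; lra]).
    assert (Hs1 : s <= / 2) by apply Rmin_l.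
    assert (Hs2 : K * s <= (val Qs - 1) / 2).
    { apply Rle_trans with (K * ((val Qs - 1) / (2 * K))); [apply Rmult_le_compat_l; [lra|apply Rmin_r]|]. apply Req_le. field. lra. }
    exists (1 - s * s). split; [nra|]. specialize (HC (1 - s * s) ltac:(nra)).
    replace (1 - (1 - s * s)) with (s * s) in HC by ring. rewrite sqrt_square in HC by lra.
    apply Rabs_le_between in HC. unfold K in Hs2. nra. }
  destruct Hx as [x [Hx Hvx]]. unfold Qs in Hvx. rewrite scale_scale in Hvx.
  assert (Hrx : 0 < rho * x < rho) by (split; nra).
  assert (Hcont : forall y, 0 <= y <= rho * x -> continuity_pt (PSeries (Qcoef c d p q)) y).
  { intros y Hy. apply PSeries_continuity. rewrite Rabs_pos_eq by lra. apply Rbar_lt_le_trans with rho; [simpl; lra|].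
    apply (proj1 (Lub_Rbar_correct (CV_disk (Qcoef c d p q)))). exact lQ. }
  destruct (f_interv_is_interv (PSeries (Qcoef c d p q)) 0 (rho * x) 1) as [r [Hr1 Hr2]]; [lra| |exact Hcont|].
  - rewrite PSeries_0, PSeries_val. simpl. lra.
  - exists r. assert (Hr0 : 0 < r).
    { destruct (proj1 Hr1) as [H|H]; [assumption|]. subst r. rewrite PSeries_0 in Hr2. simpl in Hr2. lra. }
    apply is_rho0_of_zero; [|lra]. apply zero_1mQ_val. split; [assumption|].
    split; [apply l1_ex, l1_scale_le with rho; [lra|assumption]|]. rewrite <- PSeries_val. lra.
Qed.

Lemma ecoef_at_rho eta : zero_1mQ c d p q rho -> puiseux_eta c d p q rho eta ->
  rel_O_inv_n (ecoef c d p q) (fun n => Ef c d p rho / eta * (/ rho ^ n / sqrt (PI * INR n))).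
Proof.
  intros Hz Heta. apply zero_1mQ_val in Hz. destruct Hz as [Hr [Hex Hval]].
  assert (Ht : 1 < tau) by (apply (tau_gt_1 c d p q) with rho; try assumption; apply Rle_refl).
  destruct (Cls_Q c d p q hp0 hsupp hc hd hpc hpd haper tau Htau Hder Ht) as [a Ha].
  pose proof (Q_coef_neg c d p q hp0 hsupp hc hd hpc hpd haper hq tau Htau Hder a Ha) as Ha0.
  rewrite (puiseux_eta_Cls a eta Ha Heta).
  destruct (scale_Q_pos c d p q hp0 hsupp hc hd hpc hpd haper hq tau Htau Hder rho Hr) as [m [Hm Hm']].
  pose proof (sqrt_pole Qs (scale rho (Dcoef c d p q)) (scale rho (Ecoef c d p)) a _ m
    (fun n => scale_Q_nonneg c d p q hp0 hc hd hq rho n (Rlt_le _ _ Hr)) Hval Hm Hm' Ha Ha0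
    (Cls_E c d p hp0 hsupp hc hd hpc hpd haper tau Htau Hder) (scale_Dcoef c d p q rho)) as HW.
  rewrite <- scale_ecoef in HW. change (val (scale rho (Ecoef c d p))) with (Ef c d p rho) in HW.
  assert (HV : 1 <= Ef c d p rho) by (apply E_val_ge1; assumption).
  assert (HA : 0 < Ef c d p rho / - a) by (apply Rdiv_lt_0_compat; lra).
  destruct (tq_asym _ _ (Rlt_le _ _ HA) HW) as [C HC].
  apply (rel_O_of_scaled _ _ rho (fun n => sqrt (PI * INR n)) C); try assumption.
  intros n Hn. apply sqrt_lt_R0, Rmult_lt_0_compat; [apply PI_RGT_0|apply lt_0_INR; lia].
Qed.

(** The variance of the step tilted by tau is tau^2 P''(tau)/P(tau); this rewrites the constant of
    the local limit theorem in terms of P. *)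
Lemma two_bb : 2 * / sqrt (2 * mom (S (c + d)) (tw c d p tau) (xs c) 2)
  = sqrt (2 * (Pol c d p tau / Derive_n (Pol c d p) 2 tau)) * / tau.
Proof.
  pose proof (tw_mom2_pos c d p hp0 hc hd hpc hpd tau Htau) as Hs.
  rewrite (tw_mom2 c d p hc hd tau Htau Hder) in *.
  pose proof (Pol_pos c d p hp0 hc hd hpc tau Htau) as HP. set (P := Pol c d p tau) in *. set (P2 := Derive_n (Pol c d p) 2 tau) in *.
  assert (HP2 : 0 < P2).
  { apply Rmult_lt_reg_l with (tau ^ 2 / P); [apply Rdiv_lt_0_compat; [now apply pow_lt|assumption]|].
    rewrite Rmult_0_r. replace (tau ^ 2 / P * P2) with (tau ^ 2 * P2 / P) by (field; lra). assumption. }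
  assert (Hq : 0 < sqrt (2 * (tau ^ 2 * P2 / P))) by (apply sqrt_lt_R0; lra).
  apply Rmult_eq_reg_r with (sqrt (2 * (tau ^ 2 * P2 / P))); [|lra].
  rewrite Rmult_assoc, Rinv_l, Rmult_1_r by lra.
  replace (sqrt (2 * (P / P2)) * / tau * sqrt (2 * (tau ^ 2 * P2 / P))) with (/ tau * (sqrt (2 * (P / P2)) * sqrt (2 * (tau ^ 2 * P2 / P)))) by ring.
  rewrite <- sqrt_mult; [|apply Rmult_le_pos; [lra|apply Rlt_le, Rdiv_lt_0_compat; lra]|lra].
  replace (2 * (P / P2) * (2 * (tau ^ 2 * P2 / P))) with ((2 * tau) * (2 * tau)) by (field; lra).
  rewrite sqrt_square by lra. field. lra.
Qed.

Lemma ecoef_no_zero eta : ~ (exists r, is_rho0 c d p q rho r) -> puiseux_eta c d p q rho eta ->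
  rel_O_inv_n (ecoef c d p q)
    (fun n => Df c d p q rho * Ef c d p rho / 2 *
       (sqrt (2 * (Pol c d p tau / Derive_n (Pol c d p) 2 tau)) * / tau + eta * Df c d p q rho)
       * (/ rho ^ n / sqrt (PI * INR n ^ 3))).
Proof.
  intros Hno Heta. assert (Hr : 0 < rho) by (apply rho_pos; assumption).
  assert (Hex : ex_series Qs) by (destruct Heta as [[l Hl] _]; apply is_pseries_R in Hl; now exists l).
  assert (Ht : 1 < tau) by (apply (tau_gt_1 c d p q) with rho; try assumption; apply Rle_refl).
  destruct (Cls_Q c d p q hp0 hsupp hc hd hpc hpd haper tau Htau Hder Ht) as [a Ha]. fold rho Qs in Ha.
  pose proof (Q_coef_neg c d p q hp0 hsupp hc hd hpc hpd haper hq tau Htau Hder a Ha) as Ha0.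
  rewrite (puiseux_eta_Cls a eta Ha Heta).
  assert (HQ1 : val Qs < 1).
  { destruct (Rlt_le_dec (val Qs) 1) as [H|H]; [assumption|]. exfalso. apply Hno. now apply zero_exists with a. }
  pose proof (Cls_l1 _ _ Ha) as lQ.
  assert (HQ0 : forall n, 0 <= Qs n) by (intros n; apply (scale_Q_nonneg c d p q); assumption || lra).
  assert (Hf : Cls (fone - Qs)%fps (0 - a)) by (apply Cls_sub; [apply Cls_W5, W_one|assumption]).
  assert (Hvf : val (fone - Qs)%fps = 1 - val Qs) by (rewrite val_sub, val_one by first [assumption|apply l1_one]; reflexivity).
  destruct (Cls_inverse (fone - Qs)%fps (scale rho (Dcoef c d p q)) (0 - a) (1 - val Qs)) as [HD HvD]; try assumption.
  { lra. } { lra. } { intros z Hz. now apply one_sub_Q_low'. } { apply scale_Dcoef. }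
  rewrite Hvf in HD, HvD. change (/ (1 - val Qs)) with (Df c d p q rho) in HvD.
  set (Dv := Df c d p q rho) in *. assert (HDv : Dv = / (1 - val Qs)) by reflexivity.
  assert (HDp : 0 < Dv) by (rewrite HDv; apply Rinv_0_lt_compat; lra).
  pose proof (Cls_star _ _ _ _ HD (Cls_E c d p hp0 hsupp hc hd hpc hpd haper tau Htau Hder)) as He.
  rewrite <- scale_ecoef, HvD in He. change (val (scale (/ Pol c d p tau) (Ecoef c d p))) with (Ef c d p rho) in He.
  assert (HV : 1 <= Ef c d p rho) by (apply E_val_ge1; assumption). set (V := Ef c d p rho) in *.
  rewrite <- two_bb. pose proof (bb_pos c d p hp0 hc hd hpc hpd tau Htau) as Hbb.
  set (bb := / sqrt (2 * mom (S (c + d)) (tw c d p tau) (xs c) 2)) in *.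
  set (A := Dv * V / 2 * (2 * bb + - a * Dv)).
  assert (HA : 0 < A).
  { unfold A. apply Rmult_lt_0_compat; [apply Rdiv_lt_0_compat; [apply Rmult_lt_0_compat|]; lra|].
    assert (0 < - a * Dv) by (apply Rmult_lt_0_compat; lra). lra. }
  (* The square-root coefficient of D E is D(rho) times that of E plus E(rho) times that of D, the
     latter being a D(rho)^2. The factor - 2 matches sq(n) being about - 1/(2 sqrt(PI n^3)). *)
  replace (Dv * (V * (-2 * bb)) + V * (- (0 - a) / ((1 - val Qs) * (1 - val Qs)))) with (- (2 * A)) in He
    by (unfold A; rewrite HDv; field; lra).
  destruct (sq_asym _ _ (Rlt_le _ _ HA) He) as [C HC].
  apply (rel_O_of_scaled _ _ rho (fun n => sqrt (PI * INR n ^ 3)) C); try assumption.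
  intros n Hn. apply sqrt_lt_R0, Rmult_lt_0_compat; [apply PI_RGT_0|apply pow_lt, lt_0_INR; lia].
Qed.
End Main.

Theorem theorem4p4
  (c d : nat) (p : Z -> R) (q : R)
  (hc : (1 <= c)%nat) (hd : (1 <= d)%nat)
  (hp0 : forall i : Z, 0 <= p i)
  (hsupp : forall i : Z, (i < - Z.of_nat c \/ Z.of_nat d < i)%Z -> p i = 0)
  (hpc : p (- Z.of_nat c)%Z <> 0) (hpd : p (Z.of_nat d) <> 0)
  (hq : 0 < q)
  (haper : aperiodic p)
  (tau : R) (htau : is_tau c d p tau) :
  let rho := rho_of c d p tau in
  let e := ecoef c d p q in
  (* (i) rho0 < rho *)
  (forall rho0, is_rho0 c d p q rho rho0 -> rho0 < rho ->
     exists K, 0 < K < / rho0 /\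
       is_lim_seq
         (fun n => (e n - Ef c d p rho0 / (rho0 * Derive (Qf c d p q) rho0)
                            * / rho0 ^ n) / K ^ n) 0) /\
  (* (ii) rho0 = rho *)
  (is_rho0 c d p q rho rho -> forall eta, puiseux_eta c d p q rho eta ->
     rel_O_inv_n e
       (fun n => Ef c d p rho / eta * (/ rho ^ n / sqrt (PI * INR n)))) /\
  (* (iii) rho0 does not exist *)
  ((~ exists r, is_rho0 c d p q rho r) -> forall eta, puiseux_eta c d p q rho eta ->
     rel_O_inv_n e
       (fun n => Df c d p q rho * Ef c d p rho / 2 *
          (sqrt (2 * (Pol c d p tau / Derive_n (Pol c d p) 2 tau)) * / tau
           + eta * Df c d p q rho)
          * (/ rho ^ n / sqrt (PI * INR n ^ 3)))).
Proof.
  destruct htau as [Htau [Hder _]]. intros rho e. split; [|split].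
  - intros r [Hz _] Hlt. now apply ecoef_pole with tau.
  - intros [Hz _] eta Heta. now apply ecoef_at_rho.
  - intros Hno eta Heta. now apply ecoef_no_zero.
Qed.
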